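(* Suppose that $\Omega$ is unbounded and that $\sigma,\varepsilon,\mu$ satisfy, for some constants $\varepsilon_\infty,\mu_\infty>0$, $$\lim_{R\to\infty}\Big\{\sup_{\|x\|>R}\max\big(\|\varepsilon(x)-\varepsilon_\infty\mathrm{id}\|,\|\mu(x)-\mu_\infty\mathrm{id}\|,\|\sigma(x)\|\big)\Big\}=0.$$ Let $P_\nabla$ be the orthogonal projection from $L^2(\Omega)^3=\nabla\dot H^1_0(\Omega)\oplus H(\operatorname{div}0,\Omega)$ onto $\nabla\dot H^1_0(\Omega)$ and let $\mathcal{W}(\omega):=-\omega(\omega\varepsilon+\mathrm{i}\sigma)$, $\omega\in\mathbb{C}$, in $L^2(\Omega)^3$. Then $$\sigma_{ek}(\mathcal{L})=\sigma_{ek}(L_\infty)\cup\sigma_{ek}\big(P_\nabla\mathcal{W}(\cdot)|_{\nabla\dot H^1_0(\Omega)}\big),\qquad k=1,2,3,4,$$ where $\sigma_{ek}(L_\infty)\subset\mathbb{R}$ satisfies $$\sigma_{ek}(L_\infty)\setminus\{0\}=\Big\{\omega\in\mathbb{R}\setminus\{0\}:\ \varepsilon_\infty\mu_\infty\,\omega^2\in\sigma_{ek}\big(\operatorname{curl}\operatorname{curl}_0|_{H(\operatorname{div}0,\Omega)}\big)\Big\},$$ and $\sigma_{ek}\big(P_\nabla\mathcal{W}(\cdot)|_{\nabla\dot H^1_0(\Omega)}\big)\subset\mathrm{i}\big[-\frac{\sigma_{\max}}{\varepsilon_{\min}},0\big]$.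
   Context: $\Omega\subset\mathbb{R}^3$ is a domain with Lipschitz boundary. The coefficients $\varepsilon,\mu,\sigma\in L^\infty(\Omega,\mathbb{R}^{3\times3})$ are symmetric, non-negative matrix-valued functions, and $\varepsilon_{\min},\varepsilon_{\max},\mu_{\min},\mu_{\max},\sigma_{\max}$ are constants such that a.e. in $\Omega$ and for all $\eta\in\mathbb{R}^3$, $|\eta|=1$: $0<\varepsilon_{\min}\le\eta\cdot\varepsilon\eta\le\varepsilon_{\max}$, $0<\mu_{\min}\le\eta\cdot\mu\eta\le\mu_{\max}$, $0\le\eta\cdot\sigma\eta\le\sigma_{\max}$. All function spaces are complex. $H(\operatorname{curl},\Omega)=\{u\in L^2(\Omega)^3:\operatorname{curl}u\in L^2(\Omega)^3\}$; $H_0(\operatorname{curl},\Omega)=\{u\in H(\operatorname{curl},\Omega):\nu\times u|_{\partial\Omega}=0\}$; $H(\operatorname{div}0,\Omega)=\{u\in L^2(\Omega)^3:\operatorname{div}u=0\}$ with the $L^2$-norm. As operators in $L^2(\Omega)^3$, $\operatorname{curl}$ has domain $H(\operatorname{curl},\Omega)$ and $\operatorname{curl}_0=\operatorname{curl}^*$ acts as $\operatorname{curl}$ on $H_0(\operatorname{curl},\Omega)$. $\dot H^1_0(\Omega)$ is the completion of $C_c^\infty(\Omega)$ with respect to $\|\nabla u\|_{L^2(\Omega)}$, and $\nabla\dot H^1_0(\Omega)$ is its image under the gradient. Pencils: in $L^2(\Omega)^3$, $\mathcal{L}(\omega)=\operatorname{curl}\mu^{-1}\operatorname{curl}_0-\omega(\omega\varepsilon+\mathrm{i}\sigma)$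 with $\operatorname{dom}(\mathcal{L}(\omega))=\{E\in H_0(\operatorname{curl},\Omega):\mu^{-1}\operatorname{curl}E\in H(\operatorname{curl},\Omega)\}$; in $H(\operatorname{div}0,\Omega)$, $L_\infty(\omega)=\operatorname{curl}\mu_\infty^{-1}\operatorname{curl}_0-\varepsilon_\infty\omega^2\,\mathrm{id}$ with $\operatorname{dom}(L_\infty(\omega))=\{u\in H_0(\operatorname{curl},\Omega)\cap H(\operatorname{div}0,\Omega):\operatorname{curl}u\in H(\operatorname{curl},\Omega)\}$. $\operatorname{curl}\operatorname{curl}_0|_{H(\operatorname{div}0,\Omega)}$ is the self-adjoint operator in $H(\operatorname{div}0,\Omega)$ with the same domain. $P_\nabla\mathcal{W}(\omega)|_{\nabla\dot H^1_0(\Omega)}$ is a bounded operator in $\nabla\dot H^1_0(\Omega)$. Essential spectra (Edmunds–Evans): for a closed densely defined operator $T$, $\lambda\notin\sigma_{e1}(T)$ iff $T-\lambda$ is semi-Fredholm (closed range and finite nullity or finite codimension of the range); $\lambda\notin\sigma_{e2}(T)$ iff $T-\lambda$ has closed range and finite nullity; $\lambda\notin\sigma_{e3}(T)$ iff $T-\lambda$ is Fredholm; $\lambda\notin\sigma_{e4}(T)$ iff $T-\lambda$ is Fredholm of index $0$. For a pencil $T(\cdot)$: $\omega\in\sigma_{ek}(T)$ iff $0\in\sigma_{ek}(T(\omega))$. *)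

(* Defs.v *)
From HB Require Import structures.
From mathcomp Require Import all_boot all_order all_algebra.
From mathcomp Require Import generic_quotient ring_quotient complex.
From mathcomp Require Import all_classical all_reals all_analysis.
From mathcomp Require Import measurable_realfun ess_sup_inf.

Set Implicit Arguments.
Unset Strict Implicit.
Unset Printing Implicit Defensive.

Import Order.TTheory GRing.Theory Num.Theory.
Import numFieldNormedType.Exports.

Local Open Scope classical_set_scope.
Local Open Scope ring_scope.

Definition R3 (R : realType) : Type := (R * R * R)%type.

HB.instance Definition _ (R : realType) :=
  Measurable.copy (R3 R)
    (measurableTypeR R * measurableTypeR R * measurableTypeR R)%type.
HB.instance Definition _ (R : realType) :=
  NormedModule.copy (R3 R) (R * R * R)%type.

(* The norm of the library on [R * R * R] is the maximum norm; Euclidean norms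
   are always taken on the associated column vectors. *)
Section Euclidean.
Variable R : realType.

Definition to_col (x : R3 R) : 'cV[R]_3 :=
  \col_i [:: x.1.1; x.1.2; x.2]`_i.

Definition unit_vec (i : 'I_3) : R3 R :=
  ((i == 0 :> nat)%:R, (i == 1%N :> nat)%:R, (i == 2%N :> nat)%:R).

Definition dotv (K : pzRingType) (u v : 'cV[K]_3) : K :=
  \sum_i u i 0 * v i 0.

Definition enorm (u : 'cV[R]_3) : R := Num.sqrt (dotv u u).

Definition opnorm (A : 'M[R]_3) : R :=
  sup [set enorm (A *m h) | h in [set h : 'cV[R]_3 | enorm h = 1]].

Definition volume3 :
    {measure set (measurableTypeR R * measurableTypeR R * measurableTypeR R)
     -> \bar R} :=
  ((@lebesgue_measure R \x @lebesgue_measure R) \x @lebesgue_measure R)%E.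

Definition volume : {measure set (R3 R) -> \bar R} := volume3.

Let box (p : rat * rat * rat * nat) : set (R3 R) :=
  (ball (ratr p.1.1.1 : R) p.2.+1%:R^-1 `*` ball (ratr p.1.1.2 : R) p.2.+1%:R^-1)
  `*` ball (ratr p.1.2 : R) p.2.+1%:R^-1.

Let ball_rat (x e : R) : 0 < e -> exists q : rat, `|ratr q - x| < e.
Proof.
move=> e0; have : x - e < x + e by rewrite ltrD2l gtrN.
move=> /rat_in_itvoo[q]; rewrite in_itv/= => xq.
by exists q; rewrite ltr_distl.
Qed.

Lemma open_measurable_R3 (U : set (R3 R)) : open U -> measurable U.
Proof.
move=> oU; pose F p := if `[< box p `<=` U >] then box p else set0.
suff -> : U = \bigcup_p F p.
  apply: countable_bigcupT_measurable; first exact: countableP.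
  move=> p; rewrite /F; case: ifP => _; last exact: measurable0.
  by apply: measurableX; first apply: measurableX;
    apply: open_measurable; exact: ball_open.
apply/seteqP; split => [x Ux|x [p _]]; last first.
  by rewrite /F; case: asboolP => // pU /pU.
have /nbhs_ballP[e /= e0 xeU] : nbhs x U by exact: open_nbhs_nbhs.
have [n _ /(_ n (leqnn n)) ne] := near_infty_natSinv_lt (PosNum (divr_gt0 e0 (ltr0n _ 2%N))).
have n0 : 0 < n.+1%:R^-1 :> R by [].
have [q1 h1] := ball_rat x.1.1 n0; have [q2 h2] := ball_rat x.1.2 n0.
have [q3 h3] := ball_rat x.2 n0.
exists (q1, q2, q3, n) => //; rewrite /F; case: asboolP => [_|].
  by split; first split.
apply: contra_notP => _ y [[/= y1 y2] y3]; apply: xeU.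
have tri (a b c : R) : `|a - b| < n.+1%:R^-1 -> `|a - c| < n.+1%:R^-1 -> `|b - c| < e.
  move=> ab ac; rewrite (splitr e) (le_lt_trans (ler_distD a _ _))//.
  by rewrite ltrD// (lt_trans _ ne)// distrC.
by split; first split; apply: tri; [exact: h1|exact: y1|exact: h2|exact: y2|
  exact: h3|exact: y3].
Qed.

End Euclidean.

Record domain (R : realType) := Domain {
  domain_set :> set (R3 R);
  domain_open : open domain_set;
  domain_connected : connected domain_set;
  domain_nonempty : domain_set !=set0 }.
Arguments domain_open {R} d.
Arguments domain_connected {R} d.
Arguments domain_nonempty {R} d.

Section Domain.
Variables (R : realType) (Omega : domain R).

Let measurable_domain : measurable (Omega : set (R3 R)) :=
  open_measurable_R3 (domain_open Omega).

(* Lebesgue measure on Omega, as a measure on the whole space. *)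
Definition vol : {measure set (R3 R) -> \bar R} :=
  mrestr (volume R) measurable_domain.

(* Every boundary point x0 has a neighbourhood in which, in suitable Cartesian
   coordinates (a . x, b . x, n . x), Omega is the part above the graph of a
   Lipschitz function of the first two. *)
Definition lipschitz_boundary : Prop :=
  forall x0 : R3 R, (closure Omega `\` interior Omega) x0 ->
  exists (a b n : 'cV[R]_3) (g : R * R -> R) (L : R),
    [/\ [/\ dotv a a = 1, dotv b b = 1 & dotv n n = 1],
        [/\ dotv a b = 0, dotv a n = 0 & dotv b n = 0],
        L.-lipschitz g &
        \forall x \near x0, domain_set Omega x <->
          g (dotv a (to_col x), dotv b (to_col x)) < dotv n (to_col x)].

End Domain.

Section L2.
Variables (R : realType) (Omega : domain R).
Local Notation C := R[i].
Local Notation V := (R3 R -> 'cV[C]_3).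
Local Notation mu := (vol Omega).

Definition square_integrable : {pred V} := [pred u : V |
  `[< forall i, ((fun x => complex.Re (u x i 0)) \in Lfun mu 2%:E) /\
                ((fun x => complex.Im (u x i 0)) \in Lfun mu 2%:E) >]].

Let L2p : (1 <= 2%:E :> \bar R)%E. Proof. by rewrite lee_fin ler1n. Qed.

Lemma square_integrable_submod_closed : submod_closed square_integrable.
Proof.
have [F0 FL] := Lfun_submod_closed mu L2p.
have FD f g : f \in Lfun mu 2%:E -> g \in Lfun mu 2%:E -> f \+ g \in Lfun mu 2%:E.
  by move=> hf hg; have := FL 1 f g hf hg; rewrite scale1r.
have FZ (a : R) f : f \in Lfun mu 2%:E -> a \*o f \in Lfun mu 2%:E.
  by move=> hf; have := FL a f 0 hf F0; rewrite addr0.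
split.
  apply: asboolT => i.
  by split; under eq_fun do rewrite mxE; exact: F0.
move=> [a b] u v /asboolP hu /asboolP hv; apply: asboolT => i.
have [[ru iu] [rv iv]] := (hu i, hv i).
split.
- rewrite (_ : (fun _ => _) = ((a \*o (fun x => complex.Re (u x i 0))) \+
    ((- b) \*o (fun x => complex.Im (u x i 0)))) \+ (fun x => complex.Re (v x i 0))).
    by apply: (FD) => //; apply: (FD); exact: FZ.
  apply/funext => x /=; rewrite !mxE.
  by case: (u x i 0) (v x i 0) => [? ?] [? ?] /=; rewrite mulNr.
- rewrite (_ : (fun _ => _) = ((a \*o (fun x => complex.Im (u x i 0))) \+
    (b \*o (fun x => complex.Re (u x i 0)))) \+ (fun x => complex.Im (v x i 0))).
    by apply: (FD) => //; apply: (FD); exact: FZ.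
  apply/funext => x /=; rewrite !mxE.
  by case: (u x i 0) (v x i 0) => [? ?] [? ?] /=.
Qed.

HB.instance Definition _ :=
  GRing.isSubmodClosed.Build C V square_integrable
    square_integrable_submod_closed.

Record L2fun : Type := MkL2fun {
  L2fun_val :> V; _ : L2fun_val \in square_integrable }.

HB.instance Definition _ := [isSub for L2fun_val].
HB.instance Definition _ := [Choice of L2fun by <:].
HB.instance Definition _ := [SubChoice_isSubLmodule of L2fun by <:].

Lemma L2funBE (u v : L2fun) x : (u - v) x = u x - v x.
Proof. by []. Qed.

Lemma L2funZE (a : C) (u : L2fun) x : (a *: u) x = a *: u x.
Proof. by []. Qed.

Definition L2null : {pred L2fun} := [pred u : L2fun |
  `[< {ae mu, forall x, u x = 0} >]].

Lemma L2null_zmod_closed : zmod_closed L2null.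
Proof.
split; first by apply: asboolT; apply: aeW.
move=> u v /asboolP hu /asboolP hv; apply: asboolT.
by apply: filterS2 hu hv => x ux vx; rewrite L2funBE ux vx subr0.
Qed.

HB.instance Definition _ := GRing.isZmodClosed.Build L2fun L2null
  L2null_zmod_closed.

Definition L2 : Type := Quotient.quot [the zmodClosed L2fun of L2null].

HB.instance Definition _ := GRing.Zmodule.on L2.
HB.instance Definition _ := EqQuotient.on L2.


Lemma pi_L2_eq (u v : L2fun) :
  (\pi_L2 u = \pi_L2 v)%qT <-> {ae mu, forall x, u x = v x}.
Proof.
rewrite (rwP eqP) -[X in is_true X]Quotient.idealrBE; split => [/asboolP|] h.
  by apply: filterS h => x; rewrite L2funBE => /subr0_eq.
by apply: asboolT; apply: filterS h => x uv; rewrite L2funBE uv subrr.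
Qed.

Lemma repr_piL2 (u : L2fun) : {ae mu, forall x, repr (\pi_L2 u)%qT x = u x}.
Proof. by apply/pi_L2_eq; rewrite reprK. Qed.

Definition scaleL2 (a : C) (u : L2) : L2 := (\pi_L2 (a *: repr u))%qT.

Let pi_scaleL2 a (u : L2fun) : (\pi_L2 (a *: u))%qT = scaleL2 a (\pi_L2 u)%qT.
Proof.
apply/pi_L2_eq; apply: filterS (repr_piL2 u) => x ux.
by rewrite !L2funZE ux.
Qed.

Let pi_addL2 (u v : L2fun) : (\pi_L2 (u + v))%qT = (\pi_L2 u + \pi_L2 v)%qT.
Proof. exact: (@Quotient.pi_add _ [the zmodClosed L2fun of L2null] u v). Qed.

Let scaleL2A a b u : scaleL2 a (scaleL2 b u) = scaleL2 (a * b) u.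
Proof. by rewrite -[u]reprK -!pi_scaleL2 scalerA reprK. Qed.

Let scaleL21 : left_id 1 scaleL2.
Proof. by move=> u; rewrite -[u]reprK -!pi_scaleL2 scale1r. Qed.

Let scaleL2Dr : right_distributive scaleL2 +%R.
Proof.
move=> a u v; rewrite -[u]reprK -[v]reprK -pi_addL2 -!pi_scaleL2.
by rewrite scalerDr pi_addL2.
Qed.

Let scaleL2Dl u : {morph scaleL2^~ u : a b / a + b}.
Proof.
by move=> a b; rewrite -[u]reprK -!pi_scaleL2 scalerDl pi_addL2.
Qed.

HB.instance Definition _ := GRing.Zmodule_isLmodule.Build C L2
  scaleL2A scaleL21 scaleL2Dr scaleL2Dl.

Definition L2repr (u : L2) : V := repr u.
Coercion L2repr : L2 >-> Funclass.

End L2.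

(* Unbounded operators are represented by their graphs, so that the domain of a
   sum or of a composition is the natural one. *)
Section Operators.
Variables (K : fieldType) (H : lmodType K).
Implicit Types (S T : set (H * H)) (X : set H).

Definition op_dom T : set H := [set u | exists f, T (u, f)].
Definition op_range T : set H := [set f | exists u, T (u, f)].
Definition op_ker T : set H := [set u | T (u, 0)].

Definition op_add S T : set (H * H) :=
  [set p | exists f g, [/\ S (p.1, f), T (p.1, g) & p.2 = f + g]].
Definition op_comp S T : set (H * H) :=
  [set p | exists w, T (p.1, w) /\ S (w, p.2)].
Definition op_scalar (a : K) : set (H * H) := [set p | p.2 = a *: p.1].
Definition op_restr T X : set (H * H) := [set p | X p.1 /\ T p].

(* dim (X / A) = n, for subspaces A of X *)
Definition has_codim X (A : set H) (n : nat) : Prop :=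
  exists e : 'I_n -> H, (forall i, X (e i)) /\
    forall f, X f ->
      exists! c : 'rV[K]_n, A (f - \sum_(i < n) c 0 i *: e i).

(* T is regarded as an operator in X *)
Definition nullity T n : Prop := has_codim (op_ker T) [set 0] n.
Definition deficiency X T n : Prop := has_codim X (op_range T) n.

End Operators.

(* The essential spectra sigma_e1, ..., sigma_e4 of Edmunds and Evans, of a closed
   densely defined operator T in the closed subspace X. *)
Inductive ess_kind := E1 | E2 | E3 | E4.

Section EssentialSpectra.
Variables (R : realType) (H : lmodType R[i]) (nrm : H -> R).
Implicit Types (T : set (H * H)) (X : set H).

Definition closed_range X T : Prop :=
  forall (f_ : nat -> H) f, (forall n, op_range T (f_ n)) -> X f ->
    nrm (f_ n - f) @[n --> \oo] --> (0 : R) -> op_range T f.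

Definition fredholm_kind (k : ess_kind) X T : Prop :=
  closed_range X T /\
  match k with
  | E1 => (exists n, nullity T n) \/ (exists n, deficiency X T n)
  | E2 => exists n, nullity T n
  | E3 => (exists n, nullity T n) /\ (exists n, deficiency X T n)
  | E4 => exists n, nullity T n /\ deficiency X T n
  end.

Definition ess_spectrum k X T : set R[i] :=
  [set l | ~ fredholm_kind k X (op_add T (op_scalar (- l)))].

Definition ess_spectrum_pencil k X (P : R[i] -> set (H * H)) : set R[i] :=
  [set w | ess_spectrum k X (P w) 0].

End EssentialSpectra.

Section Fields.
Variable R : realType.
Local Notation C := R[i].

Fixpoint Ck (n : nat) (f : R3 R -> R) : Prop :=
  if n is m.+1 then
    forall i, (forall x, derivable f x (unit_vec R i)) /\
              Ck m (fun x => 'D_(unit_vec R i) f x)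
  else continuous f.

(* C_c^oo(U), complex-valued, as functions on the whole space *)
Definition test_fun (U : set (R3 R)) (phi : R3 R -> C) : Prop :=
  let supp := closure [set x | phi x != 0] in
  [/\ forall n, Ck n (fun x => complex.Re (phi x)),
      forall n, Ck n (fun x => complex.Im (phi x)),
      compact supp & supp `<=` U].

Definition test_field (U : set (R3 R)) (phi : R3 R -> 'cV[C]_3) : Prop :=
  forall i, test_fun U (fun x => phi x i 0).

Definition partial (i : 'I_3) (phi : R3 R -> C) (x : R3 R) : C :=
  Complex ('D_(unit_vec R i) (fun y => complex.Re (phi y)) x)
          ('D_(unit_vec R i) (fun y => complex.Im (phi y)) x).

Definition grad (phi : R3 R -> C) (x : R3 R) : 'cV[C]_3 :=
  \col_i partial i phi x.

Definition curl_field (phi : R3 R -> 'cV[C]_3) (x : R3 R) : 'cV[C]_3 :=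
  let d (i j : nat) := partial (inord i) (fun y => phi y (inord j) 0) x in
  \col_i [:: d 1%N 2%N - d 2%N 1%N; d 2%N 0%N - d 0%N 2%N; d 0%N 1%N - d 1%N 0%N]`_i.

End Fields.

Section Maxwell.
Variables (R : realType) (Omega : domain R).
Local Notation C := R[i].
Local Notation H := (L2 Omega).

Definition integralC (f : R3 R -> C) : C :=
  Complex (\int[vol Omega]_x complex.Re (f x)) (\int[vol Omega]_x complex.Im (f x)).

Definition L2inner (u v : H) : C :=
  integralC (fun x => \sum_i u x i 0 * (v x i 0)^*).

Definition L2norm (u : H) : R := Num.sqrt (complex.Re (L2inner u u)).

(* w is the distributional curl of u in Omega *)
Definition curl : set (H * H) := [set p : H * H |
  forall phi, test_field Omega phi ->
    integralC (fun x => dotv (p.2 x) (phi x)) =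
    integralC (fun x => dotv (p.1 x) (curl_field phi x))].

Definition Hcurl : set H := op_dom curl.

(* The tangential trace nu x u of u, where w = curl u, as a functional of the
   boundary values of phi; by Green's formula it is
   \int_(boundary of Omega) (nu x u) . phi when u is smooth. *)
Definition tangential_trace (u w : H) (phi : R3 R -> 'cV[C]_3) : C :=
  integralC (fun x => dotv (w x) (phi x) - dotv (u x) (curl_field phi x)).

Definition curl0 : set (H * H) := [set p : H * H | curl p /\
  forall phi, test_field setT phi -> tangential_trace p.1 p.2 phi = 0].

Definition H0curl : set H := op_dom curl0.

Definition Hdiv0 : set H := [set u : H |
  forall phi, test_fun Omega phi ->
    integralC (fun x => dotv (u x) (grad phi x)) = 0].

Definition grad_test : set H := [set v : H |
  exists phi, test_fun Omega phi /\ {ae vol Omega, forall x, v x = grad phi x}].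

(* The completion consists of the classes of the sequences phi_n in C_c^oo(Omega)
   for which grad phi_n is Cauchy in L2; the gradient of such a class is the
   L2-limit of grad phi_n. *)
Definition grad_H10dot : set H := [set v : H |
  exists2 g_ : nat -> H, forall n, grad_test (g_ n) &
    L2norm (g_ n - v) @[n --> \oo] --> (0 : R)].

Definition orth_proj (X : set H) : set (H * H) := [set p : H * H |
  X p.2 /\ forall v, X v -> L2inner (p.1 - p.2) v = 0].

Definition mul_op (M : R3 R -> 'M[C]_3) : set (H * H) := [set p : H * H |
  {ae vol Omega, forall x, p.2 x = M x *m p.1 x}].

Definition bounded_matrix_field (M : R3 R -> 'M[R]_3) : Prop :=
  (forall i j, measurable_fun (Omega : set (R3 R)) (fun x => M x i j)) /\
  exists B : R, {ae vol Omega, forall x i j, `|M x i j| <= B}.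

(* a symmetric field in L^oo(Omega, R^(3 x 3)) whose quadratic form lies
   between m and M on unit vectors *)
Definition coefficient (A : R3 R -> 'M[R]_3) (m M : R) : Prop :=
  [/\ bounded_matrix_field A,
      {ae vol Omega, forall x, (A x)^T = A x} &
      {ae vol Omega, forall x (h : 'cV[R]_3), enorm h = 1 ->
        m <= dotv h (A x *m h) <= M}].

Definition toC (A : 'M[R]_3) : 'M[C]_3 := map_mx (real_complex R) A.

Section Pencils.
Variables eps mu sig : R3 R -> 'M[R]_3.

Definition curl_inv_curl0 : set (H * H) :=
  op_comp curl (op_comp (mul_op (fun x => toC (invmx (mu x)))) curl0).

(* W(w) = - w (w eps + i sigma) *)
Definition mul_W (w : C) : set (H * H) :=
  mul_op (fun x => - w *: (w *: toC (eps x) + 'i%C *: toC (sig x))).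

Definition pencil_L (w : C) : set (H * H) := op_add curl_inv_curl0 (mul_W w).

Definition pencil_W (w : C) : set (H * H) :=
  op_restr (op_comp (orth_proj grad_H10dot) (mul_W w)) grad_H10dot.

End Pencils.

Definition curlcurl0_div0 : set (H * H) := op_restr (op_comp curl curl0) Hdiv0.

Definition pencil_Linf (eps_inf mu_inf : R) (w : C) : set (H * H) :=
  op_restr
    (op_add (op_comp curl (op_comp (op_scalar (mu_inf^-1)%:C%C) curl0))
            (op_scalar (- (eps_inf%:C%C * w ^+ 2))))
    Hdiv0.

(* The essential supremum over x in Omega, |x| > r; extending by 0 to |x| <= r
   does not change it, as the values are non-negative. *)
Definition tail_deviation (eps mu sig : R3 R -> 'M[R]_3) (eps_inf mu_inf : R)
    (r : R) : \bar R :=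
  ess_sup (vol Omega) (fun x => if r < enorm (to_col x) then
    (Num.max (opnorm (eps x - eps_inf%:M))
       (Num.max (opnorm (mu x - mu_inf%:M)) (opnorm (sig x))))%:E
    else 0%E).

End Maxwell.

Arguments L2norm {R} Omega u.
Arguments Hdiv0 {R} Omega.
Arguments grad_H10dot {R} Omega.
Arguments pencil_L {R} Omega eps mu sig w.
Arguments pencil_W {R} Omega eps sig w.
Arguments pencil_Linf {R} Omega eps_inf mu_inf w.
Arguments curlcurl0_div0 {R} Omega.

(* Main.v *)
From HB Require Import structures.
Require Import Defs.
From mathcomp Require Import all_boot all_order all_algebra.
From mathcomp Require Import generic_quotient ring_quotient complex ring lra.
From mathcomp Require Import all_classical all_reals all_analysis.
From mathcomp Require Import measurable_realfun ess_sup_inf.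

Set Implicit Arguments.
Unset Strict Implicit.
Unset Printing Implicit Defensive.

Import Order.TTheory GRing.Theory Num.Theory.
Import numFieldNormedType.Exports.

Local Open Scope classical_set_scope.
Local Open Scope ring_scope.

(** Let [J] be complex conjugation. The operators of the theorem are symmetric for the bilinear form
[rp f (J x)], and maximal so. For such an operator, [J] maps the kernel onto the orthogonal complement of the
range, so nullity and deficiency agree, and each of the four Fredholm properties amounts to one estimate,
|x| <= c |T x| + sum_i |(x, e_i)| with finitely many e_i ([conj_selfadjoint_fredholm]). The four essential
spectra therefore coincide, and only estimates have to be compared.

Split E = v + x, with v in the closure V of the gradients of test functions and x divergence free. The curl
does not see v, so v solves the equation of the compression of W to V, and x that of L_inf, up to errors that
contain W - W_inf and mu^-1 - mu_inf^-1. These errors are negligible: smaller than any multiple of |E|, up to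
|f| and finitely many functionals of E. This gives the union of the spectra ([bel_conv], [bel_W], [bel_Linf]).

Negligibility holds because the coefficients are nearly constant far away, while on bounded sets x depends
compactly on (x, curl x) ([cutoff_compact]) and curl x is controlled by x through a Caccioppoli inequality
([caccioppoli]). Compactness up to the Lipschitz boundary ([local_compactness]) is obtained by mollification
along a cone that points into the domain. The difference of the mollifiers at two consecutive scales is a
divergence; integrated by parts against a divergence-free field it leaves terms that contain only the field,
its curl and a factor of the order of the scale. Over a geometric sequence of scales these terms sum up, and
what remains is a convolution, of finite rank up to a small error ([finite_rank]).

Where the spectra lie follows by testing the equations with multiples of the solution
([scalar_graph_bel], [dissipation_bel]). *)

Local Notation mfT := (measurable_fun [set: _]).

Lemma le_of_eq disp (T : porderType disp) (x y : T) : x = y -> (x <= y)%O.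
by move->. Qed.

Record is_ip (R : realType) (H : lmodType R[i]) (rp : H -> H -> R) : Prop := IsIp {
  rpDl : forall x y z, rp (x + y) z = rp x z + rp y z;
  rpZl : forall (a : R) x y, rp (a%:C%C *: x) y = a * rp x y;
  rpC : forall x y, rp x y = rp y x;
  rp_ge0 : forall x, 0 <= rp x x;
  rp_eq0 : forall x, rp x x = 0 -> x = 0 }.

Definition ipnorm (R : realType) (H : lmodType R[i]) (rp : H -> H -> R) (x : H) : R :=
  Num.sqrt (rp x x).

Lemma real_complexN1 (R : rcfType) : (-1)%:C%C = -1 :> R[i].
by apply/eqP; rewrite eq_complex /= oppr0 !eqxx. Qed.

(** * Real inner products and projections *)
Section InnerProduct.
Context {R : realType} {H : lmodType R[i]} {rp : H -> H -> R}.
Hypothesis ip : is_ip rp.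
Notation nrm := (ipnorm rp).

Lemma rpDr x y z : rp x (y + z) = rp x y + rp x z.
by rewrite ![rp x _](rpC ip) (rpDl ip). Qed.
Lemma rpZr (a : R) x y : rp x (a%:C%C *: y) = a * rp x y.
by rewrite ![rp x _](rpC ip) (rpZl ip). Qed.
Lemma rpNl x y : rp (- x) y = - rp x y.
have := rpZl ip (-1) x y; rewrite mulN1r => <-.
by rewrite real_complexN1 scaleN1r.
Qed.

Lemma rpNr x y : rp x (- y) = - rp x y.
by rewrite ![rp x _](rpC ip) rpNl. Qed.
Lemma rpBl x y z : rp (x - y) z = rp x z - rp y z.
by rewrite (rpDl ip) rpNl. Qed.
Lemma rpBr x y z : rp x (y - z) = rp x y - rp x z.
by rewrite rpDr rpNr. Qed.
Lemma rp0l x : rp 0 x = 0.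
by have := rpBl 0 0 x; rewrite !subrr. Qed.
Lemma rp0r x : rp x 0 = 0.
by rewrite (rpC ip) rp0l. Qed.
Lemma nrm_ge0 x : 0 <= nrm x. exact: sqrtr_ge0. Qed.

Lemma nrm_sqr x : nrm x ^+ 2 = rp x x.
by rewrite sqr_sqrtr // (rp_ge0 ip). Qed.
Lemma nrm0 : nrm 0 = 0. by rewrite /ipnorm rp0l sqrtr0. Qed.

Lemma nrm_eq0 x : nrm x = 0 -> x = 0.
by move=> x0; apply: (rp_eq0 ip); rewrite -nrm_sqr x0 expr0n. Qed.
Lemma nrmN x : nrm (- x) = nrm x.
by rewrite /ipnorm rpNl rpNr opprK. Qed.
Lemma nrmB x y : nrm (x - y) = nrm (y - x).
by rewrite -nrmN opprB. Qed.
Lemma nrmZ (a : R) x : nrm (a%:C%C *: x) = `|a| * nrm x.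
by rewrite /ipnorm (rpZl ip) rpZr mulrA -expr2 sqrtrM ?sqr_ge0 // sqrtr_sqr.
Qed.

Lemma cauchy_schwarz x y : `|rp x y| <= nrm x * nrm y.
have [y0|y0] := eqVneq (rp y y) 0.
 by rewrite (rp_eq0 ip y0) rp0r normr0 mulr_ge0 ?nrm_ge0.
have yp : 0 < rp y y by rewrite lt_def y0 (rp_ge0 ip).
have := rp_ge0 ip (x - (rp x y / rp y y)%:C%C *: y).
rewrite rpBl !rpBr !(rpZl ip) !rpZr (rpC ip y x) => h.
have h2 : rp x y ^+ 2 <= rp x x * rp y y.
 have -> : rp x x * rp y y = (rp x x - rp x y / rp y y * rp x y -
  (rp x y / rp y y * rp x y - rp x y / rp y y * (rp x y / rp y y * rp y y)))
  * rp y y + rp x y ^+ 2 by field.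
 by rewrite lerDr mulr_ge0 // ltW.
rewrite -sqrtrM ?(rp_ge0 ip) // -sqrtr_sqr ler_sqrt // mulr_ge0 ?(rp_ge0 ip) //.
Qed.

Lemma nrmD x y : nrm (x + y) <= nrm x + nrm y.
rewrite -(@ler_pXn2r _ 2) // ?nnegrE ?addr_ge0 ?nrm_ge0 //.
rewrite nrm_sqr sqrrD !nrm_sqr (rpDl ip) !rpDr (rpC ip y x).
have := le_trans (ler_norm _) (cauchy_schwarz x y).
lra.
Qed.

Lemma nrmBD x y : nrm (x - y) <= nrm x + nrm y.
by rewrite -(nrmN y) nrmD. Qed.
Lemma rp_le x y : rp x y <= nrm x * nrm y.
exact: le_trans (ler_norm _) (cauchy_schwarz x y). Qed.
Definition ip_cvg (x_ : nat -> H) x :=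
  forall e, 0 < e -> exists N, forall n, (N <= n)%N -> nrm (x_ n - x) <= e.

Definition ip_cauchy (x_ : nat -> H) :=
  forall e, 0 < e -> exists N, forall m n, (N <= m)%N -> (N <= n)%N ->
    nrm (x_ m - x_ n) <= e.

Definition ip_complete (S : set H) :=
  forall x_, (forall n, S (x_ n)) -> ip_cauchy x_ -> exists2 x, S x & ip_cvg x_ x.

Definition rsubspace (S : set H) :=
  [/\ S 0, forall x y, S x -> S y -> S (x + y) &
      forall (a : R) x, S x -> S (a%:C%C *: x)].

Lemma rsubspaceN S x : rsubspace S -> S x -> S (- x).
move=> [_ _ SZ] /(SZ (-1)).
by rewrite real_complexN1 scaleN1r.
Qed.

Lemma rsubspaceB S x y : rsubspace S -> S x -> S y -> S (x - y).
by move=> SS Sx /(rsubspaceN SS); case: SS => _ + _; exact. Qed.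
Lemma ip_cvg_cauchy x_ x : ip_cvg x_ x -> ip_cauchy x_.
move=> h e e0; have [N hN] := h _ (divr_gt0 e0 (ltr0n _ 2)).
exists N => m n /hN hm /hN hn; rewrite -(subrKA x).
rewrite (le_trans (nrmD _ _)) // (nrmB x); lra.
Qed.

Lemma ip_cvg_rp x_ x y c : ip_cvg x_ x -> (forall n, rp (x_ n) y = c) -> rp x y = c.
move=> h hc; apply/eqP; rewrite -subr_eq0 -normr_le0; apply/ler_addgt0Pl => e e0.
have y1 : 0 < nrm y + 1 by rewrite ltr_wpDl ?nrm_ge0.
have [N hN] := h _ (divr_gt0 e0 y1).
rewrite -(hc N) distrC -rpBl (le_trans (cauchy_schwarz _ _)) // addr0.
rewrite (le_trans (ler_wpM2r (nrm_ge0 y) (hN N (leqnn _)))) //.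
by rewrite -mulrA ler_piMr ?ltW // mulrC ltr_pdivrMr // mul1r ltrDl.
Qed.

Lemma ip_cvg_rp2 x_ f_ x f y z : ip_cvg x_ x -> ip_cvg f_ f -> (forall n, rp (f_ n) y = rp (x_ n) z) -> rp f y = rp x z.
move=> hx hf h; apply/eqP; rewrite -subr_eq0 -normr_le0; apply/ler_addgt0Pl => e e0; rewrite addr0.
have k0 : 0 < nrm y + nrm z + 1 by rewrite ltr_wpDl // addr_ge0 // nrm_ge0.
have [N hN] := hx _ (divr_gt0 e0 k0); have [M hM] := hf _ (divr_gt0 e0 k0); pose n := maxn N M.
have -> : rp f y - rp x z = rp (x_ n - x) z - rp (f_ n - f) y by rewrite !rpBl h; ring.
apply: le_trans (ler_normB _ _) _.
apply: le_trans (lerD (le_trans (cauchy_schwarz _ z) (ler_wpM2r (nrm_ge0 z) (hN n (leq_maxl _ _))))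
 (le_trans (cauchy_schwarz _ y) (ler_wpM2r (nrm_ge0 y) (hM n (leq_maxr _ _))))) _.
by rewrite -mulrDr mulrAC ler_pdivrMr // ler_pM2l //; lra.
Qed.

Lemma ip_cvg_unique x_ x y : ip_cvg x_ x -> ip_cvg x_ y -> x = y.
move=> hx hy; apply/eqP; rewrite -subr_eq0; apply/eqP/nrm_eq0/le_anti.
rewrite nrm_ge0 andbT; apply/ler_addgt0Pl => e e0.
have [N1 h1] := hx _ (divr_gt0 e0 (ltr0n _ 2)).
have [N2 h2] := hy _ (divr_gt0 e0 (ltr0n _ 2)).
have := h1 (maxn N1 N2) (leq_maxl _ _); have := h2 (maxn N1 N2) (leq_maxr _ _).
rewrite -(subrKA (x_ (maxn N1 N2)) x (- y)) => a b.
rewrite (le_trans (nrmD _ _)) // (nrmB x); lra.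
Qed.

Lemma ip_cvg_lip (H' : lmodType R[i]) (rp' : H' -> H' -> R) (ip' : is_ip rp')
    (F : H -> H') c x_ x :
  0 <= c -> (forall y z, ipnorm rp' (F y - F z) <= c * nrm (y - z)) ->
  ip_cvg x_ x -> forall e, 0 < e -> exists N, forall n, (N <= n)%N ->
    ipnorm rp' (F (x_ n) - F x) <= e.
move=> c0 hF hx e e0.
have c1 : 0 < c + 1 by rewrite ltr_wpDl.
have [N hN] := hx _ (divr_gt0 e0 c1); exists N => n /hN h.
rewrite (le_trans (hF _ _)) // (le_trans (ler_wpM2l c0 h)) //.
by rewrite mulrA mulrAC ler_piMl ?ltW // ltr_pdivrMr // mul1r ltrDl.
Qed.

Lemma projection (S : set H) (g : H) : rsubspace S -> ip_complete S ->
  exists2 p, S p & forall s, S s -> rp (g - p) s = 0.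
move=> SS Sc; have [S0 SD SZ] := SS.
pose E := [set d | exists2 s, S s & d = rp (g - s) (g - s)].
have E0 : has_inf E.
 split; first by exists (rp (g - 0) (g - 0)); exists 0. by exists 0 => _ [s _ ->]; exact: rp_ge0.
pose d := inf E.
have dE s : S s -> d <= rp (g - s) (g - s).
 by move=> Ss; apply: ge_inf; [case: E0|exists s].
have /choice[s_ hs] : forall n, exists s, S s /\ rp (g - s) (g - s) <= d + n.+1%:R^-1.
 move=> n; have n0 : (0 : R) < n.+1%:R^-1 by rewrite invr_gt0. have [_ [s Ss ->] /ltW h] := inf_adherent n0 E0.
 by exists s; split.
have key m n : rp (s_ m - s_ n) (s_ m - s_ n) <= 2 * (m.+1%:R^-1 + n.+1%:R^-1).
 have [[Sm hm] [Sn hn]] := (hs m, hs n). have := dE _ (SZ 2^-1 _ (SD _ _ Sm Sn)).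
 rewrite !rpBl !rpBr !(rpZl ip) !rpZr !(rpDl ip) !rpDr.
 move: hm hn; rewrite !rpBl !rpBr (rpC ip (s_ n) g) (rpC ip (s_ m) g) (rpC ip (s_ n) (s_ m)).
 move: (_^-1) (m.+1%:R^-1) => a b c; lra.
have [|p Sp hp] := Sc s_ (fun n => (hs n).1).
 move=> e e0; have e2 : 0 < e ^+ 2 / 4 by rewrite divr_gt0 ?exprn_gt0.
 have [N _ hN] := near_infty_natSinv_lt (PosNum e2).
 exists N => m n Nm Nn; rewrite -(@ler_pXn2r _ 2) // ?nnegrE ?nrm_ge0 ?(ltW e0) //.
 rewrite nrm_sqr (le_trans (key m n)) //. have := hN _ Nm; have := hN _ Nn; rewrite /=.
 by move: (n.+1%:R^-1) (m.+1%:R^-1) => a b; lra.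
have gpd : nrm (g - p) <= Num.sqrt d.
 have d0 : 0 <= d by apply: lb_le_inf; [case: E0|move=> _ [s _ ->]; exact: rp_ge0]. apply/ler_addgt0Pl => e e0.
 have [N hN] := hp _ (divr_gt0 e0 (ltr0n _ 2)). have e2 : 0 < (e / 2) ^+ 2 by rewrite exprn_gt0 // divr_gt0.
 have [M _ hM] := near_infty_natSinv_lt (PosNum e2).
 have := hN (maxn N M) (leq_maxl _ _); have := hM (maxn N M) (leq_maxr _ _) => /= /ltW a b.
 rewrite -(subrKA (s_ (maxn N M))) (le_trans (nrmD _ _)) //.
 have : nrm (g - s_ (maxn N M)) <= Num.sqrt d + e / 2; last lra.
 rewrite -(@ler_pXn2r _ 2) // ?nnegrE ?nrm_ge0 ?addr_ge0 ?sqrtr_ge0 //; last by rewrite ltW // divr_gt0.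
 rewrite nrm_sqr (le_trans (hs _).2) // sqrrD sqr_sqrtr //.
 by rewrite -addrA lerD2l (le_trans a) // lerDr mulrn_wge0 // mulr_ge0 ?sqrtr_ge0 // divr_ge0 // ltW.
exists p => // s Ss; have [s0|s0] := eqVneq (rp s s) 0.
 by rewrite (rp_eq0 ip s0) rp0r.
have sp : 0 < rp s s by rewrite lt_def s0 (rp_ge0 ip).
pose t := rp (g - p) s / rp s s.
have := dE _ (SD _ _ Sp (SZ t _ Ss)); rewrite opprD addrA.
have gp2 : rp (g - p) (g - p) <= d.
 rewrite -nrm_sqr -[d]sqr_sqrtr ?ler_pXn2r // ?nnegrE ?nrm_ge0 ?sqrtr_ge0 //.
 by apply: lb_le_inf; [case: E0|move=> _ [u _ ->]; exact: rp_ge0].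
rewrite (rpBl (g - p)) !(rpBr _ (g - p)) !(rpZl ip) !rpZr (rpC ip s (g - p)) => h.
have : t * rp (g - p) s <= 0.
 have tt : t * rp s s = rp (g - p) s by rewrite /t mulfVK. by rewrite tt in h; lra.
rewrite /t mulrAC -expr2 pmulr_lle0 ?invr_gt0 // => h2.
by apply/eqP; rewrite -sqrf_eq0 eq_le h2 sqr_ge0.
Qed.
End InnerProduct.

Arguments ip_cvg {R H} rp x_ x.
Arguments ip_cauchy {R H} rp x_.
Arguments ip_complete {R H} rp S.

(** * Uniform boundedness *)
Section UniformBoundedness.
Context {R : realType} {H : lmodType R[i]} {rp : H -> H -> R}.
Hypothesis ip : is_ip rp.
Notation nrm := (ipnorm rp).

Lemma uniform_boundedness (Y : set H) (xs : nat -> H) :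
  rsubspace Y -> ip_complete rp Y -> (forall n, Y (xs n)) ->
  (forall y, Y y -> exists C, forall n, `|rp (xs n) y| <= C) ->
  exists C, forall n, nrm (xs n) <= C.
move=> YY Yc Yx ptw; have [Y0 YD YZ] := YY.
apply: contrapT => unb.
have /choice[j hj] : forall k : nat, exists n, 2 * k.+1%:R * 3 ^+ k <= nrm (xs n).
 move=> k; apply: contrapT => /forallNP h; apply: unb; exists (2 * k.+1%:R * 3 ^+ k) => n.
 by rewrite leNgt; apply/negP => /ltW; exact: h.
pose z k := xs (j k).
have z0 k : 0 < nrm (z k).
 by rewrite (lt_le_trans _ (hj k)) // mulr_gt0 ?exprn_gt0 // mulr_gt0.
pose a k := (3 ^- k / nrm (z k))%:C%C *: z k.
pose step k y := if 3 ^- k * nrm (z k) <= `|rp (z k) (y + a k)| then y + a k else y - a k.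
pose y := fix y n := if n is k.+1 then step k (y k) else 0.
have za k : rp (z k) (a k) = 3 ^- k * nrm (z k).
 by rewrite (rpZr ip) -(nrm_sqr ip) expr2 mulrA mulfVK // gt_eqF.
have na k : nrm (a k) = 3 ^- k.
 rewrite (nrmZ ip) ger0_norm ?mulfVK ?gt_eqF //. by rewrite divr_ge0 ?invr_ge0 ?exprn_ge0 // ltW.
have Ya k : Y (a k) by apply: YZ; exact: Yx.
have Yy k : Y (y k).
 elim: k => [//|k IH] /=; rewrite /step; case: ifP => _.
  exact: YD.
 exact: rsubspaceB.
have big k : 3 ^- k * nrm (z k) <= `|rp (z k) (y k.+1)|.
 rewrite /= /step; case: ifPn => // ; rewrite -ltNge (rpDr ip) (rpBr ip) za.
 set b := 3 ^- k * _; have b0 : 0 <= b by rewrite mulr_ge0 ?invr_ge0 ?exprn_ge0 // ltW.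
 rewrite ltr_norml => /andP[h1 h2]; rewrite ler_normr; apply/orP; right; lra.
have dy k : nrm (y k.+1 - y k) = 3 ^- k.
 rewrite /= /step; case: ifP => _; first by rewrite addrAC subrr add0r. by rewrite addrAC subrr add0r nrmN.
have dist k m : nrm (y (m + k)%N - y k) <= 3 / 2 * (3 ^- k - 3 ^- (m + k)).
 elim: m => [|m IH]; first by rewrite add0n !subrr mulr0 nrm0.
 rewrite -(subrKA (y (m + k)%N)) (le_trans (nrmD ip _ _)) // addSn dy.
 have : (3 : R) ^- (m + k).+1 = 3^-1 * 3 ^- (m + k) by rewrite exprS invfM.
 by move: IH; move: (3 ^- (m + k)) (3 ^- (m + k).+1) (3 ^- k) => p q r; lra.
have p3 k : 0 < (3 : R) ^- k by rewrite invr_gt0 exprn_gt0.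
have dist2 k m : (k <= m)%N -> nrm (y m - y k) <= 3 / 2 * 3 ^- k.
 move=> km; rewrite -(subnK km); have := dist k (m - k)%N; have := p3 (m - k + k)%N.
 by move: (3 ^- _) (3 ^- k) => u v; lra.
have [|w Yw hw] := Yc y Yy.
 move=> e e0. have e3 : 0 < e / 3 by rewrite divr_gt0. have [N _ hN] := near_infty_natSinv_lt (PosNum e3).
 have h3 : 3 ^- N <= N.+1%:R^-1 :> R.
  rewrite lef_pV2 ?posrE ?exprn_gt0 // -natrX ler_nat. exact: ltn_expl.
 have := hN N (leqnn _) => /= h4. exists N => m n hm hn; rewrite -(subrKA (y N)) (le_trans (nrmD ip _ _)) //.
 rewrite (nrmB ip (y N)); have := dist2 _ _ hm; have := dist2 _ _ hn.
 by move: h3 h4; move: (3 ^- N) (N.+1%:R^-1) => u v; lra.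
have fin k : nrm (w - y k) <= 3 / 2 * 3 ^- k.
 apply/ler_addgt0Pl => e e0; have [N hN] := hw _ e0.
 have := hN (maxn N k) (leq_maxl _ _); have := dist2 k (maxn N k) (leq_maxr _ _).
 rewrite -(subrKA (y (maxn N k)) w) => h1 h2. by rewrite (le_trans (nrmD ip _ _)) // (nrmB ip w) lerD.
have [C hC] := ptw w Yw.
have low k : k.+1%:R <= `|rp (z k) w|.
 have : 3 ^- k * nrm (z k) <= `|rp (z k) w| + 2^-1 * (3 ^- k * nrm (z k)).
  rewrite (le_trans (big k)) // -[y k.+1](subrK w) (rpDr ip) addrC.
  rewrite (le_trans (ler_normD _ _)) // lerD2l (le_trans (cauchy_schwarz ip _ _)) //.
  rewrite (nrmB ip) (le_trans (ler_wpM2l (ltW (z0 k)) (fin k.+1))) //.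
  rewrite exprS invfM; move: (z0 k); move: (3 ^- k) (nrm (z k)) => u v v0. by apply: le_of_eq; field.
 have : 2 * k.+1%:R <= 3 ^- k * nrm (z k).
  by rewrite [leRHS]mulrC ler_pdivlMr ?exprn_gt0.
 by move: (3 ^- k * _) `|_| => u v; lra.
have /archi_boundP := le_trans (normr_ge0 _) (hC 0%N).
set N := Num.bound C => hN; have := le_trans (low N) (hC (j N)).
by rewrite leNgt (lt_le_trans hN) // ler_nat.
Qed.
End UniformBoundedness.

(** * Complex inner products *)
Section ComplexHilbert.
Context {R : realType} {H : lmodType R[i]}.
Variable rp : H -> H -> R.

Record is_cip : Prop := IsCip {
  cip_ip : is_ip rp;
  rpI : forall x y, rp ('i%C *: x) ('i%C *: y) = rp x y }.

Record is_conj (J : H -> H) : Prop := IsConj {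
  conjD : forall x y, J (x + y) = J x + J y;
  conjZ : forall (c : R[i]) x, J (c *: x) = c^*%C *: J x;
  conjK : forall x, J (J x) = x;
  rpJ : forall x y, rp (J x) (J y) = rp x y }.

Definition csubspace (S : set H) :=
  [/\ S 0, forall x y, S x -> S y -> S (x + y) &
      forall (c : R[i]) x, S x -> S (c *: x)].

Lemma sub_real S : csubspace S -> rsubspace S.
by case=> S0 SD SZ; split => // a x; exact: SZ. Qed.
Definition cp (x y : H) : R[i] := (rp x y +i* rp x ('i%C *: y))%C.

Notation nrm := (ipnorm rp).
Hypothesis hH : is_cip.
Let ip := cip_ip hH.

Lemma scaleii (x : H) : 'i%C *: ('i%C *: x) = - x.
by rewrite scalerA -expr2 sqr_i scaleN1r. Qed.
Lemma rpi_l x y : rp ('i%C *: x) y = - rp x ('i%C *: y).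
by rewrite -(rpI hH) scaleii (rpNl ip). Qed.
Lemma scaleCE (c : R[i]) (x : H) :
  c *: x = (complex.Re c)%:C%C *: x + (complex.Im c)%:C%C *: ('i%C *: x).
by rewrite {1}[c]complexE scalerDl scalerA [_ * 'i%C]mulrC. Qed.
Lemma nrmi x : nrm ('i%C *: x) = nrm x.
by rewrite /ipnorm (rpI hH). Qed.
Lemma cpD x y z : cp (x + y) z = cp x z + cp y z.
by apply/eqP; rewrite eq_complex /= !(rpDl ip) !eqxx. Qed.
Lemma cpZ (c : R[i]) x z : cp (c *: x) z = c * cp x z.
apply/eqP; rewrite eq_complex /cp scaleCE !(rpDl ip) !(rpZl ip) !rpi_l scaleii (rpNr ip).
case: c => a b /=; apply/andP; split; apply/eqP; ring.
Qed.

Lemma cp_sum n (F : 'I_n -> H) z : cp (\sum_i F i) z = \sum_i cp (F i) z.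
apply: (big_morph (fun x => cp x z)) => [x y|]; first exact: cpD.
by apply/eqP; rewrite eq_complex /= !(rp0l ip) !eqxx.
Qed.

Lemma cpN x z : cp (- x) z = - cp x z.
by rewrite -scaleN1r cpZ mulN1r. Qed.
Lemma cp0l z : cp 0 z = 0.
by rewrite -(scale0r 0) cpZ mul0r. Qed.
Lemma cp_self x : cp x x = (nrm x ^+ 2)%:C%C.
rewrite (nrm_sqr ip); apply/eqP; rewrite eq_complex /= eqxx /=.
have := rpi_l x x; rewrite (rpC ip) => h; apply/eqP; lra.
Qed.

Lemma rp_cp0 x y : cp x y = 0 -> forall c, rp x (c *: y) = 0.
by case=> h1 h2 c; rewrite scaleCE (rpDr ip) !(rpZr ip) h1 h2 !mulr0 addr0.
Qed.

Lemma rp_sum0 n (F : 'I_n -> H) z : (forall i, rp z (F i) = 0) -> rp z (\sum_i F i) = 0.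
by move=> h; elim/big_ind: _ => // [|x y hx hy]; rewrite ?(rp0r ip) // (rpDr ip) hx hy addr0.
Qed.

Definition orthonormal n (b : 'I_n -> H) :=
  forall i j, cp (b i) (b j) = (i == j)%:R.

Lemma cp_eq0C x y : cp x y = 0 -> cp y x = 0.
case=> h1 h2; apply/eqP; rewrite eq_complex /= (rpC ip) h1 eqxx /=.
by rewrite (rpC ip) rpi_l h2 oppr0.
Qed.

Lemma subspace_sum S n (F : 'I_n -> H) : csubspace S -> (forall i, S (F i)) -> S (\sum_i F i).
by move=> [S0 SD _] h; elim/big_ind: _. Qed.

(** If finitely many functionals separate the points of [K], then [K] is finite dimensional; Gram-Schmidt gives
the basis. *)
Lemma separation_basis (es : seq H) (K : set H) : csubspace K ->
  (forall k, K k -> (forall e, e \in es -> rp k e = 0) -> k = 0) ->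
  exists n (b : 'I_n -> H), [/\ forall i, K (b i), orthonormal b &
    forall k, K k -> k = \sum_i cp k (b i) *: b i].
elim: es K => [|e es IH] K KK sep.
 exists 0%N, (fun=> 0); split => [[]//|[]//|k Kk]. by rewrite big_ord0; apply: sep.
have [K0 KD KZ] := KK.
pose K' := K `&` [set k | cp k e = 0].
have K'K : csubspace K'.
 split; first by split => //; exact: cp0l.
  by move=> x y [Kx x0] [Ky y0]; split; [exact: KD|rewrite /= cpD x0 y0 addr0].
 by move=> c x [Kx x0]; split; [exact: KZ|rewrite /= cpZ x0 mulr0].
have [|n [b [Kb ob hb]]] := IH K' K'K.
 move=> k [Kk [k0 _]] h; apply: sep => // f; rewrite inE => /orP[/eqP->//|]; exact: h.
have [[k0 [Kk0 k0e]]|none] := pselect (exists k, K k /\ cp k e != 0); last first.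
 exists n, b; split => // [i|k Kk]; first by have [] := Kb i. apply: hb; split => //=; apply/eqP/negP => /negP ke.
 by apply: none; exists k.
pose p := k0 - \sum_i cp k0 (b i) *: b i.
have Kp : K p.
 apply: (rsubspaceB (sub_real KK)) => //. by apply: subspace_sum => // i; apply: KZ; have [] := Kb i.
have pe : cp p e = cp k0 e.
 rewrite cpD cpN cp_sum big1 ?subr0 // => i _. by have [_ /= h] := Kb i; rewrite cpZ h mulr0.
have pb i : cp p (b i) = 0.
 rewrite cpD cpN cp_sum (bigD1 i) //= cpZ ob eqxx mulr1 big1 ?addr0 ?subrr //.
 by move=> l /negPf li; rewrite cpZ ob li mulr0.
have p0 : 0 < nrm p.
 rewrite lt_def nrm_ge0 andbT; apply: contraNneq k0e => /(nrm_eq0 ip) p0. by rewrite -pe p0 cp0l.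
pose q := ((nrm p)^-1)%:C%C *: p.
have Kq : K q by exact: KZ.
have qb i : cp q (b i) = 0 by rewrite cpZ pb mulr0.
have qq : cp q q = 1.
 rewrite cp_self (nrmZ ip) ger0_norm ?invr_ge0 ?(ltW p0) // mulVf ?gt_eqF //. by rewrite expr1n.
have qe : cp q e != 0.
 by rewrite cpZ pe mulf_neq0 // eq_complex /= eqxx andbT invr_eq0 gt_eqF.
exists n.+1, (fun i => if unlift ord0 i is Some j then b j else q); split.
- by move=> i; case: unlift => // j; have [] := Kb j.
- move=> i j; case: unliftP => [i' ->|->]; case: unliftP => [j' ->|->].
 + by rewrite ob (inj_eq lift_inj).
 + by rewrite (cp_eq0C (qb i')) eq_sym (negPf (neq_lift _ _)).
 + by rewrite qb (negPf (neq_lift _ _)).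
 + by rewrite qq eqxx.
- move=> k Kk; rewrite big_ord_recl unlift_none. under eq_bigr do rewrite liftK. pose a := cp k e / cp q e.
 have Kk' : K' (k - a *: q).
  split; first by apply: (rsubspaceB (sub_real KK)) => //; exact: KZ. by rewrite /= cpD cpN cpZ mulfVK // subrr.
 have kb i : cp (k - a *: q) (b i) = cp k (b i).
  by rewrite cpD cpN cpZ qb mulr0 subr0.
 have h : k - a *: q = \sum_i cp k (b i) *: b i.
  by rewrite {1}(hb _ Kk'); apply: eq_bigr => i _; rewrite kb.
 have kq : cp k q = a.
  rewrite -[k](subrK (a *: q)) cpD cpZ qq mulr1 h cp_sum big1 ?add0r // => i _. by rewrite cpZ (cp_eq0C (qb i)) mulr0.
 by rewrite kq -h addrC subrK.
Qed.

Lemma nrm_scale_cp (x e : H) : nrm e = 1 ->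
  nrm (cp x e *: e) <= `|rp x e| + `|rp x ('i%C *: e)|.
move=> e1; rewrite scaleCE /= (le_trans (nrmD ip _ _)) //.
by rewrite !(nrmZ ip) nrmi e1 !mulr1.
Qed.
End ComplexHilbert.

Definition bounded_mod_finite (R : realType) (H : lmodType R[i])
    (rp : H -> H -> R) (T : set (H * H)) :=
  exists c (es : seq H), forall x f, T (x, f) ->
    ipnorm rp x <= c * ipnorm rp f + \sum_(e <- es) `|rp x e|.

(** * Conjugation-selfadjoint graphs *)
Section JSelfAdjoint.
Context {R : realType} {H : lmodType R[i]} {rp : H -> H -> R} {J : H -> H}.
Notation nrm := (ipnorm rp).
Hypotheses (hH : is_cip rp) (hJ : is_conj rp J).
Let ip := cip_ip hH.

(** Symmetry for the bilinear form [rp f (J x)]; by the maximality [csa_max], the adjoint is J T J. *)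
Record conj_selfadjoint (Y : set H) (T : set (H * H)) : Prop := ConjSelfadjoint {
  csaY : forall x f, T (x, f) -> Y x /\ Y f;
  csaZ : forall (c : R[i]) x f, T (x, f) -> T (c *: x, c *: f);
  csa_sym : forall x f y g, T (x, f) -> T (y, g) -> rp f (J y) = rp x (J g);
  csa_max : forall x f, Y x -> Y f -> (forall y g, T (y, g) -> rp f (J y) = rp x (J g)) -> T (x, f) }.

Lemma rpJl x y : rp (J x) y = rp x (J y).
by rewrite -(rpJ hJ) (conjK hJ). Qed.
Lemma nrmJ x : nrm (J x) = nrm x.
by rewrite /ipnorm (rpJ hJ). Qed.
Lemma conjN x : J (- x) = - J x.
by rewrite -scaleN1r (conjZ hJ) -[RHS]scaleN1r; congr (_ *: _); rewrite rmorphN1. Qed.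
Lemma conjB x y : J (x - y) = J x - J y.
by rewrite (conjD hJ) conjN. Qed.
Lemma conj0 : J 0 = 0.
by have := conjB 0 0; rewrite !subrr. Qed.
Lemma conj_sum n (F : 'I_n -> H) : J (\sum_i F i) = \sum_i J (F i).
by apply: (big_morph J) => [x y|]; [exact: (conjD hJ)|exact: conj0]. Qed.
Lemma closed_add_line (A Y : set H) g : rsubspace A -> ip_complete rp Y ->
  A `<=` Y -> (forall f_ f, (forall n, A (f_ n)) -> ip_cvg rp f_ f -> A f) ->
  forall f_ f, (forall n, exists2 t : R, True & A (f_ n - t%:C%C *: g)) ->
    ip_cvg rp f_ f -> exists t : R, A (f - t%:C%C *: g).
move=> AA Yc AY Acl f_ f hf cf; have [A0 AD AZ] := AA.
have Ac : ip_complete rp A.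
 move=> x_ Ax /(Yc _ (fun n => AY _ (Ax n)))[x _ xx]; exists x => //. exact: Acl Ax xx.
have [p Ap hp] := projection ip g AA Ac.
have [h hE] : exists h, h = g - p by exists (g - p).
have hA a : A a -> rp a h = 0 by move=> /hp; rewrite hE (rpC ip).
have [h0|h0] := eqVneq h 0.
 exists 0; rewrite scale0r subr0; apply: Acl cf => n.
 have [t _] := hf n; have -> : g = p by apply/eqP; rewrite -subr_eq0 -hE h0.
 by move=> /AD/(_ (AZ t _ Ap)); rewrite subrK.
have hh : 0 < rp h h.
 by rewrite lt_def (rp_ge0 ip) andbT; apply: contraNneq h0 => /(rp_eq0 ip) ->.
pose t f := rp f h / rp h h; pose F f := f - (t f)%:C%C *: h.
have FA n : A (F (f_ n)).
 have [s _ As] := hf n. have e : f_ n = (f_ n - s%:C%C *: g + s%:C%C *: p) + s%:C%C *: h.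
  by rewrite hE scalerBr -addrA [X in _ + X]addrC !subrK.
 have As' : A (f_ n - s%:C%C *: g + s%:C%C *: p) by apply: AD => //; exact: AZ.
 suff -> : F (f_ n) = f_ n - s%:C%C *: g + s%:C%C *: p by []. rewrite {1}/F; have -> : t (f_ n) = s.
  by rewrite /t e (rpDl ip) hA // add0r (rpZl ip) mulfK // gt_eqF.
 by rewrite {1}e addrK.
have Flip y z : nrm (F y - F z) <= 1 * nrm (y - z).
 have -> : F y - F z = F (y - z).
  rewrite /F /t (rpBl ip) mulrBl rmorphB /= scalerBl !opprB. by rewrite [_ *: h - z]addrC addrACA [- _ + _]addrC.
 rewrite mul1r -(@ler_pXn2r _ 2) // ?nnegrE ?nrm_ge0 // !(nrm_sqr ip).
 move: (y - z) => u; rewrite /F (rpBl ip u) !(rpBr ip) !(rpZl ip) !(rpZr ip) (rpC ip h u).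
 have -> : t u * rp h h = rp u h by rewrite /t mulfVK // gt_eqF.
 rewrite subrr subr0 gerBl /t mulrAC -expr2 divr_ge0 ?sqr_ge0 ?ltW //.
have FF : ip_cvg rp (F \o f_) (F f).
 exact: (ip_cvg_lip ip ler01 Flip cf).
exists (t f); have Af := Acl _ _ FA FF.
have -> : f - (t f)%:C%C *: g = F f - (t f)%:C%C *: p.
 by rewrite /F hE scalerBr opprB !addrA [RHS](ACl (1*3*(2*4))) /= subrr addr0.
by apply: (rsubspaceB AA) => //; exact: AZ.
Qed.

Definition real_graph (T : set (H * H)) :=
  [/\ T (0, 0), forall x f y g, T (x, f) -> T (y, g) -> T (x + y, f + g) &
      forall (a : R) x f, T (x, f) -> T (a%:C%C *: x, a%:C%C *: f)].

(** Were the functionals absent, the preimages of a Cauchy sequence would be Cauchy. Each functional costs one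
dimension, which [closed_add_line] gives back. *)
Lemma bounded_below_closed_range (es : seq H) c (Y : set H) (T : set (H * H)) :
  ip_complete rp Y -> (forall x f, T (x, f) -> Y x /\ Y f) -> real_graph T ->
  (forall x_ f_ x f, (forall n, T (x_ n, f_ n)) ->
    ip_cvg rp x_ x -> ip_cvg rp f_ f -> T (x, f)) ->
  (forall x f, T (x, f) -> nrm x <= c * nrm f + \sum_(e <- es) `|rp x e|) ->
  forall f_ f, (forall n, op_range T (f_ n)) -> ip_cvg rp f_ f -> op_range T f.
move=> Yc; elim: es T => [|e es IH] T TY [T0 TD TZ] Tcl bel f_ f hf cf.
 have /choice[x_ hx] := hf. have c1 : 0 < `|c| + 1 by rewrite ltr_wpDl.
 have [||x Yx xx] := Yc x_; first by move=> n; have [] := TY _ _ (hx n).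
  move=> e e0; have [N hN] := ip_cvg_cauchy ip cf (divr_gt0 e0 c1).
  exists N => m n hm hn; have := TD _ _ _ _ (hx m) (TZ (-1) _ _ (hx n)).
  rewrite real_complexN1 !scaleN1r => /bel; rewrite big_nil addr0 => h. rewrite (le_trans h) //.
  have := hN m n hm hn; rewrite ler_pdivlMr // => h2. rewrite (le_trans _ h2) // mulrC ler_wpM2l ?nrm_ge0 //.
  by rewrite (le_trans (ler_norm _)) // lerDl.
 by exists x; apply: Tcl hx xx cf.
pose T' := T `&` [set p | rp p.1 e = 0].
have T'sub : real_graph T'.
 split; first by split => //=; rewrite (rp0l ip).
  by move=> x g y h [Tx /= x0] [Ty /= y0]; split; [exact: TD|rewrite /= (rpDl ip) x0 y0 addr0].
 by move=> a x g [Tx /= x0]; split; [exact: TZ|rewrite /= (rpZl ip) x0 mulr0].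
have T'cl x_ g_ x g : (forall n, T' (x_ n, g_ n)) ->
  ip_cvg rp x_ x -> ip_cvg rp g_ g -> T' (x, g).
 move=> h cx cg; split; first by apply: Tcl cx cg => n; have [] := h n.
 by apply: (ip_cvg_rp ip cx) => n; have [] := h n.
have T'r := IH T' (fun x g h => TY x g h.1) T'sub T'cl.
have T'rc : forall f_ f, (forall n, op_range T' (f_ n)) -> ip_cvg rp f_ f -> op_range T' f.
 apply: T'r => x g [Tx /= x0]; have := bel _ _ Tx. by rewrite big_cons x0 normr0 add0r.
have [[x0 [g0 [Tx0 e0]]]|none] := pselect (exists x0 g0, T (x0, g0) /\ rp x0 e != 0); last first.
 have TT' x g : T (x, g) -> T' (x, g).
  move=> Tx; split => //=; apply/eqP/negP => /negP h. by apply: none; exists x, g.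
 have [|x [Tx _]] := T'rc f_ f _ cf; last by exists x. by move=> n; have [x /TT' Tx] := hf n; exists x.
have [|||t [x [Tx _]]] := @closed_add_line (op_range T') Y g0 _ Yc _ T'rc f_ f _ cf.
- have [T'0 T'D T'Z] := T'sub; split.
 + by exists 0.
 + by move=> u v [x hx] [y hy]; exists (x + y); exact: T'D.
 + by move=> a u [x hx]; exists (a%:C%C *: x); exact: T'Z.
- by move=> u [x [Tx _]]; have [] := TY _ _ Tx.
- move=> n; have [x Tx] := hf n; exists (rp x e / rp x0 e) => //.
 exists (x - (rp x e / rp x0 e)%:C%C *: x0); split; last first.
  by rewrite /= (rpBl ip) (rpZl ip) mulfVK // subrr.
 have := TD _ _ _ _ Tx (TZ (- (rp x e / rp x0 e)) _ _ Tx0). by rewrite rmorphN /= !scaleNr.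
exists (x + t%:C%C *: x0).
by have := TD _ _ _ _ Tx (TZ t _ _ Tx0); rewrite subrK.
Qed.

Lemma csa_real_graph (Y : set H) (T : set (H * H)) : csubspace Y -> conj_selfadjoint Y T -> real_graph T.
move=> [Y0 YD _] TT; split; last by move=> a; exact: (csaZ TT).
 by apply: (csa_max TT) => // y g _; rewrite !(rp0l ip).
move=> x f y g Tx Ty; have [Yx Yf] := csaY TT Tx; have [Yy Yg] := csaY TT Ty.
apply: (csa_max TT) => [||z h Tz]; [exact: YD|exact: YD|].
by rewrite !(rpDl ip) (csa_sym TT Tx Tz) (csa_sym TT Ty Tz).
Qed.

Lemma csa_closed (Y : set H) (T : set (H * H)) x_ f_ x f : ip_complete rp Y -> conj_selfadjoint Y T ->
  (forall n, T (x_ n, f_ n)) -> ip_cvg rp x_ x -> ip_cvg rp f_ f -> T (x, f).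
move=> Yc TT h cx cf.
have Yl u_ u : (forall n, Y (u_ n)) -> ip_cvg rp u_ u -> Y u.
 by move=> Yu cu; have [v Yv uv] := Yc u_ Yu (ip_cvg_cauchy ip cu); rewrite (ip_cvg_unique ip cu uv).
apply: (csa_max TT) => [||y g Ty].
- by apply: Yl cx => n; have [] := csaY TT (h n).
- by apply: Yl cf => n; have [] := csaY TT (h n).
by apply: (ip_cvg_rp2 ip cx cf) => n; exact: (csa_sym TT).
Qed.

Lemma closed_rangeP (Y : set H) (T : set (H * H)) :
  closed_range nrm Y T <->
  (forall f_ f, (forall n, op_range T (f_ n)) -> Y f -> ip_cvg rp f_ f -> op_range T f).
have eqv f_ f : (nrm (f_ n - f) @[n --> \oo] --> (0 : R)) <-> ip_cvg rp f_ f.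
 split.
  move=> /cvgrPdist_le h e e0; have [N _ hN] := h _ e0.
  by exists N => n /hN; rewrite sub0r normrN ger0_norm // nrm_ge0.
 move=> h; apply/cvgrPdist_le => e e0; have [N hN] := h _ e0.
 by exists N => // n /hN; rewrite sub0r normrN ger0_norm // nrm_ge0.
by split=> h f_ f hf Yf /eqv; exact: h.
Qed.

Lemma cp_coord n (b : 'I_n -> H) (d : 'I_n -> R[i]) i : orthonormal rp b -> cp rp (\sum_j d j *: b j) (b i) = d i.
move=> ob; rewrite (cp_sum hH) (bigD1 i) //= (cpZ hH) ob eqxx mulr1 big1 ?addr0 // => j /negPf ji.
by rewrite (cpZ hH) ob ji mulr0.
Qed.

Lemma cp_residual n (b : 'I_n -> H) f i : orthonormal rp b -> cp rp (f - \sum_j cp rp f (b j) *: b j) (b i) = 0.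
by move=> ob; rewrite (cpD hH) (cpN hH) (cp_coord (fun j => cp rp f (b j))) // subrr. Qed.
Definition complex_line_seq n (e : 'I_n -> H) := [seq e i | i : 'I_n] ++ [seq 'i%C *: e i | i : 'I_n].

Lemma complex_line_seq0 n (e : 'I_n -> H) x : (forall y, y \in complex_line_seq e -> rp x y = 0) ->
  forall i c, rp x (c *: e i) = 0.
move=> h i; apply: (rp_cp0 hH); rewrite /cp !h // mem_cat.
 by apply/orP; right; apply/mapP; exists i; rewrite ?mem_enum.
by apply/orP; left; apply/mapP; exists i; rewrite ?mem_enum.
Qed.

(** A lower bound modulo functionals makes the kernel finite dimensional and the range closed; the deficiency is
then the nullity. Conversely, on the complement of the kernel the lower bound comes from uniform boundedness,
since every vector there is, up to conjugation, in the range. *)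
Theorem conj_selfadjoint_fredholm (Y : set H) (T : set (H * H)) (k : ess_kind) :
  csubspace Y -> ip_complete rp Y -> (forall y, Y y -> Y (J y)) ->
  conj_selfadjoint Y T ->
  bounded_mod_finite rp T <-> fredholm_kind nrm k Y T.
move=> YY Yc YJ TT; have [Y0 YD YZ] := YY.
have Tsub := csa_real_graph YY TT; have [T0 TD _] := Tsub.
have kerS : csubspace (op_ker T).
 split; first exact: T0.
  by move=> x y Tx Ty; have := TD _ _ _ _ Tx Ty; rewrite addr0.
 by move=> c x /(csaZ TT c); rewrite scaler0.
have kerY x : op_ker T x -> Y x by move=> /(csaY TT)[].
have ranker f x : op_range T f -> op_ker T x -> rp f (J x) = 0.
 by move=> [y Ty] Tx; rewrite (csa_sym TT Ty Tx) conj0 (rp0r ip).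
have ranS : csubspace (op_range T).
 split; first by exists 0.
  by move=> f g [x Tx] [y Ty]; exists (x + y); exact: TD.
 by move=> c f [x Tx]; exists (c *: x); exact: (csaZ TT).
have ranY f : op_range T f -> Y f by move=> [x /(csaY TT)[]].
have YS := rsubspaceB (sub_real YY).
have ran_ortho n (b : 'I_n -> H) g : (forall x, op_ker T x -> x = \sum_i cp rp x (b i) *: b i) ->
  ip_complete rp (op_range T) -> Y g -> (forall i c, rp g (c *: J (b i)) = 0) -> op_range T g.
 move=> hb ranc Yg gb; have [p Tp hp] := projection ip g (sub_real ranS) ranc. have Kq : op_ker T (J (g - p)).
  apply: (csa_max TT) => [||x u Tx]; [by apply/YJ/YS => //; exact: ranY|by []|].
  by rewrite (rp0l ip) (rpJ hJ) hp //; exists x.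
 suff /eqP : g - p = 0 by rewrite subr_eq0 => /eqP ->.
 apply: (rp_eq0 ip); rewrite {1}(rpBl ip) [rp p _](rpC ip) hp // subr0.
 by rewrite -[g - p](conjK hJ) (hb _ Kq) conj_sum (rp_sum0 hH) // => i; rewrite (conjZ hJ) gb.
split.
 move=> [c [es bel]]. have [|n [b [Kb ob hb]]] := @separation_basis _ _ _ hH es (op_ker T) kerS.
  move=> x Tx xe; apply/(nrm_eq0 ip)/le_anti; rewrite nrm_ge0 andbT.
  by rewrite (le_trans (bel _ _ Tx)) // (nrm0 ip) mulr0 add0r big1_seq // => e /xe ->; rewrite normr0.
 have rcl := bounded_below_closed_range Yc (csaY TT) Tsub (fun x_ f_ x f => csa_closed Yc TT) bel.
 have crange : closed_range nrm Y T by apply/closed_rangeP => f_ f hf _; exact: rcl.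
 have ranc : ip_complete rp (op_range T).
  move=> f_ Tf cf; have [f _ ff] := Yc _ (fun n => ranY _ (Tf n)) cf. by exists f => //; exact: rcl ff.
 have nul : nullity T n.
  exists b; split => // f Tf; exists (\row_i cp rp f (b i)); split.
   rewrite /= {1}(hb f Tf); apply/eqP; rewrite subr_eq0; apply/eqP. by apply: eq_bigr => i _; rewrite mxE.
  by move=> d /= /eqP; rewrite subr_eq0 => /eqP fd; apply/rowP => i; rewrite mxE fd (cp_coord (fun j => d 0 j)).
 have YJb i : Y (J (b i)) by apply/YJ/kerY. have oJ : orthonormal rp (fun i => J (b i)).
  move=> i j; have : cp rp (b j) (b i) = (i == j)%:R by rewrite ob eq_sym.
  rewrite /cp (rpJ hJ) (rpC ip) => <-; congr (_ +i* _)%C. have -> : 'i%C *: J (b j) = - J ('i%C *: b j).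
   rewrite (conjZ hJ) -scaleNr; congr (_ *: _); apply/eqP. by rewrite eq_complex /= oppr0 opprK !eqxx.
  by rewrite (rpNr ip) (rpJ hJ) (rpC ip) (rpi_l hH) opprK.
 have cpran f i : op_range T f -> cp rp f (J (b i)) = 0.
  move=> Tf; rewrite /cp ranker //. have -> : 'i%C *: J (b i) = J (- 'i%C *: b i).
   by rewrite (conjZ hJ); congr (_ *: _); apply/eqP; rewrite eq_complex /= oppr0 opprK !eqxx.
  by rewrite ranker //; have [_ _ KZ] := kerS; exact: KZ.
 have def : deficiency Y T n.
  exists (fun i => J (b i)); split => // f Yf. pose g := f - \sum_i cp rp f (J (b i)) *: J (b i).
  have Yg : Y g by apply: YS => //; apply: subspace_sum => // i; exact: YZ. have Tg : op_range T g.
   by apply: (ran_ortho n b) => // i; apply: (rp_cp0 hH); exact: cp_residual oJ.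
  exists (\row_i cp rp f (J (b i))); split.
   by under eq_bigr do rewrite mxE.
  move=> d Td; apply/rowP => i; rewrite mxE. have := cpran _ i Td; rewrite (cpD hH) (cpN hH) => /eqP.
  by rewrite subr_eq0 => /eqP ->; exact: (cp_coord (fun j => d 0 j) i oJ).
 by split => //; case: k; [left| | |]; do ?split; exists n.
move=> [/closed_rangeP crange fk].
have fin : exists es : seq H, forall x, op_ker T x ->
  (forall e, e \in es -> rp x e = 0) -> x = 0.
 have {fk} : (exists n, nullity T n) \/ (exists n, deficiency Y T n).
  by case: k fk => [//|[n ?]|[[n ?] _]|[n [? _]]]; left; exists n.
 case=> -[n [e [Ye he]]].
  exists (complex_line_seq e) => x Tx /complex_line_seq0 xe; have [c [/= xc _]] := he x Tx.
  apply: (rp_eq0 ip); have {2}-> : x = \sum_i c 0 i *: e i by apply/eqP; rewrite -subr_eq0 xc.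
  by rewrite (rp_sum0 hH).
 exists (complex_line_seq (fun i => J (e i))) => x Tx /complex_line_seq0 xe.
 have [c [/= xc _]] := he (J x) (YJ _ (kerY _ Tx)). apply: (rp_eq0 ip); rewrite -(rpJ hJ).
 have /eqP := ranker _ _ xc Tx; rewrite (rpBl ip) subr_eq0 => /eqP ->.
 by rewrite (rpC ip) (rp_sum0 hH) // => i; rewrite rpJl (conjZ hJ).
case: fin => es sep.
have [n [b [Kb ob hb]]] := separation_basis hH kerS sep.
have ranc : ip_complete rp (op_range T).
 move=> f_ Tf cf; have [f Yf ff] := Yc _ (fun n => ranY _ (Tf n)) cf. by exists f => //; exact: crange ff.
have [c hc] : exists c, forall x f, T (x, f) -> (forall y, op_ker T y -> rp x y = 0) ->
  nrm x <= c * nrm f.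
 apply: contrapT => /forallNP unb. have /choice[xf hxf] : forall m : nat, exists p : H * H, [/\ T p,
   forall y, op_ker T y -> rp p.1 y = 0, nrm p.2 = 1 & m%:R <= nrm p.1].
  move=> m; have := unb m%:R => /existsNP[x /existsNP[f]].
  rewrite not_implyE => -[Tx]; rewrite not_implyE => -[xk /negP]. rewrite -ltNge => lt. have f0 : 0 < nrm f.
   rewrite lt_def nrm_ge0 andbT; apply/eqP => /(nrm_eq0 ip) f0.
   move: lt; rewrite f0 (nrm0 ip) mulr0; apply/negP; rewrite -leNgt. have : op_ker T x by rewrite /op_ker /= -f0.
   by move=> /xk xx; rewrite /ipnorm xx sqrtr0.
  exists (((nrm f)^-1)%:C%C *: x, ((nrm f)^-1)%:C%C *: f); split => /=.
  - exact: (csaZ TT).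
  - by move=> y /xk xy; rewrite (rpZl ip) xy mulr0.
  - by rewrite (nrmZ ip) ger0_norm ?invr_ge0 ?nrm_ge0 // mulVf // gt_eqF.
  - rewrite (nrmZ ip) ger0_norm ?invr_ge0 ?nrm_ge0 // mulrC ler_pdivlMr //. exact: ltW.
 have [|y Yy|C hC] := @uniform_boundedness _ _ _ ip Y (fun m => (xf m).1) (sub_real YY) Yc.
 - move=> m; have [] := hxf m; case: (xf m) => x f Tx _ _ _. by have [] := csaY TT Tx.
 - pose y0 := \sum_i cp rp y (b i) *: b i. have Ky0 : op_ker T y0.
   by apply: (subspace_sum kerS) => i; have [_ _ KZ] := kerS; exact: KZ.
  have [z Tz] : op_range T (J (y - y0)).
   apply: (ran_ortho n b) => // [|i c]; first by apply/YJ/YS => //; exact: kerY.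
   by rewrite rpJl (conjZ hJ) (conjK hJ) (rp_cp0 hH) //; exact: cp_residual.
  exists (nrm z) => m; have [Tm mk m1 _] := hxf m.
  have -> : rp (xf m).1 y = rp (xf m).1 (y - y0) by rewrite (rpBr ip) (mk _ Ky0) subr0.
  case: (xf m) Tm m1 => x f /= Tx f1. have := csa_sym TT Tx Tz; rewrite (conjK hJ) => <-.
  by rewrite (le_trans (cauchy_schwarz ip _ _)) // f1 mul1r nrmJ.
 - have C0 : 0 <= C by rewrite (le_trans _ (hC 0%N)) // nrm_ge0. have /archi_boundP := C0; set N := Num.bound C => hN.
  have [_ _ _ h] := hxf N; have := le_trans h (hC N). by rewrite leNgt hN.
exists c, (complex_line_seq b) => x f Tx.
pose x0 := \sum_i cp rp x (b i) *: b i.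
have Kx0 : op_ker T x0.
 by apply: (subspace_sum kerS) => i; have [_ _ KZ] := kerS; exact: KZ.
have Tx' : T (x - x0, f).
 have := TD _ _ _ _ Tx (csaZ TT (-1) Kx0); by rewrite scaleN1r scaler0 addr0.
have h1 : nrm (x - x0) <= c * nrm f.
 apply: hc Tx' _ => y /hb ->; rewrite (rp_sum0 hH) // => i; apply: (rp_cp0 hH). exact: cp_residual.
rewrite -{1}[x](subrK x0) (le_trans (nrmD ip _ _)) // lerD //.
rewrite big_cat !big_image /= -big_split /=.
have b1 i : nrm (b i) = 1.
 have := cp_self hH (b i); rewrite ob eqxx => /complexI/esym/eqP. by rewrite sqrp_eq1 ?nrm_ge0 // => /eqP.
apply: (@le_trans _ _ (\sum_i nrm (cp rp x (b i) *: b i))).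
 rewrite /x0; elim/big_ind2: _ => [|u v w t h h'|//]; first by rewrite (nrm0 ip).
 by rewrite (le_trans (nrmD ip _ _)) // lerD.
by apply: ler_sum => i _; exact: nrm_scale_cp.
Qed.

(** Graphs of [A + B] with [A = r^-1]: maximality passes through the symmetric, everywhere defined [r]. *)
Lemma csa_of_resolvent (Y : set H) (r B : H -> H) :
  csubspace Y -> (forall y, Y y -> Y (J y)) -> (forall y, Y y -> Y (r y)) -> (forall y, Y y -> Y (B y)) ->
  (forall x y, r (x + y) = r x + r y) -> (forall (c : R[i]) x, r (c *: x) = c *: r x) ->
  (forall (c : R[i]) x, B (c *: x) = c *: B x) ->
  (forall x y, rp (r x) y = rp x (r y)) -> (forall x, r (J x) = J (r x)) ->
  (forall x y, Y x -> Y y -> rp (B x) y = rp x (J (B (J y)))) ->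
  conj_selfadjoint Y [set p | [/\ Y p.1, Y p.2 & p.1 + r (B p.1) = r p.2]].
move=> YY YJ Yr YB rD rZ BZ rS rJ BJ; have [_ YD YZ] := YY.
have YS := rsubspaceB (sub_real YY).
split => /=.
- by move=> x f [].
- by move=> c x f [Yx Yf xf]; split; [exact: YZ|exact: YZ|rewrite BZ !rZ -scalerDr xf].
- move=> x f y g [Yx Yf xf] [Yy Yg yg].
 have h u : rp f (J (r u)) = rp x (J u) + rp (B x) (J (r u)) by rewrite -rJ -rS -xf (rpDl ip) rS rJ.
 have := h g; rewrite -yg (conjD hJ) !(rpDr ip) h (BJ x (J y)) //; last exact: YJ. by rewrite (conjK hJ); lra.
move=> x f Yx Yf h; split => //; apply/eqP; rewrite -subr_eq0; apply/eqP; apply: (rp_eq0 ip).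
suff key z : Y z -> rp (x + r (B x) - r f) z = 0.
 by apply: key; apply: YS; [apply: YD => //; exact/Yr/YB|exact: Yr].
move=> Yz; have Yr' := Yr _ (YJ _ Yz).
have := h (r (J z)) (J z + B (r (J z))); rewrite rJ (conjD hJ) !(conjK hJ) (rpDr ip) -BJ //; last exact: Yr.
rewrite -rJ rD => e; rewrite (rpBl ip) (rpDl ip) !rS e ?subrr //; split => //.
by apply: YD; [exact: YJ|exact: YB].
Qed.
End JSelfAdjoint.

(** * Negligible quantities *)
Section Negligible.
Context {R : realType} {H : lmodType R[i]} {rp : H -> H -> R}.
Hypothesis ip : is_ip rp.
Notation nrm := (ipnorm rp).

Definition fin (es : seq H) (u : H) : R := \sum_(e <- es) `|rp u e|.

Lemma fin_ge0 es u : 0 <= fin es u. exact: sumr_ge0. Qed.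

Lemma fin_cat es es' u : fin (es ++ es') u = fin es u + fin es' u.
by rewrite /fin big_cat. Qed.
Lemma fin_scale (c : R) es u : fin [seq c%:C%C *: e | e <- es] u = `|c| * fin es u.
by rewrite /fin big_map mulr_sumr; apply: eq_bigr => e _; rewrite (rpZr ip) normrM.
Qed.

Variables (I : Type) (S : set I) (a b : I -> R) (E : I -> H).
Hypotheses (a_ge0 : forall i, 0 <= a i) (b_ge0 : forall i, 0 <= b i).

(** [q] is small compared with [b], up to [a] and finitely many functionals of [E]. In the estimates, [a] is the
norm of the data and [b] that of the solution. *)
Definition negl (q : I -> R) := forall d, 0 < d -> exists C es,
  forall i, S i -> q i <= C * a i + d * b i + fin es (E i).

Definition bdd (q : I -> R) := exists2 K, 0 <= K & forall i, S i -> q i <= K * (a i + b i).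

Lemma bdd_le q' q : bdd q' -> (forall i, S i -> q i <= q' i) -> bdd q.
by move=> [K K0 h] le; exists K => // i Si; exact: le_trans (le i Si) (h i Si). Qed.
Lemma bdd_a : bdd a.
by exists 1 => // i _; rewrite mul1r lerDl. Qed.
Lemma bdd_b : bdd b.
by exists 1 => // i _; rewrite mul1r lerDr. Qed.
Lemma bddD q q' : bdd q -> bdd q' -> bdd (fun i => q i + q' i).
move=> [K K0 h] [K' K'0 h']; exists (K + K'); first exact: addr_ge0.
by move=> i Si; rewrite mulrDl lerD ?h ?h'.
Qed.

Lemma bddZ K q : 0 <= K -> bdd q -> bdd (fun i => K * q i).
move=> K0 [L L0 h]; exists (K * L); first exact: mulr_ge0.
by move=> i Si; rewrite -mulrA ler_wpM2l ?h.
Qed.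

Lemma bdd_sub F G : bdd (fun i => nrm (F i)) -> bdd (fun i => nrm (G i)) -> bdd (fun i => nrm (F i - G i)).
by move=> hF hG; apply: bdd_le (bddD hF hG) _ => i _; exact: nrmBD. Qed.
Lemma bdd_add F G : bdd (fun i => nrm (F i)) -> bdd (fun i => nrm (G i)) -> bdd (fun i => nrm (F i + G i)).
by move=> hF hG; apply: bdd_le (bddD hF hG) _ => i _; exact: nrmD. Qed.
Lemma negl_le q' q : negl q' -> (forall i, S i -> q i <= q' i) -> negl q.
move=> h le d /h[C [es hC]]; exists C, es => i Si.
exact: le_trans (le i Si) (hC i Si).
Qed.

Lemma neglD q q' : negl q -> negl q' -> negl (fun i => q i + q' i).
move=> h h' d d0; have d2 : 0 < d / 2 by rewrite divr_gt0.
have [C [es hC]] := h _ d2; have [C' [es' hC']] := h' _ d2.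
exists (C + C'), (es ++ es') => i Si; rewrite fin_cat.
by have := hC i Si; have := hC' i Si; lra.
Qed.

Lemma neglZ K q : 0 <= K -> negl q -> negl (fun i => K * q i).
move=> K0 h d d0; have K1 : 0 < K + 1 by rewrite ltr_wpDl.
have [C [es hC]] := h _ (divr_gt0 d0 K1).
exists (K * C), [seq K%:C%C *: e | e <- es] => i Si.
rewrite fin_scale ger0_norm //; have := ler_wpM2l K0 (hC i Si).
rewrite !mulrDr !mulrA => h1; rewrite (le_trans h1) // lerD2r lerD2l ler_wpM2r //.
by rewrite mulrAC mulrC ler_piMr ?(ltW d0) // ler_pdivrMr // mul1r lerDl.
Qed.

Lemma negl_a : negl a.
move=> d d0; exists 1, [::] => i _; rewrite mul1r -addrA lerDl addr_ge0 ?fin_ge0 //.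
by rewrite mulr_ge0 // ltW.
Qed.

Lemma negl0 : negl (fun=> 0).
by apply: negl_le negl_a _.
Qed.

Lemma negl_fun e : negl (fun i => `|rp (E i) e|).
move=> d d0; exists 0, [:: e] => i _; rewrite /fin big_seq1 mul0r add0r lerDr.
by rewrite mulr_ge0 // ltW.
Qed.

Lemma negl_adj (F : I -> H) e e' : (forall i, S i -> rp (F i) e = rp (E i) e') ->
  negl (fun i => `|rp (F i) e|).
by move=> h; apply: (negl_le (negl_fun e')) => i Si; rewrite h. Qed.
Lemma negl_fin es (F : I -> H) : (forall e, negl (fun i => `|rp (F i) e|)) ->
  negl (fun i => fin es (F i)).
move=> h; elim: es => [|e es IH].
 by apply: negl_le negl0 _ => i _; rewrite /fin big_nil.
by apply: negl_le (neglD (h e) IH) _ => i _; rewrite /fin big_cons.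
Qed.

Lemma negl_compact q n (F : I -> H) : bdd n ->
  (forall d, 0 < d -> exists es, forall i, S i -> q i <= d * n i + fin es (F i)) ->
  (forall e, negl (fun i => `|rp (F i) e|)) -> negl q.
move=> [K K0 hK] hq hF d d0.
have K1 : 0 < 2 * (K + 1) by rewrite mulr_gt0 // ltr_wpDl.
have d1 := divr_gt0 d0 K1.
have [es hes] := hq _ d1; have d2 : 0 < d / 2 by rewrite divr_gt0.
have [C [es' hC]] := @negl_fin es _ hF _ d2.
exists (d + C), es' => i Si; have h1 := hes i Si; have h2 := hC i Si; have h3 := hK i Si.
have h4 : d / (2 * (K + 1)) * n i <= d / 2 * (a i + b i).
 rewrite (le_trans (ler_wpM2l (ltW d1) h3)) // mulrA ler_wpM2r ?addr_ge0 //.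
 rewrite mulrAC ler_pdivrMr // -mulrA ler_pM2l //; lra.
have := mulr_ge0 (ltW d0) (a_ge0 i); lra.
Qed.

(** Only the square of [n] is bounded, so [q] is taken with the square of the required factor, and the cross
term is absorbed by the weighted inequality of arithmetic and geometric means. *)
Lemma negl_sqrt q n : (forall i, S i -> 0 <= n i) -> negl q ->
  (forall i, S i -> n i ^+ 2 <= b i * q i) -> negl n.
move=> n0 h hn d d0; have d2 : 0 < d ^+ 2 by rewrite exprn_gt0.
have [C [es hC]] := h _ d2.
exists (`|C| / d), [seq (d^-1)%:C%C *: e | e <- es] => i Si.
rewrite fin_scale [`|d^-1|]ger0_norm ?invr_ge0 ?(ltW d0) //.
have h1 := le_trans (hn i Si) (ler_wpM2l (b_ge0 i) (hC i Si)).
have F0 := fin_ge0 es (E i); move: (fin _ _) F0 h1 => F F0 h1.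
have y0 : 0 <= `|C| * a i + F by rewrite addr_ge0 // mulr_ge0.
have -> : `|C| / d * a i + d * b i + d^-1 * F = d * b i + (`|C| * a i + F) / d.
 by field; rewrite gt_eqF.
have d1 : 0 <= d^-1 by rewrite invr_ge0 ltW.
rewrite -(@ler_pXn2r _ 2) // ?nnegrE ?n0 //; last first.
 by rewrite addr_ge0 // mulr_ge0 // ltW.
rewrite (le_trans h1) //.
apply: (@le_trans _ _ (b i * (`|C| * a i + F) + d ^+ 2 * b i ^+ 2)).
 have := ler_wpM2r (a_ge0 i) (ler_norm C); move: (b_ge0 i) => b0 hh. have := ler_wpM2l b0 hh; rewrite !mulrDr; nra.
rewrite sqrrD; have -> : d * b i * ((`|C| * a i + F) / d) = b i * (`|C| * a i + F).
 by field; rewrite gt_eqF.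
have := mulr_ge0 (b_ge0 i) y0; have := sqr_ge0 ((`|C| * a i + F) / d).
rewrite exprMn; lra.
Qed.

Lemma negl_b : negl b -> exists c es, forall i, S i -> b i <= c * a i + fin es (E i).
move=> h; have d0 : 0 < (2^-1 : R) by [].
have [C [es hC]] := h _ d0.
exists (2 * C), [seq 2%:C%C *: e | e <- es] => i Si.
rewrite fin_scale ger0_norm //.
by have := hC i Si; lra.
Qed.
End Negligible.

(** * Weak graphs and their comparison *)
Section Comparison.
Context {R : realType} {H : lmodType R[i]} {rp : H -> H -> R} {J : H -> H}.
Notation fin := (fin (rp := rp)).
Notation negl := (negl (rp := rp)).
Notation nrm := (ipnorm rp).
Hypotheses (hH : is_cip rp) (hJ : is_conj rp J) (Hc : ip_complete rp setT).
Let ip := cip_ip hH.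

Record bounded_linear (F : H -> H) (C : R) : Prop := BoundedLinear {
  blD : forall x y, F (x + y) = F x + F y;
  blZ : forall (c : R[i]) x, F (c *: x) = c *: F x;
  bl_bd : forall x, nrm (F x) <= C * nrm x }.

Lemma blN F C x : bounded_linear F C -> F (- x) = - F x.
by move=> hF; rewrite -scaleN1r (blZ hF) scaleN1r. Qed.
Lemma blB F C x y : bounded_linear F C -> F (x - y) = F x - F y.
by move=> hF; rewrite (blD hF) (blN _ hF). Qed.

Record mass (m : H -> H) (c C : R) : Prop := Mass {
  mass_bl : bounded_linear m C;
  mass_sym : forall x y, rp (m x) y = rp x (m y);
  mass_J : forall x, m (J x) = J (m x);
  mass_c : 0 < c;
  mass_C : 0 <= C;
  mass_ge : forall x, c * nrm x ^+ 2 <= rp (m x) x }.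

Variable D : set (H * H).
Hypotheses (D0 : D (0, 0)) (DD : forall x f y g, D (x, f) -> D (y, g) -> D (x + y, f + g))
  (DZ : forall (c : R[i]) x f, D (x, f) -> D (c *: x, c *: f)).
Hypothesis Dcl : forall x_ f_ x f, (forall n, D (x_ n, f_ n)) ->
    ip_cvg rp x_ x -> ip_cvg rp f_ f -> D (x, f).
Hypothesis DJ : forall x f, D (x, f) -> D (J x, J f).

Lemma DN x f : D (x, f) -> D (- x, - f).
by move=> /(DZ (-1)); rewrite !scaleN1r. Qed.
Lemma DB x f y g : D (x, f) -> D (y, g) -> D (x - y, f - g).
by move=> hx /DN; exact: DD. Qed.
Definition solves (m : H -> H) (g : H) (p : H * H) :=
  D p /\ forall y z, D (y, z) -> rp (m p.2) z = rp (g - p.1) y.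

Lemma solution_exists m c C g : mass m c C -> exists p, solves m g p.
move=> hm; have hb := mass_bl hm; have c0 := mass_c hm.
pose rp2 (p q : H * H) := rp p.1 q.1 + rp (m p.2) q.2.
have ip2 : is_ip rp2.
 split=> [[x w] [y z] [u v]|a [x w] [y z]|[x w] [y z]|[x w]|[x w]]; rewrite /rp2 /=.
 - by rewrite (blD hb) !(rpDl ip) addrACA.
 - by rewrite (blZ hb) !(rpZl ip) mulrDr.
 - by rewrite (mass_sym hm) (rpC ip x) [rp w _](rpC ip).
 - rewrite addr_ge0 ?(rp_ge0 ip) // (le_trans _ (mass_ge hm w)) //. by rewrite mulr_ge0 ?exprn_ge0 ?nrm_ge0 // ltW.
 - have h1 := mass_ge hm w; have h2 := rp_ge0 ip x => h3.
  have n0 : 0 <= c * nrm w ^+ 2 by rewrite mulr_ge0 ?exprn_ge0 ?nrm_ge0 // ltW. have x0 : rp x x = 0 by lra.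
  have w0 : c * nrm w ^+ 2 = 0 by lra. rewrite (rp_eq0 ip x0); move/eqP: w0; rewrite mulf_eq0 gt_eqF //= sqrf_eq0.
  by move=> /eqP/(nrm_eq0 ip) ->.
have n1 p : nrm p.1 <= ipnorm rp2 p.
 rewrite -(@ler_pXn2r _ 2) // ?nnegrE ?nrm_ge0 // (nrm_sqr ip) (nrm_sqr ip2) /rp2 lerDl.
 by rewrite (le_trans _ (mass_ge hm _)) // mulr_ge0 ?exprn_ge0 ?nrm_ge0 // ltW.
have n2 p : c * nrm p.2 ^+ 2 <= ipnorm rp2 p ^+ 2.
 rewrite (nrm_sqr ip2) /rp2 (le_trans (mass_ge hm _)) //. by rewrite lerDr (rp_ge0 ip).
have n3 p : ipnorm rp2 p ^+ 2 <= nrm p.1 ^+ 2 + C * nrm p.2 ^+ 2.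
 rewrite (nrm_sqr ip2) /rp2 (nrm_sqr ip) lerD2l (le_trans (rp_le ip _ _)) //.
 by rewrite expr2 mulrA ler_wpM2r ?nrm_ge0 // (bl_bd hb).
have DS : rsubspace D.
 split; first exact: D0.
  by move=> [x f] [y g'] hx hy; exact: DD hx hy.
 by move=> a [x f]; exact: DZ.
have Dc : ip_complete rp2 D.
 move=> p_ Dp cp. have [|x _ hx] := Hc (x_ := fun n => (p_ n).1) (fun=> Logic.I).
  move=> e e0; have [N hN] := cp e e0; exists N => i j hi hj. exact: le_trans (n1 (p_ i - p_ j)) (hN _ _ hi hj).
 have [|w _ hw] := Hc (x_ := fun n => (p_ n).2) (fun=> Logic.I).
  move=> e e0; have e1 : 0 < Num.sqrt c * e by rewrite mulr_gt0 // sqrtr_gt0.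
  have [N hN] := cp _ e1; exists N => i j hi hj.
  rewrite -(@ler_pXn2r _ 2) // ?nnegrE ?nrm_ge0 ?(ltW e0) // -(ler_pM2l c0).
  rewrite (le_trans (n2 (p_ i - p_ j))) // -{1}[c]sqr_sqrtr ?(ltW c0) // -exprMn.
  by rewrite ler_pXn2r ?nnegrE ?nrm_ge0 ?(ltW e1) // hN.
 exists (x, w).
  by apply: (Dcl (x_ := fun n => (p_ n).1) (f_ := fun n => (p_ n).2)) hx hw => n; case: (p_ n) (Dp n).
 move=> e e0; have C1 : 0 < 2 * (C + 1) by rewrite mulr_gt0 // ltr_wpDl // (mass_C hm).
 have e1 : 0 < e / 2 by rewrite divr_gt0. have e2 : 0 < e / (2 * (C + 1)) by rewrite divr_gt0.
 have [N1 h1] := hx _ e1; have [N2 h2] := hw _ e2. exists (maxn N1 N2) => n; rewrite geq_max => /andP[/h1 a1 /h2 a2].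
 rewrite -(@ler_pXn2r _ 2) // ?nnegrE ?nrm_ge0 ?(ltW e0) // (le_trans (n3 _)) //=.
 have b1 : nrm ((p_ n).1 - x) ^+ 2 <= (e / 2) ^+ 2.
  by rewrite ler_pXn2r ?nnegrE ?nrm_ge0 ?(ltW e1).
 have b2 : C * nrm ((p_ n).2 - w) ^+ 2 <= C * (e / (2 * (C + 1))) ^+ 2.
  by rewrite ler_wpM2l ?(mass_C hm) // ler_pXn2r ?nnegrE ?nrm_ge0 ?(ltW e2).
 have b3 : C * (e / (2 * (C + 1))) ^+ 2 <= (e / 2) ^+ 2.
  have -> : C * (e / (2 * (C + 1))) ^+ 2 = (e / 2) ^+ 2 * (C / (C + 1) ^+ 2).
   by field; lra.
  rewrite ler_piMr ?sqr_ge0 // ler_pdivrMr ?exprn_gt0 // ?ltr_wpDl ?(mass_C hm) // mul1r. by have := mass_C hm; nra.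
 have -> : e ^+ 2 = (e / 2) ^+ 2 *+ 4 by field. have := sqr_ge0 (e / 2); lra.
have [[x w] Dx hx] := projection ip2 (g, 0) DS Dc.
exists (x, w); split => // y z /hx; rewrite /rp2 /= sub0r (blN _ hb) (rpNl ip).
by move/eqP; rewrite subr_eq0 => /eqP.
Qed.

Lemma solves_bound m c C g p : mass m c C -> solves m g p ->
  nrm p.1 ^+ 2 + c * nrm p.2 ^+ 2 <= rp g p.1.
case: p => x w hm [/= Dp /(_ _ _ Dp)]; rewrite /= (rpBl ip) => h.
by have := mass_ge hm w; rewrite h (nrm_sqr ip x); lra.
Qed.

Lemma solves_bound1 m c C g p : mass m c C -> solves m g p -> nrm p.1 <= nrm g.
move=> hm hs; have h := le_trans (solves_bound hm hs) (rp_le ip _ _).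
have [->|p0] := eqVneq (nrm p.1) 0; first exact: nrm_ge0.
have pp : 0 < nrm p.1 by rewrite lt_def p0 nrm_ge0.
rewrite -(ler_pM2r pp) (le_trans _ h) // -expr2 lerDl.
by rewrite mulr_ge0 ?exprn_ge0 ?nrm_ge0 // ltW // (mass_c hm).
Qed.

Lemma solves_bound2 m c C g p : mass m c C -> solves m g p ->
  nrm p.2 <= (Num.sqrt c)^-1 * nrm g.
move=> hm hs; have h := le_trans (solves_bound hm hs) (rp_le ip _ _).
have c0 := mass_c hm; have s0 : 0 < Num.sqrt c by rewrite sqrtr_gt0.
rewrite mulrC ler_pdivlMr // -(@ler_pXn2r _ 2) // ?nnegrE ?mulr_ge0 ?nrm_ge0 ?(ltW s0) //.
rewrite exprMn [Num.sqrt c ^+ 2]sqr_sqrtr ?(ltW c0) //.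
have h1 := solves_bound1 hm hs.
have h2 := ler_wpM2l (nrm_ge0 (rp := rp) g) h1; have h3 := exprn_ge0 2 (nrm_ge0 (rp := rp) p.1).
by lra.
Qed.

Lemma solves_uniq m c C g p q : mass m c C -> solves m g p -> solves m g q -> p = q.
move=> hm [Dp hp] [Dq hq].
have hb := mass_bl hm.
have hs : solves m 0 (p - q).
 case: p q Dp hp Dq hq => x w [y z] /= Dx hx Dy hy; split; first exact: DB.
 move=> u v Du; rewrite /= (blB _ _ hb) (rpBl ip) (hx _ _ Du) (hy _ _ Du) -(rpBl ip).
 by congr rp; rewrite opprB sub0r opprB [LHS]addrC subrKA.
have h1 := solves_bound1 hm hs; have h2 := solves_bound2 hm hs.
rewrite (nrm0 ip) mulr0 in h2; rewrite (nrm0 ip) in h1.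
apply/eqP; rewrite -subr_eq0; apply/eqP; move: h1 h2.
case: (p - q) => x w /= h1 h2.
have -> : x = 0 by apply: (nrm_eq0 ip); apply/le_anti; rewrite h1 nrm_ge0.
by have -> : w = 0 by apply: (nrm_eq0 ip); apply/le_anti; rewrite h2 nrm_ge0.
Qed.

Definition sol m c C (hm : mass m c C) g : H * H := projT1 (cid (solution_exists g hm)).

Section Sol.
Variables (m : H -> H) (c C : R) (hm : mass m c C).
Notation s := (sol hm).

Lemma solP g : solves m g (s g).
by rewrite /sol; case: cid. Qed.
Lemma sol_uniq g p : solves m g p -> p = s g.
by move=> hp; exact: solves_uniq hm hp (solP g). Qed.
Lemma solD g h : (s (g + h)).1 = (s g).1 + (s h).1.
have [Dg eg] := solP g; have [Dh eh] := solP h.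
suff <- : ((s g).1 + (s h).1, (s g).2 + (s h).2) = s (g + h) by [].
apply: sol_uniq; case: (s g) (s h) Dg eg Dh eh => x w [y z] /= Dg eg Dh eh.
split; first exact: DD.
move=> u v Du; rewrite /= (blD (mass_bl hm)) (rpDl ip) (eg _ _ Du) (eh _ _ Du) -(rpDl ip).
by rewrite opprD addrACA.
Qed.

Lemma solZ (k : R[i]) g : (s (k *: g)).1 = k *: (s g).1.
have [Dg eg] := solP g.
suff <- : (k *: (s g).1, k *: (s g).2) = s (k *: g) by [].
apply: sol_uniq; case: (s g) Dg eg => x w /= Dg eg.
split; first exact: DZ.
move=> u v Du; rewrite /= (blZ (mass_bl hm)) -scalerBr.
have e1 := eg _ _ Du; have e2 := eg _ _ (DZ 'i%C Du).
rewrite !(scaleCE k) !(rpDl ip) !(rpZl ip) e1; congr (_ + _ * _).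
by rewrite !(rpi_l hH) e2.
Qed.

Lemma solJ g : (s (J g)).1 = J (s g).1.
have [Dg eg] := solP g.
suff <- : (J (s g).1, J (s g).2) = s (J g) by [].
apply: sol_uniq; case: (s g) Dg eg => x w /= Dg eg.
split; first exact: DJ.
by move=> u v /DJ Du; rewrite /= (mass_J hm) -(conjB hJ) !(rpJl hJ) (eg _ _ Du).
Qed.

Lemma sol_sym g h : rp (s g).1 h = rp g (s h).1.
have [Dg eg] := solP g; have [Dh eh] := solP h.
case: (s g) (s h) Dg eg Dh eh => x w [y z] /= Dg eg Dh eh.
have := eg _ _ Dh; have := eh _ _ Dg.
by rewrite (mass_sym hm) [rp z _](rpC ip) => -> ; rewrite !(rpBl ip) (rpC ip h) (rpC ip y) => /addIr.
Qed.

Lemma sol_bd g : nrm (s g).1 <= 1 * nrm g.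
by rewrite mul1r (solves_bound1 hm (solP g)). Qed.
End Sol.

(** The graph of A^* m A + W, for [D] the graph of A. *)
Definition weak_graph (m W : H -> H) : set (H * H) :=
  [set p | exists2 w, D (p.1, w) &
    forall y z, D (y, z) -> rp (m w) z = rp (p.2 - W p.1) y].

Lemma weak_graphP m c C (hm : mass m c C) W x f :
  weak_graph m W (x, f) <-> x + (sol hm (W x - x)).1 = (sol hm f).1.
have -> : (sol hm f).1 = (sol hm (f - (W x - x))).1 + (sol hm (W x - x)).1.
 by rewrite -solD subrK.
have -> : f - (W x - x) = f - W x + x by rewrite opprB addrA addrAC.
split=> [[w Dw hw]|/addIr hx].
 congr (_ + _); rewrite -(sol_uniq hm (p := (x, w))) //. by split => //= y z; rewrite addrK; exact: hw.
have [] := solP hm (f - W x + x); move: hx; case: (sol hm _) => x' w /= <- Ds hs.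
by exists w => // y z /hs ->; rewrite addrK.
Qed.

Lemma weak_graph_csa (Y : set H) m c C W CW : mass m c C ->
  bounded_linear W CW -> (forall x y, rp (W x) y = rp x (J (W (J y)))) ->
  csubspace Y -> ip_complete rp Y -> (forall y, Y y -> Y (J y)) ->
  (forall y, Y y -> Y (W y)) ->
  (forall g p, Y g -> solves m g p -> Y p.1) ->
  conj_selfadjoint (rp := rp) (J := J) Y (weak_graph m W `&` (Y `*` Y)).
move=> hm hW WJ YY Yc YJ YW Ysol; have [Y0 YD YZ] := YY.
have -> : weak_graph m W `&` (Y `*` Y) =
  [set p | [/\ Y p.1, Y p.2 & p.1 + (sol hm (W p.1 - p.1)).1 = (sol hm p.2).1]].
 apply/seteqP; split => [[x f]|[x f]] /=; first by move=> [/(weak_graphP hm) h [/= Yx Yf]].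
 by move=> [Yx Yf h]; split => //; apply/(weak_graphP hm).
apply: (csa_of_resolvent hH hJ (r := fun g => (sol hm g).1) (B := fun x => W x - x)) => //.
- by move=> y Yy; exact: Ysol Yy (solP hm y).
- by move=> y Yy; apply: (rsubspaceB (sub_real YY)) => //; exact: YW.
- by move=> x y; exact: solD.
- by move=> k x; exact: solZ.
- by move=> k x; rewrite (blZ hW) scalerBr.
- by move=> x y; exact: sol_sym.
- by move=> x; exact: solJ.
- by move=> x y _ _; rewrite (rpBl ip) WJ (conjB hJ) (conjK hJ) (rpBr ip).
Qed.

Variable V : set H.
Hypotheses (VV : csubspace V) (Vc : ip_complete rp V) (VJ : forall v, V v -> V (J v))
  (VD : forall v, V v -> D (v, 0)).

Definition ortho : set H := [set x | forall v, V v -> rp x v = 0].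
Notation X := ortho.

Lemma ortho_csub : csubspace X.
have [_ _ VZ] := VV; split.
- by move=> v _; rewrite (rp0l ip).
- by move=> x y Xx Xy v Vv; rewrite (rpDl ip) Xx // Xy // addr0.
- move=> k x Xx v Vv; rewrite scaleCE (rpDl ip) !(rpZl ip) (rpi_l hH).
 by rewrite !Xx ?oppr0 ?mulr0 ?addr0 //; exact: VZ.
Qed.

Lemma ortho_complete : ip_complete rp X.
move=> x_ Xx /(Hc (fun=> Logic.I))[x _ xx]; exists x => // v Vv.
by apply: (ip_cvg_rp ip xx) => n; exact: Xx.
Qed.

Lemma ortho_J x : X x -> X (J x).
by move=> Xx v /VJ Vv; rewrite (rpJl hJ) Xx. Qed.

(** [V] lies in the kernel of A, so that the component of [p.1] in [V] solves the equation with the component of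
[g]. *)
Lemma ortho_sol m g p : X g -> solves m g p -> X p.1.
move=> Xg [_ hp] v Vv; have := hp _ _ (VD Vv).
by rewrite (rp0r ip) (rpBl ip) Xg // sub0r => /esym/eqP; rewrite oppr_eq0 => /eqP.
Qed.

Lemma projection_exists u : exists2 p, V p & X (u - p).
by have [p Vp hp] := projection ip u (sub_real VV) Vc; exists p. Qed.
Definition prj u := projT1 (cid2 (projection_exists u)).

Lemma prjV u : V (prj u). by rewrite /prj; case: cid2. Qed.
Lemma prjX u : X (u - prj u). by rewrite /prj; case: cid2. Qed.

Lemma prj_uniq u p : V p -> X (u - p) -> prj u = p.
move=> Vp Xp; apply/eqP; rewrite -subr_eq0; apply/eqP/(rp_eq0 ip).
have Vq : V (prj u - p) by apply: (rsubspaceB (sub_real VV)) => //; exact: prjV.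
have h1 := Xp _ Vq; have h2 := prjX u Vq.
have e : prj u - p = (u - p) - (u - prj u) by rewrite opprB [RHS]addrC subrKA.
by rewrite {1}e (rpBl ip) h1 h2 subrr.
Qed.

Lemma prj_id v : V v -> prj v = v.
by move=> Vv; apply: prj_uniq => //; rewrite subrr; case: ortho_csub. Qed.
Lemma prj_ortho x : X x -> prj x = 0.
by move=> Xx; apply: prj_uniq; [case: VV|rewrite subr0]. Qed.
Lemma prjD u w : prj (u + w) = prj u + prj w.
have [_ VDD _] := VV; have [_ XD _] := ortho_csub.
apply: prj_uniq; first by apply: VDD; exact: prjV.
by rewrite opprD addrACA; apply: XD; exact: prjX.
Qed.

Lemma prjZ (k : R[i]) u : prj (k *: u) = k *: prj u.
have [_ _ VZ] := VV; have [_ _ XZ] := ortho_csub.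
apply: prj_uniq; first by apply: VZ; exact: prjV.
by rewrite -scalerBr; apply: XZ; exact: prjX.
Qed.

Lemma prjJ u : prj (J u) = J (prj u).
apply: prj_uniq; first by apply: VJ; exact: prjV.
by rewrite -(conjB hJ); apply: ortho_J; exact: prjX.
Qed.

Lemma rp_prj u v : V v -> rp (prj u) v = rp u v.
by move=> Vv; apply/esym/eqP; rewrite -subr_eq0 -(rpBl ip) prjX.
Qed.

Lemma prj_sym u w : rp (prj u) w = rp u (prj w).
by rewrite -(rp_prj _ (prjV w)) ![rp (prj u) _](rpC ip) rp_prj //; exact: prjV. Qed.
Lemma prj_bd u : nrm (prj u) <= 1 * nrm u.
have [p0|p0] := eqVneq (nrm (prj u)) 0; first by rewrite p0 mul1r nrm_ge0.
have pp : 0 < nrm (prj u) by rewrite lt_def p0 nrm_ge0.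
rewrite mul1r -(ler_pM2r pp) -expr2 (nrm_sqr ip) (rp_prj _ (prjV u)); exact: rp_le.
Qed.

Lemma prj_le u : nrm (prj u) <= nrm u.
by rewrite -[leRHS]mul1r prj_bd. Qed.
Lemma prjB_le u : nrm (u - prj u) <= 2 * nrm u.
by rewrite (le_trans (nrmBD ip _ _)) //; have := prj_le u; lra. Qed.
Lemma prjN u : prj (- u) = - prj u.
by rewrite -scaleN1r prjZ scaleN1r. Qed.
Lemma prjB u w : prj (u - w) = prj u - prj w.
by rewrite prjD prjN. Qed.
Definition compression_graph (W : H -> H) : set (H * H) :=
  [set p | V p.1 /\ p.2 = prj (W p.1)].

Lemma compression_csa W CW : bounded_linear W CW ->
  (forall x y, rp (W x) y = rp x (J (W (J y)))) ->
  conj_selfadjoint (rp := rp) (J := J) V (compression_graph W).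
move=> hW WJ; have [V0 VDD VZ] := VV.
have -> : compression_graph W =
  [set p | [/\ V p.1, V p.2 & p.1 + id (prj (W p.1) - p.1) = id p.2]].
 apply/seteqP; split => [[x f]|[x f]] /=.
  by move=> [/= Vx ->]; split => //; [exact: prjV|rewrite addrC subrK].
 by move=> [Vx Vf <-]; split => //=; rewrite addrC subrK.
apply: (csa_of_resolvent hH hJ (r := id) (B := fun x => prj (W x) - x)) => //.
- by move=> y Vy; apply: (rsubspaceB (sub_real VV)) => //; exact: prjV.
- by move=> k x; rewrite (blZ hW) prjZ scalerBr.
move=> x y Vx Vy; rewrite (rpBl ip) (rp_prj _ Vy) WJ (conjB hJ) (conjK hJ) (rpBr ip).
by rewrite -prjJ -prj_sym prj_id.
Qed.

Variables (m : H -> H) (c C : R).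
Hypothesis hm : mass m c C.
Variable mi : R.
Hypothesis mi0 : 0 < mi.
Variables (W : H -> H) (CW : R).
Hypotheses (CW0 : 0 <= CW) (hW : bounded_linear W CW) (WJ : forall x y, rp (W x) y = rp x (J (W (J y)))).
Variable a : R[i].

Definition minf (x : H) := mi%:C%C *: x.
Definition Winf (x : H) := - a *: x.
(** The part of [W] that decays at infinity, [a] being the limit of the multiplier up to its sign. *)
Definition decaying (u : H) := W u + a *: u.

Hypothesis decaying_compact : forall d, 0 < d -> exists es, forall u w, D (u, w) -> X u ->
  nrm (decaying u) <= d * (nrm u + nrm w) + fin es u.
Hypothesis mass_compact : forall d, 0 < d -> exists es, forall x w g, X x -> D (x, w) ->
  (forall y z, D (y, z) -> rp w z = rp g y) ->
  nrm (m w - minf w) <= d * (nrm x + nrm w + nrm g) + fin es x.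

Lemma minf_mass : mass minf mi mi.
split=> //; [split|..|exact: ltW|] => //.
- by move=> x y; rewrite /minf scalerDr.
- by move=> k x; rewrite /minf !scalerA mulrC.
- by move=> x; rewrite (nrmZ ip) gtr0_norm.
- by move=> x y; rewrite (rpZl ip) (rpZr ip).
- by move=> x; rewrite /minf (conjZ hJ); congr (_ *: _); rewrite conjc_real.
- by move=> x; rewrite (rpZl ip) (nrm_sqr ip).
Qed.

Lemma nrm_scale_le (k : R[i]) x : nrm (k *: x) <= (`|complex.Re k| + `|complex.Im k|) * nrm x.
rewrite scaleCE (le_trans (nrmD ip _ _)) // !(nrmZ ip) (nrmi hH) mulrDl //.
Qed.

Lemma Winf_bl : bounded_linear Winf (`|complex.Re a| + `|complex.Im a|).
split; first by move=> x y; rewrite /Winf scalerDr.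
- by move=> k x; rewrite /Winf !scalerA mulrC.
- by move=> x; rewrite /Winf scaleNr nrmN // nrm_scale_le.
Qed.

Lemma Winf_J x y : rp (Winf x) y = rp x (J (Winf (J y))).
rewrite /Winf (conjZ hJ) (conjK hJ) (scaleCE (- a) x) (scaleCE _ y) (rpDl ip) (rpDr ip).
rewrite !(rpZl ip) !(rpZr ip) (rpi_l hH).
by case: a => p q /=; rewrite !mulNr !mulrN !opprK.
Qed.

Definition CM := CW + (`|complex.Re a| + `|complex.Im a|).

Lemma CM_ge0 : 0 <= CM. by rewrite !addr_ge0. Qed.

Lemma decaying_bl : bounded_linear decaying CM.
split.
- by move=> x y; rewrite /decaying (blD hW) scalerDr addrACA.
- by move=> k x; rewrite /decaying (blZ hW) scalerDr !scalerA mulrC.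
- move=> x; rewrite /decaying /CM mulrDl (le_trans (nrmD ip _ _)) //. by rewrite lerD ?nrm_scale_le // (bl_bd hW).
Qed.

Lemma decaying_J x y : rp (decaying x) y = rp x (J (decaying (J y))).
rewrite /decaying (rpDl ip) WJ (conjD hJ) (rpDr ip); congr (_ + _).
have := Winf_J x y; rewrite /Winf !scaleNr (conjN hJ) (rpNl ip) (rpNr ip).
by move/oppr_inj.
Qed.

Definition graph_L := weak_graph m W.
Definition graph_Linf := weak_graph minf Winf `&` (X `*` X).
Definition graph_W := compression_graph W.

Lemma prj_decaying u : X u -> prj (decaying u) = prj (W u).
by move=> Xu; rewrite /decaying prjD prjZ (prj_ortho Xu) scaler0 addr0. Qed.

Notation bel := (bounded_mod_finite rp).

Lemma rpminf x z : rp (minf x) z = mi * rp x z.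
by rewrite (rpZl ip). Qed.
Lemma perturbed_solution d e k : D (d, e) ->
  (forall y z, D (y, z) -> rp (m e) z = - rp d y + rp k z) ->
  nrm d <= (Num.sqrt c)^-1 * nrm k.
move=> De /(_ _ _ De) h.
have c0 := mass_c hm; have s0 : 0 < Num.sqrt c by rewrite sqrtr_gt0.
have h1 := mass_ge hm e; rewrite h in h1.
have h2 := rp_le ip k e; have h3 := nrm_sqr ip d.
rewrite mulrC ler_pdivlMr // -(@ler_pXn2r _ 2) // ?nnegrE ?mulr_ge0 ?nrm_ge0 ?(ltW s0) //.
rewrite exprMn [Num.sqrt c ^+ 2]sqr_sqrtr ?(ltW c0) //.
have h4 : nrm d ^+ 2 <= nrm k * nrm e - c * nrm e ^+ 2 by rewrite h3; lra.
rewrite (le_trans (ler_wpM2r (ltW c0) h4)) //.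
have := sqr_ge0 (c * nrm e - nrm k / 2); have := sqr_ge0 (nrm k); nra.
Qed.

Lemma rp_inj u v : (forall y, rp u y = rp v y) -> u = v.
by move=> h; apply/eqP; rewrite -subr_eq0; apply/eqP/(rp_eq0 ip); rewrite {1}(rpBl ip) h subrr.
Qed.

Lemma residual_Linf f v x x' : V v -> X x ->
  f - W (v + x) + (v + x) - prj (f - W (v + x) + (v + x)) - x' =
  (f - prj f) - (decaying v - prj (decaying v)) - (decaying x - prj (decaying x))
    + (1 + a) *: (x - x') - Winf x'.
move=> Vv Xx; apply: rp_inj => y.
rewrite /Winf scaleNr opprK /decaying (blD hW) !(prjB, prjD, prjN) !prjZ (prj_ortho Xx) (prj_id Vv) scaler0.
by rewrite scalerDl scale1r !scalerBr !(rpDl ip, rpBl ip, rpNl ip, rp0l ip); lra.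
Qed.

Lemma residual_L f x x' : f - Winf x + x - x' + W x' =
  f + decaying x + (decaying (x' - x) - (1 + a) *: (x' - x)).
apply: rp_inj => y.
rewrite /Winf scaleNr /decaying (blB _ _ hW).
by rewrite scalerDl scale1r !scalerBr !(rpDl ip, rpBl ip, rpNl ip, rp0l ip); lra.
Qed.

(** The component [x] of the solution is compared with the solution [x'] of the constant-coefficient equation
whose right-hand side is that of [x]. The difference of their fluxes is negligible, hence so is [x - x'], and
the lower bound for the limit applies to [x']. *)
Lemma bel_conv : bel graph_Linf -> bel graph_W -> bel graph_L.
move=> [ci [esi hLi]] [cW [esW hLW]].
pose I := (H * H * H)%type.
pose E (i : I) := i.1.1; pose f (i : I) := i.1.2; pose w (i : I) := i.2.
pose S := [set i : I | D (E i, w i) /\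
 forall y z, D (y, z) -> rp (m (w i)) z = rp (f i - W (E i)) y].
suff [c0 [es h]] : exists c es, forall i, S i -> nrm (E i) <= c * nrm (f i) + fin es (E i).
 exists c0, es => x g [u Dx hx]; exact: (h ((x, g), u)).
apply: (negl_b ip).
have A0 i : 0 <= nrm (f i) by exact: nrm_ge0.
have B0 i : 0 <= nrm (E i) by exact: nrm_ge0.
pose ng q := negl S (fun i => nrm (f i)) (fun i => nrm (E i)) E q.
pose bd q := bdd S (fun i => nrm (f i)) (fun i => nrm (E i)) q.
rewrite -/(ng (fun i => nrm (E i))).
pose v i := prj (E i); pose x i := E i - v i.
have Xx i : X (x i) by exact: prjX.
have Vv i : V (v i) by exact: prjV.
have Dx i : S i -> D (x i, w i).
 by move=> [DE _]; rewrite -[w i]subr0; apply: DB => //; exact: VD.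
have c0 := mass_c hm; have s0 : 0 < Num.sqrt c by rewrite sqrtr_gt0.
have WE i : nrm (W (E i)) <= CW * nrm (E i) by exact: (bl_bd hW).
have ng_f : ng (fun i => nrm (f i)) by apply: negl_a.
pose r i := f i - W (E i) + E i.
have sV (k : R) : 0 <= (Num.sqrt k)^-1 by rewrite invr_ge0 sqrtr_ge0.
have bd_f : bd (fun i => nrm (f i)) by exact: bdd_a.
have bd_E : bd (fun i => nrm (E i)) by exact: bdd_b.
have bd_W : bd (fun i => nrm (W (E i))) by apply: bdd_le (bddZ CW0 bd_E) (fun i _ => WE i).
have bd_r : bd (fun i => nrm (r i)) := bdd_add ip (bdd_sub ip bd_f bd_W) bd_E.
have sE i : S i -> solves m (r i) (E i, w i).
 by move=> [DE hf]; split => //= y z Dy; rewrite /r addrK; exact: hf.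
have bd_x : bd (fun i => nrm (x i)) by apply: bdd_le (bddZ _ bd_E) (fun i _ => prjB_le (E i)).
have bd_w : bd (fun i => nrm (w i)).
 exact: bdd_le (bddZ (sV c) bd_r) (fun i Si => solves_bound2 hm (sE i Si)).
have ng_Mx : ng (fun i => nrm (decaying (x i))).
 apply: (negl_compact _ _ (n := fun i => nrm (x i) + nrm (w i)) (F := x)) => //.
 - exact: bddD.
 - move=> d d0; have [es hes] := decaying_compact d0. by exists es => i Si; apply: hes (Dx i Si) (Xx i).
 - move=> e; apply: (negl_adj _ _ (e' := e - prj e)) => // i _. by rewrite /x /v (rpBl ip) prj_sym -(rpBr ip).
have Pf i : S i -> prj (W (v i)) = prj (f i) - prj (decaying (x i)).
 move=> [_ hf]; rewrite prj_decaying //. suff : prj (f i - W (E i)) = 0.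
  have e : W (E i) = W (v i) + W (x i) by rewrite -(blD hW) /x addrCA subrr addr0.
  by rewrite prjB e prjD => /eqP; rewrite subr_eq0 => /eqP ->; rewrite addrK.
 apply: prj_ortho => u /VD /hf; rewrite (rp0r ip) => /esym; exact.
have ng_v : ng (fun i => nrm (v i)).
 have : ng (fun i => `|cW| * (nrm (f i) + nrm (decaying (x i))) + fin esW (v i)).
  apply: neglD; first by apply: neglZ => //; exact: neglD.
  apply: negl_fin => // e; apply: (negl_adj _ _ (e' := prj e)) => // i _; exact: prj_sym.
 move/negl_le; apply => i Si; rewrite (le_trans (hLW (v i) (prj (W (v i))) (conj (Vv i) erefl))) //.
 rewrite lerD2r (le_trans (ler_wpM2r (nrm_ge0 _) (ler_norm _))) // ler_wpM2l //.
 rewrite Pf // (le_trans (nrmBD ip _ _)) //. by rewrite lerD ?prj_le.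
pose g i := r i - prj (r i).
have Xg i : X (g i) by exact: prjX.
pose s i := sol minf_mass (g i); pose x' i := (s i).1; pose w' i := (s i).2.
have [Ds hs] : (forall i, D (x' i, w' i)) /\ forall i y z, D (y, z) -> rp (minf (w' i)) z = rp (g i - x' i) y.
 by split => i; have [] := solP minf_mass (g i); rewrite /x' /w' /s; case: sol.
have Xx' i : X (x' i) by apply: ortho_sol (Xg i) (solP minf_mass (g i)).
have hx i y z : S i -> D (y, z) -> rp (m (w i)) z = rp (g i - x i) y.
 move=> [DE hf] Dy; rewrite (hf _ _ Dy).
 have ort u : V u -> rp (f i - W (E i)) u = 0 by move=> /VD /hf; rewrite (rp0r ip) => /esym; exact.
 have -> : g i - x i = f i - W (E i) - prj (f i - W (E i)).
  by rewrite /g /x /v /r prjD opprD addrACA addrK.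
 by rewrite (prj_ortho ort) subr0.
have bd_g : bd (fun i => nrm (g i)) by apply: bdd_le (bddZ _ bd_r) (fun i _ => prjB_le (r i)).
have bd_x' : bd (fun i => nrm (x' i)).
 exact: bdd_le bd_g (fun i _ => solves_bound1 minf_mass (solP minf_mass (g i))).
have bd_w' : bd (fun i => nrm (w' i)).
 exact: bdd_le (bddZ (sV mi) bd_g) (fun i _ => solves_bound2 minf_mass (solP minf_mass (g i))).
have ng_funx' e : ng (fun i => `|rp (x' i) e|).
 pose xi := (sol minf_mass e).1; pose q := xi - prj xi.
 have eq i : rp (x' i) e = rp (f i) q + rp (E i) (q - J (W (J q))).
  rewrite /x' /s sol_sym -/xi /g (rpBl ip) prj_sym -(rpBr ip) -/q /r (rpDl ip) (rpBl ip) WJ (rpBr ip).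
  by rewrite (rpBr ip (E i) q); ring.
 have : ng (fun i => nrm q * nrm (f i) + `|rp (E i) (q - J (W (J q)))|).
  by apply: neglD; [apply: neglZ => //; exact: nrm_ge0|exact: (negl_fun _ _ _ B0)].
 move/negl_le; apply => i Si; rewrite eq (le_trans (ler_normD _ _)) // lerD2r. by rewrite mulrC cauchy_schwarz.
pose k i := m (w' i) - minf (w' i).
have ng_k : ng (fun i => nrm (k i)).
 pose h i := (mi^-1)%:C%C *: (g i - x' i).
 apply: (negl_compact _ _ (n := fun i => nrm (x' i) + nrm (w' i) + nrm (h i)) (F := x')) => //.
 - apply: bddD; first exact: bddD.
  by apply: bdd_le (bddZ _ (bdd_sub ip bd_g bd_x')) (fun i _ => nrm_scale_le _ _); exact: addr_ge0.
 - move=> d d0; have [es hes] := mass_compact d0. exists es => i Si; apply: hes => // y z Dy.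
  by rewrite (rpZl ip) -(hs _ _ _ Dy) rpminf mulrA mulVf ?mul1r ?gt_eqF.
pose d i := x i - x' i.
have ng_d : ng (fun i => nrm (d i)).
 have : ng (fun i => (Num.sqrt c)^-1 * nrm (k i)).
  exact: neglZ.
 move/negl_le; apply => i Si. rewrite -(nrmN ip (k i)); apply: (perturbed_solution (e := w i - w' i)).
  by apply: DB => //; exact: Dx.
 move=> y z Dy; rewrite (blB _ _ (mass_bl hm)) (rpBl ip) (hx _ _ _ Si Dy) /k (rpNl ip) (rpBl ip (m (w' i))) (hs _ _ _ Dy) /d.
 rewrite !(rpBl ip); lra.
have ng_x' : ng (fun i => nrm (x' i)).
 pose L i := (f i - prj (f i)) - (decaying (v i) - prj (decaying (v i)))
  - (decaying (x i) - prj (decaying (x i))) + (1 + a) *: d i.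
 pose KL := `|complex.Re (1 + a)| + `|complex.Im (1 + a)|.
 have : ng (fun i => `|ci| * (2 * nrm (f i) + 2 * CM * nrm (v i) + 2 * nrm (decaying (x i))
   + KL * nrm (d i)) + fin esi (x' i)).
  apply: neglD; last by apply: negl_fin => //.
  apply: neglZ => //; apply: neglD; last by apply: neglZ => //; exact: addr_ge0. apply: neglD; last exact: neglZ.
  apply: neglD; first exact: neglZ. by apply: neglZ => //; rewrite mulr_ge0 // CM_ge0.
 move/negl_le; apply => i Si. have PB := prjB_le. have TL : graph_Linf (x' i, L i).
  split; last first.
   split; first exact: Xx'. have [_ XD XZ] := ortho_csub.
   have XB u u' : X u -> X u' -> X (u - u') by exact: (rsubspaceB (sub_real ortho_csub)).
   rewrite /= /L; apply: XD; last by apply: XZ; apply: (XB); [exact: Xx|exact: Xx'].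
   by apply: (XB); [apply: (XB)|]; exact: prjX.
  exists (w' i); first exact: Ds. move=> y z Dy; rewrite (hs _ _ _ Dy); congr rp; rewrite /= -residual_Linf //.
  by have -> : v i + x i = E i by rewrite /x addrCA subrr addr0.
 rewrite (le_trans (hLi _ _ TL)) // lerD2r (le_trans (ler_wpM2r (nrm_ge0 _) (ler_norm _))) // ler_wpM2l //.
 rewrite (le_trans (nrmD ip _ _)) // lerD //; last exact: nrm_scale_le.
 rewrite (le_trans (nrmBD ip _ _)) // lerD // (le_trans (nrmBD ip _ _)) // lerD //.
 by rewrite (le_trans (prjB_le _)) // -mulrA ler_pM2l // (bl_bd decaying_bl).
have : ng (fun i => nrm (v i) + (nrm (x' i) + nrm (d i))).
 by apply: neglD => //; apply: neglD.
move/negl_le; apply => i Si.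
have -> : E i = v i + (x' i + d i) by rewrite /d [x' i + _]addrC subrK /x addrCA subrr addr0.
by rewrite (le_trans (nrmD ip _ _)) // lerD2l nrmD.
Qed.

Lemma negl_rpD (I : Type) (S : set I) (A B : I -> R) (E F G : I -> H) e :
  (forall i, 0 <= B i) ->
  negl S A B E (fun i => `|rp (F i) e|) ->
  negl S A B E (fun i => nrm (G i)) ->
  negl S A B E (fun i => `|rp (F i + G i) e|).
move=> B0 hF hG.
have h : negl S A B E (fun i => `|rp (F i) e| + nrm e * nrm (G i)).
 by apply: neglD => //; apply: neglZ => //; exact: nrm_ge0.
apply: (negl_le h) => i Si.
by rewrite (rpDl ip) (le_trans (ler_normD _ _)) // lerD2l mulrC cauchy_schwarz.
Qed.

(** Given [v] in [V], the equation with shifted mass term yields [x] in [X] that cancels the divergence-free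
part of [W v]. The full estimate applied to [v + x] then bounds [v], and [x] is negligible by its energy
identity. *)
Lemma bel_W : bel graph_L -> bel graph_W.
move=> [cL [esL hL]].
pose S : set H := V.
suff [c1 [es h]] : exists c es, forall v, S v ->
  nrm v <= c * nrm (prj (W v)) + fin es v.
 by exists c1, es => x g [/= Vx ->]; exact: h.
apply: (negl_b ip).
pose A v := nrm (prj (W v)).
have A0 i : 0 <= A i by exact: nrm_ge0.
have B0 i : 0 <= nrm i by exact: nrm_ge0.
pose ng q := negl S A nrm id q.
pose bd q := bdd S A nrm q.
rewrite -/(ng nrm).
pose q v := decaying v - prj (decaying v).
pose s v := sol hm (- q v); pose x v := (s v).1; pose w v := (s v).2.
have Xq v : X (- q v) by apply: (rsubspaceN (sub_real ortho_csub)); exact: prjX.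
have Xx v : X (x v) by exact: (ortho_sol (Xq v) (solP hm _)).
have Dx v : D (x v, w v).
 by have [] := solP hm (- q v); rewrite /x /w /s; case: sol.
have hs v y z : D (y, z) -> rp (m (w v)) z = rp (- q v - x v) y.
 by have [_] := solP hm (- q v); exact.
have q_le v : nrm (- q v) <= 2 * CM * nrm v.
 rewrite nrmN // (le_trans (prjB_le _)) // -mulrA ler_pM2l //; exact: (bl_bd decaying_bl).
have CM2 : 0 <= 2 * CM by rewrite mulr_ge0 // CM_ge0.
have bd_q : bd (fun v => nrm (- q v)).
 have bd_v : bd nrm by exact: bdd_b. exact: bdd_le (bddZ CM2 bd_v) (fun v _ => q_le v).
have bd_x : bd (fun v => nrm (x v)).
 exact: bdd_le bd_q (fun v _ => solves_bound1 hm (solP hm (- q v))).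
have bd_w : bd (fun v => nrm (w v)).
 apply: bdd_le (bddZ _ bd_q) (fun v _ => solves_bound2 hm (solP hm (- q v))). by rewrite invr_ge0 sqrtr_ge0.
have qE v y : X y -> rp (- q v) y = - rp v (J (decaying (J y))).
 move=> Xy; rewrite (rpNl ip) (rpBl ip (decaying v)) [rp (prj _) y](rpC ip) Xy; last exact: prjV.
 by rewrite subr0 decaying_J.
have ng_M : ng (fun v => nrm (decaying (J (x v)))).
 apply: (negl_compact A0 B0 (n := fun v => nrm (x v) + nrm (w v)) (F := fun v => J (x v))).
 - exact: bddD.
 - move=> d d0; have [es hes] := decaying_compact d0. exists es => v Sv; have := hes _ _ (DJ (Dx v)) (ortho_J (Xx v)).
  by rewrite !(nrmJ hJ).
 - move=> e; pose xi := (sol hm (J e)).1. apply: (negl_adj _ B0 (e' := - J (decaying (J (xi - prj xi))))) => v Sv.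
  rewrite (rpJl hJ) /x /s sol_sym -/xi (rpNr ip) -qE; last exact: prjX.
  rewrite (rpBr ip _ xi); have -> : rp (- q v) (prj xi) = 0 by apply: Xq; exact: prjV. by rewrite subr0.
have ng_x : ng (fun v => nrm (x v)).
 apply: (negl_sqrt ip A0 B0 (fun v _ => nrm_ge0 _) ng_M) => v Sv.
 have := solves_bound hm (solP hm (- q v)); rewrite -/(s v) -/(x v) -/(w v) qE // => h.
 have h2 : - rp v (J (decaying (J (x v)))) <= nrm v * nrm (decaying (J (x v))).
  by rewrite -(rpNr ip) (le_trans (rp_le ip _ _)) // (nrmN ip) (nrmJ hJ).
 have := mulr_ge0 (ltW (mass_c hm)) (exprn_ge0 2 (nrm_ge0 (rp := rp) (w v))); lra.
pose F v := W (v + x v) - q v - x v.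
have hF v : S v -> graph_L (v + x v, F v).
 move=> Sv; exists (w v).
  by rewrite -[w v]add0r; apply: DD => //; exact: VD.
 move=> y z Dy; rewrite (hs _ _ _ Dy) /F; congr rp => /=. by rewrite [RHS](ACl ((1*4)*2*3)) /= subrr add0r.
have nF v : S v -> nrm (F v) <= A v + (CW + 1) * nrm (x v).
 move=> Sv; have [_ _ VZ] := VV. have -> : F v = prj (W v) + W (x v) - x v.
  rewrite /F /q (blD hW) /decaying prjD (prj_id (VZ _ _ Sv)) opprB addrA. congr (_ - _); rewrite !opprD !addrA.
  by rewrite [LHS](ACl ((1*5)*(4*6)*3*2)) /= !subrr !add0r.
 rewrite -addrA (le_trans (nrmD ip _ _)) // lerD2l (le_trans (nrmBD ip _ _)) //.
 by rewrite mulrDl mul1r lerD2r (bl_bd hW).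
have ng_all : ng (fun v => `|cL| * (A v + (CW + 1) * nrm (x v)) + fin esL (v + x v) + nrm (x v)).
 apply: neglD => //; apply: neglD.
  apply: neglZ => //; apply: neglD; first exact: negl_a. by apply: neglZ => //; exact: addr_ge0.
 apply: (negl_fin A0 B0) => e; apply: (negl_rpD (F := id)) => //; exact: (negl_fun _ _ _ B0).
apply: (negl_le ng_all) => v Sv.
have -> : nrm v = nrm (v + x v - x v) by rewrite addrK.
rewrite (le_trans (nrmBD ip _ _)) // lerD2r (le_trans (hL _ _ (hF v Sv))) // lerD2r.
rewrite (le_trans (ler_wpM2r (nrm_ge0 _) (ler_norm _))) // ler_wpM2l //; exact: nF.
Qed.

(** The solution [x'] of the full equation with the right-hand side of [x] differs from [x] by a negligible
term, and the full estimate applies to [x']. *)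
Lemma bel_Linf : bel graph_L -> bel graph_Linf.
move=> [cL [esL hL]].
pose I := (H * H * H)%type.
pose x (i : I) := i.1.1; pose f (i : I) := i.1.2; pose w (i : I) := i.2.
pose S := [set i : I | [/\ X (x i), X (f i), D (x i, w i) &
 forall y z, D (y, z) -> rp (minf (w i)) z = rp (f i - Winf (x i)) y]].
suff [c1 [es h]] : exists c es, forall i, S i -> nrm (x i) <= c * nrm (f i) + fin es (x i).
 exists c1, es => u g [[y Du hu] [/= Xu Xg]]; exact: (h ((u, g), y)).
apply: (negl_b ip).
have A0 i : 0 <= nrm (f i) by exact: nrm_ge0.
have B0 i : 0 <= nrm (x i) by exact: nrm_ge0.
pose ng q := negl S (fun i => nrm (f i)) (fun i => nrm (x i)) x q.
pose bd q := bdd S (fun i => nrm (f i)) (fun i => nrm (x i)) q.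
rewrite -/(ng (fun i => nrm (x i))).
pose Ka := `|complex.Re a| + `|complex.Im a|.
have Ka0 : 0 <= Ka by exact: addr_ge0.
pose g i := f i - Winf (x i) + x i.
have sx i : S i -> solves minf (g i) (x i, w i).
 move=> [_ _ Dx hx]; split => //= y z Dy; rewrite /g addrK; exact: hx.
have bd_f : bd (fun i => nrm (f i)) by exact: bdd_a.
have bd_x : bd (fun i => nrm (x i)) by exact: bdd_b.
have bd_Wx : bd (fun i => nrm (Winf (x i))).
 exact: bdd_le (bddZ Ka0 bd_x) (fun i _ => bl_bd Winf_bl (x i)).
have bd_r := bdd_sub ip bd_f bd_Wx.
have bd_w : bd (fun i => nrm (w i)).
 apply: bdd_le (bddZ _ (bdd_add ip bd_r bd_x)) (fun i Si => solves_bound2 minf_mass (sx i Si)).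
 by rewrite invr_ge0 sqrtr_ge0.
have bd_xw := bddD bd_x bd_w.
have ng_fx e : ng (fun i => `|rp (x i) e|) by exact: (negl_fun _ _ _ B0).
have ng_Mx : ng (fun i => nrm (decaying (x i))).
 apply: (negl_compact A0 B0 bd_xw (F := x)) => // d d0.
 by have [es hes] := decaying_compact d0; exists es => i [Xx _ Dx _]; exact: hes.
pose k i := m (w i) - minf (w i).
have ng_k : ng (fun i => nrm (k i)).
 pose h i := (mi^-1)%:C%C *: (f i - Winf (x i)).
 apply: (negl_compact A0 B0 (n := fun i => nrm (x i) + nrm (w i) + nrm (h i)) (F := x)) => //.
 - apply: (bddD bd_xw). by apply: bdd_le (bddZ _ bd_r) (fun i _ => nrm_scale_le _ _); exact: addr_ge0.
 - move=> d d0; have [es hes] := mass_compact d0. exists es => i [Xx _ Dx hx]; apply: hes => // y z Dy.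
  by rewrite (rpZl ip) -(hx _ _ Dy) rpminf mulrA mulVf ?mul1r ?gt_eqF.
pose s i := sol hm (g i); pose x' i := (s i).1; pose w' i := (s i).2.
have Ds i : D (x' i, w' i).
 by have [] := solP hm (g i); rewrite /x' /w' /s; case: sol.
have hs i y z : D (y, z) -> rp (m (w' i)) z = rp (g i - x' i) y.
 by have [_] := solP hm (g i); exact.
pose d i := x' i - x i.
have ng_d : ng (fun i => nrm (d i)).
 have : ng (fun i => (Num.sqrt c)^-1 * nrm (k i)).
  by apply: neglZ => //; rewrite invr_ge0 sqrtr_ge0.
 move/negl_le; apply => i Si; have [_ _ Dx _] := Si.
 rewrite -(nrmN ip (k i)); apply: (perturbed_solution (e := w' i - w i)).
  exact: DB.
 move=> y z Dy; rewrite (blB _ _ (mass_bl hm)) (rpBl ip) (hs _ _ _ Dy) /k (rpNl ip) (rpBl ip (m (w i))).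
 have [_ h] := sx i Si; rewrite (h _ _ Dy) /d /=. rewrite !(rpBl ip); lra.
pose F i := g i - x' i + W (x' i).
have hF i : graph_L (x' i, F i).
 by exists (w' i); [exact: Ds|move=> y z Dy; rewrite (hs _ _ _ Dy) /F addrK].
pose KL := `|complex.Re (1 + a)| + `|complex.Im (1 + a)|.
have nF i : nrm (F i) <= nrm (f i) + nrm (decaying (x i)) + (KL + CM) * nrm (d i).
 have -> : F i = f i + decaying (x i) + (decaying (d i) - (1 + a) *: d i).
  exact: residual_L.
 rewrite (le_trans (nrmD ip _ _)) // lerD ?nrmD // (le_trans (nrmBD ip _ _)) //.
 by rewrite mulrDl addrC lerD ?nrm_scale_le // (bl_bd decaying_bl).
have ng_all : ng (fun i => `|cL| * (nrm (f i) + nrm (decaying (x i)) + (KL + CM) * nrm (d i))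
  + fin esL (x i + d i) + nrm (d i)).
 apply: neglD => //; apply: neglD.
  apply: neglZ => //; apply: neglD; first by apply: neglD => //; exact: negl_a.
  by apply: neglZ => //; rewrite addr_ge0 ?CM_ge0 // addr_ge0.
 by apply: (negl_fin A0 B0) => e; exact: (negl_rpD B0 (ng_fx e) ng_d).
apply: (negl_le ng_all) => i Si.
have xd : x i + d i = x' i by rewrite /d addrCA subrr addr0.
have -> : nrm (x i) = nrm (x' i - d i) by rewrite -xd addrK.
rewrite (le_trans (nrmBD ip _ _)) // lerD2r xd (le_trans (hL _ _ (hF i))) // lerD2r.
rewrite (le_trans (ler_wpM2r (nrm_ge0 _) (ler_norm _))) // ler_wpM2l //; exact: nF.
Qed.
End Comparison.

Lemma Re_mul (R : rcfType) (z w : R[i]) :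
  complex.Re (z * w) = complex.Re z * complex.Re w - complex.Im z * complex.Im w.
by case: z w => [? ?] [? ?]. Qed.
Lemma Im_mul (R : rcfType) (z w : R[i]) :
  complex.Im (z * w) = complex.Re z * complex.Im w + complex.Im z * complex.Re w.
by case: z w => [? ?] [? ?]. Qed.

(** * Where the spectra lie *)
Section Localization.
Context {R : realType} {H : lmodType R[i]} {rp : H -> H -> R}.
Notation nrm := (ipnorm rp).
Notation bel := (bounded_mod_finite rp).
Hypothesis hH : is_cip rp.
Let ip := cip_ip hH.

Lemma rp_scaler (c : R[i]) u v : rp u (c *: v) = rp (c^*%C *: u) v.
rewrite (scaleCE c v) (scaleCE c^*%C u).
rewrite (rpDr ip) !(rpZr ip) (rpDl ip) !(rpZl ip) (rpi_l hH).
by case: c => p q /=; rewrite mulNr mulrN opprK.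
Qed.

Lemma rp_real_scale (z : R[i]) u v : rp u ('i%C *: v) = 0 -> rp (z *: u) v = complex.Re z * rp u v.
by move=> uv; rewrite (scaleCE z u) (rpDl ip) !(rpZl ip) (rpi_l hH) uv oppr0 mulr0 addr0.
Qed.

Lemma rp_real_scale2 (z c : R[i]) u v : rp u ('i%C *: v) = 0 ->
  rp (z *: u) (c *: v) = complex.Re (c^*%C * z) * rp u v.
by move=> uv; rewrite rp_scaler scalerA rp_real_scale. Qed.
Lemma sym_form_real (F : H -> H) v : (forall (c : R[i]) x, F (c *: x) = c *: F x) ->
  (forall x y, rp (F x) y = rp x (F y)) -> rp (F v) ('i%C *: v) = 0.
move=> FZ Fs; have : rp (F v) ('i%C *: v) = - rp (F v) ('i%C *: v).
 by rewrite [in RHS](rpC ip) (rpi_l hH) opprK Fs FZ.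
lra.
Qed.

Lemma rp_self_i v : rp v ('i%C *: v) = 0.
exact: (@sym_form_real id). Qed.
Lemma bel_form (T : set (H * H)) (b K : R) : 0 < b ->
  (forall x f, T (x, f) -> exists2 y, nrm y <= K * nrm x & b * nrm x ^+ 2 <= `|rp f y|) -> bel T.
move=> b0 h; exists (`|K| / b), [::] => x f /h[y yK le]; rewrite big_nil addr0.
have [x0|x0] := eqVneq (nrm x) 0.
 by rewrite x0 mulr_ge0 ?nrm_ge0 // divr_ge0 // ltW.
have xp : 0 < nrm x by rewrite lt_neqAle eq_sym x0 nrm_ge0.
rewrite mulrAC ler_pdivlMr // mulrC -(ler_pM2r xp) -mulrA -expr2.
apply: le_trans le _; apply: le_trans (cauchy_schwarz ip f y) _.
rewrite (_ : `|K| * nrm f * nrm x = nrm f * (`|K| * nrm x)); last by ring.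
apply: ler_wpM2l; first exact: nrm_ge0.
by apply: le_trans yK _; apply: ler_wpM2r; [exact: nrm_ge0|exact: ler_norm].
Qed.

Lemma bel_scaled (T T' : set (H * H)) (t : R) : (forall x f, T (x, f) -> T' (x, t%:C%C *: f)) -> bel T' -> bel T.
move=> h [c [es hT]]; exists (c * `|t|), es => x f /h /hT.
by rewrite (nrmZ ip) mulrA.
Qed.

Section ScalarGraph.
Variables (D : set (H * H)) (X : set H).
Hypothesis DZ : forall (c : R[i]) x f, D (x, f) -> D (c *: x, c *: f).

Definition scalar_graph mi a := weak_graph (rp := rp) D (minf mi) (Winf a) `&` (X `*` X).

Lemma scalar_graph_test mi a x f : scalar_graph mi a (x, f) -> forall c : R[i], exists2 e, 0 <= e &
  rp f (c *: x) = mi * complex.Re c * e - complex.Re (c^*%C * a) * nrm x ^+ 2.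
move=> [[w Dxw hw] _] c; exists (nrm w ^+ 2); first exact: sqr_ge0.
have := hw _ _ (DZ c Dxw); rewrite (rpBl ip) /minf /Winf /= (rpZl ip).
have -> : rp (- a *: x) (c *: x) = - (complex.Re (c^*%C * a) * nrm x ^+ 2).
 by rewrite rp_real_scale2 ?rp_self_i // (nrm_sqr ip) -[RHS]mulNr; congr (_ * _); rewrite mulrN; case: (_ * _).
have -> : rp w (c *: w) = complex.Re c * nrm w ^+ 2.
 by rewrite (rpC ip) rp_real_scale ?rp_self_i // (nrm_sqr ip).
by rewrite opprK mulrA => ->; rewrite addrK.
Qed.

(** Testing with [u] gives a nonnegative energy minus [a] times the square of the norm, which cannot be small
for [a] off the half-line. *)
Lemma scalar_graph_bel mi a : 0 < mi -> complex.Re a < 0 \/ complex.Im a != 0 -> bel (scalar_graph mi a).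
move=> mi0 [a0|a0].
 apply: (@bel_form _ (- complex.Re a) 1); first by rewrite oppr_gt0.
 move=> x f /scalar_graph_test/(_ 1)[e e0]; rewrite scale1r => E; exists x; first by rewrite mul1r.
 rewrite E; apply: le_trans (ler_norm _); rewrite conjc1 mul1r mulNr lerDr mulr_ge0 // mulr1 ltW //.
apply: (@bel_form _ `|complex.Im a| 1); first by rewrite normr_gt0.
move=> x f /scalar_graph_test/(_ 'i%C)[e e0] /= E; exists ('i%C *: x).
 by rewrite (nrmi hH) mul1r.
rewrite E mulr0 mul0r add0r normrN normrM; apply: ler_pM => //.
- exact: sqr_ge0.
- by rewrite Re_mul /= mul0r mulN1r sub0r opprK.
- by rewrite ger0_norm // sqr_ge0.
Qed.

Hypothesis XZ : forall (c : R[i]) x, X x -> X (c *: x).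

Lemma scalar_graph_scale mi a t x f : scalar_graph mi a (x, f) ->
  scalar_graph (t * mi) (t%:C%C * a) (x, t%:C%C *: f).
move=> [[w Dxw hw] [Xx Xf]]; split; last by split=> //; exact: XZ.
exists w => // y z Dyz; have := hw y z Dyz; rewrite /minf /Winf /= !(rpZl ip) -mulrA => ->.
by rewrite -(rpZl ip) scalerBr scalerA mulrN.
Qed.

Lemma scalar_graph_normalize mi a : 0 < mi ->
  (bel (scalar_graph mi a) <-> bel (scalar_graph 1 (mi^-1%:C%C * a))).
move=> mi0; have m0 : mi != 0 by rewrite gt_eqF.
split; [apply: (@bel_scaled _ _ mi)|apply: (@bel_scaled _ _ mi^-1)] => x f /scalar_graph_scale => [/(_ mi)|/(_ mi^-1)].
 by rewrite mulr1 mulrA -rmorphM divff // mul1r.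
by rewrite mulVf.
Qed.
End ScalarGraph.

Section Dissipation.
Variables (E S W : H -> H) (e0 s0 : R) (w : R[i]) (T : set (H * H)).
Hypotheses (EZ : forall (c : R[i]) x, E (c *: x) = c *: E x) (SZ : forall (c : R[i]) x, S (c *: x) = c *: S x)
  (Es : forall x y, rp (E x) y = rp x (E y)) (Ss : forall x y, rp (S x) y = rp x (S y)) (e0_gt0 : 0 < e0)
  (E_ge : forall x, e0 * nrm x ^+ 2 <= rp (E x) x) (s0_ge0 : 0 <= s0) (S_ge : forall x, 0 <= rp (S x) x)
  (S_le : forall x, rp (S x) x <= s0 * nrm x ^+ 2) (WE : forall x, W x = - w ^+ 2 *: E x + - ('i%C * w) *: S x)
  (TW : forall v f, T (v, f) -> forall c : R[i], rp f (c *: v) = rp (W v) (c *: v)).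

Lemma dissipation_test v f (k : R[i]) : T (v, f) ->
  rp f ((- w * k^*%C) *: v) = (complex.Re w ^+ 2 + complex.Im w ^+ 2) *
    (complex.Re (w * k) * rp (E v) v + complex.Re ('i%C * k) * rp (S v) v).
move=> Tvf; rewrite (TW Tvf) WE (rpDl ip) !rp_real_scale2; try exact: sym_form_real.
move: (rp (E v) v) (rp (S v) v) => e s.
rewrite mulrDr !mulrA; congr (_ * _ + _ * _); case: (w) (k) => [p q] [k1 k2].
 by rewrite !expr2 !(Re_mul, Im_mul) /=; ring.
by rewrite !(Re_mul, Im_mul) /=; ring.
Qed.

(** Tested with multiples of [v], the form is - w^2 e - i w s, where e >= e0 and 0 <= s <= s0 for unit vectors;
its real and imaginary parts exclude a neighbourhood of zero off the segment. *)
Lemma dissipation_bel : w != 0 ->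
  [\/ complex.Re w != 0, 0 < complex.Im w | complex.Im w < - (s0 / e0)] -> bel T.
move=> w0; have N0 : 0 < complex.Re w ^+ 2 + complex.Im w ^+ 2.
 rewrite lt_neqAle addr_ge0 ?sqr_ge0 // andbT eq_sym; apply: contra w0.
 by rewrite paddr_eq0 ?sqr_ge0 // !sqrf_eq0 eq_complex.
set N := _ + _ in N0 *.
have test k b : 0 < b -> (forall v, b * nrm v ^+ 2 <= `|complex.Re (w * k) * rp (E v) v + complex.Re ('i%C * k) * rp (S v) v|) -> bel T.
 move=> b0 h; pose c := - w * k^*%C.
 apply: (@bel_form _ (N * b) (`|complex.Re c| + `|complex.Im c|)); first exact: mulr_gt0.
 move=> v f Tvf; exists (c *: v); first exact: nrm_scale_le.
 by rewrite (dissipation_test _ Tvf) normrM (gtr0_norm N0) -mulrA ler_pM2l.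
have e1 : complex.Re (w * 'i%C) = - complex.Im w by rewrite Re_mul /=; ring.
have e2 : complex.Re ('i%C * 'i%C : R[i]) = - 1 by rewrite Re_mul /=; ring.
case=> [p0|q0|q0].
- apply: (test 1 (`|complex.Re w| * e0)) => [|v]; first by rewrite mulr_gt0 // normr_gt0.
 rewrite !mulr1 /= mul0r addr0 normrM -mulrA; apply: ler_wpM2l => //. exact: le_trans (E_ge v) (ler_norm _).
- apply: (test 'i%C (complex.Im w * e0)) => [|v]; first exact: mulr_gt0. rewrite e1 e2 mulN1r mulNr -opprD normrN.
 apply: le_trans (ler_norm _); rewrite -mulrA; apply: ler_wpDr => //. by apply: ler_wpM2l => //; exact: ltW.
have q1 : s0 / e0 < - complex.Im w by rewrite ltrNr.
have q2 : 0 <= - complex.Im w by apply: le_trans (ltW q1); apply: divr_ge0 => //; exact: ltW.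
have qe : 0 < - complex.Im w * e0 - s0 by rewrite subr_gt0 -ltr_pdivrMr.
apply: (test 'i%C _ qe) => v; rewrite e1 e2 mulN1r.
apply: le_trans (ler_norm _); rewrite mulrBl; apply: lerB => //.
by rewrite -mulrA; apply: ler_wpM2l.
Qed.
End Dissipation.
End Localization.

(** * Real integrals and square-integrable functions *)
Section RealIntegral.
Context d (T : measurableType d) (R : realType).
Variable mu : {measure set T -> \bar R}.
Implicit Types f g : T -> R.

Definition itg f := mu.-integrable setT (EFin \o f).

Lemma itg_mf f : itg f -> mfT f.
by move=> /integrableP[/measurable_EFinP]. Qed.
Lemma itg0 : itg (fun=> 0). exact: integrable0. Qed.

Lemma itgD f g : itg f -> itg g -> itg (fun x => f x + g x).
exact: integrableD. Qed.
Lemma itgZ c f : itg f -> itg (fun x => c * f x).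
exact: integrableZl. Qed.
Lemma itgN f : itg f -> itg (fun x => - f x).
exact: integrableN. Qed.
Lemma itgB f g : itg f -> itg g -> itg (fun x => f x - g x).
exact: integrableB. Qed.
Lemma itg_norm f : itg f -> itg (fun x => `|f x|).
exact: integrable_norm. Qed.
Lemma itg_dom g f : mfT f -> itg g -> (forall x, `|f x| <= g x) -> itg f.
move=> mf ig fg; apply: (le_integrable measurableT) ig => //; first exact/measurable_EFinP.
by move=> x _ /=; rewrite lee_fin (le_trans (fg x)) // ler_norm.
Qed.

Notation int f := (\int[mu]_x f x)%R.

Lemma intD f g : itg f -> itg g -> int (fun x => f x + g x) = int f + int g.
by move=> hf hg; rewrite RintegralD. Qed.
Lemma intZ c f : itg f -> int (fun x => c * f x) = c * int f.
by move=> hf; rewrite RintegralZl. Qed.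
Lemma intB f g : itg f -> itg g -> int (fun x => f x - g x) = int f - int g.
by move=> hf hg; rewrite RintegralB. Qed.
Lemma intN f : itg f -> int (fun x => - f x) = - int f.
move=> hf; rewrite -mulN1r -intZ //; apply: eq_Rintegral => x _; by rewrite mulN1r.
Qed.

Lemma int0 : int (fun=> 0) = 0.
by rewrite -[RHS](mul0r (int (fun=> 0))) -intZ //; [apply: eq_Rintegral => x _; rewrite mul0r|exact: itg0]. Qed.
Lemma itg_sum (I : Type) (s : seq I) (F : I -> T -> R) : (forall i, itg (F i)) ->
  itg (fun x => \sum_(i <- s) F i x).
move=> h; elim: s => [|i s IH].
 by under eq_fun do rewrite big_nil; exact: itg0.
by under eq_fun do rewrite big_cons; exact: itgD.
Qed.

Lemma int_sum (I : Type) (s : seq I) (F : I -> T -> R) : (forall i, itg (F i)) ->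
  int (fun x => \sum_(i <- s) F i x) = \sum_(i <- s) int (F i).
move=> h; elim: s => [|i s IH].
 by under eq_fun do rewrite big_nil; rewrite big_nil int0.
under eq_fun do rewrite big_cons.
by rewrite intD // ?IH ?big_cons //; exact: itg_sum.
Qed.

Lemma int_ge0 f : (forall x, 0 <= f x) -> 0 <= int f.
by move=> h; exact: Rintegral_ge0. Qed.
Lemma le_int f g : itg f -> itg g -> (forall x, f x <= g x) -> int f <= int g.
by move=> hf hg h; apply: le_Rintegral. Qed.
Lemma norm_int_le f : itg f -> `|int f| <= int (fun x => `|f x|).
by move=> hf; apply: le_normr_Rintegral. Qed.
Lemma eq_int_ae f g : mfT f -> mfT g ->
  {ae mu, forall x, f x = g x} -> int f = int g.
move=> mf mg fg; rewrite /Rintegral; congr fine; apply: ae_eq_integral => //.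
- exact/measurable_EFinP.
- exact/measurable_EFinP.
- by apply: filterS fg => x /= -> _.
Qed.

Lemma le_int_ae f g : itg f -> itg g -> {ae mu, forall x, f x <= g x} -> int f <= int g.
move=> hf hg h.
have mf := itg_mf hf; have mg := itg_mf hg.
have -> : int f = int (fun x => Num.min (f x) (g x)).
 apply: eq_int_ae => //; first exact: measurable_minr. by apply: filterS h => x fg; rewrite min_l.
apply: le_int => //; last by move=> x; rewrite ge_min lexx orbT.
apply: (itg_dom (g := fun x => `|f x| + `|g x|)).
- exact: measurable_minr.
- by apply: itgD; exact: itg_norm.
- by move=> x; rewrite /Num.min; case: ifP => _; rewrite ?lerDl ?lerDr.
Qed.

Lemma int_eq0_ae f : (forall x, 0 <= f x) -> itg f -> int f = 0 -> {ae mu, forall x, f x = 0}.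
move=> f0 hf h.
have := @ae_eq_integral_abs _ _ _ mu setT measurableT (EFin \o f).
have mf := itg_mf hf; move=> /(_ _)[|+ _]; first exact/measurable_EFinP.
have -> : (\int[mu]_(x in setT) `|(EFin \o f) x|)%E = (\int[mu]_x (f x)%:E)%E.
 by apply: eq_integral => x _ /=; rewrite ger0_norm.
have -> : (\int[mu]_x (f x)%:E)%E = 0%E.
 have := integrable_fin_num measurableT hf. by move=> /fineK <-; move: h; rewrite /Rintegral => ->.
by move=> /(_ erefl); apply: filterS => x /= /(_ Logic.I)[].
Qed.

Lemma dominated_cvg (f_ : nat -> T -> R) f g : (forall n, mfT (f_ n)) ->
  mfT f -> itg g ->
  {ae mu, forall x, f_ n x @[n --> \oo] --> f x} ->
  (forall n x, `|f_ n x| <= g x) ->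
  itg f /\ int (f_ n) @[n --> \oo] --> int f.
move=> mf_ mf hg cf le.
have [] := @dominated_convergence _ _ _ mu setT measurableT (fun n => EFin \o f_ n) (EFin \o f) (EFin \o g).
- by move=> n; exact/measurable_EFinP.
- exact/measurable_EFinP.
- by apply: filterS cf => x h _; apply: cvg_EFin => //; exact: nearW.
- exact: hg.
- by apply: aeW => x n _ /=; rewrite lee_fin.
move=> hf _ h; split => //.
rewrite /Rintegral; apply: fine_cvg => /=.
by rewrite fineK //; exact: integrable_fin_num.
Qed.

Definition l2 f := mfT f /\ itg (fun x => f x ^+ 2).

Lemma l2_mul f g : l2 f -> l2 g -> itg (fun x => f x * g x).
move=> [mf hf] [mg hg]; apply: (itg_dom (g := fun x => f x ^+ 2 + g x ^+ 2)).
- exact: measurable_funM.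
- exact: itgD.
- move=> x; rewrite normrM -(real_normK (num_real (f x))) -(real_normK (num_real (g x))).
 have := sqr_ge0 (`|f x| - `|g x|); have := mulr_ge0 (normr_ge0 (f x)) (normr_ge0 (g x)); nra.
Qed.

Lemma l2D f g : l2 f -> l2 g -> l2 (fun x => f x + g x).
move=> hf hg; have h := l2_mul hf hg; case: hf hg => [mf hf] [mg hg]; split.
 exact: measurable_funD.
have -> : (fun x => (f x + g x) ^+ 2) = (fun x => f x ^+ 2 + 2 * (f x * g x) + g x ^+ 2).
 by apply/funext => x; rewrite sqrrD mulr_natl.
by apply: itgD => //; apply: itgD => //; exact: itgZ.
Qed.

Lemma l2M (b : T -> R) B f : mfT b -> (forall x, `|b x| <= B) -> l2 f ->
  l2 (fun x => b x * f x).
move=> mb bB [mf hf]; split; first exact: measurable_funM.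
apply: (itg_dom (g := fun x => B ^+ 2 * f x ^+ 2)).
- by apply: measurable_funX; exact: measurable_funM.
- exact: itgZ.
- move=> x; rewrite ger0_norm ?sqr_ge0 // exprMn ler_wpM2r ?sqr_ge0 //.
 rewrite -(real_normK (num_real (b x))) ler_pXn2r ?nnegrE //. exact: le_trans (bB x).
Qed.

Lemma l2Z c f : l2 f -> l2 (fun x => c * f x).
by apply: l2M => //; exact: measurable_cst. Qed.
Lemma l2N f : l2 f -> l2 (fun x => - f x).
by move=> /(l2Z (-1)); under eq_fun do rewrite mulN1r. Qed.
Lemma l2B f g : l2 f -> l2 g -> l2 (fun x => f x - g x).
by move=> hf /l2N; exact: l2D. Qed.
Lemma l20 : l2 (fun=> 0).
by split; [exact: measurable_cst|under eq_fun do rewrite expr0n; exact: itg0]. Qed.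
Lemma l2_sum (I : Type) (s : seq I) (F : I -> T -> R) : (forall i, l2 (F i)) ->
  l2 (fun x => \sum_(i <- s) F i x).
move=> h; elim: s => [|i s IH].
 by under eq_fun do rewrite big_nil; exact: l20.
by under eq_fun do rewrite big_cons; exact: l2D.
Qed.

Lemma l2_sqr f : l2 f -> itg (fun x => f x ^+ 2). by case. Qed.

Lemma l2_bounded (A : set T) f B : measurable A -> (mu A < +oo)%E ->
  mfT f -> (forall x, `|f x| <= B) -> (forall x, ~ A x -> f x = 0) -> l2 f /\ itg f.
move=> mA fA mf fB f0.
have iA : itg (\1_A : T -> R).
 apply/integrableP; split; first by apply/measurable_EFinP; exact: measurable_indic.
 rewrite (eq_integral (fun x => (\1_A x)%:E)).
  by rewrite integral_indic // setIT.
 by move=> x _; rewrite /= ger0_norm.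
have B0 (x : T) : 0 <= B by exact: (le_trans _ (fB x)).
split; first split => //.
 apply: (itg_dom (g := fun x => B ^+ 2 * \1_A x)); [exact: measurable_funX|exact: itgZ|].
 move=> x; have [Ax|nAx] := pselect (A x); last by rewrite f0 // expr0n normr0 mulr_ge0 ?sqr_ge0.
 by rewrite indicE mem_set //= mulr1 normrX ler_pXn2r ?nnegrE // (B0 x).
apply: (itg_dom (g := fun x => B * \1_A x)) => //; first exact: itgZ.
move=> x; have [Ax|nAx] := pselect (A x); last by rewrite f0 // normr0 mulr_ge0 ?(B0 x).
by rewrite indicE mem_set //= mulr1.
Qed.

Lemma l2_Lfun f : l2 f <-> f \in Lfun mu 2%:E.
split; last first.
 move=> h; split; last exact: Lfun2_integrable_sqr. by move: h; rewrite inE => /andP[/[!inE]].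
move=> [mf hf]; rewrite inE; apply/andP; split; rewrite inE //=.
rewrite /finite_norm unlock /Lnorm /= poweR_lty //.
move/integrableP: hf => [_]; apply: le_lt_trans; apply: le_of_eq.
by apply: eq_integral => x _; rewrite /= powR_mulrn // -normrX.
Qed.
End RealIntegral.

Lemma cvg_ge (R : realType) (u : nat -> R) l a : u n @[n --> \oo] --> l -> (forall n, a <= u n) -> a <= l.
move=> h le; rewrite -(cvg_lim _ h) //; apply: limr_ge; first exact: cvgP h.
exact: nearW.
Qed.

(** * Completeness of L2 *)
Section RieszFischer.
Context d (T : measurableType d) (R : realType).
Variable mu : {measure set T -> \bar R}.
Implicit Types f g : T -> R.
Notation int f := (\int[mu]_x f x)%R.

Lemma int_fin f : itg mu f -> (\int[mu]_x (f x)%:E)%E = (int f)%:E.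
by move=> hf; rewrite /Rintegral fineK //; exact: integrable_fin_num. Qed.
Lemma fatou_int (f_ : nat -> T -> R) f e : (forall n, itg mu (f_ n)) ->
  (forall n x, 0 <= f_ n x) -> (forall x, f_ n x @[n --> \oo] --> f x) ->
  (forall n, int (f_ n) <= e) -> itg mu f /\ int f <= e.
move=> hf f0 cf le.
have mf : mfT f.
 by apply: (measurable_fun_cvg (h := f_)) => // n; exact: itg_mf.
have f0' x : 0 <= f x by apply: (cvg_ge (cf x)).
have h : (\int[mu]_x (f x)%:E <= e%:E)%E.
 have := @fatou _ _ _ mu setT measurableT (fun n x => (f_ n x)%:E) _ _.
 rewrite (_ : (fun x => limn_einf _) = (fun x => (f x)%:E)); last first.
  apply/funext => x; apply: (cvg_limn_einf_sup _).1. by apply: cvg_EFin; [exact: nearW|exact: cf].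
 move=> /(_ _ _)/le_trans; apply.
 - by move=> n; apply/measurable_EFinP/itg_mf.
 - by move=> n x _; rewrite lee_fin.
 rewrite limn_einf_lim; apply: lime_le; first exact: is_cvg_einfs.
 apply: nearW => n; apply: (@le_trans _ _ (int (f_ n))%:E); last by rewrite lee_fin.
 by rewrite -int_fin //; apply: ereal_inf_lbound; exists n => //=.
have i : itg mu f.
 apply/integrableP; split; first exact/measurable_EFinP. under eq_integral do rewrite /= ger0_norm //.
 exact: le_lt_trans h (ltry _).
by split => //; rewrite -lee_fin -int_fin.
Qed.

(* a subsequence along which consecutive differences are square summable fast *)
Lemma fast_subsequence (P : nat -> nat -> R -> Prop) :
  (forall e, 0 < e -> exists N, forall m n, (N <= m)%N -> (N <= n)%N -> P m n e) ->
  exists s : nat -> nat, (forall k, (s k < s k.+1)%N) /\ forall k, P (s k.+1) (s k) (8 ^- k).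
move=> h; have e0 k : 0 < 8 ^- k :> R by rewrite invr_gt0 exprn_gt0.
have /choice[N hN] k := h _ (e0 k).
pose s := fix s k := if k is k'.+1 then maxn (s k').+1 (N k'.+1) else N 0%N.
have sN k : (N k <= s k)%N by case: k => //= k; exact: leq_maxr.
have si k : (s k < s k.+1)%N by rewrite /= leq_maxl.
exists s; split => // k; apply: hN => //.
by rewrite (leq_trans (sN k)) // ltnW.
Qed.

Lemma riesz_fischer (f_ : nat -> T -> R) : (forall n, l2 mu (f_ n)) ->
  (forall e, 0 < e -> exists N, forall m n, (N <= m)%N -> (N <= n)%N ->
    int (fun x => (f_ m x - f_ n x) ^+ 2) <= e) ->
  exists2 f, l2 mu f & forall e, 0 < e -> exists N, forall n, (N <= n)%N ->
    int (fun x => (f_ n x - f x) ^+ 2) <= e.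
move=> hf hc.
have [s [si hs]] := fast_subsequence hc.
have sg k : (k <= s k)%N by elim: k => // k IH; rewrite (leq_ltn_trans IH).
pose dk k x := (f_ (s k.+1) x - f_ (s k) x) ^+ 2.
have idk k : itg mu (dk k) by apply/l2_sqr/l2B.
pose g x : \bar R := (\sum_(0 <= k <oo) (2 ^+ k * dk k x)%:E)%E.
have g0 k x : (0 <= (2 ^+ k * dk k x)%:E)%E.
 by rewrite lee_fin mulr_ge0 ?sqr_ge0 ?exprn_ge0.
have mg0 k : mfT (fun x => (2 ^+ k * dk k x)%:E).
 exact/measurable_EFinP/itg_mf/itgZ.
have mg : mfT g by apply: ge0_emeasurable_sum => // k x _ _.
have ig : (\int[mu]_x g x < +oo)%E.
 rewrite integral_nneseries //. apply: (@le_lt_trans _ _ (\sum_(0 <= k <oo) (1 / 4 ^+ k)%:E)%E).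
  apply: lee_nneseries => k _.
   by move=> _; apply: integral_ge0.
  rewrite int_fin; last exact: itgZ. rewrite lee_fin intZ // (le_trans (ler_wpM2l _ (hs k))) ?exprn_ge0 //.
  rewrite -(_ : 2 * 4 = 8); last by rewrite -natrM. by rewrite exprMn invfM mulrA divff ?expf_neq0.
 apply: (@le_lt_trans _ _ (\sum_(0 <= k <oo) (2 / (2 ^ (k + 1))%:R)%:E)%E).
  apply: lee_nneseries => k _; first by rewrite lee_fin divr_ge0 ?exprn_ge0.
  rewrite lee_fin addn1 natrX exprS invfM mulrA divff // ler_pM2l // lef_pV2 ?posrE ?exprn_gt0 //.
  by rewrite -!natrX ler_nat -[4%N]/(2 ^ 2)%N -expnM leq_pexp2l // mulSn leq_addr.
 by rewrite (cvg_lim _ (@cvg_geometric_eseries_half R 2 0)) ?ltry.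
have g0' x : (0 <= g x)%E by apply: nneseries_ge0.
have gae : {ae mu, forall x, (g x < +oo)%E}.
 have igg : mu.-integrable setT g.
  by apply/integrableP; split => //; under eq_integral do rewrite gee0_abs //.
 apply: filterS (integrable_ae measurableT igg) => x /(_ I). by rewrite fin_numElt => /andP[].
pose E := [set x | (g x < +oo)%E].
have mE : measurable E.
 by rewrite -[E]setTI; exact: emeasurable_fun_infty_o.
pose h k x := \1_E x * f_ (s k) x.
have ch x : cvgn (fun k => h k x).
 have [Ex|nEx] := pselect (E x); last first.
  rewrite (_ : (fun k => h k x) = fun=> 0); first exact: is_cvg_cst.
  by apply/funext => k; rewrite /h indicE memNset ?mul0r.
 rewrite (_ : (fun k => h k x) = (fun k => f_ (s 0%N) x + series (fun j => f_ (s j.+1) x - f_ (s j) x) k)); last first.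
  apply/funext => k; rewrite /h indicE mem_set // mul1r. by rewrite seriesEnat /= telescope_sumr // addrC subrK.
 apply: is_cvgD; first exact: is_cvg_cst. apply: normed_cvg; apply: nondecreasing_is_cvgn.
  by apply: nondecreasing_series => n _ _; exact: normr_ge0.
 exists (2 + fine (g x)) => _ [n _ <-]; rewrite /normed_series_of /series /=.
 apply: (@le_trans _ _ (\sum_(0 <= j < n) (2 ^- j + 2 ^+ j * dk j x))).
  apply: ler_sum => j _; rewrite /dk -real_normK ?num_real //.
  move: (`|_|) => a; have p0 : 0 < 2 ^+ j :> R by exact: exprn_gt0.
  have [q q0 ->] : exists2 q : R, 0 < q & 2 ^+ j = q by exists (2 ^+ j).
  rewrite -subr_ge0 (_ : _ - _ = q^-1 * ((1 - q * a / 2) ^+ 2 + 3 / 4 * (q * a) ^+ 2)); last by field; exact: lt0r_neq0.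
  by rewrite mulr_ge0 ?invr_ge0 ?(ltW q0) // addr_ge0 ?sqr_ge0 // mulr_ge0 ?sqr_ge0 // divr_ge0.
 rewrite big_split /= lerD //.
  have := @geometric_le_lim R n 1 2^-1 ler01 _ _; rewrite seriesEnat /=.
  rewrite ger0_norm ?invr_ge0 // invf_lt1 ?ltr1n // => /(_ _ isT)/(le_trans _).
  rewrite (_ : 1 / (1 - 2^-1) = 2) //; last by field.
  by apply; rewrite ?invr_gt0 //; apply: ler_sum => j _; rewrite /geometric /= mul1r exprVn.
 rewrite -lee_fin fineK; last by rewrite ge0_fin_numE. rewrite -sumEFin; exact: nneseries_lim_ge.
pose f x := limn (fun k => h k x).
have cf x : h k x @[k --> \oo] --> f x by exact: ch.
have mh k : mfT (h k).
 apply: measurable_funM; last by have [] := hf (s k). exact: measurable_indic.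
have mf : mfT f by apply: (measurable_fun_cvg mh) => x _; exact: cf.
have hh k : l2 mu (h k).
 apply: (@l2M _ _ _ mu (\1_E) 1) => //. by move=> x; rewrite indicE; case: (_ \in _); rewrite ?normr1 ?normr0.
have key e : 0 < e -> exists N, forall n, (N <= n)%N -> itg mu (fun x => (f_ n x - f x) ^+ 2) /\
  int (fun x => (f_ n x - f x) ^+ 2) <= e.
 move=> /hc[N hN]; exists N => n Nn. apply: (@fatou_int (fun k x => (f_ n x - h (N + k)%N x) ^+ 2)).
 - by move=> k; exact/l2_sqr/l2B.
 - by move=> k x; rewrite sqr_ge0.
 - move=> x; rewrite [X in _ --> X]expr2; under eq_fun do rewrite expr2.
  have c : f_ n x - h (N + k)%N x @[k --> \oo] --> f_ n x - f x.
   apply: cvgB; first exact: cvg_cst. by have := cf x; rewrite -(cvg_shiftn N); under eq_fun do rewrite addnC.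
  exact: cvgM.
 - move=> k; apply: le_trans (hN n (s (N + k)%N) Nn _); last by rewrite (leq_trans _ (sg _)) // leq_addr.
  apply: le_of_eq; apply: eq_int_ae.
  + exact/itg_mf/l2_sqr/l2B.
  + exact/itg_mf/l2_sqr/l2B.
  + by apply: filterS gae => x gx; rewrite /h indicE mem_set ?mul1r.
have [N hN] := key 1 ltr01.
exists f; last by move=> e /key[M hM]; exists M => n /hM[].
have [i _] := hN N (leqnn N).
have lh : l2 mu (fun x => f_ N x - f x) by split => //; apply: measurable_funB => //; have [] := hf N.
have := l2B (hf N) lh; rewrite (_ : (fun x => f_ N x - (f_ N x - f x)) = f) //.
by apply/funext => x; rewrite subKr.
Qed.
End RieszFischer.

(** * The Hilbert space of complex fields *)
Section L2Hilbert.
Variables (R : realType) (Omega : domain R).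
Notation C := R[i].
Notation H := (L2 Omega).
Notation mu := (vol Omega).
Notation V := (R3 R -> 'cV[C]_3).

Definition re (u : V) (i : 'I_3) (x : R3 R) : R := complex.Re (u x i 0).
Definition im (u : V) (i : 'I_3) (x : R3 R) : R := complex.Im (u x i 0).

Definition sqi (f : V) := forall i, l2 mu (re f i) /\ l2 mu (im f i).

Lemma sqiP (f : V) : sqi f <-> f \in square_integrable Omega.
split=> [h|/asboolP h i]; last by have [/l2_Lfun ? /l2_Lfun ?] := h i.
by apply: asboolT => i; have [/l2_Lfun ? /l2_Lfun ?] := h i.
Qed.

Lemma L2_sqi (u : H) : sqi u.
by apply/sqiP; exact: (valP (repr u)). Qed.
Definition mkL2_def (f : V) : H :=
  if pselect (f \in square_integrable Omega) is left h then (\pi_(L2 Omega) (MkL2fun h))%qT else 0.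

Fact mkL2_key : unit. by []. Qed.
Definition mkL2 := locked_with mkL2_key mkL2_def.

Lemma mkL2E (f : V) : sqi f -> {ae mu, forall x, mkL2 f x = f x}.
move=> /sqiP h; rewrite /mkL2 unlock /mkL2_def; case: pselect => // h'.
exact: (repr_piL2 (MkL2fun h')).
Qed.

Lemma L2_ext (u v : H) : {ae mu, forall x, u x = v x} -> u = v.
by move=> h; rewrite -[u]reprK -[v]reprK; apply/pi_L2_eq. Qed.
Lemma pi_addL2 (u v : L2fun Omega) :
  (\pi_(L2 Omega) (u + v))%qT = (\pi_(L2 Omega) u + \pi_(L2 Omega) v)%qT.
exact: (@Quotient.pi_add _ [the zmodClosed (L2fun Omega) of @L2null R Omega] u v). Qed.
Lemma L2DE (u v : H) : {ae mu, forall x, L2repr (u + v) x = u x + v x}.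
have e : u + v = (\pi_(L2 Omega) (repr u + repr v))%qT.
 by rewrite pi_addL2 !reprK.
by rewrite e; exact: repr_piL2.
Qed.

Lemma L2ZE (a : C) (u : H) : {ae mu, forall x, L2repr (a *: u) x = a *: u x}.
exact: (repr_piL2 (a *: repr u)). Qed.
Lemma L20E : {ae mu, forall x, L2repr (0 : H) x = 0}.
by have := L2ZE 0 0; rewrite scale0r; apply: filterS => x ->; rewrite scale0r. Qed.
Lemma L2NE (u : H) : {ae mu, forall x, L2repr (- u) x = - u x}.
by have := L2ZE (-1) u; rewrite scaleN1r; apply: filterS => x ->; rewrite scaleN1r. Qed.
Definition rdot (u v : V) (x : R3 R) : R :=
  \sum_i (re u i x * re v i x + im u i x * im v i x).

Definition rp (u v : H) : R := complex.Re (L2inner u v).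

Lemma Re_conjM (z w : C) : complex.Re (z * w^*) = complex.Re z * complex.Re w + complex.Im z * complex.Im w.
by case: z w => [a b] [c d] /=; rewrite mulrN opprK. Qed.
Lemma Re_sum n (F : 'I_n -> C) : complex.Re (\sum_i F i) = \sum_i complex.Re (F i).
by apply: (big_morph (@complex.Re R)) => // -[? ?] [? ?]. Qed.
Lemma Im_sum n (F : 'I_n -> C) : complex.Im (\sum_i F i) = \sum_i complex.Im (F i).
by apply: (big_morph (@complex.Im R)) => // -[? ?] [? ?]. Qed.
Lemma rpE (u v : H) : rp u v = \int[mu]_x rdot u v x.
rewrite /rp /L2inner /integralC /=; apply: eq_Rintegral => x _.
by rewrite Re_sum; apply: eq_bigr => i _; rewrite Re_conjM.
Qed.

Lemma Im_conjM (z w : C) : complex.Im (z * w^*) = complex.Im z * complex.Re w - complex.Re z * complex.Im w.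
by case: z w => [a b] [c d] /=; rewrite mulrN addrC. Qed.
Lemma rdot_itg (u v : V) : sqi u -> sqi v -> itg mu (rdot u v).
move=> hu hv; apply: itg_sum => i; have [ru iu] := hu i; have [rv iv] := hv i.
by apply: itgD; exact: l2_mul.
Qed.

Lemma rp_ae (u v : H) (f g : V) : sqi f -> sqi g -> {ae mu, forall x, u x = f x} ->
  {ae mu, forall x, v x = g x} -> rp u v = \int[mu]_x rdot f g x.
move=> hf hg uf vg; rewrite rpE; apply: eq_int_ae.
- exact/itg_mf/rdot_itg/L2_sqi/L2_sqi.
- exact/itg_mf/rdot_itg.
- by apply: filterS2 uf vg => x; rewrite /rdot /re /im => -> ->.
Qed.

Lemma sqiD (f g : V) : sqi f -> sqi g -> sqi (fun x => f x + g x).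
move=> hf hg i; have [h1 h2] := hf i; have [h3 h4] := hg i.
have -> : re (fun x => f x + g x) i = (fun x => re f i x + re g i x).
 by apply/funext => x; rewrite /re mxE; case: (f x i 0) (g x i 0) => [? ?] [? ?].
have -> : im (fun x => f x + g x) i = (fun x => im f i x + im g i x).
 by apply/funext => x; rewrite /im mxE; case: (f x i 0) (g x i 0) => [? ?] [? ?].
by split; exact: l2D.
Qed.

Lemma reZ (c : C) (f : V) i : re (fun x => c *: f x) i =
  (fun x => complex.Re c * re f i x - complex.Im c * im f i x).
by apply/funext => x; rewrite /re /im mxE; case: c (f x i 0) => [? ?] [? ?]. Qed.
Lemma imZ (c : C) (f : V) i : im (fun x => c *: f x) i =
  (fun x => complex.Re c * im f i x + complex.Im c * re f i x).
by apply/funext => x; rewrite /re /im mxE; case: c (f x i 0) => [? ?] [? ?]. Qed.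
Lemma sqiZ (c : C) (f : V) : sqi f -> sqi (fun x => c *: f x).
move=> hf i; have [h1 h2] := hf i; split.
 by rewrite reZ; apply: l2B; exact: l2Z.
by rewrite imZ; apply: l2D; exact: l2Z.
Qed.

Lemma rp_is_ip : is_ip rp.
split.
- move=> x y z; rewrite (rp_ae (sqiD (L2_sqi x) (L2_sqi y)) (L2_sqi z) (L2DE x y)); last exact: aeW.
 rewrite !rpE -intD; [|exact/rdot_itg/L2_sqi/L2_sqi..].
 apply: eq_Rintegral => t _; rewrite /rdot -big_split /=; apply: eq_bigr => i _.
 by rewrite /re /im mxE; case: (L2repr x t i 0) (L2repr y t i 0) => [? ?] [? ?] /=; ring.
- move=> a x y; rewrite (rp_ae (sqiZ a%:C%C (L2_sqi x)) (L2_sqi y) (L2ZE _ x)); last exact: aeW.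
 rewrite rpE -intZ; last exact/rdot_itg/L2_sqi/L2_sqi.
 apply: eq_Rintegral => t _; rewrite /rdot mulr_sumr; apply: eq_bigr => i _. by rewrite reZ imZ /=; ring.
- by move=> x y; rewrite !rpE; apply: eq_Rintegral => t _; apply: eq_bigr => i _; congr (_ + _); exact: mulrC.
- by move=> x; rewrite rpE; apply: int_ge0 => t; apply: sumr_ge0 => i _; rewrite -!expr2 addr_ge0 ?sqr_ge0.
- move=> x; rewrite rpE => h; apply: L2_ext.
 have p0 (t : R3 R) : 0 <= rdot (L2repr x) (L2repr x) t by apply: sumr_ge0 => i _; rewrite -!expr2 addr_ge0 ?sqr_ge0.
 apply: filterS2 (int_eq0_ae p0 (rdot_itg (L2_sqi x) (L2_sqi x)) h) L20E => t h1 ->; apply/colP => i; rewrite mxE.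
 have h0 (j : 'I_3) : 0 <= re (L2repr x) j t * re (L2repr x) j t + im (L2repr x) j t * im (L2repr x) j t.
  by rewrite -!expr2 addr_ge0 ?sqr_ge0.
 have : re (L2repr x) i t * re (L2repr x) i t + im (L2repr x) i t * im (L2repr x) i t = 0.
  apply/le_anti; rewrite h0 andbT -h1 /rdot (bigD1 i) //= lerDl. by apply: sumr_ge0 => j _.
 rewrite -!expr2 => /eqP; rewrite paddr_eq0 ?sqr_ge0 // !sqrf_eq0 => /andP[/eqP a /eqP b].
 by apply/eqP; rewrite eq_complex /= -/(re (L2repr x) i t) -/(im (L2repr x) i t) a b !eqxx.
Qed.

Lemma rp_is_cip : is_cip rp.
split; first exact: rp_is_ip.
move=> x y; rewrite (rp_ae (sqiZ _ (L2_sqi x)) (sqiZ _ (L2_sqi y)) (L2ZE _ x) (L2ZE _ y)) rpE.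
apply: eq_Rintegral => t _; apply: eq_bigr => i _; rewrite !reZ !imZ /=; ring.
Qed.

Definition conjv (a : 'cV[C]_3) : 'cV[C]_3 := map_mx (fun z : C => z^*) a.

Definition conjf (f : V) : V := fun x => conjv (f x).

Lemma re_conjf (f : V) i : re (conjf f) i = re f i.
by apply/funext => x; rewrite /re /conjf mxE; case: (f x i 0). Qed.
Lemma im_conjf (f : V) i : im (conjf f) i = (fun x => - im f i x).
by apply/funext => x; rewrite /im /conjf mxE; case: (f x i 0). Qed.
Lemma sqi_conjf (f : V) : sqi f -> sqi (conjf f).
move=> hf i; have [h1 h2] := hf i; split.
 by rewrite re_conjf.
by rewrite im_conjf; exact: l2N.
Qed.

Definition cj (u : H) : H := mkL2 (conjf u).

Lemma cjE (u : H) : {ae mu, forall x, cj u x = conjf u x}.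
exact/mkL2E/sqi_conjf/L2_sqi. Qed.
Lemma conjvD a b : conjv (a + b) = conjv a + conjv b.
by apply/colP => i; rewrite !mxE rmorphD. Qed.
Lemma conjvZ c a : conjv (c *: a) = c^* *: conjv a.
by apply/colP => i; rewrite !mxE rmorphM. Qed.
Lemma conjvK a : conjv (conjv a) = a.
by apply/colP => i; rewrite !mxE conjCK. Qed.
Lemma cj_is_conj : is_conj rp cj.
split.
- move=> x y; apply: L2_ext.
 apply: filterS2 (filterI (cjE (x + y)) (L2DE x y)) (filterI (filterI (cjE x) (cjE y)) (L2DE (cj x) (cj y))) => t [h1 h2] [[h3 h4] h5].
 by rewrite h1 h5 h3 h4 /conjf h2; exact: conjvD.
- move=> c x; apply: L2_ext; apply: filterS2 (filterI (cjE (c *: x)) (L2ZE c x)) (filterI (cjE x) (L2ZE c^*%C (cj x))) => t [h1 h2] [h3 h4].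
 by rewrite h1 h4 h3 /conjf h2; exact: conjvZ.
- move=> x; apply: L2_ext; apply: filterS2 (cjE (cj x)) (cjE x) => t h1 h2. by rewrite h1 /conjf h2; exact: conjvK.
- move=> x y; rewrite (rp_ae (sqi_conjf (L2_sqi x)) (sqi_conjf (L2_sqi y)) (cjE x) (cjE y)) rpE.
 apply: eq_Rintegral => t _; apply: eq_bigr => i _; rewrite !re_conjf !im_conjf; ring.
Qed.
End L2Hilbert.

(** * Multiplication by real matrix fields *)
Section Fields.
Variables (R : realType) (Omega : domain R).
Notation C := R[i].
Notation H := (L2 Omega).
Notation mu := (vol Omega).
Notation V := (R3 R -> 'cV[C]_3).
Notation rp := (@rp R Omega).
Notation nrm := (ipnorm rp).
Notation sqi := (sqi Omega).
Let hH := rp_is_cip Omega.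
Let ip := rp_is_ip Omega.

Definition mkc (f g : 'I_3 -> R3 R -> R) : V := fun x => \col_i (f i x +i* g i x)%C.

Lemma re_mkc f g i : re (mkc f g) i = f i.
by apply/funext => x; rewrite /re mxE. Qed.
Lemma im_mkc f g i : im (mkc f g) i = g i.
by apply/funext => x; rewrite /im mxE. Qed.
Lemma rp_sum (u v : H) (f g : V) : sqi f -> sqi g -> {ae mu, forall x, u x = f x} ->
  {ae mu, forall x, v x = g x} ->
  rp u v = \sum_i (\int[mu]_x (re f i x * re g i x) + \int[mu]_x (im f i x * im g i x)).
move=> hf hg uf vg; rewrite (rp_ae hf hg uf vg) /rdot.
have h i : itg mu (fun x => re f i x * re g i x) /\ itg mu (fun x => im f i x * im g i x).
 by have [? ?] := hf i; have [? ?] := hg i; split; exact: l2_mul.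
rewrite int_sum; last by move=> i; have [? ?] := h i; exact: itgD.
by apply: eq_bigr => i _; have [? ?] := h i; rewrite intD.
Qed.

Lemma sqiB (f g : V) : sqi f -> sqi g -> sqi (fun x => f x - g x).
move=> hf hg; have := sqiD hf (sqiZ (-1) hg).
by under eq_fun do rewrite scaleN1r.
Qed.

Lemma reB (f g : V) i : re (fun x => f x - g x) i = (fun x => re f i x - re g i x).
by apply/funext => x; rewrite /re !mxE; case: (f x i 0) (g x i 0) => [? ?] [? ?]. Qed.
Lemma imB (f g : V) i : im (fun x => f x - g x) i = (fun x => im f i x - im g i x).
by apply/funext => x; rewrite /im !mxE; case: (f x i 0) (g x i 0) => [? ?] [? ?]. Qed.
Lemma L2BE (u v : H) : {ae mu, forall x, L2repr (u - v) x = u x - v x}.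
by apply: filterS2 (L2DE u (- v)) (L2NE v) => x -> ->. Qed.
Lemma L2_complete : ip_complete rp setT.
move=> u_ _ hu.
have nB (u v : H) (f : V) : sqi f -> {ae mu, forall x, v x = f x} -> nrm (u - v) ^+ 2 =
  \sum_i (\int[mu]_x (re u i x - re f i x) ^+ 2 + \int[mu]_x (im u i x - im f i x) ^+ 2).
 move=> sf vf; rewrite (nrm_sqr ip); have s := sqiB (L2_sqi u) sf.
 have e : {ae mu, forall x, L2repr (u - v) x = u x - f x}.
  by apply: filterS2 (L2BE u v) vf => x -> ->.
 rewrite (rp_sum s s e e); apply: eq_bigr => i _.
 by rewrite reB imB; congr (_ + _); apply: eq_Rintegral => x _; rewrite expr2.
have comp (F : V -> 'I_3 -> R3 R -> R) :
  (forall (u : H) i, l2 mu (F u i)) ->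
  (forall (u v : H) i, \int[mu]_x (F u i x - F v i x) ^+ 2 <= nrm (u - v) ^+ 2) ->
  forall i : 'I_3, exists f, l2 mu f /\ forall e, 0 < e -> exists N, forall n, (N <= n)%N ->
   \int[mu]_x (F (L2repr (u_ n)) i x - f x) ^+ 2 <= e.
 move=> F2 Fle i; have [||f hf cf] := @riesz_fischer _ _ _ mu (fun n => F (L2repr (u_ n)) i).
 - by move=> n.
 - move=> e e0; have [|N hN] := hu (Num.sqrt e); first by rewrite sqrtr_gt0.
  exists N => m n Nm Nn; rewrite (le_trans (Fle _ _ _)) //.
  by rewrite -[leRHS]sqr_sqrtr ?(ltW e0) // ler_pXn2r ?nnegrE ?nrm_ge0 ?sqrtr_ge0 // hN.
 - by exists f.
have le1 (u v : H) (a b : 'I_3 -> R) i : (forall i, 0 <= a i) -> (forall i, 0 <= b i) ->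
  nrm (u - v) ^+ 2 = \sum_i (a i + b i) -> a i <= nrm (u - v) ^+ 2 /\ b i <= nrm (u - v) ^+ 2.
 move=> a0 b0 ->; rewrite (bigD1 i) //=.
 have s0 : 0 <= \sum_(j < 3 | j != i) (a j + b j) by apply: sumr_ge0 => j _; rewrite addr_ge0.
 have := a0 i; have := b0 i; split; lra.
have i0 (f : R3 R -> R) : 0 <= \int[mu]_x f x ^+ 2 by apply: int_ge0 => x; rewrite sqr_ge0.
have nBle (u v : H) i := le1 u v _ _ i (fun i => i0 _) (fun i => i0 _) (nB u v _ (L2_sqi v) (aeW mu (fun x => erefl))).
have /choice[fr hr] := comp (fun u i => re u i) (fun u i => (L2_sqi u i).1) (fun u v i => (nBle u v i).1).
have /choice[fi hi] := comp (fun u i => im u i) (fun u i => (L2_sqi u i).2) (fun u v i => (nBle u v i).2).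
have s : sqi (mkc fr fi) by move=> i; rewrite re_mkc im_mkc; split; [case: (hr i)|case: (hi i)].
exists (mkL2 Omega (mkc fr fi)) => // e e0.
have e6 : 0 < e ^+ 2 / 6 by rewrite divr_gt0 ?exprn_gt0.
have /choice[N hN] i : exists N, forall n, (N <= n)%N ->
  \int[mu]_x (re (L2repr (u_ n)) i x - fr i x) ^+ 2 <= e ^+ 2 / 6 /\
  \int[mu]_x (im (L2repr (u_ n)) i x - fi i x) ^+ 2 <= e ^+ 2 / 6.
 have [_ /(_ _ e6)[N1 h1]] := hr i; have [_ /(_ _ e6)[N2 h2]] := hi i.
 by exists (maxn N1 N2) => n; rewrite geq_max => /andP[/h1 ? /h2 ?].
exists (\max_i N i)%N => n Nn.
rewrite -(@ler_pXn2r _ 2) ?nnegrE ?nrm_ge0 ?(ltW e0) //.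
rewrite (nB _ _ _ s (mkL2E s)).
apply: (@le_trans _ _ (\sum_(i < 3) (e ^+ 2 / 6 + e ^+ 2 / 6))); last by rewrite sumr_const card_ord; lra.
apply: ler_sum => i _; rewrite re_mkc im_mkc; have [|? ?] := hN i n; last exact: lerD.
by rewrite (leq_trans _ Nn) // leq_bigmax.
Qed.

Definition bmf (B : R) (A : R3 R -> 'M[R]_3) :=
  (forall i j, mfT (fun x => A x i j)) /\ forall x i j, `|A x i j| <= B.

Definition mulf (A : R3 R -> 'M[R]_3) (f : V) : V := fun x => toC (A x) *m f x.

Lemma re_mulf A f i : re (mulf A f) i = fun x => \sum_j A x i j * re f j x.
apply/funext => x; rewrite /re mxE Re_sum; apply: eq_bigr => j _.
by rewrite mxE; case: (f x j 0) => a b /=; rewrite mul0r subr0.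
Qed.

Lemma im_mulf A f i : im (mulf A f) i = fun x => \sum_j A x i j * im f j x.
apply/funext => x; rewrite /im mxE Im_sum; apply: eq_bigr => j _.
by rewrite mxE; case: (f x j 0) => a b /=; rewrite mul0r addr0.
Qed.

Lemma sqi_mulf B A f : bmf B A -> sqi f -> sqi (mulf A f).
move=> [mA bA] hf i; rewrite re_mulf im_mulf.
by split; apply: l2_sum => j; (apply: (l2M (B := B)) => //; have [] := hf j).
Qed.

Definition opm (A : R3 R -> 'M[R]_3) (u : H) : H := mkL2 Omega (mulf A u).

Lemma mulmxD_eq (M : 'M[C]_3) (a b c d e f : 'cV[C]_3) :
  c = a + b -> d = M *m a -> e = M *m b -> f = d + e -> f = M *m c.
by move=> -> -> -> ->; rewrite mulmxDr. Qed.

Section Opm.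
Variables (B : R) (A : R3 R -> 'M[R]_3).
Hypothesis hA : bmf B A.

Lemma opmE (u : H) : {ae mu, forall x, opm A u x = toC (A x) *m u x}.
exact/mkL2E/(sqi_mulf hA)/L2_sqi. Qed.
Lemma opm_eq (u v : H) : {ae mu, forall x, v x = toC (A x) *m u x} -> v = opm A u.
by move=> h; apply: L2_ext; apply: filterS2 h (opmE u) => x -> ->. Qed.
Lemma opmD u v : opm A (u + v) = opm A u + opm A v.
apply/esym/opm_eq; apply: filterS2 (filterI (L2DE u v) (L2DE (opm A u) (opm A v))) (filterI (opmE u) (opmE v)) => x [h1 h2] [h3 h4].
exact: mulmxD_eq h1 h3 h4 h2.
Qed.

Lemma opmZ (c : C) u : opm A (c *: u) = c *: opm A u.
apply/esym/opm_eq; apply: filterS2 (filterI (L2ZE c u) (L2ZE c (opm A u))) (opmE u) => x [h1 h2] h3.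
by rewrite h2 h3 h1; exact: (scalemxAr c (toC (A x)) (L2repr u x)).
Qed.

Lemma opmJ u : opm A (cj u) = cj (opm A u).
apply/esym/opm_eq; apply: filterS2 (filterI (cjE u) (cjE (opm A u))) (opmE u) => x [h1 h2] h3.
rewrite h2 /conjf h3 h1 /conjf /conjv map_mxM; congr (_ *m _).
by apply/matrixP => i j; rewrite !mxE /=; exact: conjc_real.
Qed.

Lemma rp_opm2 (u : H) : rp (opm A u) (opm A u) = \int[mu]_x
  (\sum_i (\sum_j A x i j * re (L2repr u) j x) ^+ 2 + \sum_i (\sum_j A x i j * im (L2repr u) j x) ^+ 2).
have s := sqi_mulf hA (L2_sqi u).
rewrite (rp_ae s s (opmE u) (opmE u)); apply: eq_Rintegral => x _.
by rewrite -big_split /=; apply: eq_bigr => i _; rewrite re_mulf im_mulf !expr2.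
Qed.
End Opm.
End Fields.

(** * Real vectors and positive definite matrices *)
Section Dotv.
Variable R : realType.
Implicit Types h g : 'cV[R]_3.

Lemma dotvC h g : dotv h g = dotv g h.
by apply: eq_bigr => i _; rewrite mulrC. Qed.
Lemma dotvDl h g k : dotv (h + g) k = dotv h k + dotv g k.
by rewrite -big_split; apply: eq_bigr => i _; rewrite mxE mulrDl. Qed.
Lemma dotvZl a h g : dotv (a *: h) g = a * dotv h g.
by rewrite mulr_sumr; apply: eq_bigr => i _; rewrite mxE mulrA. Qed.
Lemma dotvZr a h g : dotv h (a *: g) = a * dotv h g.
by rewrite dotvC dotvZl dotvC. Qed.
Lemma dotvBl h g k : dotv (h - g) k = dotv h k - dotv g k.
by rewrite dotvDl -scaleN1r dotvZl mulN1r. Qed.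
Lemma dotvBr h g k : dotv h (g - k) = dotv h g - dotv h k.
by rewrite dotvC dotvBl !(dotvC h). Qed.
Lemma dotv_ge0 h : 0 <= dotv h h.
by apply: sumr_ge0 => i _; rewrite -expr2 sqr_ge0. Qed.
Lemma dotv_ge_sqr h i : h i 0 ^+ 2 <= dotv h h.
by rewrite /dotv (bigD1 i) //= -expr2 lerDl; apply: sumr_ge0 => j _; rewrite -expr2 sqr_ge0. Qed.
Lemma dotv_eq0 h : dotv h h = 0 -> h = 0.
move=> e; apply/colP => i; rewrite mxE; have := dotv_ge_sqr h i; rewrite e => l.
by apply/eqP; rewrite -sqrf_eq0 eq_le l sqr_ge0.
Qed.

Lemma dotv_trmx (A : 'M[R]_3) h g : dotv (A *m h) g = dotv h (A^T *m g).
rewrite /dotv; under eq_bigr do rewrite mxE mulr_suml.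
rewrite exchange_big; apply: eq_bigr => i _; rewrite mxE mulr_sumr; apply: eq_bigr => j _.
by rewrite mxE; ring.
Qed.

Lemma dotv0 h : dotv h 0 = 0.
by rewrite /dotv big1 // => i _; rewrite mxE mulr0. Qed.
Lemma dotv_cs h g : dotv h g ^+ 2 <= dotv h h * dotv g g.
have [g0|g0] := eqVneq (dotv g g) 0.
 by rewrite (dotv_eq0 g0) !dotv0 mulr0 expr0n.
have gp : 0 < dotv g g by rewrite lt_def g0 dotv_ge0.
have := dotv_ge0 (dotv g g *: h - dotv h g *: g).
rewrite !(dotvBl, dotvBr, dotvZl, dotvZr) (dotvC g h) => e.
rewrite -subr_ge0 -(pmulr_rge0 _ gp); lra.
Qed.

Lemma dotv_entries (A : 'M[R]_3) B h : (forall i j, `|A i j| <= B) ->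
  dotv (A *m h) (A *m h) <= (3 * B) ^+ 2 * dotv h h.
move=> AB; have B0 : 0 <= B by exact: le_trans (AB 0 0).
have b i : (A *m h) i 0 * (A *m h) i 0 <= 3 * B ^+ 2 * dotv h h.
 have -> : (A *m h) i 0 = dotv (\col_j A i j) h by rewrite mxE; apply: eq_bigr => j _; rewrite mxE.
 rewrite -expr2 (le_trans (dotv_cs _ _)) // ler_wpM2r ?dotv_ge0 //.
 rewrite /dotv (@le_trans _ _ (\sum_(j < 3) B ^+ 2)) //; last by rewrite sumr_const card_ord; lra.
 apply: ler_sum => j _; rewrite mxE -expr2 -real_normK ?num_real // ler_pXn2r ?nnegrE //.
rewrite {1}/dotv (le_trans (ler_sum _ (fun i _ => b i))) // sumr_const card_ord.
by have := dotv_ge0 h => h0; rewrite -mulr_natl; nra.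
Qed.

Lemma enorm1_scale h : h != 0 -> exists2 g, enorm g = 1 & exists2 t, 0 < t & h = t *: g /\ t ^+ 2 = dotv h h.
move=> h0; have p : 0 < dotv h h.
 by rewrite lt_def dotv_ge0 andbT; apply: contra h0 => /eqP/dotv_eq0 ->.
have t0 : 0 < enorm h by rewrite sqrtr_gt0.
exists ((enorm h)^-1 *: h).
 rewrite {1}/enorm dotvZl dotvZr mulrA -expr2 sqrtrM ?sqr_ge0 // sqrtr_sqr gtr0_norm ?invr_gt0 //.
 by rewrite -/(enorm h) mulVf ?gt_eqF.
exists (enorm h) => //; split; first by rewrite scalerA mulfV ?gt_eqF // scale1r.
by rewrite sqr_sqrtr ?ltW.
Qed.

Lemma enorm1_dotv h : enorm h = 1 -> dotv h h = 1.
by move=> h1; rewrite -(@sqr_sqrtr _ (dotv h h)) ?dotv_ge0 // -/(enorm h) h1 expr1n. Qed.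
Lemma enorm_delta : enorm (delta_mx 0 0 : 'cV[R]_3) = 1.
rewrite /enorm /dotv (bigD1 0) //= big1 => [|i /negPf i0]; last by rewrite !mxE i0 mul0r.
by rewrite !mxE !eqxx mulr1 addr0 sqrtr1.
Qed.

Lemma quad_bounds (A : 'M[R]_3) m M : (forall h, enorm h = 1 -> m <= dotv h (A *m h) <= M) ->
  forall h, m * dotv h h <= dotv h (A *m h) <= M * dotv h h.
move=> H h; have [->|/enorm1_scale[g g1 [t t0 [-> e]]]] := eqVneq h 0.
 by rewrite mulmx0 !dotv0 !mulr0 lexx.
have /andP[H1 H2] := H _ g1.
rewrite -scalemxAr !dotvZl !dotvZr.
rewrite (enorm1_dotv g1).
have t2 : 0 < t ^+ 2 by exact: exprn_gt0.
rewrite mulr1 ![t * (t * _)]mulrA -!expr2 (mulrC m) (mulrC M).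
by rewrite !ler_pM2l // H1 H2.
Qed.

Lemma posdef_unit (A : 'M[R]_3) m : 0 < m -> (forall h, m * dotv h h <= dotv h (A *m h)) -> A \in unitmx.
move=> m0 H; rewrite -unitmx_tr -row_free_unit -kermx_eq0; apply/rowV0P => v /sub_kermxP e.
have := H v^T; rewrite -[A *m _]trmxK trmx_mul trmxK e trmx0.
rewrite dotv0.
rewrite pmulr_rle0 // => h; have /dotv_eq0 : dotv v^T v^T = 0 by apply/le_anti; rewrite h dotv_ge0.
by move/(congr1 trmx); rewrite trmxK trmx0.
Qed.

Section PosdefInv.
Variables (A : 'M[R]_3) (m B : R).
Hypotheses (m0 : 0 < m) (H : forall h, m * dotv h h <= dotv h (A *m h)).
Let u := posdef_unit m0 H.

Lemma invmx_sym : A^T = A -> (invmx A)^T = invmx A.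
by move=> e; rewrite trmx_inv e. Qed.
Lemma invmx_bound h : m ^+ 2 * dotv (invmx A *m h) (invmx A *m h) <= dotv h h.
set g := invmx A *m h; have e : A *m g = h by rewrite mulmxA mulmxV // mul1mx.
have := H g; rewrite e => h1; have := dotv_cs g h; have := dotv_ge0 g; have := dotv_ge0 h.
move: (dotv g g) (dotv g h) (dotv h h) h1 => a b c h1 c0 a0 h2.
have [->|an] := eqVneq a 0; first by rewrite mulr0.
have ap : 0 < a by rewrite lt_def an.
rewrite -(ler_pM2l ap); apply: le_trans h2.
rewrite (_ : a * (m ^+ 2 * a) = (m * a) ^+ 2); last by ring.
by rewrite ler_pXn2r ?nnegrE ?mulr_ge0 ?(ltW m0) ?(le_trans _ h1) // mulr_ge0 // ltW.
Qed.

Lemma invmx_entry i j : `|invmx A i j| <= m^-1.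
have := invmx_bound (delta_mx j 0); set g := _ *m _ => h.
have e : invmx A i j = g i 0.
 rewrite /g mxE (bigD1 j) //= big1 ?addr0 ?mxE ?eqxx ?mulr1 // => k kj. by rewrite mxE (negbTE kj) mulr0.
have d1 : dotv (delta_mx j 0 : 'cV[R]_3) (delta_mx j 0) = 1.
 rewrite /dotv (bigD1 j) //= big1 ?addr0 ?mxE ?eqxx ?mulr1 // => k kj. by rewrite mxE (negbTE kj) mulr0.
rewrite e -(@ler_pXn2r _ 2) ?nnegrE ?invr_ge0 ?(ltW m0) // real_normK ?num_real //.
rewrite (le_trans (dotv_ge_sqr _ _)) // exprVn -[leRHS]mul1r ler_pdivlMr ?exprn_gt0 // mulrC.
by rewrite d1 in h.
Qed.

Lemma invmx_ge : 0 < B -> (forall i j, `|A i j| <= B) ->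
  forall h, m / (3 * B) ^+ 2 * dotv h h <= dotv h (invmx A *m h).
move=> B0 AB h; set g := invmx A *m h; have e : A *m g = h by rewrite mulmxA mulmxV // mul1mx.
have := H g; rewrite e (dotvC g) => /(le_trans _); apply.
have := dotv_entries g AB; rewrite e => l.
have q0 : 0 < (3 * B) ^+ 2 by rewrite exprn_gt0 // mulr_gt0.
by rewrite -mulrA ler_pM2l // ler_pdivrMl.
Qed.
End PosdefInv.
End Dotv.

(** * Bounds for multiplication operators *)
Section OpmBounds.
Variables (R : realType) (Omega : domain R).
Notation C := R[i].
Notation H := (L2 Omega).
Notation mu := (vol Omega).
Notation V := (R3 R -> 'cV[C]_3).
Notation rp := (@rp R Omega).
Notation nrm := (ipnorm rp).
Notation sqi := (sqi Omega).
Let hH := rp_is_cip Omega.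
Let ip := rp_is_ip Omega.

Definition rec (f : V) (x : R3 R) : 'cV[R]_3 := \col_i re f i x.
Definition imc (f : V) (x : R3 R) : 'cV[R]_3 := \col_i im f i x.

Lemma rdot_dotv (f g : V) x : rdot f g x = dotv (rec f x) (rec g x) + dotv (imc f x) (imc g x).
by rewrite /dotv -big_split; apply: eq_bigr => i _; rewrite !mxE. Qed.
Lemma rec_mulf A (f : V) x : rec (mulf A f) x = A x *m rec f x.
by apply/colP => i; rewrite !mxE re_mulf; apply: eq_bigr => j _; rewrite mxE. Qed.
Lemma imc_mulf A (f : V) x : imc (mulf A f) x = A x *m imc f x.
by apply/colP => i; rewrite !mxE im_mulf; apply: eq_bigr => j _; rewrite mxE. Qed.
Lemma opm_rp B A (u v : H) : bmf B A ->
  rp (opm A u) v = \int[mu]_x rdot (mulf A u) v x /\ itg mu (rdot (mulf A u) v).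
move=> hA; have s := sqi_mulf hA (L2_sqi u); split; last exact: rdot_itg s (L2_sqi v).
exact: rp_ae s (L2_sqi v) (opmE hA u) (aeW mu (fun x => erefl)).
Qed.

Lemma opm_rp2 B A (u : H) : bmf B A ->
  rp (opm A u) (opm A u) = \int[mu]_x rdot (mulf A u) (mulf A u) x /\ itg mu (rdot (mulf A u) (mulf A u)).
move=> hA; have q := sqi_mulf hA (L2_sqi u); split; last exact: (rdot_itg q q).
exact: (rp_ae q q (opmE hA u) (opmE hA u)).
Qed.

Section One.
Variables (B : R) (A : R3 R -> 'M[R]_3).
Hypothesis hA : bmf B A.

Lemma opm_ge c (u : H) : {ae mu, forall x, forall h, c * dotv h h <= dotv h (A x *m h)} ->
  c * nrm u ^+ 2 <= rp (opm A u) u.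
move=> hc; have [-> i2] := opm_rp u u hA; rewrite (nrm_sqr ip) rpE.
have i1 := rdot_itg (L2_sqi u) (L2_sqi u); rewrite -intZ //; apply: le_int_ae => //; first exact: itgZ.
by apply: filterS hc => x h; rewrite !rdot_dotv rec_mulf imc_mulf mulrDr lerD // (dotvC (A x *m _)).
Qed.

Lemma opm_le c (u : H) : {ae mu, forall x, forall h, dotv h (A x *m h) <= c * dotv h h} ->
  rp (opm A u) u <= c * nrm u ^+ 2.
move=> hc; have [-> i2] := opm_rp u u hA; rewrite (nrm_sqr ip) rpE.
have i1 := rdot_itg (L2_sqi u) (L2_sqi u); rewrite -intZ //; apply: le_int_ae => //; first exact: itgZ.
by apply: filterS hc => x h; rewrite !rdot_dotv rec_mulf imc_mulf mulrDr lerD // (dotvC (A x *m _)).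
Qed.

Lemma opm_sym (u v : H) : {ae mu, forall x, (A x)^T = A x} -> rp (opm A u) v = rp u (opm A v).
move=> hs; have [e1 i1] := opm_rp u v hA; have [e2 i2] := opm_rp v u hA.
rewrite (rpC ip u (opm A v)) e1 e2.
apply: eq_int_ae; [exact: itg_mf i1|exact: itg_mf i2|].
apply: filterS hs => x e; rewrite !rdot_dotv !rec_mulf !imc_mulf [dotv (_ *m rec u x) _]dotv_trmx [dotv (_ *m imc u x) _]dotv_trmx e.
by congr (_ + _); exact: dotvC.
Qed.

Lemma opm_dom b B2 A2 (u : H) : bmf B2 A2 ->
  {ae mu, forall x, forall h, dotv (A x *m h) (A x *m h) <= b * dotv h h + dotv (A2 x *m h) (A2 x *m h)} ->
  rp (opm A u) (opm A u) <= b * rp u u + rp (opm A2 u) (opm A2 u).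
move=> hA2 hb; have [-> i1] := opm_rp2 u hA; have [-> i3] := opm_rp2 u hA2.
have i2 := rdot_itg (L2_sqi u) (L2_sqi u); rewrite rpE -intZ // -intD //; last exact: itgZ.
apply: le_int_ae => //; first by apply: itgD => //; exact: itgZ.
apply: filterS hb => x h; rewrite !rdot_dotv !rec_mulf !imc_mulf.
by have := lerD (h (rec u x)) (h (imc u x)); lra.
Qed.

Lemma opm_bl : 0 <= B -> bounded_linear (rp := rp) (opm A) (3 * B).
move=> B0; split; [exact: opmD hA|exact: opmZ hA|] => u.
have p : 0 <= 3 * B by rewrite mulr_ge0.
rewrite -(@ler_pXn2r _ 2) // ?nnegrE ?nrm_ge0 ?mulr_ge0 ?nrm_ge0 // exprMn !(nrm_sqr ip).
have [-> i1] := opm_rp2 u hA; have i2 := rdot_itg (L2_sqi u) (L2_sqi u).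
rewrite rpE -intZ //; apply: le_int => //; first exact: itgZ.
move=> x; rewrite !rdot_dotv rec_mulf imc_mulf mulrDr.
by rewrite lerD //; apply: dotv_entries; have [_ h] := hA.
Qed.
End One.

Lemma ae_subset (P : set (R3 R)) : {ae mu, forall x, P x} ->
  exists E, [/\ measurable E, E `<=` (Omega : set (R3 R)), E `<=` P & {ae mu, forall x, E x}].
move=> [N [mN N0 NP]].
have mO := open_measurable_R3 (domain_open Omega).
exists ((Omega : set (R3 R)) `\` N); split.
- exact: measurableD.
- by move=> x [].
- by move=> x [_ nN]; apply: contrapT => nP; apply: nN; exact: NP.
exists (N `|` ~` (Omega : set (R3 R))); split.
- by apply: measurableU => //; exact: measurableC.
- apply/eqP; rewrite eq_le measure_ge0 andbT (le_trans (measureU2 _ _ _)) //; first exact: measurableC.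
 have nO : mu (~` (Omega : set (R3 R))) = 0%E by change (volume R (~` (Omega : set (R3 R)) `&` (Omega : set (R3 R))) = 0%E); rewrite setICl measure0.
 by rewrite -[leRHS]addr0; apply: leeD; apply: le_of_eq; [exact: N0|exact: nO].
- by move=> x /= nE; apply: contrapT => /not_orP[nN /contrapT Ox]; apply: nE.
Qed.

Lemma coef_good (A : R3 R -> 'M[R]_3) m M : coefficient Omega A m M ->
  exists B E, [/\ 0 < B, measurable E /\ E `<=` (Omega : set (R3 R)), {ae mu, forall x, E x},
    (forall i j, measurable_fun E (fun x => A x i j)) &
    forall x, E x -> [/\ forall i j, `|A x i j| <= B, (A x)^T = A x &
      forall h, m * dotv h h <= dotv h (A x *m h) <= M * dotv h h]].
move=> [[mA [B hB]] hs hb].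
have [E [mE EO EP aeE]] := ae_subset (filterI hB (filterI hs hb)).
exists (Num.max B 1), E; split => //.
- by rewrite lt_max ltr01 orbT.
- by move=> i j; apply: measurable_funS (mA i j) => //; exact: open_measurable_R3 (domain_open Omega).
- move=> x /EP[h1 [h2 h3]]; split => //; last exact: quad_bounds. by move=> i j; rewrite le_max h1.
Qed.

(** The coefficients are controlled only almost everywhere; cutting them off on a good set of full measure makes
them bounded and measurable everywhere. *)
Definition cutfield (E : set (R3 R)) (A : R3 R -> 'M[R]_3) (x : R3 R) : 'M[R]_3 := \1_E x *: A x.

Lemma cutfield_bmf E (A : R3 R -> 'M[R]_3) B : measurable E -> 0 <= B -> (forall i j, measurable_fun E (fun x => A x i j)) ->
  (forall x, E x -> forall i j, `|A x i j| <= B) -> bmf B (cutfield E A).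
move=> mE B0 mA hB; split.
- move=> i j; rewrite (_ : (fun _ => _) = (fun x => A x i j) \_ E); last first.
  apply/funext => x; rewrite /cutfield mxE indicE patchE. by case: (_ \in _); rewrite ?mul1r ?mul0r.
 exact: (measurable_restrictT (fun x => A x i j) mE).1 (mA i j).
- move=> x i j; rewrite /cutfield mxE indicE; case: (boolP (x \in E)) => [/set_mem h|_].
  by rewrite mul1r hB.
 by rewrite mul0r normr0.
Qed.

Lemma cutfieldE E A x : E x -> cutfield E A x = A x.
by move=> Ex; rewrite /cutfield indicE mem_set // scale1r. Qed.
Lemma measurable_det n (E : set (R3 R)) (A : R3 R -> 'M[R]_n) :
  (forall i j, measurable_fun E (fun x => A x i j)) -> measurable_fun E (fun x => \det (A x)).
move=> mA; rewrite /determinant; apply: measurable_sum => s.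
apply: measurable_funM; first exact: measurable_cst.
exact: measurable_prod.
Qed.

Lemma measurable_invmx (E : set (R3 R)) (A : R3 R -> 'M[R]_3) : measurable E ->
  (forall x, E x -> A x \in unitmx) ->
  (forall i j, measurable_fun E (fun x => A x i j)) -> forall i j, measurable_fun E (fun x => invmx (A x) i j).
move=> mE uA mA i j.
apply: (eq_measurable_fun (fun x => ((\det (A x)) * ((\det (A x) ^+ 2) `^ (-1))) * cofactor (A x) j i)).
 move=> x /set_mem Ex; have ne : \det (A x) != 0 by have := uA _ Ex; rewrite unitmxE unitfE.
 rewrite /invmx uA // !mxE powR_inv1 ?sqr_ge0 //. by move: (\det (A x)) (cofactor _ _ _) ne => a b a0; field.
have md := measurable_det mA.
apply: measurable_funM; first apply: measurable_funM => //.
 apply: (measurableT_comp (measurable_powR _)) => //.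
 by rewrite (_ : (fun x => _) = (fun x => \det (A x) * \det (A x))) //; exact: measurable_funM.
rewrite /cofactor; apply: measurable_funM; first exact: measurable_cst.
apply: measurable_det => k l; under eq_fun do rewrite !mxE; exact: mA.
Qed.
End OpmBounds.

Lemma is_derive_line {R : realType} {V : normedModType R} (f : V -> R) x v d :
  is_derive x v f d <-> is_derive (0 : R) (1 : R) (fun h => f (h *: v + x)) d.
have e : (fun h : R => h^-1 *: ((f \o shift x) (h *: v) - f x)) =
 (fun h : R => h^-1 *: (((fun h => f (h *: v + x)) \o shift 0) (h *: (1 : R)) - f (0 *: v + x))).
 by apply/funext => h /=; rewrite addr0 scale0r add0r scaler1.
split=> -[h1 h2]; split.
- by move: h1; rewrite /derivable e.
- by move: h2; rewrite /derive e.
- by rewrite /derivable e.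
- by rewrite /derive e.
Qed.

(** * Smooth functions *)
Section SmoothClass.
Context {R : realType} {V : normedModType R} (E : set V).
Implicit Types (f g : V -> R) (P : set (V -> R)).

(** Smoothness in the directions of [E] as membership in a class of continuous functions closed under
derivation: this coinductive form makes products and compositions accessible by exhibiting a class. *)
Definition smooth_class P := forall f, P f -> continuous f /\
  forall v, E v -> exists2 g, P g & forall x, is_derive x v f (g x).

Definition smooth f := exists2 P, smooth_class P & P f.

Lemma smooth_cts f : smooth f -> continuous f.
by case=> P hP /hP[]. Qed.
Lemma smooth_derive f v : smooth f -> E v ->
  exists2 g, smooth g & forall x, is_derive x v f (g x).
by case=> P hP /hP[_ h] /h[g Pg gf]; exists g => //; exists P. Qed.
Lemma is_derive_eqfun f g v : (forall x, is_derive x v f (g x)) -> (fun x => 'D_v f x) = g.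
by move=> h; apply/funext => x; apply: derive_val. Qed.
Lemma smooth_D f v : smooth f -> E v -> smooth (fun x => 'D_v f x).
by move=> hf /(smooth_derive hf)[g sg /is_derive_eqfun ->]. Qed.
Lemma smooth_der f v x : smooth f -> E v -> is_derive x v f ('D_v f x).
by move=> hf /(smooth_derive hf)[g sg h]; have [h1 _] := h x; split. Qed.

Inductive alg P : (V -> R) -> Prop :=
| alg_base f : P f -> alg P f
| alg_cst (c : R) : alg P (fun=> c)
| alg_add f g : alg P f -> alg P g -> alg P (fun x => f x + g x)
| alg_mul f g : alg P f -> alg P g -> alg P (fun x => f x * g x)
| alg_inv f : (forall x, f x != 0) -> alg P f -> alg P (fun x => (f x)^-1).

Lemma alg_smooth_gen P : (forall f, P f -> continuous f /\
    forall v, E v -> exists2 g, alg P g & forall x, is_derive x v f (g x)) -> smooth_class (alg P).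
move=> hP f; elim=> {f} [f /hP[cf df]|c|f g _ [cf df] _ [cg dg]|f g hf [cf df] hg [cg dg]|f f0 hf [cf df]].
- by split.
- split; first exact: cst_continuous.
 by move=> v _; exists (fun=> 0); [exact: alg_cst|move=> x; exact: is_derive_cst].
- split; first by move=> x; apply: continuousD; [exact: cf|exact: cg].
 move=> v Ev; have [f' Pf' hf'] := df v Ev; have [g' Pg' hg'] := dg v Ev.
 exists (fun x => f' x + g' x); first exact: alg_add. by move=> x; exact: is_deriveD.
- split; first by move=> x; apply: continuousM; [exact: cf|exact: cg].
 move=> v Ev; have [f' Pf' hf'] := df v Ev; have [g' Pg' hg'] := dg v Ev.
 exists (fun x => f x * g' x + g x * f' x); first by apply: alg_add; apply: alg_mul.
 by move=> x; have := is_deriveM (hf' x) (hg' x).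
- split; first by move=> x; apply: continuousV => //; exact: cf. move=> v Ev; have [f' Pf' hf'] := df v Ev.
 exists (fun x => -1 * ((f x)^-1 * (f x)^-1) * f' x).
  by apply: alg_mul => //; apply: alg_mul; [exact: alg_cst|apply: alg_mul; exact: alg_inv].
 move=> x; apply/is_derive_line. have hl := (is_derive_line _ _ _ _).1 (hf' x).
 have f00 : f (0 *: v + x) != 0 by exact: f0. have := is_deriveV f00 hl; rewrite scale0r add0r.
 by rewrite mulN1r -invfM -expr2.
Qed.

Lemma alg_smooth P : smooth_class P -> smooth_class (alg P).
move=> hP; apply: alg_smooth_gen => f /hP[cf df]; split => // v /df[g Pg h].
by exists g => //; exact: alg_base.
Qed.

Lemma smooth_classU P Q : smooth_class P -> smooth_class Q -> smooth_class (P `|` Q).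
move=> hP hQ f [/hP|/hQ][cf df]; split => // v /df[g Pg h]; exists g => //; [by left|by right].
Qed.

Lemma smoothD f g : smooth f -> smooth g -> smooth (fun x => f x + g x).
move=> [P hP Pf] [Q hQ Qg]; exists (alg (P `|` Q)); first exact/alg_smooth/smooth_classU.
by apply: alg_add; apply: alg_base; [left|right].
Qed.

Lemma smoothM f g : smooth f -> smooth g -> smooth (fun x => f x * g x).
move=> [P hP Pf] [Q hQ Qg]; exists (alg (P `|` Q)); first exact/alg_smooth/smooth_classU.
by apply: alg_mul; apply: alg_base; [left|right].
Qed.

Lemma smoothV f : (forall x, f x != 0) -> smooth f -> smooth (fun x => (f x)^-1).
move=> f0 [P hP Pf]; exists (alg P); first exact/alg_smooth.
by apply: alg_inv => //; apply: alg_base.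
Qed.

Lemma smooth_cst (c : R) : smooth (fun=> c).
by exists (alg set0); [apply: alg_smooth => f []|exact: alg_cst]. Qed.
Lemma smoothZ c f : smooth f -> smooth (fun x => c * f x).
by apply: smoothM; exact: smooth_cst. Qed.
Lemma smoothN f : smooth f -> smooth (fun x => - f x).
by move=> /(smoothZ (-1)); under eq_fun do rewrite mulN1r. Qed.
Lemma smoothB f g : smooth f -> smooth g -> smooth (fun x => f x - g x).
by move=> hf /smoothN; exact: smoothD. Qed.
Lemma smooth_sum (I : Type) (s : seq I) (F : I -> V -> R) : (forall i, smooth (F i)) ->
  smooth (fun x => \sum_(i <- s) F i x).
move=> h; elim: s => [|i s IH].
 by under eq_fun do rewrite big_nil; exact: smooth_cst.
by under eq_fun do rewrite big_cons; exact: smoothD.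
Qed.

Lemma smooth_DM f g v x : smooth f -> smooth g -> E v ->
  'D_v (fun x => f x * g x) x = f x * 'D_v g x + g x * 'D_v f x.
move=> hf hg Ev; have h1 := smooth_der x hf Ev; have h2 := smooth_der x hg Ev.
by have [_ ->] := is_deriveM h1 h2.
Qed.

Lemma smooth_DD f g v x : smooth f -> smooth g -> E v ->
  'D_v (fun x => f x + g x) x = 'D_v f x + 'D_v g x.
move=> hf hg Ev; have h1 := smooth_der x hf Ev; have h2 := smooth_der x hg Ev.
by have [_ ->] := is_deriveD h1 h2.
Qed.
End SmoothClass.

Lemma smooth_affine {R : realType} {V W : normedModType R} (E : set V) (F : set W)
    (l : V -> W) (f : W -> R) : smooth F f -> continuous l ->
  (forall v, E v -> exists c w, F w /\ forall x h, l (h *: v + x) = (h * c) *: w + l x) ->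
  smooth E (fun x => f (l x)).
move=> [P hP Pf] cl hl.
have key (g : W -> R) v : P g -> E v -> exists (c : R) g', P g' /\ forall x, is_derive x v (fun x => g (l x)) (c * g' (l x)).
 move=> Pg Ev; have [c [w [Fw hlv]]] := hl v Ev; have [_ /(_ w Fw)[g' Pg' dg]] := hP _ Pg.
 exists c, g'; split => // x; apply/is_derive_line.
 rewrite (_ : (fun h => g (l (h *: v + x))) = (fun k => g (k *: w + l x)) \o (fun h : R => h * c)); last first.
  by apply/funext => h /=; rewrite hlv.
 rewrite mulrC; apply: is_derive1_comp.
  by rewrite mul0r; exact: (is_derive_line _ _ _ _).1 (dg (l x)).
 have := is_deriveM (is_derive_id (0 : R) (1 : R)) (is_derive_cst c (0 : R) (1 : R)).
 by rewrite scaler0 add0r /GRing.scale /= mulr1.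
have cls : smooth_class E (fun h => exists c g, P g /\ h = fun x => c * g (l x)).
 move=> h [c [g [Pg ->]]]; split.
  move=> x; apply: continuousM; first exact: cst_continuous.
  apply: continuous_comp; [exact: cl|]; by have [cg _] := hP _ Pg; exact: cg.
 move=> v Ev; have [c' [g' [Pg' hg']]] := key g v Pg Ev.
 exists (fun x => (c * c') * g' (l x)); first by exists (c * c'), g'.
 move=> x; rewrite -mulrA; have := is_deriveZ c (hg' x). by [].
exists (fun h => exists c g, P g /\ h = fun x => c * g (l x)) => //.
by exists 1, f; split => //; apply/funext => x; rewrite mul1r.
Qed.

(** * A smooth step *)
Section Step.
Context {R : realType}.
Implicit Types t : R.

(** For positive [t] this is t^-n exp(-1/t); the family is closed under derivation, whence its smoothness at
zero. *)
Definition flat (n : nat) t := if 0 < t then t ^- n * expR (- t^-1) else 0.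

Lemma expR_flat m t : 0 < t -> expR (- t^-1) <= (m%:R * t) ^+ m.
move=> t0; case: m => [|m]; first by rewrite expr0 -expR0 ler_expR oppr_le0 invr_ge0 ltW.
set M := m.+1%:R; have M0 : 0 < M :> R by rewrite ltr0n.
have Mt0 : 0 < M * t by exact: mulr_gt0.
have h : (M * t)^-1 <= expR ((M * t)^-1) by rewrite (le_trans _ (expR_ge1Dx _)) // lerDr.
have e : expR (t^-1) = expR ((M * t)^-1) ^+ m.+1.
 by rewrite -expRM_natl invfM mulrA mulfV ?mul1r // gt_eqF.
rewrite expRN e -exprVn ler_pXn2r ?nnegrE ?invr_ge0 ?expR_ge0 ?(ltW Mt0) //.
by rewrite -[leRHS]invrK lef_pV2 ?posrE ?invr_gt0 ?expR_gt0.
Qed.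

Lemma flat_ge0 n t : 0 <= flat n t.
by rewrite /flat; case: ifP => // t0; rewrite mulr_ge0 ?expR_ge0 // invr_ge0 exprn_ge0 // ltW. Qed.
Lemma flat_le0 n t : t <= 0 -> flat n t = 0.
by rewrite /flat leNgt => /negbTE ->. Qed.
Lemma flat_gt0 n t : 0 < t -> 0 < flat n t.
by move=> t0; rewrite /flat t0 mulr_gt0 ?expR_gt0 // invr_gt0 exprn_gt0. Qed.
Lemma flat_small n t : 0 < t -> flat n t <= n.+2%:R ^+ n.+2 * t ^+ 2.
move=> t0; rewrite /flat t0 (le_trans (ler_wpM2l _ (expR_flat n.+2 t0))) ?invr_ge0 ?exprn_ge0 ?(ltW t0) //.
by rewrite exprMn -[X in _ * (_ * t ^+ X)](addn2 n) exprD mulrCA mulKf ?expf_neq0 ?gt_eqF.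
Qed.

Lemma flat_derive n t : is_derive t (1 : R) (flat n) (flat n.+2 t - n%:R * flat n.+1 t).
have [t0|t0|<-] := ltgtP 0 t.
- have e : \near t, (fun y : R => y ^+ n * expR (- y)) (t^-1) = flat n t.
  by near=> s; rewrite /flat ifT ?exprVn //; near: s; exact: lt_nbhsr.
 apply: near_eq_is_derive e _. have dV : is_derive t (1 : R) (fun t => t^-1) (- t ^- 2).
  have tn0 : id t != 0 by rewrite /= gt_eqF.
  by have := is_deriveV tn0 (is_derive_id t (1 : R)); rewrite /GRing.scale /= mulr1.
 pose y := t^-1. have dp : is_derive y (1 : R) (fun y => y ^+ n) (n%:R * y ^+ n.-1).
  case: n => [|n].
   rewrite mul0r (_ : (fun y => y ^+ 0) = cst 1); last by apply/funext => z; rewrite expr0. exact: is_derive_cst.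
  have := is_deriveX n.+1 (is_derive_id y (1 : R)).
  rewrite /GRing.scale /= mulr1 (_ : (id : R -> R) ^+ n.+1 = (fun y => y ^+ n.+1)) //.
  by apply/funext => z; rewrite exprfctE.
 have dN : is_derive y (1 : R) (fun y => expR (- y)) (expR (- y) * (- 1)).
  apply: (is_derive1_comp (is_derive_expR (- y))); exact: (is_deriveN (is_derive_id y (1 : R))).
 have := is_derive1_comp (is_deriveM dp dN) dV. suff -> : flat n.+2 t - n%:R * flat n.+1 t =
  (y ^+ n *: (expR (- y) * -1) + expR (- y) *: (n%:R * y ^+ n.-1)) * - t ^- 2 by [].
 rewrite /flat t0 /GRing.scale /= -!exprVn -/y. by clear dp; case: n => [|n] /=; rewrite ?exprS; ring.
- have e : \near t, (fun _ : R => 0) t = flat n t.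
  by near=> s; rewrite flat_le0 // ltW //; near: s; exact: lt_nbhsl.
 apply: near_eq_is_derive e _. by rewrite !flat_le0 ?(ltW t0) // mulr0 subr0; exact: is_derive_cst.
have h0 : (h^-1 *: ((flat n \o shift 0) (h *: (1 : R)) - flat n 0)) @[h --> 0^'] --> (0 : R).
 pose K : R := n.+2%:R ^+ n.+2; have K0 : 0 < K by rewrite exprn_gt0. apply/cvgr0Pnorm_le => e e0; near=> h.
 rewrite /= addr0 scaler1 (flat_le0 n (lexx 0)) subr0. have hn0 : h != 0 by near: h; exact: nbhs_dnbhs_neq.
 have hle : `|h| <= e / K by near: h; apply: dnbhs0_le; rewrite divr_gt0.
 have [hp|hn] := ltP 0 h; last by rewrite flat_le0 // scaler0 normr0 ltW.
 rewrite ger0_norm; last by rewrite mulr_ge0 ?flat_ge0 // invr_ge0 ltW.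
 rewrite /GRing.scale /= ler_pdivrMl // (le_trans (flat_small n hp)) // -/K. rewrite gtr0_norm // in hle.
 by rewrite expr2 mulrCA ler_pM2l // mulrC -ler_pdivlMr.
rewrite !flat_le0 // mulr0 subr0; split.
 by apply/cvg_ex; exists 0.
exact: cvg_lim h0.
Unshelve. all: by end_near.
Qed.

Lemma flat_smooth n : smooth [set (1 : R)] (flat n).
exists (alg [set flat k | k in setT]); last by apply: alg_base; exists n.
apply: alg_smooth_gen => f [k _ <-]; split.
 move=> x; apply: differentiable_continuous; apply/derivable1_diffP. by have [] := flat_derive k x.
move=> v ->; exists (fun t => flat k.+2 t + - k%:R * flat k.+1 t).
 apply: alg_add; first by apply: alg_base; exists k.+2.
 by apply: alg_mul; [exact: alg_cst|apply: alg_base; exists k.+1].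
by move=> x; have := flat_derive k x; rewrite mulNr.
Qed.

Definition step t := flat 0 t / (flat 0 t + flat 0 (1 - t)).

Lemma step_den t : 0 < flat 0 t + flat 0 (1 - t).
have [t0|t0] := leP t 0; first by rewrite ltr_wpDl ?flat_ge0 ?flat_gt0 // subr_gt0 (le_lt_trans t0).
by rewrite ltr_pwDl ?flat_ge0 ?flat_gt0.
Qed.

Lemma step_le0 t : t <= 0 -> step t = 0.
by move=> t0; rewrite /step flat_le0 // mul0r. Qed.
Lemma step_ge1 t : 1 <= t -> step t = 1.
move=> t1; have := step_den t; rewrite /step (flat_le0 _ (_ : 1 - t <= 0)) ?subr_le0 // addr0.
by move=> h; rewrite mulfV // gt_eqF.
Qed.

Lemma step_ge0 t : 0 <= step t.
by rewrite mulr_ge0 ?flat_ge0 // invr_ge0 ltW // step_den. Qed.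
Lemma step_le1 t : step t <= 1.
by rewrite ler_pdivrMr ?step_den // mul1r lerDl flat_ge0. Qed.
Lemma step_smooth : smooth [set (1 : R)] step.
apply: smoothM; first exact: flat_smooth.
apply: smoothV; first by move=> x; rewrite gt_eqF ?step_den.
apply: smoothD; first exact: flat_smooth.
apply: (@smooth_affine R R R [set 1] [set 1] (fun t => 1 - t) (flat 0)); first exact: flat_smooth.
 by move=> x; apply: continuousB; [exact: cst_continuous|exact: cvg_id].
move=> v ->; exists (-1), 1; split => // x h; rewrite /GRing.scale /=; ring.
Qed.
End Step.

(** * Coordinates, cubes and test functions *)
Section R3Basics.
Variable R : realType.
Implicit Types (x y c : R3 R) (f g : R3 R -> R) (i j : 'I_3).

Definition co i x : R := to_col x i 0.

Lemma coE x : [/\ co 0 x = x.1.1, co 1 x = x.1.2 & co 2%:R x = x.2].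
by split; rewrite /co mxE. Qed.
Lemma I3P (P : 'I_3 -> Prop) : P 0 -> P 1 -> P 2%:R -> forall i, P i.
move=> h0 h1 h2 [[|[|[|//]]] hi].
- by rewrite (_ : Ordinal hi = 0) //; exact: val_inj.
- by rewrite (_ : Ordinal hi = 1) //; exact: val_inj.
- by rewrite (_ : Ordinal hi = 2%:R) //; exact: val_inj.
Qed.

Lemma co_ext x y : (forall i, co i x = co i y) -> x = y.
move=> h; have [a1 a2 a3] := coE x; have [b1 b2 b3] := coE y.
have e1 := h 0; have e2 := h 1; have e3 := h 2%:R.
rewrite a1 b1 in e1; rewrite a2 b2 in e2; rewrite a3 b3 in e3.
by move: x y e1 e2 e3 {h a1 a2 a3 b1 b2 b3} => [[? ?] ?] [[? ?] ?] /= -> -> ->.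
Qed.

Lemma coD i x y : co i (x + y) = co i x + co i y.
by move: i; apply: I3P; rewrite /co !mxE. Qed.
Lemma coN i x : co i (- x) = - co i x.
by move: i; apply: I3P; rewrite /co !mxE. Qed.
Lemma coB i x y : co i (x - y) = co i x - co i y.
by rewrite coD coN. Qed.
Lemma co0 i : co i 0 = 0.
by rewrite -(subrr 0) coB subrr. Qed.
Lemma coZ i (h : R) x : co i (h *: x) = h * co i x.
by move: i; apply: I3P; rewrite /co !mxE. Qed.
Lemma co_unit i j : co i (unit_vec R j) = (i == j)%:R.
by move: i; apply: I3P; move: j; apply: I3P; rewrite /co mxE. Qed.
Lemma co_continuous i : continuous (co i).
move: i; apply: I3P.
- rewrite (_ : co 0 = (fun x => x.1.1)); last by apply/funext => x; have [] := coE x.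
 by move=> x; apply: (continuous_comp (g := fst)); exact: cvg_fst.
- rewrite (_ : co 1 = (fun x => x.1.2)); last by apply/funext => x; have [] := coE x.
 move=> x; apply: (continuous_comp (f := fst) (g := snd)); [exact: cvg_fst|exact: cvg_snd].
- rewrite (_ : co 2%:R = (fun x => x.2)); last by apply/funext => x; have [] := coE x. by move=> x; exact: cvg_snd.
Qed.

Definition vec3 (F : 'I_3 -> R) : R3 R := (F 0, F 1, F 2%:R).

Lemma co_vec3 F i : co i (vec3 F) = F i.
by move: i; apply: I3P; rewrite /co mxE. Qed.
Definition dirs : set (R3 R) := range (@unit_vec R).

Definition sm f := smooth dirs f.

Definition pd i f x : R := 'D_(unit_vec R i) f x.

Lemma dirsP i : dirs (unit_vec R i). by exists i. Qed.
Hint Resolve dirsP : core.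

Lemma sm_cts f : sm f -> continuous f. exact: smooth_cts. Qed.
Lemma sm_pd i f : sm f -> sm (pd i f). by move=> hf; exact: smooth_D. Qed.
Lemma pdM i f g x : sm f -> sm g -> pd i (fun x => f x * g x) x = f x * pd i g x + g x * pd i f x.
by move=> hf hg; exact: smooth_DM hf hg _. Qed.
Lemma pdD i f g x : sm f -> sm g -> pd i (fun x => f x + g x) x = pd i f x + pd i g x.
by move=> hf hg; exact: smooth_DD hf hg _. Qed.
Lemma sm_der i f x : sm f -> is_derive x (unit_vec R i) f (pd i f x).
by move=> hf; exact: (smooth_der x hf (dirsP i)). Qed.
Lemma pd_eq i f g x : is_derive x (unit_vec R i) f (g x) -> pd i f x = g x.
by case. Qed.
Lemma pdZ i a f x : sm f -> pd i (fun x => a * f x) x = a * pd i f x.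
move=> hf; rewrite (pdM _ _ (smooth_cst _ a) hf) (_ : pd i (fun=> a) x = 0) ?mulr0 ?addr0 //.
exact: pd_eq (is_derive_cst a x _).
Qed.

Lemma pd_cst i a x : pd i (fun=> a) x = 0.
exact: pd_eq (is_derive_cst a x _). Qed.
Lemma smCk f : sm f <-> forall n, Ck n f.
split=> [hf n|h].
 elim: n f hf => [|n IH] f hf /=; first exact: sm_cts. move=> i; split; first by move=> x; have [] := sm_der i x hf.
 by apply: IH; exact: sm_pd.
exists [set f | forall n, Ck n f] => // {h}f h; split; first exact: (h 0%N).
move=> _ [i _ <-]; exists (pd i f).
 by move=> n; have [_] := h n.+1 i.
by move=> x; have [d _] := h 1%N i; split => //; exact: d.
Qed.

Lemma sm_co i (f : R -> R) : smooth [set (1 : R)] f -> sm (fun x => f (co i x)).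
move=> hf; apply: (smooth_affine hf); first exact: co_continuous.
move=> _ [j _ <-]; exists (i == j)%:R, 1; split => // x h.
by rewrite coD coZ co_unit /GRing.scale /= mulr1.
Qed.

Lemma sm_refl f x : sm f -> sm (fun y => f (x - y)).
move=> hf; apply: (smooth_affine hf).
 by move=> y; apply: continuousB; [exact: cst_continuous|exact: cvg_id].
move=> _ [j _ <-]; exists (-1), (unit_vec R j); split => // y h.
by rewrite mulrN1 scaleNr opprD addrCA.
Qed.

Lemma pd_refl i f x y : sm f -> pd i (fun y => f (x - y)) y = - pd i f (x - y).
move=> hf; apply: (pd_eq (g := fun y => - pd i f (x - y))); apply/is_derive_line.
rewrite (_ : (fun h : R => f (x - (h *: unit_vec R i + y))) = (fun k : R => f (k *: unit_vec R i + (x - y))) \o (fun h : R => - h)); last first.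
 by apply/funext => h /=; rewrite scaleNr opprD addrCA.
have dN : is_derive (0 : R) (1 : R) (fun h : R => - h) (-1) := is_deriveN (is_derive_id (0 : R) (1 : R)).
rewrite -[- pd i f _]mulrN1; apply: (is_derive1_comp _ dN).
by rewrite oppr0; exact: ((is_derive_line _ _ _ _).1 (sm_der i (x - y) hf)).
Qed.

Definition cube c (h : R) : set (R3 R) := [set x | forall i, `|co i x - co i c| <= h].

Lemma cube_prod c h : cube c h = (([set t | `|t - c.1.1| <= h] `*` [set t | `|t - c.1.2| <= h]) `*` [set t | `|t - c.2| <= h]).
have [c1 c2 c3] := coE c; apply/seteqP; split => [x hx|x [[h1 h2] h3]].
 have [x1 x2 x3] := coE x; split; first split.
 - by have := hx 0; rewrite x1 c1.
 - by have := hx 1; rewrite x2 c2.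
 - by have := hx 2%:R; rewrite x3 c3.
have [x1 x2 x3] := coE x.
by apply: I3P; rewrite ?x1 ?x2 ?x3 ?c1 ?c2 ?c3.
Qed.

Lemma seg_cube (a h : R) : [set t | `|t - a| <= h] = `[a - h, a + h]%classic.
by apply/seteqP; split => t; rewrite /= in_itv /= ler_distl. Qed.
Lemma cube_compact c h : compact (cube c h).
rewrite cube_prod !seg_cube; apply: compact_setX; last exact: segment_compact.
by apply: compact_setX; exact: segment_compact.
Qed.

Lemma compact_cl (K : set (R3 R)) : compact K -> closed K.
by apply: compact_closed; exact: norm_hausdorff. Qed.
Lemma cube_closed c h : closed (cube c h).
by apply: compact_cl; exact: cube_compact. Qed.
Lemma norm_co x e : `|x| <= e <-> forall i, `|co i x| <= e.
have [x1 x2 x3] := coE x; rewrite /Num.norm /= !ge_max; split.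
 by move=> /andP[/andP[h1 h2] h3]; apply: I3P; rewrite ?x1 ?x2 ?x3.
by move=> h; have := h 0; have := h 1; have := h 2%:R; rewrite x1 x2 x3 => -> -> ->.
Qed.

Lemma cube_nbhs c h : 0 < h -> nbhs c (cube c h).
move=> h0; apply/nbhs_ballP; exists h => // y.
rewrite -ball_normE /= => /ltW; rewrite norm_co => hy i.
by rewrite -coB -normrN -coN opprB.
Qed.

Lemma nbhs_cube c A : nbhs c A -> exists2 h, 0 < h & cube c h `<=` A.
move=> /nbhs_ballP[e /= e0 eA]; exists (e / 2); first by rewrite divr_gt0.
move=> y hy; apply: eA; rewrite -ball_normE /=; apply: (@le_lt_trans _ _ (e / 2)); last by lra.
by rewrite norm_co => i; rewrite -normrN -coN opprB coB.
Qed.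

Lemma cube_bounded (K : set (R3 R)) : compact K -> exists2 h, 0 < h & K `<=` cube 0 h.
move=> /compact_bounded[M [_ hM]]; exists (Num.max 1 (M + 1)); first by rewrite lt_max ltr01.
move=> x Kx i; rewrite -coB subr0; move: i; apply/norm_co; apply: hM => //.
by rewrite lt_max ltrDl ltr01 orbT.
Qed.

Definition rtest (U : set (R3 R)) f := sm f /\ exists2 K, compact K /\ K `<=` U & forall x, ~ K x -> f x = 0.

Lemma supp_test (U K : set (R3 R)) (T : zmodType) (f : R3 R -> T) :
  compact K -> K `<=` U -> (forall x, ~ K x -> f x = 0) ->
  compact (closure [set x | f x != 0]) /\ closure [set x | f x != 0] `<=` U.
move=> cK KU fK.
have s : closure [set x | f x != 0] `<=` K.
 rewrite [X in _ `<=` X](_ : K = closure K); last by apply/closure_id; exact: compact_cl. apply: closureS.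
 by move=> x /= fx; apply: contrapT => /fK e; rewrite e eqxx in fx.
by split; [apply: (subclosed_compact _ cK s); exact: closed_closure|exact: subset_trans KU].
Qed.

Lemma test_funP (U : set (R3 R)) (phi : R3 R -> R[i]) :
  test_fun U phi <-> rtest U (fun x => complex.Re (phi x)) /\ rtest U (fun x => complex.Im (phi x)).
split=> [[h1 h2 h3 h4]|[[s1 [K1 [c1 u1] z1]] [s2 [K2 [c2 u2] z2]]]].
 have z x : ~ closure [set x | phi x != 0] x -> phi x = 0.
  by move=> nx; apply/eqP; apply: contrapT => /negP p; apply: nx; exact: subset_closure.
 by split; (split; first exact/smCk); exists (closure [set x | phi x != 0]) => // x /z ->.
have cK : compact (K1 `|` K2) by exact: compactU.
have [|x|a b] := @supp_test U (K1 `|` K2) _ phi cK.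
- by move=> x [/u1|/u2].
- move=> /not_orP[/z1 e1 /z2 e2]; case: (phi x) e1 e2 => a b /= -> ->; by [].
by split => //; exact/smCk.
Qed.

Lemma rtestW U U' f : U `<=` U' -> rtest U f -> rtest U' f.
by move=> UU [s [K [cK KU] z]]; split => //; exists K => //; split => //; exact: subset_trans UU. Qed.
Lemma rtestMr U f g : rtest U f -> sm g -> rtest U (fun x => f x * g x).
by move=> [s [K k z]] hg; split; [exact: smoothM|exists K => // x /z ->; rewrite mul0r].
Qed.

Lemma rtestMl U f g : sm g -> rtest U f -> rtest U (fun x => g x * f x).
by move=> hg hf; under eq_fun do rewrite mulrC; exact: rtestMr. Qed.
Lemma rtestD U f g : rtest U f -> rtest U g -> rtest U (fun x => f x + g x).
move=> [s [K [cK KU] z]] [s' [K' [cK' KU'] z']]; split; first exact: smoothD.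
exists (K `|` K'); first by split; [exact: compactU|move=> x [/KU|/KU']].
by move=> x /not_orP[/z -> /z' ->]; rewrite addr0.
Qed.

Lemma pd_out i f K x : closed K -> (forall x, ~ K x -> f x = 0) -> ~ K x -> pd i f x = 0.
move=> cK z nK; rewrite -(pd_cst i 0 x); apply: near_eq_derive.
have : nbhs x (~` K) by apply: open_nbhs_nbhs; split => //; exact: closed_openC.
by apply: filterS => y /z.
Qed.

Lemma rtest_pd U i f : rtest U f -> rtest U (pd i f).
move=> [s [K [cK KU] z]]; split; first exact: sm_pd.
by exists K => // x; apply: pd_out => //; exact: compact_cl.
Qed.

Lemma rtest_refl f x : rtest setT f -> rtest setT (fun y => f (x - y)).
move=> [s [K [cK _] z]]; have [h h0 Kh] := cube_bounded cK.
split; first exact: sm_refl.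
exists (cube x h); first by split => //; exact: cube_compact.
move=> y ny; apply: z => /Kh k; apply: ny => i.
by have := k i; rewrite co0 subr0 coB distrC.
Qed.
End R3Basics.
#[export] Hint Resolve dirsP : core.

(** * Integrals over the domain and over space *)
Section Restriction.
Context d (T : measurableType d) (R : realType) (m : {measure set T -> \bar R}).
Variables (D : set T) (mD : measurable D).
Implicit Types (f g : T -> R).

Lemma int_mrestr_ge0 f : mfT f -> (forall x, 0 <= f x) ->
  (forall x, ~ D x -> f x = 0) ->
  (\int[mrestr m mD]_x (f x)%:E = \int[m]_x (f x)%:E)%E.
move=> mf f0 fO.
have mOc : measurable (~` D) by exact: measurableC.
have mEf : mfT (EFin \o f) by exact/measurable_EFinP.
have e : (\int[measure_add (mrestr m mD) (mrestr m mOc)]_x (f x)%:E = \int[m]_x (f x)%:E)%E.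
 apply: eq_measure_integral => A mA _; rewrite /measure_add /= /msum !big_ord_recl big_ord0 adde0 /=.
 rewrite /mrestr -measureU; [|exact: measurableI|exact: measurableI|]; last first.
  by rewrite setIACA setICr setI0.
 by rewrite -setIUr setUv setIT.
rewrite -e ge0_integral_measure_add //.
rewrite [X in (_ + X)%E](_ : _ = 0)%E ?adde0 //.
rewrite -[RHS](@integral0 _ _ _ (mrestr m mOc) setT).
apply: ae_eq_integral => //.
exists D; split => //; first by change (m (D `&` ~` D) = 0%E); rewrite setICr measure0.
 by move=> x /= h; apply: contrapT => nO; apply: h => _; rewrite /= fO.
by move=> x _; rewrite lee_fin.
Qed.

Lemma itg_mrestr f : itg m f -> (forall x, ~ D x -> f x = 0) -> itg (mrestr m mD) f.
move=> /[dup] /itg_mf mf hf fO; apply/integrableP; split; first exact/measurable_EFinP.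
have /integrableP[_] := hf; apply: le_lt_trans; apply: le_of_eq.
apply: (int_mrestr_ge0 (f := fun x => `|f x|)) => //; first exact: measurableT_comp.
by move=> x /fO ->; rewrite normr0.
Qed.

Lemma int_mrestr f : itg m f -> (forall x, ~ D x -> f x = 0) ->
  \int[mrestr m mD]_x f x = \int[m]_x f x.
move=> hf fO; have mf := itg_mf hf.
have pos g : itg m g -> (forall x, 0 <= g x) -> (forall x, ~ D x -> g x = 0) ->
  \int[mrestr m mD]_x g x = \int[m]_x g x.
 by move=> hg g0 gO; rewrite /Rintegral int_mrestr_ge0 //; exact: itg_mf hg.
pose p x := (`|f x| + f x); pose n x := `|f x|.
have hn : itg m n by exact: itg_norm.
have hp : itg m p by exact: itgD.
have e : f = (fun x => p x - n x) by apply/funext => x; rewrite /p /n addrAC subrr add0r.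
have pO x : ~ D x -> p x = 0 by move=> /fO; rewrite /p => ->; rewrite normr0 addr0.
have nO x : ~ D x -> n x = 0 by move=> /fO; rewrite /n => ->; rewrite normr0.
have p0 x : 0 <= p x by rewrite /p -lerBlDr sub0r -normrN ler_norm.
have n0 x : 0 <= n x by rewrite /n.
rewrite e (intB hp hn) (intB (itg_mrestr hp pO) (itg_mrestr hn nO)).
by rewrite (pos p hp p0 pO) (pos n hn n0 nO).
Qed.
End Restriction.

Lemma sfinite_pack d (T : measurableType d) (R : realType) (m : {measure set T -> \bar R}) :
  sigma_finite setT m -> exists sm : {sigma_finite_measure set T -> \bar R}, (sm : {measure set T -> \bar R}) = m.
move=> h.
pose sm : {sigma_finite_measure set T -> \bar R} :=
 HB.pack (Measure.sort m) (Measure.class m) (@isSFinite.Build _ _ _ m (sfinite_measure_sigma_finite h)) (@isSigmaFinite.Build _ _ _ m h).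
exists sm; rewrite {}/sm; move: h; case: m => f [a b] h //=.
Qed.

Section Measure.
Variables (R : realType) (Omega : domain R).
Notation mu := (vol Omega).
Notation lam := (@lebesgue_measure R).
Notation vol3 := (volume R).
Implicit Types (f g : R3 R -> R).

Let mO : measurable (Omega : set (R3 R)) := open_measurable_R3 (domain_open Omega).

Lemma cube_meas (c : R3 R) h : measurable (cube c h).
rewrite cube_prod !seg_cube; apply: measurableX; last exact: measurable_itv.
by apply: measurableX; exact: measurable_itv.
Qed.

Lemma seg_measure (a h : R) : 0 <= h -> lam [set t | `|t - a| <= h] = (2 * h)%:E.
move=> h0; rewrite seg_cube lebesgue_measure_itv /= lte_fin.
have [lt|] := ltP (a - h) (a + h); first by rewrite -EFinB; congr (_%:E); ring.
move=> le; have -> : h = 0 by lra.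
by rewrite mulr0.
Qed.

Lemma volume_cube (c : R3 R) h : 0 <= h -> vol3 (cube c h) = ((2 * h) ^+ 3)%:E.
move=> h0; rewrite cube_prod.
have ms a : measurable [set t : R | `|t - a| <= h] by rewrite seg_cube; exact: measurable_itv.
rewrite [LHS](product_measure1E (lam \x lam)%E lam (measurableX (ms _) (ms _)) (ms _)).
apply: (etrans (congr1 (fun z => (z * lam _)%E) (product_measure1E lam lam (ms _) (ms _)))).
transitivity (((2 * h) * (2 * h) * (2 * h))%:E); last by congr (_%:E); ring.
rewrite [RHS](EFinM _ (2 * h)) EFinM; congr (_ * _ * _)%E; exact: seg_measure.
Qed.

Lemma vol_le (A : set (R3 R)) : measurable A -> (mu A <= vol3 A)%E.
move=> mA; rewrite /vol /mrestr /=; apply: le_measure; rewrite ?inE //.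
exact: measurableI.
Qed.

Lemma vol_cube (c : R3 R) h : 0 <= h -> (mu (cube c h) <= ((2 * h) ^+ 3)%:E)%E.
by move=> h0; rewrite -(volume_cube c h0); apply: vol_le; exact: cube_meas. Qed.
Lemma vol_sigma_finite : sigma_finite setT mu.
exists (fun n => cube 0 n%:R).
 apply/seteqP; split => // x _; exists (Num.truncn (`|x|)).+1 => // i. rewrite -coB subr0; move: i; apply/norm_co.
 by rewrite ltW // truncnS_gt.
move=> n; split; first exact: cube_meas.
by rewrite (le_lt_trans (vol_cube _ _)) ?ltry.
Qed.

Lemma cont_mf f : continuous f -> mfT f.
move=> cf; apply: (measurability _ (RGenOpens.measurableE R)) => _ [_ [a [b ->]] <-].
rewrite setTI; apply: open_measurable_R3.
by move/continuousP : cf; apply; exact: interval_open.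
Qed.

Lemma sm_mf f : sm f -> mfT f.
by move=> /sm_cts; exact: cont_mf. Qed.
Lemma int_vol f : itg vol3 f -> (forall x, ~ (Omega : set (R3 R)) x -> f x = 0) ->
  \int[mu]_x f x = \int[vol3]_x f x.
exact: int_mrestr. Qed.
Lemma cube_itg (nu : {measure set (R3 R) -> \bar R}) c h f : (forall A, measurable A -> (nu A <= vol3 A)%E) ->
  continuous f -> (forall x, ~ cube c h x -> f x = 0) -> l2 nu f /\ itg nu f.
move=> le cf f0; have cK := @cube_compact R c h.
have [M [_ hM]] : bounded_set (f @` cube c h).
 by apply: compact_bounded; apply: continuous_compact => //; exact: continuous_subspaceT.
apply: (@l2_bounded _ _ _ nu (cube c h) f (`|M| + 1)) => //.
- exact: cube_meas.
- apply: le_lt_trans (le _ (cube_meas c h)) _. have [h0|h0] := leP 0 h; first by rewrite volume_cube // ltry.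
 rewrite (_ : cube c h = set0) ?measure0 ?ltry //. apply/seteqP; split => // x /(_ 0); rewrite leNgt => /negP; apply.
 by rewrite (lt_le_trans h0).
- exact: cont_mf.
- move=> x; have [kx|nk] := pselect (cube c h x); last by rewrite f0 // normr0.
 by apply: hM; [rewrite (le_lt_trans (ler_norm _)) // ltrDl|exists x].
Qed.
End Measure.

(** * Integration by parts *)
Section Fubini.
Variable R : realType.
Context d1 d2 (T1 : measurableType d1) (T2 : measurableType d2)
    (m1 : {measure set T1 -> \bar R}) (m2 : {sigma_finite_measure set T2 -> \bar R}).
Hypothesis s1 : sigma_finite setT m1.

Lemma fubini_vanish1 (f : T1 * T2 -> R) : itg (m1 \x m2)%E f -> (forall x, itg m2 (fun y => f (x, y))) ->
  (forall x, \int[m2]_y f (x, y) = 0) -> \int[(m1 \x m2)%E]_z f z = 0.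
have [sm e] := sfinite_pack s1; subst m1.
move=> hf hi h; rewrite /Rintegral -(integral12_prod_meas1 hf) integral0_eq // => x _.
by rewrite /fubini_F /= (int_fin (hi x)) h.
Qed.

Lemma fubini_vanish2 (f : T1 * T2 -> R) : itg (m1 \x m2)%E f -> (forall y, itg m1 (fun x => f (x, y))) ->
  (forall y, \int[m1]_x f (x, y) = 0) -> \int[(m1 \x m2)%E]_z f z = 0.
have [sm e] := sfinite_pack s1; subst m1.
move=> hf hi h; rewrite /Rintegral -(integral21_prod_meas1 hf) integral0_eq // => x _.
by rewrite /fubini_G /= (int_fin (hi x)) h.
Qed.

Lemma itg_prod (f : T1 -> R) (g : T2 -> R) : itg m1 f -> itg m2 g ->
  itg (m1 \x m2)%E (fun p => f p.1 * g p.2).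
have [sm e] := sfinite_pack s1; subst m1.
move=> hf hg.
have mfg : mfT (fun p : T1 * T2 => f p.1 * g p.2).
 apply: measurable_funM; first exact: (measurableT_comp (itg_mf hf) measurable_fst).
 exact: (measurableT_comp (itg_mf hg) measurable_snd).
apply/integrable12ltyP; first exact/measurable_EFinP.
rewrite (eq_integral (fun x => (`|f x| * \int[m2]_y `|g y|)%:E)).
 rewrite (int_fin (f := fun x => `|f x| * \int[m2]_y `|g y|)) ?ltry //. under [X in itg _ X]eq_fun do rewrite mulrC.
 by apply: itgZ; exact: itg_norm.
move=> x _; rewrite EFinM -(int_fin (itg_norm hg)) -ge0_integralZl //.
- by apply: eq_integral => y _ /=; rewrite normrM EFinM.
- by apply/measurable_EFinP; apply: (itg_mf (itg_norm hg)).
Qed.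

Lemma int_prod1 (f : T1 -> R) (g : T2 -> R) : itg m1 f -> itg m2 g -> \int[m2]_y g y = 1 ->
  \int[(m1 \x m2)%E]_z (f z.1 * g z.2) = \int[m1]_x f x.
move=> hf hg g1; have hfg := itg_prod hf hg; move: hfg.
have [sm e] := sfinite_pack s1; subst m1 => hfg.
rewrite /Rintegral -(integral12_prod_meas1 hfg); congr fine; apply: eq_integral => x _.
by rewrite /fubini_F /= (int_fin (itgZ (f x) hg)) intZ // g1 mulr1.
Qed.
End Fubini.

Section IBP.
Variable R : realType.
Notation lam := (@lebesgue_measure R).

Lemma int_derive_diff (f g : R -> R) (h : R) : 0 < h -> (forall x : R, is_derive x (1 : R) f (g x)) -> continuous g ->
  (forall x, h <= `|x| -> g x = 0) ->
  itg lam g /\ \int[lam]_x g x = f h - f (- h).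
move=> h0 dfg cg g0.
have cf : continuous f.
 by move=> x; apply: differentiable_continuous; apply/derivable1_diffP; have [] := dfg x.
have e : (\int[lam]_(x in `[(- h)%R, h]) (g x)%:E = (f h - f (- h))%:E)%E.
 have hh : - h < h by rewrite gtrN. rewrite (@continuous_FTC2 _ g f (- h) h hh).
 - by rewrite EFinB.
 - exact: continuous_subspaceT.
 - split; first by move=> x _; have [] := dfg x.
  + by apply: cvg_at_right_filter; exact: cf.
  + by apply: cvg_at_left_filter; exact: cf.
 - by move=> x _; rewrite derive1E; have [_ ->] := dfg x.
have ms : measurable `[- h, h]%classic by exact: measurable_itv.
have patch : EFin \o g = ((EFin \o g) \_ `[- h, h]).
 apply/funext => x; rewrite patchE; case: ifPn => // /negP nx.
 rewrite /= g0 //; rewrite leNgt; apply/negP => lt; apply: nx; rewrite inE /= in_itv /=. by rewrite -ler_norml ltW.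
have i : lam.-integrable `[- h, h] (EFin \o g).
 apply: continuous_compact_integrable; first exact: segment_compact. exact: continuous_subspaceT.
split; first by rewrite /itg patch -integrable_mkcond.
by rewrite /Rintegral (_ : (fun x => (g x)%:E) = EFin \o g) // patch -integral_mkcond e.
Qed.

Lemma int_derive (f g : R -> R) (h : R) : 0 < h -> (forall x : R, is_derive x (1 : R) f (g x)) -> continuous g ->
  (forall x, h <= `|x| -> f x = 0) -> (forall x, h <= `|x| -> g x = 0) ->
  itg lam g /\ \int[lam]_x g x = 0.
move=> h0 dfg cg f0 g0; have [i ->] := int_derive_diff h0 dfg cg g0.
by split => //; rewrite !f0 ?subrr ?normrN ?ger0_norm // ltW.
Qed.
End IBP.

Section Divergence.
Variables (R : realType).
Notation lam := (@lebesgue_measure R).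
Notation vol3 := (volume R).
Notation lam2 := (lam \x lam)%E.
Implicit Types (f g : R3 R -> R).

Lemma is_derive_shift (f : R -> R) (z d : R) :
  is_derive z (1 : R) f d <-> is_derive (0 : R) (1 : R) (fun h => f (h + z)) d.
rewrite is_derive_line.
by rewrite (_ : (fun h : R => f (h *: (1 : R) + z)) = (fun h => f (h + z))) //; apply/funext => h; rewrite scaler1.
Qed.

Lemma vanish_bounded f h : continuous f -> (forall x, ~ cube 0 h x -> f x = 0) ->
  exists M, forall x, `|f x| <= M.
move=> cf f0; have cK := @cube_compact R 0 h.
have [M [_ hM]] : bounded_set (f @` cube 0 h).
 by apply: compact_bounded; apply: continuous_compact => //; exact: continuous_subspaceT.
exists (`|M| + 1) => x; have [kx|nk] := pselect (cube 0 h x); last by rewrite f0 // normr0.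
by apply: hM; [rewrite (le_lt_trans (ler_norm _)) // ltrDl|exists x].
Qed.

Lemma cube0P h (x : R3 R) : cube 0 h x <-> [/\ `|x.1.1| <= h, `|x.1.2| <= h & `|x.2| <= h].
by rewrite cube_prod /=; split=> [[[]]|[? ? ?]]; rewrite !subr0.
Qed.

Definition axis_line i (t : R -> R3 R) := forall h s j, co j (t (h + s)) = h * (j == i)%:R + co j (t s).

Lemma axis_line_derive i f t s : sm f -> axis_line i t -> is_derive s (1 : R) (fun s => f (t s)) (pd i f (t s)).
move=> sf ht; apply/is_derive_shift; have := (is_derive_line _ _ _ _).1 (sm_der i (t s) sf).
rewrite (_ : (fun h : R => f (h *: unit_vec R i + t s)) = (fun h => f (t (h + s)))) //.
by apply/funext => h; congr f; apply: co_ext => j; rewrite coD coZ co_unit ht eq_sym.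
Qed.

Lemma axis_line_int i f t h : 0 < h -> sm f -> (forall x, ~ cube 0 h x -> f x = 0) ->
  axis_line i t -> itg lam (fun s => pd i f (t s)) /\ \int[lam]_s pd i f (t s) = 0.
move=> h0 sf f0 ht.
have g0 x : ~ cube 0 h x -> pd i f x = 0 by apply: pd_out => //; exact: cube_closed.
pose h1 := h + 1 + `|co i (t 0)|.
have far s : h1 <= `|s| -> ~ cube 0 h (t s).
 move=> hs /(_ i); rewrite -[s]addr0 ht eqxx mulr1 co0 subr0 => le.
 have := ler_normB (s + co i (t 0)) (co i (t 0)); rewrite addrK. by move: hs; rewrite /h1; lra.
apply: (@int_derive _ (fun s => f (t s)) _ h1).
- by rewrite /h1 ltr_wpDr // addr_gt0.
- by move=> s; exact: axis_line_derive.
- move=> s; apply: differentiable_continuous; apply/derivable1_diffP.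
 by have [] := axis_line_derive s (sm_pd i sf) ht.
- by move=> s /far; exact: f0.
- by move=> s /far; exact: g0.
Qed.

Lemma axis_line2 a b : axis_line 2%:R (fun z => (a, b, z)).
by move=> h s; apply: I3P; rewrite /co !mxE /= ?mulr0 ?add0r ?mulr1. Qed.
Lemma axis_line1 a z : axis_line 1 (fun b => (a, b, z)).
by move=> h s; apply: I3P; rewrite /co !mxE /= ?mulr0 ?add0r ?mulr1. Qed.
Lemma axis_line0 b z : axis_line 0 (fun a => (a, b, z)).
by move=> h s; apply: I3P; rewrite /co !mxE /= ?mulr0 ?add0r ?mulr1. Qed.
Lemma section_itg g h M : 0 <= h -> mfT g -> (forall x, `|g x| <= M) ->
  (forall x, ~ cube 0 h x -> g x = 0) -> forall z, itg lam2 (fun p => g (p, z)).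
move=> h0 mg gM g0 z.
pose S := [set t : R | `|t - 0| <= h].
have mS : measurable S by rewrite /S seg_cube; exact: measurable_itv.
apply: (@l2_bounded _ _ _ lam2 (S `*` S) _ M _ _ _ _ _).2.
- exact: measurableX.
- have e := product_measure1E lam lam mS mS; have e1 : lam S = (2 * h)%:E := seg_measure 0 h0.
 have e2 : (lam S * lam S = (2 * h)%:E * (2 * h)%:E)%E by congr (_ * _)%E; exact: e1.
 apply: (@le_lt_trans _ _ (lam S * lam S)%E); last by rewrite e2 -EFinM ltry. by apply: le_of_eq; exact: e.
- exact: measurable_fun_pair1.
- by move=> p; exact: gM.
- move=> p np; apply: g0 => /cube0P[a b _]; apply: np; split; by rewrite /S /= subr0.
Qed.

Lemma lam2_sigma_finite : sigma_finite setT lam2.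
pose S n := [set t : R | `|t - 0| <= n%:R].
have mS n : measurable (S n) by rewrite /S seg_cube; exact: measurable_itv.
exists (fun n => S n `*` S n).
 apply/seteqP; split => // [[x y]] _. exists (Num.truncn (Num.max `|x| `|y|)).+1 => //; rewrite /S /setX /= !subr0.
 have h := truncnS_gt (Num.max `|x| `|y|). by split; rewrite ltW // (le_lt_trans _ h) // le_max lexx ?orbT.
move=> n; split; first exact: (measurableX (mS n) (mS n)).
have e := product_measure1E lam lam (mS n) (mS n); have e1 : lam (S n) = (2 * n%:R)%:E := seg_measure 0 (ler0n _ _).
have e2 : (lam (S n) * lam (S n) = (2 * n%:R)%:E * (2 * n%:R)%:E)%E by congr (_ * _)%E; exact: e1.
apply: (@le_lt_trans _ _ (lam (S n) * lam (S n))%E); last by rewrite e2 -EFinM ltry.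
by apply: le_of_eq; exact: e.
Qed.

Lemma int_pd_volume f i h : 0 < h -> sm f -> (forall x, ~ cube 0 h x -> f x = 0) ->
  \int[vol3]_x pd i f x = 0.
move=> h0 sf f0.
have cg : continuous (pd i f) by apply: sm_cts; exact: sm_pd.
have g0 x : ~ cube 0 h x -> pd i f x = 0 by apply: pd_out => //; exact: cube_closed.
have [M gM] := vanish_bounded cg g0.
have mg := cont_mf cg.
have ig : itg vol3 (pd i f) by have [] := @cube_itg R vol3 0 h (pd i f) (fun A _ => lexx _) cg g0.
have i2 := section_itg (ltW h0) mg gM g0.
have sf2 := lam2_sigma_finite.
have sf1 : sigma_finite setT (lam : {measure set (measurableTypeR R) -> \bar R}) by exact: sigma_finiteT.
have line := fun t => @axis_line_int i f t h h0 sf f0.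
have [e|e|e] : [\/ i = 2%:R, i = 1 | i = 0].
 by move: (i); apply: I3P; [exact: Or33|exact: Or32|exact: Or31].
- subst i; have H := fubini_vanish1 (m2 := lam) sf2 ig.
 have h1 : forall x, itg lam (fun y => pd 2%:R f (x, y)) by move=> [a b]; have [] := line _ (axis_line2 a b).
 have h2 : forall x, \int[lam]_y pd 2%:R f (x, y) = 0 by move=> [a b]; have [] := line _ (axis_line2 a b).
 exact (H h1 h2).
- subst i; have H := fubini_vanish2 (m2 := lam) sf2 ig i2.
 suff h2 : forall z, \int[lam2]_x pd 1 f (x, z) = 0 by exact (H h2).
 move=> z; have H' := fubini_vanish1 (m2 := lam) sf1 (i2 z).
 have h1 : forall x, itg lam (fun y => pd 1 f (x, y, z)) by move=> a; have [] := line _ (axis_line1 a z).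
 have h2 : forall x, \int[lam]_y pd 1 f (x, y, z) = 0 by move=> a; have [] := line _ (axis_line1 a z).
 exact (H' h1 h2).
subst i; have H := fubini_vanish2 (m2 := lam) sf2 ig i2.
suff h2 : forall z, \int[lam2]_x pd 0 f (x, z) = 0 by exact (H h2).
move=> z; have H' := fubini_vanish2 (m2 := lam) sf1 (i2 z).
have h1 : forall y, itg lam (fun x => pd 0 f (x, y, z)) by move=> b; have [] := line _ (axis_line0 b z).
have h2 : forall y, \int[lam]_x pd 0 f (x, y, z) = 0 by move=> b; have [] := line _ (axis_line0 b z).
exact (H' h1 h2).
Qed.
End Divergence.

(** * Convolution with test functions *)
Section TestIntegrals.
Variables (R : realType) (Omega : domain R).
Notation mu := (vol Omega).
Implicit Types (f g k w : R3 R -> R).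

Lemma rtest_cube U f : rtest U f -> exists2 h, 0 < h & forall x, ~ cube 0 h x -> f x = 0.
by move=> [_ [K [cK _] z]]; have [h h0 Kh] := cube_bounded cK; exists h => // x nx; apply: z => /Kh.
Qed.

Lemma rtest_itg U f : rtest U f -> l2 mu f /\ itg mu f.
move=> hf; have [h h0 z] := rtest_cube hf; apply: (@cube_itg _ mu 0 h) => //.
 exact: vol_le.
by apply: sm_cts; case: hf.
Qed.

Lemma rtest_bd U f : rtest U f -> exists2 M, 0 < M & forall x, `|f x| <= M.
move=> hf; have [h h0 z] := rtest_cube hf; have [s _] := hf.
have [M hM] := vanish_bounded (sm_cts s) z.
exists (`|M| + 1); first by rewrite ltr_wpDl.
by move=> x; rewrite (le_trans (hM x)) // (le_trans (ler_norm M)) // lerDl.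
Qed.

Lemma rtest_out U f x : rtest U f -> ~ U x -> f x = 0.
by move=> [_ [K [_ KU] z]] nU; apply: z => /KU. Qed.
Lemma int_pd i f : rtest Omega f -> \int[mu]_x pd i f x = 0.
move=> hf; have [h h0 z] := rtest_cube hf; have [s _] := hf.
have hd := rtest_pd i hf; have [h' h0' z'] := rtest_cube hd; have [s' _] := hd.
rewrite int_vol; first exact: int_pd_volume h0 s z.
- apply: (@cube_itg _ (volume R) 0 h' (pd i f) _ _ _).2 => //; exact: sm_cts.
- by move=> x; exact: rtest_out.
Qed.

Lemma line_mvt i f t (a b : R) M : sm f -> axis_line i t -> (forall x, `|pd i f x| <= M) ->
  `|f (t a) - f (t b)| <= M * `|a - b|.
move=> sf ht hM.
have key (a' b' : R) : a' <= b' -> `|f (t b') - f (t a')| <= M * `|b' - a'|.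
 move=> le; have d s := axis_line_derive s sf ht. have cs : {within `[a', b'], continuous (fun s => f (t s))}.
  apply: continuous_subspaceT => s. by apply: differentiable_continuous; apply/derivable1_diffP; have [] := d s.
 have [c _ ->] := @MVT_segment _ (fun s => f (t s)) (fun s => pd i f (t s)) a' b' le (fun s _ => d s) cs.
 by rewrite normrM ler_wpM2r.
by have [/key|/ltW/key] := leP b a; rewrite ?(distrC b) ?(distrC (f (t b))).
Qed.

Lemma sm_lipschitz U f : rtest U f -> exists2 L, 0 < L & forall x y s, (forall i, `|co i x - co i y| <= s) ->
  `|f x - f y| <= L * s.
move=> hf; have /choice[M hM] : forall i, exists M, 0 < M /\ forall x, `|pd i f x| <= M.
 by move=> i; have [M M0 h] := rtest_bd (rtest_pd i hf); exists M.
have [sf _] := hf; have M0 i : 0 < M i by case: (hM i).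
exists (M 0 + M 1 + M 2%:R); first by rewrite !addr_gt0.
move=> x y s h; case: x y h => [[x0 x1] x2] [[y0 y1] y2] h.
have h0 := h 0; have h1 := h 1; have h2 := h 2%:R; rewrite /co !mxE /= in h0 h1 h2.
have e0 := line_mvt x0 y0 sf (axis_line0 x1 x2) (hM 0).2.
have e1 := line_mvt x1 y1 sf (axis_line1 y0 x2) (hM 1).2.
have e2 := line_mvt x2 y2 sf (axis_line2 y0 y1) (hM 2%:R).2.
have m0 := ler_wpM2l (ltW (M0 0)) h0.
have m1 := ler_wpM2l (ltW (M0 1)) h1.
have m2 := ler_wpM2l (ltW (M0 2%:R)) h2.
rewrite !mulrDl (le_trans (ler_distD (f (y0, y1, x2)) _ _)) // lerD //; last exact: le_trans e2 m2.
rewrite (le_trans (ler_distD (f (y0, x1, x2)) _ _)) // lerD //; [exact: le_trans e0 m0|exact: le_trans e1 m1].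
Qed.

Definition conv k f x := \int[mu]_y (k (x - y) * f y).

Lemma conv_itg U k f x : rtest U k -> l2 mu f -> itg mu (fun y => k (x - y) * f y).
move=> /(rtestW (@subsetT _ _))/(rtest_refl x)/rtest_itg[h _]; exact: l2_mul.
Qed.

Lemma cube_ind_l2 c h : l2 mu (\1_(cube c h)).
have [h0|h0] := leP 0 h; last first.
 rewrite (_ : \1_(cube c h) = (fun=> 0)); first exact: l20. apply/funext => x; rewrite indicE memNset // => /(_ 0) a.
 by have := le_lt_trans (normr_ge0 _) (le_lt_trans a h0); rewrite ltxx.
apply: (@l2_bounded _ _ _ mu (cube c h) _ 1 _ _ _ _ _).1.
- exact: cube_meas.
- by apply: le_lt_trans (vol_cube Omega c h0) _; rewrite ltry.
- by apply: measurable_indic; exact: cube_meas.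
- by move=> x; rewrite indicE; case: (_ \in _); rewrite ?normr1 ?normr0.
- by move=> x nx; rewrite indicE memNset.
Qed.

Lemma conv_lip U k f x : rtest U k -> l2 mu f -> exists2 L, 0 < L &
  forall y s, s <= 1 -> (forall i, `|co i x - co i y| <= s) -> `|conv k f x - conv k f y| <= L * s.
move=> hk hf; have [L L0 hL] := sm_lipschitz hk; have [h h0 z] := rtest_cube hk.
pose c := cube x (h + 1).
have ic : itg mu (fun y => \1_c y * `|f y|).
 apply: l2_mul; first exact: cube_ind_l2. have [mf i] := hf; split; first exact: measurableT_comp.
 by under eq_fun do rewrite real_normK ?num_real //.
have I0 : 0 <= \int[mu]_y (\1_c y * `|f y|) by apply: int_ge0 => y; rewrite mulr_ge0 // indicE.
exists (L * (\int[mu]_y (\1_c y * `|f y|) + 1)); first by rewrite mulr_gt0 // ltr_wpDl.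
move=> y s s1 hs.
have i1 := conv_itg x hk hf; have i2 := conv_itg y hk hf.
have s0 : 0 <= s by exact: le_trans (hs 0).
rewrite /conv -intB // (le_trans (norm_int_le (itgB i1 i2))) //.
apply: (@le_trans _ _ (\int[mu]_y ((L * s) * (\1_c y * `|f y|)))).
 apply: le_int; [exact/itg_norm/itgB|exact: itgZ|move=> u]. rewrite -mulrBl normrM mulrA ler_wpM2r //.
 rewrite indicE; case: (boolP (u \in c)) => [_|/negP nc].
  by rewrite mulr1; apply: hL => i; rewrite !coB opprB addrA subrK.
 rewrite !z ?subrr ?normr0 ?mulr0 // => hc; apply: nc; rewrite inE => i;
  have := hc i; rewrite co0 subr0 coB => hci; last by rewrite distrC; lra.
 have := hs i; have := ler_distD (co i y) (co i u) (co i x).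
 by rewrite (distrC (co i u) (co i y)) (distrC (co i y) (co i x)); lra.
by rewrite intZ // mulrDr mulr1 mulrDl [leRHS]addrC mulrAC lerDr mulr_ge0 ?(ltW L0).
Qed.

Lemma conv_continuous U k f : rtest U k -> l2 mu f -> continuous (conv k f).
move=> hk hf x; have [L L0 hL] := conv_lip x hk hf.
apply/cvgrPdist_le => e e0.
have d0 : 0 < Num.min 1 (e / L) by rewrite lt_min ltr01 divr_gt0.
have /nbhs_cube : nbhs x (cube x (Num.min 1 (e / L))) by exact: cube_nbhs.
move=> _; apply: filterS (cube_nbhs x d0) => y hy.
have : `|conv k f x - conv k f y| <= L * Num.min 1 (e / L).
 by apply: hL; [rewrite ge_min lexx|move=> i; rewrite distrC].
move/le_trans; apply; rewrite -ler_pdivlMl // mulrC.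
by rewrite ge_min lexx orbT.
Qed.

Lemma conv_is_derive U i k f x : rtest U k -> l2 mu f ->
  is_derive x (unit_vec R i) (conv k f) (conv (pd i k) f x).
move=> hk hf; apply/is_derive_line.
have [h h0 z] := rtest_cube hk; have [sk _] := hk.
have hdk := rtest_pd i hk; have [M M0 hM] := rtest_bd hdk.
pose F (s : R) y := k (s *: unit_vec R i + x - y) * f y.
have dF (s : R) y : is_derive s (1 : R) (F^~ y) (pd i k (s *: unit_vec R i + x - y) * f y).
 have dk : is_derive s (1 : R) (fun s => k (s *: unit_vec R i + x - y)) (pd i k (s *: unit_vec R i + x - y)).
  apply: (axis_line_derive (t := fun s => s *: unit_vec R i + x - y) s sk).
  move=> a b j; rewrite !coB !coD !coZ co_unit; ring.
 have := is_deriveM dk (is_derive_cst (f y) s (1 : R)).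
 by rewrite scaler0 add0r /GRing.scale /= [X in is_derive _ _ _ X -> _]mulrC.
pose c := cube x (h + 1).
have iG : itg mu (fun y => M * (\1_c y * `|f y|)).
 apply/itgZ/l2_mul; first exact: cube_ind_l2. have [mf j] := hf; split; first exact: measurableT_comp.
 by under eq_fun do rewrite real_normK ?num_real //.
have iF (s : R) : itg mu (F s) by exact: conv_itg hk hf.
have I0 : `](-1 : R), 1[%classic 0 by rewrite /= in_itv /= ltrN10 ltr01.
have bd (s : R) y : `](-1 : R), 1[%classic s -> setT y -> `|partial1of2 F s y| <= M * (\1_c y * `|f y|).
 rewrite /= in_itv /= => hs _; rewrite partial1of2E; have [_ ->] := dF s y.
 rewrite normrM mulrA ler_wpM2r // indicE; case: (boolP (y \in c)) => [_|/negP nc].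
  by rewrite mulr1.
 rewrite mulr0 (pd_out i (@cube_closed _ 0 h) z) ?normr0 // => hc; apply: nc; rewrite inE => j.
 have := hc j; rewrite co0 subr0 coB coD coZ co_unit => h1. have h2 : `|s * (j == i)%:R| <= 1.
  have hs1 : `|s| <= 1 by rewrite ler_norml; case/andP: hs => a b; rewrite !ltW.
  by case: (_ == _); rewrite ?mulr1 ?mulr0 ?normr0.
 have := ler_normB (s * (j == i)%:R + co j x - co j y) (s * (j == i)%:R).
 by rewrite (_ : _ - _ - _ = - (co j y - co j x)); [rewrite normrN; lra|ring].
have df (s : R) y : `](-1 : R), 1[%classic s -> setT y -> derivable (F^~ y) s 1.
 by move=> _ _; have [] := dF s y.
have G0 y : 0 <= M * (\1_c y * `|f y|) by rewrite mulr_ge0 ?(ltW M0) // mulr_ge0 // indicE.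
have D1 := derivable_under_integral measurableT I0 (fun s _ => iF s) df G0 iG bd.
have D2 := differentiation_under_integral measurableT I0 (fun s _ => iF s) df G0 iG bd.
split; first exact: D1.
rewrite -derive1E [LHS]D2 /conv; apply: eq_Rintegral => y _.
by rewrite partial1of2E; have [_ ->] := dF 0 y; rewrite scale0r add0r.
Qed.

Lemma conv_sm U k f : rtest U k -> l2 mu f -> sm (conv k f).
move=> hk hf; exists [set g | exists2 k, rtest U k & g = conv k f]; last by exists k.
move=> _ [k' hk' ->]; split; first exact: conv_continuous hk' hf.
move=> _ [i _ <-]; exists (conv (pd i k') f); first by exists (pd i k') => //; exact: rtest_pd.
by move=> x; exact: conv_is_derive hk' hf.
Qed.

Lemma pd_conv U i k f x : rtest U k -> l2 mu f -> pd i (conv k f) x = conv (pd i k) f x.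
by move=> hk hf; have [_] := conv_is_derive i x hk hf. Qed.
End TestIntegrals.

(** * The Schur test *)
Section Schur.
Context {R : realType} d (T : measurableType d) (m : {sigma_finite_measure set T -> \bar R}).
Implicit Types (w f : T -> R).
Notation int f := (\int[m]_x f x).

Variables (K q : T * T -> R) (M V : R).
Hypotheses (M0 : 0 <= M) (mK : mfT K) (mq : mfT q).
Hypotheses (q0 : forall p, 0 <= q p) (Kq : forall p, `|K p| <= M * q p).
Hypotheses
  (q1 : forall x, [/\ l2 m (fun y => q (x, y)), itg m (fun y => q (x, y)) & int (fun y => q (x, y)) <= V])
  (q2 : forall y, [/\ l2 m (fun x => q (x, y)), itg m (fun x => q (x, y)) & int (fun x => q (x, y)) <= V]).

Let l2abs f : l2 m f -> l2 m (fun x => `|f x|).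
move=> [mf i]; split; first exact: measurableT_comp.
by under eq_fun do rewrite real_normK ?num_real //.
Qed.

Lemma kernel_section_itg f x : l2 m f -> itg m (fun y => K (x, y) * f y).
move=> hf; have [mf _] := hf; have [ql _ _] := q1 x.
apply: (itg_dom (g := fun y => M * (q (x, y) * `|f y|))).
- by apply: measurable_funM => //; exact: measurable_fun_pair2.
- by apply/itgZ/l2_mul => //; exact: l2abs.
- by move=> y; rewrite normrM mulrA ler_wpM2r.
Qed.

Lemma ge0_itg_bound (F : T * T -> R) c : mfT F -> (forall p, 0 <= F p) ->
  (\int[m \x m]_p (F p)%:E <= c%:E)%E -> itg (m \x m)%E F /\ \int[(m \x m)%E]_p F p <= c.
move=> mF F0 le; suff i : itg (m \x m)%E F by split=> //; rewrite -lee_fin -int_fin.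
apply/integrableP; split; first exact/measurable_EFinP.
by under eq_integral do rewrite /= ger0_norm //; exact: le_lt_trans le (ltry _).
Qed.

Lemma tonelli_bound1 (F : T * T -> R) (g : T -> R) : mfT F -> (forall p, 0 <= F p) -> itg m g ->
  (forall x, (\int[m]_y (F (x, y))%:E <= (g x)%:E)%E) -> itg (m \x m)%E F /\ \int[(m \x m)%E]_p F p <= int g.
move=> mF F0 ig le; have mE : mfT (EFin \o F) by exact/measurable_EFinP.
apply: ge0_itg_bound => //; rewrite (fubini_tonelli1 (m1 := m) (m2 := m) (EFin \o F)) //.
rewrite -int_fin //; apply: ge0_le_integral => //.
- by move=> x _; apply: integral_ge0 => y _; rewrite lee_fin.
- by apply: (measurable_fun_fubini_tonelli_F (m2 := m) (EFin \o F)) => // p; rewrite lee_fin.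
- by apply/measurable_EFinP; exact: itg_mf ig.
by move=> t _; exact: le.
Qed.

Lemma tonelli_bound2 (F : T * T -> R) (g : T -> R) : mfT F -> (forall p, 0 <= F p) -> itg m g ->
  (forall y, (\int[m]_x (F (x, y))%:E <= (g y)%:E)%E) -> itg (m \x m)%E F /\ \int[(m \x m)%E]_p F p <= int g.
move=> mF F0 ig le; have mE : mfT (EFin \o F) by exact/measurable_EFinP.
apply: ge0_itg_bound => //; rewrite (fubini_tonelli2 (m1 := m) (m2 := m) (EFin \o F)) //.
rewrite -int_fin //; apply: ge0_le_integral => //.
- by move=> x _; apply: integral_ge0 => y _; rewrite lee_fin.
- by apply: (measurable_fun_fubini_tonelli_G (m1 := m) (EFin \o F)) => // p; rewrite lee_fin.
- by apply/measurable_EFinP; exact: itg_mf ig.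
by move=> t _; exact: le.
Qed.

Definition schur_bound w f := M * V * ((int (fun x => w x ^+ 2) + int (fun x => f x ^+ 2)) / 2).

Lemma schur w f : l2 m w -> l2 m f -> itg m (fun x => w x * int (fun y => K (x, y) * f y)) /\
  `|int (fun x => w x * int (fun y => K (x, y) * f y))| <= schur_bound w f.
move=> hw hf; pose F (p : T * T) := K p * (w p.1 * f p.2).
pose G1 (p : T * T) := q p * w p.1 ^+ 2; pose G2 (p : T * T) := q p * f p.2 ^+ 2.
have m1 : mfT (fun p : T * T => w p.1) := measurableT_comp hw.1 measurable_fst.
have m2 : mfT (fun p : T * T => f p.2) := measurableT_comp hf.1 measurable_snd.
have sec (S : T -> R) t : itg m S -> int S <= V -> (\int[m]_x (S x * t ^+ 2)%:E <= (V * t ^+ 2)%:E)%E.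
 move=> i le; under eq_integral do rewrite mulrC.
 by rewrite (int_fin (itgZ _ i)) lee_fin intZ // mulrC ler_wpM2r ?sqr_ge0.
have [i1 b1] : itg (m \x m)%E G1 /\ \int[(m \x m)%E]_p G1 p <= int (fun x => V * w x ^+ 2).
 apply: tonelli_bound1 => [|p||x]; last by have [_ i le] := q1 x; exact: (sec (fun y => q (x, y)) (w x) i le).
 - by apply: measurable_funM => //; apply: measurable_funX.
 - by rewrite mulr_ge0 ?sqr_ge0.
 - exact/itgZ/hw.2.
have [i2 b2] : itg (m \x m)%E G2 /\ \int[(m \x m)%E]_p G2 p <= int (fun x => V * f x ^+ 2).
 apply: tonelli_bound2 => [|p||y]; last by have [_ i le] := q2 y; exact: (sec (fun x => q (x, y)) (f y) i le).
 - by apply: measurable_funM => //; apply: measurable_funX.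
 - by rewrite mulr_ge0 ?sqr_ge0.
 - exact/itgZ/hf.2.
have i12 := itgZ (M / 2) (itgD i1 i2).
have FG p : `|F p| <= M / 2 * (G1 p + G2 p).
 rewrite /F normrM (le_trans (ler_wpM2r (normr_ge0 _) (Kq p))) //.
 have -> : M / 2 * (G1 p + G2 p) = M * q p * ((w p.1 ^+ 2 + f p.2 ^+ 2) / 2) by rewrite /G1 /G2; field.
 rewrite ler_wpM2l ?mulr_ge0 // normrM -(real_normK (num_real (w _))) -(real_normK (num_real (f _))).
 by have := sqr_ge0 (`|w p.1| - `|f p.2|); rewrite sqrrB; lra.
have iF : itg (m \x m)%E F by apply: itg_dom i12 FG; do 2?[apply: measurable_funM => //].
have fubF : fubini_F m (EFin \o F) = (fun x => (w x * int (fun y => K (x, y) * f y))%:E).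
 apply/funext => x; have i := kernel_section_itg x hf; rewrite /fubini_F -intZ // -int_fin; last exact/itgZ.
 by apply: eq_integral => y _; rewrite /= /F /= mulrCA.
have i := integrable_fubini_F iF; rewrite fubF in i; split; first exact: i.
have -> : int (fun x => w x * int (fun y => K (x, y) * f y)) = \int[(m \x m)%E]_p F p.
 by rewrite /Rintegral -(integral12_prod_meas1 iF) fubF.
apply: le_trans (norm_int_le iF) _; apply: le_trans (le_int (itg_norm iF) i12 FG) _.
rewrite intZ ?intD //; last exact: itgD.
rewrite (intZ _ hw.2) in b1; rewrite (intZ _ hf.2) in b2.
apply: le_trans (ler_wpM2l _ (lerD b1 b2)) _; first by rewrite divr_ge0.
by rewrite /schur_bound le_eqVlt; apply/orP; left; apply/eqP; field.
Qed.
End Schur.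

Section L2Real.
Context d (T : measurableType d) (R : realType) (m : {measure set T -> \bar R}).
Notation int f := (\int[m]_x f x).

Definition sq (f : T -> R) := int (fun x => f x ^+ 2).

Lemma sq_ge0 f : 0 <= sq f. by apply: int_ge0 => x; rewrite sqr_ge0. Qed.

Lemma l2_cs f g : l2 m f -> l2 m g -> int (fun x => f x * g x) ^+ 2 <= sq f * sq g.
move=> hf hg; have ifg := l2_mul hf hg; set dd := int (fun x => f x * g x).
have [F0|F0] := eqVneq (sq f) 0.
 have /int_eq0_ae fae := F0. rewrite F0 mul0r /dd (_ : int (fun x => f x * g x) = 0) ?expr0n // -[RHS](int0 m).
 apply: eq_int_ae; [exact: itg_mf ifg|exact: measurable_cst|].
 apply: filterS (fae (fun x => sqr_ge0 _) hf.2) => x /eqP; rewrite sqrf_eq0 => /eqP ->. by rewrite mul0r.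
have Fp : 0 < sq f by rewrite lt_def F0 sq_ge0.
have : 0 <= int (fun x => (sq f * g x - dd * f x) ^+ 2) by apply: int_ge0 => x; rewrite sqr_ge0.
have -> : (fun x => (sq f * g x - dd * f x) ^+ 2) =
  (fun x => (sq f ^+ 2 * g x ^+ 2 + dd ^+ 2 * f x ^+ 2) - 2 * sq f * dd * (f x * g x)).
 by apply/funext => x; ring.
have i1 : itg m (fun x => sq f ^+ 2 * g x ^+ 2) by exact/itgZ/hg.2.
have i2 : itg m (fun x => dd ^+ 2 * f x ^+ 2) by exact/itgZ/hf.2.
have i3 : itg m (fun x => 2 * sq f * dd * (f x * g x)) by exact/itgZ.
have i12 := itgD i1 i2.
rewrite (intB i12 i3) (intD i1 i2) !intZ //; [|exact: hf.2|exact: hg.2].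
rewrite -/dd -!/(sq _) => h; rewrite -(ler_pM2l Fp) -subr_ge0.
by rewrite (_ : _ - _ = sq f ^+ 2 * sq g + dd ^+ 2 * sq f - 2 * sq f * dd * dd) //; ring.
Qed.
End L2Real.

Definition subp (R : realType) (p : R3 R * R3 R) : R3 R := p.1 - p.2.

Lemma measurable_subp (R : realType) : mfT (@subp R).
have mB (g : R3 R -> R) : mfT g ->
  mfT (fun p : R3 R * R3 R => g p.1 - g p.2).
 move=> mg; apply: measurable_funB.
  exact: (measurableT_comp mg measurable_fst).
 exact: (measurableT_comp mg measurable_snd).
have m1 : mfT (fun x : R3 R => x.1.1) by exact: (measurableT_comp measurable_fst measurable_fst).
have m2 : mfT (fun x : R3 R => x.1.2) by exact: (measurableT_comp measurable_snd measurable_fst).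
have m3 : mfT (fun x : R3 R => x.2) by exact: measurable_snd.
have h := measurable_fun_pair (measurable_fun_pair (mB _ m1) (mB _ m2)) (mB _ m3).
exact: h.
Qed.

(** * Kernels concentrated near the diagonal *)
Section NearKernel.
Variables (R : realType) (Omega : domain R).
Notation mu := (vol Omega).
Notation int f := (\int[mu]_x f x).
Notation sq := (sq mu).
Implicit Types (w f k : R3 R -> R).

Lemma near_schur (K : R3 R * R3 R -> R) M c h w f : 0 <= M -> 0 <= h ->
  mfT K -> (forall p, `|K p| <= M * \1_(cube c h) (p.1 - p.2)) ->
  l2 mu w -> l2 mu f ->
  itg mu (fun x => w x * int (fun y => K (x, y) * f y)) /\
  `|int (fun x => w x * int (fun y => K (x, y) * f y))| <= M * (2 * h) ^+ 3 * ((sq w + sq f) / 2).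
move=> M0 h0 mK hK; have mc := fun c => vol_cube Omega c h0.
have [sm e] := sfinite_pack (vol_sigma_finite Omega); rewrite -e in mc *.
move=> hw hf.
pose q (p : R3 R * R3 R) : R := \1_(cube c h) (p.1 - p.2).
have q0 p : 0 <= q p by rewrite /q indicE.
have mq : mfT q.
 have mi : mfT (\1_(cube c h) : R3 R -> R).
  by apply: measurable_indic; exact: cube_meas.
 exact: (measurableT_comp mi (@measurable_subp R)).
have ci b : [/\ l2 sm (\1_(cube b h)), itg sm (\1_(cube b h)) & \int[sm]_y \1_(cube b h) y <= (2 * h) ^+ 3].
 have [] := @l2_bounded _ _ _ sm (cube b h) (\1_(cube b h)) 1.
 - exact: cube_meas.
 - by apply: le_lt_trans (mc b) _; rewrite ltry.
 - by apply: measurable_indic; exact: cube_meas.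
 - by move=> x; rewrite indicE; case: (_ \in _); rewrite ?normr1 ?normr0.
 - by move=> x nx; rewrite indicE memNset.
 move=> i1 i2; split => //; rewrite -lee_fin -int_fin // integral_indic ?setIT; [exact: mc|by []|exact: cube_meas].
have e1 x : (fun y => q (x, y)) = \1_(cube (x - c) h).
 apply/funext => y; rewrite /q /= !indicE; congr (nat_of_bool _)%:R.
 apply/idP/idP => /set_mem H; apply/mem_set => i; have := H i; rewrite !coB.
  by rewrite (_ : co i x - co i y - co i c = - (co i y - (co i x - co i c))) ?normrN //; ring.
 by rewrite (_ : co i y - (co i x - co i c) = - (co i x - co i y - co i c)) ?normrN //; ring.
have e2 y : (fun x => q (x, y)) = \1_(cube (y + c) h).
 apply/funext => x; rewrite /q /= !indicE; congr (nat_of_bool _)%:R.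
 apply/idP/idP => /set_mem H; apply/mem_set => i; have := H i; rewrite !(coB, coD).
  by rewrite (_ : co i x - co i y - co i c = co i x - (co i y + co i c)) //; ring.
 by rewrite (_ : co i x - (co i y + co i c) = co i x - co i y - co i c) //; ring.
have q1 x : [/\ l2 sm (fun y => q (x, y)), itg sm (fun y => q (x, y)) & \int[sm]_y q (x, y) <= (2 * h) ^+ 3].
 by rewrite e1; exact: ci.
have q2 y : [/\ l2 sm (fun x => q (x, y)), itg sm (fun x => q (x, y)) & \int[sm]_x q (x, y) <= (2 * h) ^+ 3].
 by rewrite e2; exact: ci.
exact: (schur M0 mK mq q0 hK q1 q2 hw hf).
Qed.

Lemma conv_kernel_mf k : continuous k -> mfT (fun p : R3 R * R3 R => k (p.1 - p.2)).
move=> ck; have mk := cont_mf ck.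
exact: (measurableT_comp mk (@measurable_subp R)).
Qed.

Lemma conv_schur k M c h w f : 0 <= M -> 0 <= h -> continuous k ->
  (forall z, `|k z| <= M * \1_(cube c h) z) -> l2 mu w -> l2 mu f ->
  itg mu (fun x => w x * conv Omega k f x) /\
  `|int (fun x => w x * conv Omega k f x)| <= M * (2 * h) ^+ 3 * ((sq w + sq f) / 2).
move=> M0 h0 ck hk hw hf.
exact: (@near_schur (fun p => k (p.1 - p.2)) M c h w f M0 h0 (conv_kernel_mf ck) (fun p => hk _) hw hf).
Qed.

Lemma rtest_conv_itg U k w f : rtest U k -> l2 mu w -> l2 mu f -> itg mu (fun x => w x * conv Omega k f x).
move=> hk hw hf; have [h h0 z] := rtest_cube hk; have [M M0 hM] := rtest_bd hk.
have [] // := @conv_schur k M 0 h w f (ltW M0) (ltW h0).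
 by apply: sm_cts; case: hk.
move=> z'; rewrite indicE; case: (boolP (_ \in _)) => [_|/negP nz]; first by rewrite mulr1.
by rewrite z ?normr0 ?mulr0 // => hz; apply: nz; rewrite inE.
Qed.

(** A partition of unity by indicators, subordinate to the cubes of radius [s] around the points: each point
takes what its predecessors leave. *)
Fixpoint cells (s : R) (ps : seq (R3 R)) : seq ((R3 R -> R) * R3 R) :=
  if ps is p :: ps' then (\1_(cube p s), p) ::
    [seq ((fun x => (1 - \1_(cube p s) x) * t.1 x), t.2) | t <- cells s ps'] else [::].

Lemma cells_bmf s ps : forall t, t \in [seq t.1 | t <- cells s ps] ->
  mfT t /\ forall x, `|t x| <= 1.
elim: ps => //= p ps IH t.
have mi : mfT (\1_(cube p s) : R3 R -> R) by apply: measurable_indic; exact: cube_meas.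
rewrite inE -map_comp => /orP[/eqP ->|].
 by split => // x; rewrite indicE; case: (_ \in _); rewrite ?normr1 ?normr0.
move=> /mapP[[t' q] tin ->] /=.
have [mt ht] := IH t' (map_f (fun t => t.1) tin).
split; first by apply: measurable_funM => //; exact: measurable_funB.
move=> x; rewrite normrM indicE -[leRHS]mulr1 ler_pM //.
by case: (_ \in _); rewrite ?subrr ?subr0 ?normr1 ?normr0.
Qed.

Lemma cells_pick s ps (g : R3 R -> R) x : (exists2 p, p \in ps & cube p s x) ->
  exists2 p, cube p s x & \sum_(t <- cells s ps) t.1 x * g t.2 = g p.
elim: ps => [[p]//|p ps IH] h /=.
have [xp|nxp] := pselect (cube p s x).
 exists p => //; rewrite big_cons big_map /= indicE mem_set // mul1r big1 ?addr0 // => t _. by rewrite subrr !mul0r.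
have [|q xq e] := IH.
 by case: h => q; rewrite inE => /orP[/eqP ->//|qin] xq; exists q.
exists q => //; rewrite big_cons big_map /= indicE memNset // mul0r add0r -e.
by apply: eq_bigr => t _; rewrite subr0 mul1r.
Qed.

Lemma grid_cover (H s : R) : 0 < s -> exists ps : seq (R3 R), forall x, cube 0 H x -> exists2 p, p \in ps & cube p s x.
move=> s0; pose n := (Num.truncn (2 * H / s)).+1.
pose pt (t : 'I_n * 'I_n * 'I_n) : R3 R := (- H + t.1.1%:R * s, - H + t.1.2%:R * s, - H + t.2%:R * s).
exists [seq pt t | t <- enum {: 'I_n * 'I_n * 'I_n}] => x xH.
have /choice[r hr] (i : 'I_3) : exists r : 'I_n, `|co i x - (- H + r%:R * s)| <= s.
 have := xH i; rewrite co0 subr0 ler_norml => /andP[l u]. pose a := (co i x + H) / s.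
 have a0 : 0 <= a by rewrite divr_ge0 ?(ltW s0) //; lra.
 have ale : a <= 2 * H / s by rewrite ler_pM2r ?invr_gt0 //; lra.
 have lt : (Num.truncn a < n)%N by rewrite ltnS le_truncn. exists (Ordinal lt) => /=.
 have e : co i x = - H + a * s by rewrite /a mulfVK ?gt_eqF //; ring.
 have l1 := truncn_le a; rewrite a0 in l1; have l2 := truncnS_gt a.
 rewrite e (_ : _ - _ = (a - (Num.truncn a)%:R) * s); last by ring.
 rewrite normrM (gtr0_norm s0) -[leRHS]mul1r ler_wpM2r ?(ltW s0) //. rewrite -natr1 in l2; rewrite ger0_norm; lra.
exists (pt (r 0, r 1, r 2%:R)); first by apply: map_f; rewrite mem_enum.
by apply: I3P; rewrite {2}/co !mxE /=; exact: hr.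
Qed.

(** The kernel is replaced by its values at the nodes of a fine grid. The error is of the order of the mesh and
supported near the diagonal, so that the Schur test applies; the rest is a finite sum of functionals. *)
Lemma finite_rank (chi : R3 R -> R) (B H0 : R) k (d : R) : mfT chi ->
  (forall x, `|chi x| <= B) -> (forall x, ~ cube 0 H0 x -> chi x = 0) -> rtest setT k -> 0 < d ->
  exists es : seq (R3 R -> R), (forall e, List.In e es -> l2 mu e) /\
    forall a f, l2 mu a -> l2 mu f ->
      `|int (fun x => chi x * a x * conv Omega k f x)| <= d * (sq a + sq f) + \sum_(e <- es) int (fun x => a x * e x) ^+ 2.
move=> mchi chiB chi0 hk d0.
have B0 : 0 <= B by exact: le_trans (normr_ge0 _) (chiB 0).
have [L L0 hL] := sm_lipschitz hk; have [h h0 z] := rtest_cube hk.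
have kc : continuous k by apply: sm_cts; case: hk.
pose Q := B * L * (2 * (h + 1)) ^+ 3.
have h10 : 0 <= h + 1 by lra.
have Q0 : 0 <= Q by rewrite /Q !(mulr_ge0, exprn_ge0) // ltW.
pose s := Num.min 1 (d / (Q + 1)).
have Q1 : 0 < Q + 1 by rewrite ltr_wpDl.
have s0 : 0 < s by rewrite lt_min ltr01 divr_gt0.
have s1 : s <= 1 by rewrite ge_min lexx.
have sQ : s * Q <= d.
 rewrite (@le_trans _ _ (s * (Q + 1))) ?ler_wpM2l ?(ltW s0) ?lerDl //. by rewrite -ler_pdivlMr // ge_min lexx orbT.
have [ps hps] := grid_cover H0 s0.
pose cs := cells s ps.
pose S (p : R3 R * R3 R) := \sum_(t <- cs) t.1 p.1 * k (t.2 - p.2).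
pose E (p : R3 R * R3 R) := chi p.1 * (k (p.1 - p.2) - S p).
have mth t : t \in cs -> mfT t.1 /\ forall x, `|t.1 x| <= 1.
 by move=> tin; apply: (cells_bmf (s := s) (ps := ps)); exact: (map_f (fun t => t.1) tin).
have mchi1 : mfT (fun p : R3 R * R3 R => chi p.1).
 exact: (measurableT_comp mchi measurable_fst).
have mE : mfT E.
 apply: measurable_funM => //; apply: measurable_funB; first exact: conv_kernel_mf.
 suff H cs' : {subset cs' <= cs} -> mfT (fun p : R3 R * R3 R => \sum_(t <- cs') t.1 p.1 * k (t.2 - p.2)) by exact: H.
 elim: cs' => [|t cs' IH] sub.
  by under eq_fun do rewrite big_nil; exact: measurable_cst.
 have tin : t \in cs by apply: sub; exact: mem_head.
 have /IH H : {subset cs' <= cs} by move=> u uin; apply: sub; rewrite inE uin orbT.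
 under eq_fun do rewrite big_cons; apply: measurable_funD => //; apply: measurable_funM.
  exact: (measurableT_comp (mth t tin).1 measurable_fst).
 have mk : mfT (fun y : R3 R => k (t.2 - y)).
  by apply: sm_mf; apply: sm_refl; case: hk.
 exact: (measurableT_comp mk measurable_snd).
have hE p : `|E p| <= B * L * s * \1_(cube 0 (h + 1)) (p.1 - p.2).
 case: p => x y; rewrite /E /S /=. have [xH|nxH] := pselect (cube 0 H0 x); last first.
  by rewrite chi0 // mul0r normr0 !mulr_ge0 ?(ltW L0) ?(ltW s0) // indicE.
 have [p xp ->] := @cells_pick s ps (fun q => k (q - y)) x (hps x xH). rewrite normrM -!mulrA ler_pM ?mulrA //.
 rewrite indicE; case: (boolP (_ \in _)) => [_|/negP nc].
  rewrite mulr1; apply: hL => i; have := xp i. by rewrite !coB opprB addrA subrK.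
 rewrite !z ?subrr ?normr0 ?mulr0 //; move=> hc; apply: nc; rewrite inE => i; have := hc i;
  rewrite !co0 !subr0 !coB => h1; last lra.
 have := xp i; have := ler_normD (co i p - co i y) (co i x - co i p). by rewrite addrC addrA subrK; lra.
pose n := (size cs).+1%:R : R.
pose Ck t := sq (fun y : R3 R => k (t - y)).
have l2k t : l2 mu (fun y : R3 R => k (t - y)) by have [] := rtest_itg Omega (rtest_refl t hk).
have Ck0 t : 0 <= Ck t by exact: sq_ge0.
pose eta (t : R3 R) := d / 2 / (n * (Ck t + 1)).
have n0 : 0 < n by rewrite ltr0n.
have Ck1 t : 0 < Ck t + 1 by rewrite ltr_wpDl.
have eta0 t : 0 < eta t by rewrite !divr_gt0 // mulr_gt0.
pose th (t : (R3 R -> R) * R3 R) := fun x => chi x * t.1 x.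
pose e (t : (R3 R -> R) * R3 R) := fun x => (2 * Num.sqrt (eta t.2))^-1 * th t x.
have lth t : t \in cs -> l2 mu (th t).
 move=> tin; have [mt ht] := mth t tin. apply: (@l2_bounded _ _ _ mu (cube 0 H0) (th t) B _ _ _ _ _).1.
 - exact: cube_meas.
 - have [H00|H00] := leP 0 H0; first by apply: le_lt_trans (vol_cube Omega 0 H00) _; rewrite ltry.
  rewrite (_ : cube 0 H0 = set0) ?measure0 ?ltry //.
  apply/seteqP; split => // x /(_ 0); rewrite leNgt => /negP; apply. by rewrite (lt_le_trans H00).
 - exact: measurable_funM.
 - by move=> x; rewrite /th normrM -[leRHS]mulr1 ler_pM.
 - by move=> x nx; rewrite /th chi0 // mul0r.
exists [seq e t | t <- cs]; split.
 move=> g gin; suff [t tin <-] : exists2 t, t \in cs & e t = g by exact/l2Z/lth.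
 elim: (cs) gin => //= t cs' IH [<-|/IH[u uin <-]]; first by exists t => //; exact: mem_head.
 by exists u => //; rewrite inE uin orbT.
move=> a f ha hf; have [ma _] := ha.
have [iE bE] := near_schur (mulr_ge0 (mulr_ge0 B0 (ltW L0)) (ltW s0)) h10 mE hE ha hf.
pose c t := int (fun x => a x * th t x); pose dd (t : R3 R) := conv Omega (fun y => k y) f t.
have ic t : t \in cs -> itg mu (fun x => a x * th t x) by move=> tin; exact/l2_mul/lth.
have eq1 x : chi x * a x * conv Omega k f x = a x * int (fun y => E (x, y) * f y) +
  \sum_(t <- cs) dd t.2 * (a x * (if t \in cs then th t x else 0)).
 have e1 : int (fun y => E (x, y) * f y) = chi x * conv Omega k f x - \sum_(t <- cs) th t x * dd t.2.
  have i1 := conv_itg x hk hf; have i2 (t : (R3 R -> R) * R3 R) := itgZ (th t x) (conv_itg t.2 hk hf).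
  rewrite /conv -intZ // (eq_bigr _ (fun t _ => esym (intZ _ (conv_itg t.2 hk hf)))) -int_sum // -intB.
  - apply: eq_Rintegral => y _; rewrite /E /S /= mulrBr mulrBl mulrA; congr (_ - _).
   rewrite mulr_sumr mulr_suml; apply: eq_bigr => t _; rewrite /th; ring.
  - exact: itgZ.
  - exact: itg_sum.
 rewrite e1 mulrBr; rewrite [X in _ = _ + X](_ : _ = a x * \sum_(t <- cs) th t x * dd t.2).
  by rewrite subrK; ring.
 rewrite mulr_sumr big_seq [RHS]big_seq; apply: eq_bigr => t tin; rewrite tin; ring.
have isum : forall t, itg mu (fun x => dd t.2 * (a x * (if t \in cs then th t x else 0))).
 move=> t; case: (boolP (t \in cs)) => [/ic|_]; first exact: itgZ. by under eq_fun do rewrite !mulr0; exact: itg0.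
have -> : int (fun x => chi x * a x * conv Omega k f x) = int (fun x => a x * int (fun y => E (x, y) * f y)) + \sum_(t <- cs) dd t.2 * c t.
 rewrite (_ : (fun x => chi x * a x * conv Omega k f x) = (fun x => a x * int (fun y => E (x, y) * f y) +
  \sum_(t <- cs) dd t.2 * (a x * (if t \in cs then th t x else 0)))); last by apply/funext => x; exact: eq1.
 rewrite intD //; last exact: itg_sum.
 rewrite int_sum // big_seq [X in _ = _ + X]big_seq; congr (_ + _); apply: eq_bigr => t tin.
 by rewrite tin intZ //; exact: ic.
apply: le_trans (ler_normD _ _) _.
have A1 : `|int (fun x => a x * int (fun y => E (x, y) * f y))| <= d / 2 * (sq a + sq f).
 apply: le_trans bE _; rewrite (_ : _ * _ = s * Q * (sq a + sq f) / 2); last by rewrite /Q; ring.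
 rewrite (_ : d / 2 * _ = d * (sq a + sq f) / 2); last by ring.
 by rewrite ler_wpM2r ?invr_ge0 // ler_wpM2r ?addr_ge0 ?sq_ge0.
have A2 t : t \in cs -> `|dd t.2 * c t| <= d / 2 / n * sq f + int (fun x => a x * e t x) ^+ 2.
 move=> tin. have -> : int (fun x => a x * e t x) = (2 * Num.sqrt (eta t.2))^-1 * c t.
  by rewrite -intZ; [apply: eq_Rintegral => x _; rewrite /e; ring|exact: ic].
 have se : 0 < Num.sqrt (eta t.2) by rewrite sqrtr_gt0.
 have h1 : `|dd t.2 * c t| <= eta t.2 * dd t.2 ^+ 2 + ((2 * Num.sqrt (eta t.2))^-1 * c t) ^+ 2.
  rewrite -[X in X * _ ^+ 2](@sqr_sqrtr _ (eta t.2)) ?(ltW (eta0 _)) // normrM.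
  rewrite -(real_normK (num_real (dd _))) -[((2 * _)^-1 * _) ^+ 2]real_normK ?num_real // normrM.
  rewrite (@gtr0_norm _ (2 * _)^-1) ?invr_gt0 ?mulr_gt0 //. move: (Num.sqrt _) se (`|dd _|) (`|c _|) => r r0 x y.
  have := sqr_ge0 (r * x - (2 * r)^-1 * y).
  rewrite (_ : (r * x - (2 * r)^-1 * y) ^+ 2 = r ^+ 2 * x ^+ 2 + ((2 * r)^-1 * y) ^+ 2 - x * y); last by field; exact: lt0r_neq0.
  by rewrite subr_ge0.
 apply: le_trans h1 _; rewrite lerD2r. have h2 : dd t.2 ^+ 2 <= (Ck t.2 + 1) * sq f.
  apply: le_trans (l2_cs (l2k t.2) hf) _; rewrite ler_wpM2r ?sq_ge0 // lerDl //.
 apply: le_trans (ler_wpM2l (ltW (eta0 _)) h2) _.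
 rewrite mulrA ler_wpM2r ?sq_ge0 // /eta invfM !mulrA mulfVK ?gt_eqF //.
have A3 : `|\sum_(t <- cs) dd t.2 * c t| <= d / 2 * sq f + \sum_(t <- cs) int (fun x => a x * e t x) ^+ 2.
 apply: le_trans (ler_norm_sum _ _ _) _.
 apply: (@le_trans _ _ (\sum_(t <- cs) (d / 2 / n * sq f + int (fun x => a x * e t x) ^+ 2))).
  by rewrite big_seq [leRHS]big_seq; apply: ler_sum => t; exact: A2.
 rewrite big_split /= lerD2r; set D := d / 2 / n * sq f.
 have -> : \sum_(t <- cs) D = (size cs)%:R * D by rewrite big_const_seq count_predT iter_addr_0 mulr_natl.
 have -> : d / 2 * sq f = n * D by rewrite /D; field; exact: lt0r_neq0.
 by rewrite ler_wpM2r ?ler_nat // /D mulr_ge0 ?sq_ge0 // !divr_ge0 ?(ltW d0) ?(ltW n0).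
apply: le_trans (lerD A1 A3) _; rewrite big_map addrA lerD2r.
by have := sq_ge0 mu a; have := sq_ge0 mu f; nra.
Qed.
End NearKernel.

(** * The fundamental lemma of the calculus of variations *)
Section Dynkin.
Context {R : realType} d (T : measurableType d) (m : {measure set T -> \bar R}).
Variable g : T -> R.
Hypothesis ig : itg m g.
Notation I E := (\int[m]_(x in E) (g x)%:E)%E.

Lemma integral_dynkin d' (T' : measurableType d') (phi : T -> T') (G : set (set T')) E :
  measurable E -> mfT phi -> (@measurable _ T') = <<s G >> -> setI_closed G -> I E = 0%E ->
  (forall S, G S -> I (E `&` phi @^-1` S) = 0%E) -> forall S, measurable S -> I (E `&` phi @^-1` S) = 0%E.
move=> mE mphi mG GI E0 hG.
have mp S : measurable S -> measurable (E `&` phi @^-1` S).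
 by move=> mS; apply: measurableI => //; rewrite -[X in measurable X]setTI; exact: mphi.
have itA A : measurable A -> m.-integrable A (EFin \o g).
 by move=> mA; apply: integrableS ig => //; exact: measurableT.
pose P S := I (E `&` phi @^-1` S) = 0%E; move=> S mS.
apply: (@dynkin_induction _ _ G P mG GI) => //; rewrite /P.
- by rewrite preimage_setT setIT.
- move=> A mA PA; have mAc := measurableC mA. have := @integral_setU _ _ _ m _ _ (EFin \o g) (mp _ mA) (mp _ mAc).
 rewrite -setIUr -preimage_setU setUv preimage_setT setIT E0 PA add0e => <- //.
  by have /integrableP[] := itA _ mE.
 by apply/disj_setPS => x [[_ Ax] [_ nAx]].
- move=> F mF tF PF; rewrite preimage_bigcup setI_bigcupr integral_bigcup.
 + by apply: eseries0 => n _ _; exact: PF.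
 + by move=> i j _ _ [x [[_ Fi] [_ Fj]]]; apply: (tF i j Logic.I Logic.I); exists (phi x).
 + by move=> n; exact: mp.
 by apply: itA; apply: bigcup_measurable => n _; exact: mp.
by rewrite -mG.
Qed.

Lemma ae0_of_integral : (forall S, measurable S -> I S = 0%E) -> {ae m, forall x, g x = 0}.
move=> h; have := integral_ae_eq measurableT ig (measurable_cst (0 : \bar R)%E)
 (fun E _ mE => etrans (h E mE) (esym (integral0 m E))).
by apply: filterS => x /(_ Logic.I)[].
Qed.
End Dynkin.

Section Boxes.
Variables (R : realType) (m : {measure set (R3 R) -> \bar R}).
Notation ray := (fun a : R => [set t : measurableTypeR R | a < t]).
Notation line := (measurableTypeR R).
Variable g : R3 R -> R.
Hypothesis ig : itg m g.
Variable h : R.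
Hypothesis g0 : forall x, ~ cube 0 h x -> g x = 0.
Notation I E := (\int[m]_(x in E) (g x)%:E)%E.
Hypothesis gray : forall a b c : R, I ((ray a `*` ray b) `*` ray c) = 0%E.

Lemma integral_rays i (phi : R3 R -> line) E : (forall x, phi x = co i x) -> mfT phi -> measurable E ->
  (forall a : R, I (E `&` phi @^-1` ray a) = 0%E) -> forall S, measurable S -> I (E `&` phi @^-1` S) = 0%E.
move=> phiE mphi mE hr; apply: (integral_dynkin ig (G := @RGenOInfty.G R)) => //.
- exact: RGenOInfty.measurableE.
- move=> _ _ [a ->] [b ->]; exists (Num.max a b); apply/seteqP; split => x /=; rewrite !in_itv /= !andbT.
  by move=> [xa xb]; rewrite gt_max xa xb.
 by rewrite gt_max => /andP[].
- rewrite -(hr (- h - 1)) integral_mkcondr; apply: eq_integral => x _; rewrite patchE.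
 case: ifPn => // nx; rewrite g0 // => /(_ i); rewrite co0 subr0 ler_norml => /andP[lx _].
 by move/negP: nx; apply; rewrite inE /= phiE; apply: lt_le_trans lx; rewrite ltrBlDr ltrDl.
move=> _ [a ->]; rewrite -(hr a); congr (I (_ `&` _)); apply/seteqP; split=> x /=; by rewrite in_itv /= andbT.
Qed.

Let mX d d' (A : measurableType d) (B : measurableType d') : setI_closed [set S `*` S' | S in @measurable _ A & S' in @measurable _ B].
move=> _ _ [A1 mA1 [A2 mA2 <-]] [B1 mB1 [B2 mB2 <-]]; exists (A1 `&` B1); first exact: measurableI.
by exists (A2 `&` B2); [exact: measurableI|rewrite setXI].
Qed.

(** Dynkin's argument, one coordinate at a time: from rays to measurable sets. *)
Lemma ae0_of_rays : {ae m, forall x, g x = 0}.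
have c := coE (R := R).
have mr (a : R) : measurable (ray a).
 by rewrite (_ : ray a = `]a, +oo[%classic); [exact: measurable_itv|apply/seteqP; split => x /=; rewrite in_itv /= andbT].
have m1 := @measurable_fst _ _ (line * line)%type line; have m2 := @measurable_snd _ _ (line * line)%type line.
have m11 : mfT (fun x : R3 R => x.1.1 : line) := measurableT_comp measurable_fst m1.
have m12 : mfT (fun x : R3 R => x.1.2 : line) := measurableT_comp measurable_snd m1.
have mb (A B C : set line) : measurable A -> measurable B -> measurable C -> measurable ((A `*` B) `*` C : set (R3 R)).
 by move=> mA mB mC; apply: measurableX => //; exact: measurableX.
have s1 b d (A : set line) : measurable A -> I ((A `*` ray b) `*` ray d) = 0%E.
 have e (S : set line) : (S `*` ray b) `*` ray d = ((setT `*` ray b) `*` ray d) `&` (fun x : R3 R => x.1.1 : line) @^-1` S.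
  by apply/seteqP; split=> x /=; tauto.
 rewrite e; apply: (integral_rays (i := 0)) => // [x||a]; [by case: (c x)|exact: mb|by rewrite -e].
have s2 d (A B : set line) : measurable A -> measurable B -> I ((A `*` B) `*` ray d) = 0%E.
 have e (S : set line) : (A `*` S) `*` ray d = ((A `*` setT) `*` ray d) `&` (fun x : R3 R => x.1.2 : line) @^-1` S.
  by apply/seteqP; split=> x /=; tauto.
 move=> mA; rewrite e; apply: (integral_rays (i := 1)) => // [x||a]; [by case: (c x)|exact: mb|by rewrite -e; exact: s1].
have s3 (A B C : set line) : measurable A -> measurable B -> measurable C -> I ((A `*` B) `*` C) = 0%E.
 have e (S : set line) : (A `*` B) `*` S = ((A `*` B) `*` setT) `&` (fun x : R3 R => x.2 : line) @^-1` S.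
  by apply/seteqP; split=> x /=; tauto.
 move=> mA mB; rewrite e; apply: (integral_rays (i := 2%:R)) => // [x||a]; [by case: (c x)|exact: mb|by rewrite -e; exact: s2].
have s4 (D : set (line * line)) (C : set line) : measurable D -> measurable C -> I (D `*` C) = 0%E.
 have e (S : set (line * line)) : S `*` C = (setT `*` C) `&` (fun x : R3 R => x.1) @^-1` S.
  by apply/seteqP; split=> x /=; tauto.
 move=> mD mC; rewrite e; apply: (integral_dynkin ig _ m1 (@measurable_prod_measurableType _ _ _ _) (@mX _ _ _ _)) => //.
 - exact: measurableX.
 - by rewrite -setXTT; exact: s3.
 by move=> _ [A mA [B mB <-]]; rewrite -e; exact: s3.
apply: (ae0_of_integral ig) => S mS; rewrite -[S]setTI.
apply: (integral_dynkin ig (phi := id) measurableT (@measurable_id _ _ setT) (@measurable_prod_measurableType _ _ _ _) (@mX _ _ _ _)) => //.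
 by rewrite -!setXTT; exact: s3.
by move=> _ [D mD [C mC <-]]; rewrite setTI; exact: s4.
Qed.
End Boxes.

Lemma ord3E : (lift ord0 ord0 = 1 :> 'I_3) /\ (lift ord0 (lift ord0 ord0) = 2%:R :> 'I_3).
by split; apply/val_inj. Qed.
Lemma prod3 (R : comNzRingType) (F : 'I_3 -> R) : \prod_i F i = F 0 * F 1 * F 2%:R.
by have [e1 e2] := ord3E; rewrite !big_ord_recl big_ord0 mulr1 mulrA e1 e2. Qed.
Lemma sum3 (V : nmodType) (F : 'I_3 -> V) : \sum_i F i = F 0 + F 1 + F 2%:R.
by have [e1 e2] := ord3E; rewrite !big_ord_recl big_ord0 addr0 addrA e1 e2. Qed.

Section FundamentalLemma.
Variables (R : realType) (Omega : domain R).
Notation mu := (vol Omega).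
Notation int f := (\int[mu]_x f x).
Implicit Types f : R3 R -> R.

Lemma step_lim (s : R) : step (n%:R * s) @[n --> \oo] --> (\1_[set t : R | 0 < t] s : R).
rewrite indicE; have [s0|s0] := leP s 0.
 rewrite memNset /=; last by apply/negP; rewrite -leNgt.
 by apply: cvg_near_cst; near=> n; rewrite step_le0 // mulr_ge0_le0.
rewrite mem_set //; apply: cvg_near_cst; near=> n; apply: step_ge1.
rewrite -ler_pdivrMr // mul1r.
by near: n; exact: nbhs_infty_ger.
Unshelve. all: by end_near.
Qed.

Lemma sm_affine_co i (F : R -> R) (a b : R) : smooth [set (1 : R)] F -> sm (fun x : R3 R => F (a * co i x + b)).
move=> sF; apply: (@sm_co R i (fun t => F (a * t + b))).
apply: (smooth_affine (l := fun t : R => a * t + b) sF).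
 move=> t; apply: continuousD; last exact: cst_continuous.
 by apply: continuousM; [exact: cst_continuous|exact: cvg_id].
move=> v ->; exists a, 1; split => // t h.
by rewrite /GRing.scale /=; ring.
Qed.

Definition window (n : nat) (a b : R) (t : R) : R := step (n%:R * (t - a)) * step (n%:R * (b - t)).

Lemma sm_window n a b i : sm (fun x : R3 R => window n a b (co i x)).
apply: smoothM.
 rewrite (_ : (fun x => _) = (fun x : R3 R => step (n%:R * co i x + - n%:R * a))).
  exact: (sm_affine_co i _ _ step_smooth).
 by apply/funext => x; congr step; ring.
rewrite (_ : (fun x => _) = (fun x : R3 R => step (- n%:R * co i x + n%:R * b))).
 exact: (sm_affine_co i _ _ step_smooth).
by apply/funext => x; congr step; ring.
Qed.

Lemma window_bound n a b t : `|window n a b t| <= 1.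
rewrite /window normrM !ger0_norm ?step_ge0 //.
by apply: mulr_ile1; rewrite ?step_ge0 ?step_le1.
Qed.

Lemma window_out n a b t : ~ (a <= t <= b) -> window n a b t = 0.
move=> h; rewrite /window; have [ta|ta] := ltP t a.
 by rewrite step_le0 ?mul0r // mulr_ge0_le0 // subr_le0 ltW.
rewrite [X in _ * X]step_le0 ?mulr0 // mulr_ge0_le0 // subr_le0.
by move: h; rewrite ta /= => /negP; rewrite -ltNge => /ltW.
Qed.

Lemma window_lim a b t : window n a b t @[n --> \oo] --> (\1_[set s : R | a < s < b] t : R).
rewrite (_ : \1__ t = \1_[set s : R | 0 < s] (t - a) * \1_[set s : R | 0 < s] (b - t) :> R).
 by apply: cvgM; exact: step_lim.
rewrite !indicE -natrM mulnb; congr (nat_of_bool _)%:R.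
by apply/idP/andP => [/set_mem /= /andP[u v]|[/set_mem /= u /set_mem /= v]];
 [split; rewrite inE /= subr_gt0|rewrite inE /=; rewrite !subr_gt0 in u v; rewrite u v].
Qed.

Lemma l2_itg_cube f c h : 0 <= h -> l2 mu f -> itg mu (fun x => f x * \1_(cube c h) x).
by move=> h0 hf; apply: l2_mul => //; exact: cube_ind_l2. Qed.
Definition obox (a b : 'I_3 -> R) : set (R3 R) := [set x | forall i, a i < co i x < b i].

Lemma obox_indic a b x : \1_(obox a b) x = \prod_i \1_[set s : R | a i < s < b i] (co i x) :> R.
rewrite indicE; case: (boolP (_ \in _)) => [/set_mem h|/negP h].
 by rewrite big1 // => i _; rewrite indicE mem_set //; exact: h.
have [i ni] : exists i, ~ (a i < co i x < b i).
 by apply: contrapT => /forallNP n; apply: h; apply/mem_set => i; exact: contrapT (n i).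
by rewrite (bigD1 i) //= indicE memNset ?mul0r.
Qed.

Lemma obox_measurable a b : measurable (obox a b).
rewrite (_ : obox a b = (`]a 0, b 0[ `*` `]a 1, b 1[) `*` `]a 2%:R, b 2%:R[).
 by apply: measurableX; [apply: measurableX|]; exact: measurable_itv.
apply/seteqP; split=> x; have [e0 e1 e2] := coE x; rewrite /= !in_itv /= -e0 -e1 -e2.
 by move=> h; split; [split|]; exact: h.
by move=> [[h1 h2] h3]; apply: I3P.
Qed.

Variable f : R3 R -> R.
Hypotheses (hf : l2 mu f) (f0 : forall psi, rtest Omega psi -> int (fun x => f x * psi x) = 0).

Lemma box_int0 (c : R3 R) r a b : 0 < r -> cube c r `<=` (Omega : set (R3 R)) ->
  (forall i, co i c - r <= a i /\ b i <= co i c + r) -> int (fun x => f x * \1_(obox a b) x) = 0.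
move=> r0 cO hab; pose th n x := \prod_i window n (a i) (b i) (co i x).
have out n x : ~ cube c r x -> th n x = 0.
 move=> ncx; have [i ni] : exists i, ~ (a i <= co i x <= b i).
  apply: contrapT => /forallNP h; apply: ncx => i. have /andP[u v] := contrapT (h i); have [h1 h2] := hab i.
  by rewrite ler_distl; apply/andP; split; [exact: le_trans h1 u|exact: le_trans v h2].
 by rewrite /th (bigD1 i) //= window_out ?mul0r.
have smth n : sm (th n).
 rewrite /th; under eq_fun do rewrite prod3. by apply: smoothM; [apply: smoothM|]; exact: sm_window.
have tth n : rtest Omega (th n).
 by split => //; exists (cube c r); [split => //; exact: cube_compact|exact: out].
have bth n x : `|th n x| <= 1.
 by rewrite /th normr_prod; apply: prodr_ile1 => i _; rewrite normr_ge0 window_bound.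
have [mf _] := hf.
have h1 n : mfT (fun x => f x * th n x).
 by apply: measurable_funM => //; apply: cont_mf; exact: sm_cts.
have h4 n x : `|f x * th n x| <= `|f x * \1_(cube c r) x|.
 rewrite !normrM ler_wpM2l // indicE; case: (boolP (_ \in _)) => [_|/negP nx]; first by rewrite normr1.
 by rewrite out ?normr0 // => /mem_set.
have h3 : {ae mu, forall x, f x * th n x @[n --> \oo] --> f x * \1_(obox a b) x}.
 apply: aeW => x; apply: cvgM; first exact: cvg_cst. rewrite obox_indic prod3; under eq_fun do rewrite /th prod3.
 by apply: cvgM; [apply: cvgM|]; exact: window_lim.
have h2 := measurable_funM mf (measurable_indic (obox_measurable a b)).
have [_] := @dominated_cvg _ _ _ mu (fun n x => f x * th n x) _ _ h1 h2 (itg_norm (l2_itg_cube c (ltW r0) hf)) h3 h4.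
under eq_fun do rewrite (f0 (tth _)).
by move=> H; apply/esym; apply: (cvg_unique _ _ H) => //; exact: cvg_cst.
Qed.

(** Indicators of boxes are bounded limits of products of smooth windows, so all integrals of [f] over boxes
vanish. *)
Lemma vanish_cube (c : R3 R) r : 0 < r -> cube c r `<=` (Omega : set (R3 R)) ->
  {ae mu, forall x, (forall i, `|co i x - co i c| < r) -> f x = 0}.
move=> r0 cO; pose Q := obox (fun i => co i c - r) (fun i => co i c + r); pose g x := f x * \1_Q x.
have gz x : ~ cube c r x -> g x = 0.
 move=> nx; rewrite /g indicE memNset ?mulr0 // => Qx; apply: nx => i. by have := Qx i; rewrite -ltr_distl => /ltW.
have mg : mfT g by apply: measurable_funM; [case: hf|exact: measurable_indic (obox_measurable _ _)].
have ig : itg mu g.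
 apply: (itg_dom mg (itg_norm (l2_itg_cube c (ltW r0) hf))) => x.
 have [cx|/gz ->] := pselect (cube c r x); last by rewrite normr0.
 rewrite /g !normrM [in leRHS]indicE mem_set // normr1 ler_wpM2l // indicE.
 by case: (_ \in _); rewrite ?normr1 ?normr0.
pose h := \sum_i `|co i c| + r.
have gz' x : ~ cube 0 h x -> g x = 0.
 move=> nx; apply: gz => hx; apply: nx => i; rewrite co0 subr0.
 have hi : `|co i c| <= \sum_i `|co i c| by rewrite (bigD1 i) //= lerDl sumr_ge0.
 rewrite /h addrC -(subrK (co i c) (co i x)); apply: le_trans (ler_normD _ _) _. by apply: lerD => //; exact: hx.
have key : {ae mu, forall x, g x = 0}.
 apply: (@ae0_of_rays R mu g ig h gz') => a b d; set E := _ `*` _.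
 pose A := vec3 (fun i : 'I_3 => if i == 0 then a else if i == 1 then b else d).
 pose lo i := Num.max (co i A) (co i c - r). have mE : measurable E.
  by do 2?[apply: measurableX]; rewrite -set_itvoy; exact: measurable_itv.
 have eE x : g x * \1_E x = f x * \1_(obox lo (fun i => co i c + r)) x.
  rewrite /g -mulrA !indicE -natrM mulnb; congr (_ * (nat_of_bool _)%:R). have EA : E x <-> forall i, co i A < co i x.
   rewrite /A; have [e0 e1 e2] := coE x; split=> [[[x0 x1] x2]|hA].
    by apply: I3P; rewrite co_vec3 /= ?e0 ?e1 ?e2.
   by split; [split|]; rewrite /= -?e0 -?e1 -?e2; [have := hA 0|have := hA 1|have := hA 2%:R]; rewrite co_vec3.
  apply/andP/idP => [[/set_mem q /set_mem/EA p]|/set_mem q].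
   by apply/mem_set => i; rewrite gt_max -andbA p; exact: q.
  have q' i : co i A < co i x /\ co i c - r < co i x < co i c + r.
   by have := q i; rewrite gt_max -andbA => /andP[].
  by split; apply/mem_set; [move=> i|apply/EA => i]; have [] := q' i.
 have igE : itg mu (fun x => g x * \1_E x).
  apply: (itg_dom (measurable_funM mg (measurable_indic mE)) (itg_norm ig)) => x.
  by rewrite normrM ler_piMr // indicE; case: (_ \in _); rewrite ?normr1 ?normr0.
 rewrite integral_mkcond (_ : _ \_ _ = fun x => (g x * \1_E x)%:E); last first.
  by apply/funext => x; rewrite patchE indicE; case: ifP; rewrite ?mulr1 ?mulr0.
 have hlo i : co i c - r <= lo i /\ co i c + r <= co i c + r by rewrite le_max !lexx orbT.
 by rewrite int_fin // (funext eE) (box_int0 r0 cO hlo).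
apply: filterS key => x gx hx; move: gx; rewrite /g indicE mem_set ?mulr1 // => i.
by rewrite -ltr_distl.
Qed.

Theorem fundamental_lemma : {ae mu, forall x, f x = 0}.
pose pt (p : rat * rat * rat * nat) : R3 R := (ratr p.1.1.1, ratr p.1.1.2, ratr p.1.2).
pose rad (p : rat * rat * rat * nat) : R := p.2.+1%:R^-1.
have rad0 p : 0 < rad p by rewrite invr_gt0.
pose P p x := cube (pt p) (rad p) `<=` (Omega : set (R3 R)) -> (forall i, `|co i x - co i (pt p)| < rad p) -> f x = 0.
have aeP p : {ae mu, forall x, P p x}.
 have [h|h] := pselect (cube (pt p) (rad p) `<=` (Omega : set (R3 R))).
  by apply: filterS (vanish_cube (rad0 p) h) => x hx _.
 by apply: aeW => x; rewrite /P.
have aeall : {ae mu, forall x, forall n, if unpickle n is Some p then P p x else True}.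
 apply/ae_foralln => n; case: (unpickle n) => [p|]; [exact: aeP|exact: aeW].
have [E [_ EO _ aeE]] := @ae_subset R Omega setT (aeW mu (fun _ => I)).
apply: filterS2 aeall aeE => x hx /EO Ox.
have nx : nbhs x (Omega : set (R3 R)) by apply: open_nbhs_nbhs; split => //; exact: domain_open.
have [h h0 hO] := nbhs_cube nx.
have [n _ /(_ n (leqnn n)) ne] := near_infty_natSinv_lt (PosNum (divr_gt0 h0 (ltr0n _ 2%N))).
have n0 : 0 < n.+1%:R^-1 :> R by [].
have rt i : exists q : rat, `|co i x - ratr q| < n.+1%:R^-1.
 have : co i x - n.+1%:R^-1 < co i x + n.+1%:R^-1 by rewrite ltrD2l gtrN.
 by move=> /rat_in_itvoo[q]; rewrite in_itv /= => xq; exists q; rewrite distrC ltr_distl.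
have [q0 h0'] := rt 0; have [q1 h1] := rt 1; have [q2 h2] := rt 2%:R.
pose p := (q0, q1, q2, n).
have near i : `|co i x - co i (pt p)| < rad p.
 by case: (coE (pt p)) => e0 e1 e2; move: i; apply: I3P; rewrite ?e0 ?e1 ?e2.
have := hx (pickle p); rewrite pickleK; apply => // y hy; apply: hO => i.
apply: le_trans (ler_distD (co i (pt p)) _ _) _.
apply: le_trans (lerD (hy i) (ltW _)) _; first by rewrite distrC; exact: near i.
have : rad p < h / 2 := ne.
by move: (rad p) => s hs; lra.
Qed.
End FundamentalLemma.

(** * Product mollifiers *)
Section Products.
Variable R : realType.
Implicit Types (f g : 'I_3 -> R -> R) (x : R3 R).

Definition prodf f x : R := \prod_j f j (co j x).

Lemma prodf_sm f : (forall j, smooth [set (1 : R)] (f j)) -> sm (prodf f).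
move=> sf; rewrite (_ : prodf f = (fun x => f 0 (co 0 x) * f 1 (co 1 x) * f 2%:R (co 2%:R x))).
 by apply: smoothM; [apply: smoothM|]; exact: sm_co.
by apply/funext => x; rewrite /prodf prod3.
Qed.

Lemma pd_prodf f g i x : (forall s : R, is_derive s (1 : R) (f i) (g i s)) ->
  pd i (prodf f) x = \prod_j (if j == i then g j else f j) (co j x).
move=> df; apply: (@pd_eq _ i _ (fun x => \prod_j (if j == i then g j else f j) (co j x))).
apply/is_derive_line.
pose K := \prod_(j | j != i) f j (co j x).
rewrite (_ : (fun h : R => prodf f _) = K *: (fun h => f i (h + co i x))); last first.
 apply/funext => h; rewrite /prodf (bigD1 i) //= coD coZ co_unit eqxx mulr1 mulrC; congr (_ * _).
 by apply: eq_bigr => j /negPf ji; rewrite coD coZ co_unit ji mulr0 add0r.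
rewrite (bigD1 i) //= eqxx mulrC (_ : \prod_(j | j != i) _ = K); last first.
 by apply: eq_bigr => j /negPf ->.
by apply: is_deriveZ; apply: (is_derive_shift _ _ _).1; exact: df.
Qed.

Lemma prodf_out f c h x : (forall j s, ~ `|s - co j c| <= h -> f j s = 0) -> ~ cube c h x -> prodf f x = 0.
move=> f0 nx; have [i ni] : exists i, ~ `|co i x - co i c| <= h.
 by apply: contrapT => /forallNP hh; apply: nx => i; exact: contrapT (hh i).
by rewrite /prodf (bigD1 i) //= f0 ?mul0r.
Qed.

Lemma prodf_rtest f c h : (forall j, smooth [set (1 : R)] (f j)) ->
  (forall j s, ~ `|s - co j c| <= h -> f j s = 0) -> rtest setT (prodf f).
move=> sf f0; split; first exact: prodf_sm.
by exists (cube c h); [split => //; exact: cube_compact|move=> x; exact: prodf_out].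
Qed.

Lemma prodf_bound f (B : 'I_3 -> R) c h x : (forall j s, `|f j s| <= B j) ->
  (forall j s, ~ `|s - co j c| <= h -> f j s = 0) -> `|prodf f x| <= (\prod_j B j) * \1_(cube c h) x.
move=> fB f0; rewrite indicE; case: (boolP (_ \in _)) => [_|/negP nx].
 by rewrite mulr1 normr_prod; apply: ler_prod => i _; rewrite normr_ge0 fB.
by rewrite mulr0 (prodf_out f0) ?normr0 // => cx; apply: nx; rewrite inE.
Qed.

Lemma prodf_integral f c h : (forall j, continuous (f j)) -> (forall j s, ~ `|s - co j c| <= h -> f j s = 0) ->
  (forall j, \int[@lebesgue_measure R]_s f j s = 1 /\ itg (@lebesgue_measure R) (f j)) ->
  \int[volume R]_x prodf f x = 1.
move=> cf f0 f1.
have s1 : sigma_finite setT (@lebesgue_measure R : {measure set (measurableTypeR R) -> \bar R}) by exact: sigma_finiteT.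
have [i0 j0] := f1 0; have [i1 j1] := f1 1; have [i2 j2] := f1 2%:R.
have e2 := @int_prod1 R _ _ _ _ _ (@lebesgue_measure R) (@lam2_sigma_finite R) _ (f 2%:R) (itg_prod s1 j0 j1) j2 i2.
have e1 := @int_prod1 R _ _ _ _ _ (@lebesgue_measure R) s1 (f 0) (f 1) j0 j1 i1.
rewrite (_ : prodf f = (fun x : R3 R => f 0 x.1.1 * f 1 x.1.2 * f 2%:R x.2)).
 by rewrite -i0 -e1; exact: e2.
by apply/funext => x; rewrite /prodf prod3; case: (coE x) => -> -> ->.
Qed.
End Products.

Section Mollifier.
Context {R : realType}.

Definition dstep : R -> R := fun s => 'D_1 step s.

Lemma dstep_smooth : smooth [set (1 : R)] dstep.
by apply: smooth_D => //; exact: step_smooth. Qed.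
Lemma dstepP s : is_derive s (1 : R) step (dstep s).
by apply: (smooth_der _ step_smooth). Qed.
Lemma dstep_out s : ~ (0 <= s <= 1) -> dstep s = 0.
move=> h; rewrite /dstep.
have loc c : (\forall r \near s, step r = c) -> 'D_1 step s = 0.
 move=> hn; rewrite (@near_eq_derive _ _ _ step (cst c)) ?derive_cst ?oner_eq0 //.
have [s0|s0] := ltP s 0.
 apply: (loc 0); near=> r; apply: step_le0; apply: ltW. by near: r; exact: lt_nbhsl.
have s1 : 1 < s by move: h; rewrite s0 /= => /negP; rewrite -ltNge.
apply: (loc 1); near=> r; apply: step_ge1; apply: ltW.
by near: r; exact: lt_nbhsr.
Unshelve. all: by end_near.
Qed.

Lemma dstep_bounded : exists2 A, 0 < A & forall s, `|dstep s| <= A.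
have cd : continuous dstep by apply: smooth_cts; exact: dstep_smooth.
have [M [_ hM]] : bounded_set (dstep @` `[0, 1]%classic).
 by apply: compact_bounded; apply: continuous_compact; [exact: continuous_subspaceT|exact: segment_compact].
have M1 : `|M| < `|M| + 1 by rewrite ltrDl.
exists (`|M| + 1) => [|s]; first by rewrite (le_lt_trans (normr_ge0 M)).
have [s01|/dstep_out ->] := pselect (0 <= s <= 1); last by rewrite normr0 addr_ge0.
by apply: hM; [rewrite (le_lt_trans (ler_norm _))|exists s => //; rewrite /= in_itv].
Qed.

Variables (d : 'I_3 -> R) (eta : R).
Hypothesis eta0 : 0 < eta.
Implicit Types t : R.

Definition ramp t i s := step ((s - t * d i) / (eta * t)).
Definition bump t i s := dstep ((s - t * d i) / (eta * t)) / (eta * t).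

Let affine_smooth (F : R -> R) t i : smooth [set (1 : R)] F -> smooth [set (1 : R)] (fun s => F ((s - t * d i) / (eta * t))).
move=> sF; apply: (smooth_affine (l := fun s : R => (s - t * d i) / (eta * t)) sF).
 move=> s; apply: cvgM; last exact: cvg_cst. by apply: cvgB; [exact: cvg_id|exact: cvg_cst].
move=> v ->; exists (eta * t)^-1, 1; split => // s h.
by rewrite /GRing.scale /=; ring.
Qed.

Lemma ramp_smooth t i : smooth [set (1 : R)] (ramp t i).
by apply: (affine_smooth t i); exact: step_smooth. Qed.
Lemma bump_smooth t i : smooth [set (1 : R)] (bump t i).
rewrite (_ : bump t i = fun s => (eta * t)^-1 * dstep ((s - t * d i) / (eta * t))).
 by apply: smoothZ; apply: (affine_smooth t i); exact: dstep_smooth.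
by apply/funext => s; rewrite /bump mulrC.
Qed.

Lemma ramp_derive t i s : is_derive s (1 : R) (ramp t i) (bump t i s).
have h : is_derive s (1 : R) (fun s : R => (s - t * d i) / (eta * t)) (eta * t)^-1.
 rewrite (_ : (fun s : R => _) = (eta * t)^-1 *: (fun s : R => s - t * d i)).
  rewrite -[X in is_derive _ _ _ X]mulr1; apply: is_deriveZ.
  by rewrite -[X in is_derive _ _ _ X]subr0; apply: is_deriveB.
 by apply/funext => r; rewrite /GRing.scale /= mulrC.
exact: (is_derive1_comp (dstepP _) h).
Qed.

Section Scale.
Variable t : R.
Hypothesis t0 : 0 < t.
Let et0 : 0 < eta * t. exact: mulr_gt0. Qed.

Lemma ramp_left i s : s <= t * d i -> ramp t i s = 0.
by move=> h; apply: step_le0; rewrite pmulr_lle0 ?invr_gt0 // subr_le0. Qed.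
Lemma ramp_right i s : t * d i + eta * t <= s -> ramp t i s = 1.
by move=> h; apply: step_ge1; rewrite ler_pdivlMr // mul1r lerBrDl. Qed.
Lemma bump_out i s : ~ `|s - t * d i| <= eta * t -> bump t i s = 0.
move=> h; rewrite /bump dstep_out ?mul0r // => /andP[u v]; apply: h.
rewrite ger0_norm; first by move: v; rewrite ler_pdivrMr // mul1r.
by move: u; rewrite pmulr_lge0 // invr_gt0.
Qed.

Lemma bump_bound A i s : (forall s, `|dstep s| <= A) -> `|bump t i s| <= A / (eta * t).
by move=> hA; rewrite /bump normrM ler_pM // gtr0_norm // invr_gt0. Qed.
Lemma bump_integral (x : R) i : itg (@lebesgue_measure R) (fun s => bump t i (x - s)) /\
  \int[@lebesgue_measure R]_s bump t i (x - s) = 1.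
pose h := `|x| + `|t * d i| + eta * t + 1.
have ax := ler_norm x; have ax' := ler_norm (- x).
have at_ := ler_norm (t * d i); have at' := ler_norm (- (t * d i)).
rewrite !normrN in ax' at'.
have h0 : 0 < h by rewrite /h; have := normr_ge0 x; have := normr_ge0 (t * d i); move: et0; lra.
have df s : is_derive s (1 : R) (fun s => - ramp t i (x - s)) (bump t i (x - s)).
 rewrite -[X in is_derive _ _ _ X]opprK; apply: is_deriveN. rewrite -[X in is_derive _ _ _ X]mulrN1.
 apply: (@is_derive1_comp _ (ramp t i) (fun s => x - s)); first exact: ramp_derive.
 by rewrite -[X in is_derive _ _ _ X]sub0r; apply: is_deriveB.
have cg : continuous (fun s => bump t i (x - s)).
 move=> s; apply: (@continuous_comp _ _ _ (fun s => x - s) (bump t i)).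
  by apply: cvgB; [exact: cvg_cst|exact: cvg_id].
 exact: (smooth_cts (bump_smooth t i)).
have g0 s : h <= `|s| -> bump t i (x - s) = 0.
 move=> hs; apply: bump_out => h1; move: hs; apply/negP; rewrite -ltNge /h.
 have := ler_distD x s 0; rewrite !subr0 => hh. have := ler_norm (s - x); have := ler_norm (x - s) => *.
 have e : `|s - x| <= `|t * d i| + eta * t.
  rewrite distrC -[x - s](subrK (t * d i)). by apply: le_trans (ler_normD _ _) _; rewrite addrC lerD2l.
 by move: hh e; lra.
have [i1 ->] := int_derive_diff h0 df cg g0; split => //.
rewrite ramp_left ?ramp_right; first by ring.
- by rewrite /h; move: et0; lra.
- by rewrite /h; move: et0; lra.
Qed.

Definition moll : R3 R -> R := prodf (bump t).

Lemma co_dir i : co i (t *: vec3 d) = t * d i.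
by rewrite coZ co_vec3. Qed.
Lemma moll_rtest : rtest setT moll.
apply: (@prodf_rtest _ _ (t *: vec3 d) (eta * t)); first exact: bump_smooth.
by move=> j s; rewrite co_dir; exact: bump_out.
Qed.

Lemma moll_bound A x : (forall s, `|dstep s| <= A) -> `|moll x| <= (A / (eta * t)) ^+ 3 * \1_(cube (t *: vec3 d) (eta * t)) x.
move=> hA; rewrite (_ : _ ^+ 3 = \prod_(j < 3) (A / (eta * t))); last by rewrite prodr_const card_ord.
apply: prodf_bound => [j s|j s]; first exact: bump_bound.
by rewrite co_dir; exact: bump_out.
Qed.

Lemma moll_integral (x : R3 R) : \int[volume R]_y moll (x - y) = 1.
rewrite (_ : (fun y : R3 R => moll (x - y)) = prodf (fun j s => bump t j (co j x - s))); last first.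
 by apply/funext => y; rewrite /moll /prodf; apply: eq_bigr => j _; rewrite coB.
apply: (@prodf_integral _ _ (x - t *: vec3 d) (eta * t)).
- move=> j s; apply: (@continuous_comp _ _ _ (fun s => co j x - s) (bump t j)).
  by apply: cvgB; [exact: cvg_cst|exact: cvg_id].
 exact: (smooth_cts (bump_smooth t j)).
- move=> j s; rewrite coB co_dir => h; apply: bump_out => h'; apply: h.
 by rewrite (_ : s - _ = - (co j x - s - t * d j)) ?normrN //; ring.
- by move=> j; have [? ?] := bump_integral (co j x) j.
Qed.
End Scale.

Section TwoScales.
Variables (t t' : R).
Hypotheses (t0 : 0 < t) (t'0 : 0 < t').

(** The coordinates are rescaled one after the other: those before [i] are at the scale [t] and those after it
at [t']. *)
Definition flux i : R3 R -> R := prodf (fun j : 'I_3 =>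
  if j == i then (fun s => ramp t' j s - ramp t j s) else if (j < i)%N then bump t j else bump t' j).

Let flux_smooth i j : smooth [set (1 : R)] (if j == i then (fun s => ramp t' j s - ramp t j s) else if (j < i)%N then bump t j else bump t' j).
case: ifP => _; first by apply: smoothB; exact: ramp_smooth.
by case: ifP => _; exact: bump_smooth.
Qed.

(** A ramp is a primitive of the bump, so each rescaled coordinate contributes one derivative and the sum
telescopes. *)
Lemma flux_div x : moll t' x - moll t x = \sum_i pd i (flux i) x.
have h i : pd i (flux i) x = \prod_j (if j == i then (fun s => bump t' j s - bump t j s) else if (j < i)%N then bump t j else bump t' j) (co j x).
 rewrite /flux; set F := (fun j : 'I_3 => _).
 have dF : forall s : R, is_derive s (1 : R) (F i) ((fun j s => bump t' j s - bump t j s) i s).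
  by move=> s; rewrite /F eqxx; apply: is_deriveB; exact: ramp_derive.
 apply: (eq_trans (pd_prodf (g := fun j s => bump t' j s - bump t j s) x dF)).
 by apply: eq_bigr => j _; rewrite /F; case: (j == i).
have h' i : pd i (flux i) x = \prod_j (if j == i then bump t' j (co j x) - bump t j (co j x) else if (j < i)%N then bump t j (co j x) else bump t' j (co j x)).
 by rewrite h; apply: eq_bigr => j _; case: (j == i) => //; case: (j < i)%N.
rewrite sum3 !h' !prod3 /moll /prodf !prod3 /=.
move: (bump t 0 _) (bump t 1 _) (bump t 2%:R _) (bump t' 0 _) (bump t' 1 _) (bump t' 2%:R _) => a1 a2 a3 b1 b2 b3.
ring.
Qed.

Hypotheses (tt' : t' <= t) (close : forall i, (t - t') * (`|d i| + eta) <= eta * t).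

Lemma flux_out i j s : ~ `|s - t * d j| <= 2 * (eta * t) ->
  (if j == i then (fun s => ramp t' j s - ramp t j s) else if (j < i)%N then bump t j else bump t' j) s = 0.
move=> h; have et : 0 < eta * t by exact: mulr_gt0.
have et' : eta * t' <= eta * t by rewrite ler_wpM2l // ltW.
have dd : `|t' * d j - t * d j| <= eta * t - (t - t') * eta.
 rewrite (_ : t' * d j - t * d j = - ((t - t') * d j)); last by ring.
 by rewrite normrN normrM (ger0_norm (x := t - t')) ?subr_ge0 // lerBrDr -mulrDr.
have tt0 : 0 <= (t - t') * eta by rewrite mulr_ge0 ?subr_ge0 // ltW.
move: dd; rewrite ler_norml => /andP[dd1 dd2].
case: ifP => _.
 have [s1|s1] := leP s (t * d j); first have [s2|s2] := leP s (t' * d j).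
 - by rewrite !ramp_left // subrr.
 - by exfalso; apply: h; rewrite ler_norml; lra.
 have s2 : t * d j + 2 * (eta * t) < s.
  by rewrite ltNge; apply/negP => s2; apply: h; rewrite ler_norml; lra.
 by rewrite !ramp_right ?subrr //; move: (mulrBl eta t t') et'; lra.
case: ifP => _; apply: bump_out => // h'; apply: h; apply: (le_trans h' _) || idtac.
 by lra.
by move: h'; rewrite !ler_norml; lra.
Qed.

Lemma flux_rtest i : rtest setT (flux i).
apply: (@prodf_rtest _ _ (t *: vec3 d) (2 * (eta * t))) => [j|j s]; first exact: flux_smooth.
by rewrite co_dir; exact: flux_out.
Qed.

Lemma flux_bound A i x : (forall s, `|dstep s| <= A) ->
  `|flux i x| <= (A / (eta * t')) ^+ 2 * \1_(cube (t *: vec3 d) (2 * (eta * t))) x.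
move=> hA; have A0 : 0 <= A by exact: le_trans (normr_ge0 _) (hA 0).
have et' : 0 < eta * t' by exact: mulr_gt0.
have b1 j s : `|bump t j s| <= A / (eta * t').
 apply: le_trans (bump_bound t0 j s hA) _; rewrite ler_wpM2l // lef_pV2 ?posrE //.
  by rewrite ler_pM2l.
 exact: mulr_gt0.
have b2 j s : `|bump t' j s| <= A / (eta * t') by exact: bump_bound.
have b3 j s : `|ramp t' j s - ramp t j s| <= 1.
 have := step_ge0 ((s - t * d j) / (eta * t)); have := step_le1 ((s - t * d j) / (eta * t)).
 have := step_ge0 ((s - t' * d j) / (eta * t')); have := step_le1 ((s - t' * d j) / (eta * t')).
 by rewrite -!/(ramp _ _ _) ler_norml; lra.
rewrite (_ : (A / (eta * t')) ^+ 2 = \prod_j (if j == i then 1 else A / (eta * t'))).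
 apply: prodf_bound => [j s|j s]; last by rewrite co_dir; exact: flux_out. by case: ifP => _; [exact: b3|case: ifP].
rewrite prod3; move: i; apply: I3P => /=; ring.
Qed.
End TwoScales.
End Mollifier.

Lemma abs_split (R : realFieldType) (a b c d e : R) : `|a| <= e / 2 -> `|b - d| <= e / 4 -> `|c| <= e / 4 ->
  `|a + b - (c + d)| <= e.
by rewrite !ler_norml; lra. Qed.
Lemma weighted_average d (T : measurableType d) (R : realType) (m : {measure set T -> \bar R})
    (k g q : T -> R) (a B : R) : itg m (fun y => k y * g y) -> itg m k -> \int[m]_y k y = 1 ->
  itg m q -> (forall y, `|k y * (g y - a)| <= B * q y) -> `|\int[m]_y (k y * g y) - a| <= B * \int[m]_y q y.
move=> ikg ik k1 iq le.
have ea : a = \int[m]_y (a * k y) by rewrite intZ // k1 mulr1.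
have i3 := itgB ikg (itgZ a ik).
rewrite {1}ea -intB //; last exact: itgZ.
apply: le_trans (norm_int_le i3) _; rewrite -intZ //.
apply: le_int; [exact: itg_norm|exact: itgZ|move=> y].
by rewrite [a * _]mulrC -mulrBr.
Qed.

Lemma indicator_integral d (T : measurableType d) (R : realType) (m : {measure set T -> \bar R}) (A : set T) r :
  measurable A -> m A = r%:E -> itg m (\1_A : T -> R) /\ \int[m]_y (\1_A y : R) = r.
move=> mA mr.
have i : itg m (\1_A : T -> R).
 have [] // := @l2_bounded _ _ _ m A (\1_A) 1 mA.
 - by rewrite mr ltry.
 - by move=> y; rewrite indicE; case: (_ \in _); rewrite ?normr1 ?normr0.
 - by move=> y ny; rewrite indicE memNset.
by split => //; apply: EFin_inj; rewrite -(int_fin i) -mr integral_indic ?setIT.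
Qed.

(** * Approximation by mollification *)
Section ClosedSpan.
Context {R : realType} {H : lmodType R[i]} {rp : H -> H -> R}.
Hypotheses (hH : is_cip rp) (Hc : ip_complete rp setT).
Let ip := cip_ip hH.
Notation nrm := (ipnorm rp).

Definition adherence (S : set H) : set H := [set v | forall e, 0 < e -> exists2 s, S s & nrm (s - v) <= e].

Lemma adherence_sub S : S `<=` adherence S.
by move=> s Ss e e0; exists s => //; rewrite subrr (nrm0 ip) ltW. Qed.
Lemma adherence_real S : rsubspace S -> rsubspace (adherence S).
move=> hS; have [S0 SD SZ] := hS; split; first exact: adherence_sub.
 move=> x y Sx Sy e e0; have e2 : 0 < e / 2 by rewrite divr_gt0.
 have [s Ss hs] := Sx _ e2; have [s' Ss' hs'] := Sy _ e2; exists (s + s'); first exact: SD.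
 rewrite (_ : _ - _ = (s - x) + (s' - y)); last by rewrite opprD addrACA.
 by apply: le_trans (nrmD ip _ _) _; rewrite [e]splitr lerD.
move=> a x Sx e e0; have a1 : 0 < `|a| + 1 by rewrite ltr_wpDl.
have [s Ss hs] := Sx _ (divr_gt0 e0 a1); exists (a%:C%C *: s); first exact: SZ.
rewrite -scalerBr (nrmZ ip) mulrC; apply: le_trans (ler_wpM2r (normr_ge0 _) hs) _.
by rewrite mulrAC ler_pdivrMr // ler_pM2l // lerDl.
Qed.

Lemma adherence_csub S : csubspace S -> csubspace (adherence S).
move=> hS; have [A0 AD AZ] := adherence_real (sub_real hS).
split => // c x Ax; rewrite scaleCE; apply: AD; apply: AZ => //.
move=> e e0; have [s Ss hs] := Ax e e0; have [_ _ SZ] := hS.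
by exists ('i%C *: s); [exact: SZ|rewrite -scalerBr (nrmi hH)].
Qed.

Lemma adherence_complete S : ip_complete rp (adherence S).
move=> x_ Ax cx; have [x _ hx] := Hc (fun _ => I) cx; exists x => // e e0.
have e2 : 0 < e / 2 by rewrite divr_gt0.
have [N hN] := hx _ e2; have [s Ss hs] := Ax N _ e2; exists s => //.
rewrite -[s - x](subrKA (x_ N)); apply: le_trans (nrmD ip _ _) _.
by rewrite [e]splitr lerD // hN.
Qed.
End ClosedSpan.

Section Density.
Variables (R : realType) (Omega : domain R).
Notation mu := (vol Omega).
Notation int f := (\int[mu]_x f x).
Notation sq := (sq mu).
Notation rp := (@rp R Omega).
Notation nrm := (ipnorm rp).
Implicit Types (f g k w : R3 R -> R).
Let hH := rp_is_cip Omega.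
Let ip := rp_is_ip Omega.

Definition emb f : R3 R -> 'cV[R[i]]_3 := mkc (fun i x => if i == 0 then f x else 0) (fun _ _ => 0).

Lemma emb_sqi f : l2 mu f -> sqi Omega (emb f).
move=> hf i; rewrite re_mkc im_mkc; split; last exact: l20.
by case: (i == 0) => //; exact: l20.
Qed.

Lemma emb_rp f (u : L2 Omega) : l2 mu f -> rp (mkL2 Omega (emb f)) u = int (fun x => f x * re u 0 x).
move=> hf; have := emb_sqi hf => sf; have su := L2_sqi u.
rewrite (rp_sum sf su (mkL2E sf) (aeW _ (fun x => erefl))) sum3 !re_mkc !im_mkc /=.
have z (F : R3 R -> R) : int (fun x => 0 * F x) = 0.
 by under eq_fun do rewrite mul0r; exact: int0.
by rewrite !z !addr0.
Qed.

Lemma embD (a : R) f g : l2 mu f -> l2 mu g ->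
  mkL2 Omega (emb (fun x => a * f x + g x)) = a%:C%C *: mkL2 Omega (emb f) + mkL2 Omega (emb g).
move=> hf hg; apply/esym/L2_ext.
have h1 := L2DE (a%:C%C *: mkL2 Omega (emb f)) (mkL2 Omega (emb g)).
have h2 := L2ZE (a%:C%C) (mkL2 Omega (emb f)).
have h3 := mkL2E (emb_sqi hf); have h4 := mkL2E (emb_sqi hg).
have h5 := mkL2E (emb_sqi (l2D (l2Z a hf) hg)).
apply: filterS3 h1 h2 (filterI h3 (filterI h4 h5)) => x e1 e2 [e3 [e4 e5]].
rewrite e1 e2 e3 e4 e5; apply/matrixP => i j; rewrite (ord1 j) !mxE /=.
by case: (i == 0); apply/eqP; rewrite eq_complex /=; apply/andP; split; apply/eqP; ring.
Qed.

Lemma component_le (u : L2 Omega) i : sq (re u i) <= rp u u /\ sq (im u i) <= rp u u.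
have su := L2_sqi u; have [l1 l2'] := su i.
have rd x : rdot u u x = \sum_j (re u j x ^+ 2 + im u j x ^+ 2) by apply: eq_bigr => j _; rewrite !expr2.
have bd x : re u i x ^+ 2 <= rdot u u x /\ im u i x ^+ 2 <= rdot u u x.
 rewrite rd (bigD1 i) //=; set r := \sum_(_ | _) _.
 have r0 : 0 <= r by apply: sumr_ge0 => j _; rewrite addr_ge0 ?sqr_ge0.
 by have := sqr_ge0 (re u i x); have := sqr_ge0 (im u i x); split; lra.
by rewrite !rpE; split; apply: le_int; (try exact: l2_sqr); (try exact: rdot_itg); move=> x; have [] := bd x.
Qed.

Lemma test_dense f (e : R) : l2 mu f -> 0 < e -> exists2 g, rtest Omega g & sq (fun x => f x - g x) <= e.
move=> hf e0.
pose S : set (L2 Omega) := [set u | exists2 g, rtest Omega g & u = mkL2 Omega (emb g)].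
have tl2 g : rtest Omega g -> l2 mu g by move=> h; have [] := rtest_itg Omega h.
have cst0 : rtest Omega (fun=> 0).
 split; first exact: smooth_cst. by exists set0 => //; split; [exact: compact0|exact: sub0set].
have hS : rsubspace S.
 have lin (a : R) g g' : rtest Omega g -> rtest Omega g' -> S (a%:C%C *: mkL2 Omega (emb g) + mkL2 Omega (emb g')).
  move=> hg hg'; exists (fun x => a * g x + g' x); last by rewrite embD //; exact: tl2.
  by apply: rtestD => //; apply: rtestMl => //; exact: smooth_cst.
 have S0 : S 0.
  by have := lin (-1) _ _ cst0 cst0; rewrite real_complexN1 scaleN1r addNr.
 split => //.
 - by move=> _ _ [g hg ->] [g' hg' ->]; have := lin 1 g g' hg hg'; rewrite scale1r.
 - move=> a _ [g hg ->]; have [z hz ez] := S0. by have := lin a g _ hg hz; rewrite -ez addr0.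
have [p Ap hp] := projection ip (mkL2 Omega (emb f)) (adherence_real hH hS) (adherence_complete hH (@L2_complete R Omega) (S := S)).
have q0 : {ae mu, forall x, re (L2repr (mkL2 Omega (emb f) - p)) 0 x = 0}.
 apply: fundamental_lemma.
  by have [] := L2_sqi (mkL2 Omega (emb f) - p) 0.
 move=> psi hpsi; have := hp (mkL2 Omega (emb psi)). rewrite (rpC ip) emb_rp; last exact: tl2.
 under eq_fun do rewrite mulrC. by apply; apply: adherence_sub => //; exists psi.
have se0 : 0 < Num.sqrt e by rewrite sqrtr_gt0.
have [s [g hg es] hs] := Ap _ se0; exists g => //.
set u := mkL2 Omega (emb f) in q0.
have e1 : {ae mu, forall x, f x - g x = re (L2repr (p - s)) 0 x}.
 apply: filterS3 (filterI (L2BE p s) (L2BE u p)) (mkL2E (emb_sqi hf)) (filterI q0 (mkL2E (emb_sqi (tl2 _ hg)))).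
 move=> x [b1 b2] eu [q eg]; rewrite -es in eg. have e3 : re (L2repr u) 0 x = f x by rewrite /re eu mxE.
 have e4 : re (L2repr s) 0 x = g x by rewrite /re eg mxE.
 have e5 : re (L2repr (u - p)) 0 x = re (L2repr u) 0 x - re (L2repr p) 0 x.
  by rewrite /re b2 !mxE; case: (L2repr u x 0 0) (L2repr p x 0 0) => [? ?] [? ?].
 rewrite /re b1 !mxE -e3 -e4; move: q; rewrite e5 /re.
 by case: (L2repr u x 0 0) (L2repr p x 0 0) (L2repr s x 0 0) => [? ?] [? ?] [? ?] /= /subr0_eq ->.
have [lps _] := L2_sqi (p - s) 0.
rewrite /sq (@eq_int_ae _ _ _ mu _ (fun x => re (L2repr (p - s)) 0 x ^+ 2)).
- have [le _] := component_le (p - s) 0; apply: le_trans le _.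
 rewrite -(nrm_sqr ip) (nrmB ip) -[e](sqr_sqrtr (ltW e0)). by rewrite lerXn2r // nnegrE ?sqrtr_ge0 ?(nrm_ge0 ip).
- by have [m _] := l2B hf (tl2 _ hg); apply: measurable_funX.
- by have [m _] := lps; apply: measurable_funX.
by apply: filterS e1 => x ->.
Qed.

Lemma conv_eq0 k f x : (forall y, k (x - y) * f y = 0) -> conv Omega k f x = 0.
by move=> h; rewrite /conv -[RHS](int0 mu); congr (Rintegral _ _ _); apply/funext. Qed.

Section Mollify.
Variables (d : 'I_3 -> R) (eta : R).
Hypothesis eta0 : 0 < eta.
Notation rho t := (moll d eta t).

Lemma moll_schur : exists2 C, 0 < C & forall t s w f, 0 < t -> 0 < s -> l2 mu w -> l2 mu f ->
  itg mu (fun x => w x * conv Omega (rho t) f x) /\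
  `|int (fun x => w x * conv Omega (rho t) f x)| <= C * (s * sq w + sq f / s).
have [A A0 hA] := @dstep_bounded R.
have A3 : 0 < (2 * A) ^+ 3 / 2 by rewrite divr_gt0 // exprn_gt0 // mulr_gt0.
exists ((2 * A) ^+ 3 / 2) => // t s w f t0 s0 hw hf.
have et : 0 < eta * t by rewrite mulr_gt0.
have M0 : 0 <= (A / (eta * t)) ^+ 3 by rewrite exprn_ge0 // divr_ge0 // ltW.
have cr : continuous (rho t) by apply: sm_cts; case: (moll_rtest d eta0 t0).
have sch w' := @conv_schur R Omega (rho t) _ (t *: vec3 d) (eta * t) w' f M0 (ltW et) cr
 (fun z => moll_bound d eta0 t0 z hA).
have [i1 _] := sch w hw hf; split => //.
have [_ b] := sch (fun x => s * w x) (l2Z s hw) hf.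
have e1 : int (fun x => s * w x * conv Omega (rho t) f x) = s * int (fun x => w x * conv Omega (rho t) f x).
 by rewrite -intZ //; apply: eq_Rintegral => x _; rewrite mulrA.
have e2 : sq (fun x => s * w x) = s ^+ 2 * sq w.
 by rewrite /sq -intZ; [apply: eq_Rintegral => x _; rewrite exprMn|exact: l2_sqr].
have e3 : (A / (eta * t)) ^+ 3 * (2 * (eta * t)) ^+ 3 = (2 * A) ^+ 3.
 rewrite -exprMn; congr (_ ^+ 3); by field; rewrite !lt0r_neq0.
move: b; rewrite e1 e2 e3 normrM (gtr0_norm s0) -ler_pdivlMl // => /le_trans; apply.
apply: le_of_eq; by field; rewrite lt0r_neq0.
Qed.

Lemma moll_near g : rtest Omega g -> exists C, exists2 h, 0 <= C /\ 0 <= h &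
  forall t, 0 < t -> t <= 1 -> forall x, `|conv Omega (rho t) g x - g x| <= C * t * \1_(cube 0 h) x.
move=> hg; have [A A0 hA] := @dstep_bounded R.
have [L L0 lip] := sm_lipschitz hg; have [h0 h00 gout] := rtest_cube hg.
pose D := \sum_i `|d i| + eta.
have D0 : 0 <= D by rewrite addr_ge0 ?sumr_ge0 // ltW.
have Di i : `|d i| + eta <= D by rewrite lerD2r (bigD1 i) //= lerDl sumr_ge0.
exists ((2 * A) ^+ 3 * (L * D)); exists (h0 + D).
 by split; [rewrite mulr_ge0 ?exprn_ge0 ?mulr_ge0 // ltW|rewrite addr_ge0 // ltW].
move=> t t0 t1 x; have et : 0 < eta * t by rewrite mulr_gt0.
set B := (A / (eta * t)) ^+ 3.
have B0 : 0 <= B by rewrite /B exprn_ge0 // divr_ge0 // ltW.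
have rb z := moll_bound d eta0 t0 z hA.
have near z : cube (t *: vec3 d) (eta * t) z -> forall i, `|co i z| <= D * t.
 move=> hz i; apply: le_trans (_ : (`|d i| + eta) * t <= _); last by rewrite ler_wpM2r // ltW.
 rewrite mulrDl -(subrK (t * d i) (co i z)) addrC; apply: le_trans (ler_normD _ _) _.
 apply: lerD; last by have := hz i; rewrite co_dir. by rewrite normrM (gtr0_norm t0) mulrC.
have cr : continuous (rho t) by apply: sm_cts; case: (moll_rtest d eta0 t0).
have cg : continuous g by apply: sm_cts; case: hg.
have crx : continuous (fun y : R3 R => rho t (x - y)).
 move=> y; apply: (@continuous_comp _ _ _ (fun y : R3 R => x - y) (rho t)); last exact: cr.
 by apply: cvgB; [exact: cvg_cst|exact: cvg_id].
have cxE y : cube (t *: vec3 d) (eta * t) (x - y) <-> cube (x - t *: vec3 d) (eta * t) y.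
 by split => hy i; have := hy i; rewrite !coB -normrN; congr (`|_| <= _); ring.
have rout y : ~ cube (x - t *: vec3 d) (eta * t) y -> rho t (x - y) = 0.
 move=> ny; have := rb (x - y); rewrite indicE memNset ?mulr0 ?normr_le0 => [/eqP //|hy]. by apply: ny; apply/cxE.
have vol_cube' (c : R3 R) h := fun h0 : 0 <= h => volume_cube c h0.
have far : ~ (x \in cube 0 (h0 + D)) -> conv Omega (rho t) g x = 0 /\ g x = 0.
 move=> nx; split; last first.
  by apply: gout => hx; apply: nx; rewrite inE => i; apply: le_trans (hx i) _; rewrite lerDl.
 apply: conv_eq0 => y; have [hy|/rout ->] := pselect (cube (x - t *: vec3 d) (eta * t) y); last by rewrite mul0r.
 rewrite [g y]gout ?mulr0 // => gy; apply: nx; rewrite inE => i.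
 rewrite co0 subr0 -(subrK (co i y) (co i x)) addrC; apply: le_trans (ler_normD _ _) _.
 apply: lerD; first by have := gy i; rewrite co0 subr0. rewrite -coB; apply: le_trans (near _ _ i) _; first exact/cxE.
 by rewrite ler_piMr.
have pw y : `|rho t (x - y) * (g y - g x)| <= B * (L * (D * t)) * \1_(cube (x - t *: vec3 d) (eta * t)) y.
 rewrite normrM; have := rb (x - y). rewrite !indicE; case: (boolP (y \in _)) => [|/negP ny] hy; last first.
  by rewrite rout ?normr0 ?mul0r ?mulr0 // => cy; apply: ny; rewrite inE.
 rewrite mem_set ?mulr1; last by apply/cxE; rewrite inE in hy. move=> le; apply: ler_pM => //; apply: lip => i.
 by rewrite distrC -coB; apply: near; apply/cxE; rewrite inE in hy.
have i1 : itg (volume R) (fun y => rho t (x - y) * g y).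
 have [] // := @cube_itg R (volume R) (x - t *: vec3 d) (eta * t) (fun y => rho t (x - y) * g y) (fun A _ => lexx _).
  by move=> y; apply: cvgM; [exact: crx|exact: cg].
 by move=> y ny; rewrite rout ?mul0r.
have i2 : itg (volume R) (fun y => rho t (x - y)).
 by have [] // := @cube_itg R (volume R) (x - t *: vec3 d) (eta * t) (fun y => rho t (x - y)) (fun A _ => lexx _).
have e1 : conv Omega (rho t) g x = \int[volume R]_y (rho t (x - y) * g y).
 by apply: (int_vol i1) => y nO; rewrite (rtest_out hg nO) mulr0.
rewrite indicE; case: (boolP (x \in _)) => [_|/negP nx]; last by have [-> ->] := far nx; rewrite subr0 mulr0 normr0 lexx.
rewrite mulr1 e1.
have [ic ec] := indicator_integral (cube_meas (x - t *: vec3 d) (eta * t)) (volume_cube (x - t *: vec3 d) (ltW et)).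
rewrite (_ : (2 * A) ^+ 3 * (L * D) * t = B * (L * (D * t)) * (2 * (eta * t)) ^+ 3); last first.
 by rewrite /B; field; rewrite !lt0r_neq0.
rewrite -ec; exact: (weighted_average i1 i2 (moll_integral d eta0 t0 x) ic pw).
Qed.

(** Approximate [f] by a test function, for which the mollifications converge uniformly, and bound the error by
the Schur test, uniformly in the scale. *)
Lemma moll_weak w f : l2 mu w -> l2 mu f -> forall e, 0 < e -> exists2 T, 0 < T & forall t, 0 < t -> t <= T ->
  `|int (fun x => w x * conv Omega (rho t) f x) - int (fun x => w x * f x)| <= e.
move=> hw hf e e0; have [C C0 sch] := moll_schur.
have sw := sq_ge0 mu w.
have e4 : 0 < e / 4 by rewrite divr_gt0.
have sw1 : 0 < sq w + 1 by rewrite ltr_wpDl.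
pose s := e / 4 / (C * (sq w + 1)).
have s0 : 0 < s by rewrite divr_gt0 // mulr_gt0.
pose dl := Num.min (e / 4 * s / C) ((e / 4) ^+ 2 / (sq w + 1)).
have dl0 : 0 < dl by rewrite lt_min; apply/andP; split; apply: divr_gt0 => //; [exact: mulr_gt0|exact: exprn_gt0].
have [g hg] := test_dense hf dl0; rewrite le_min => /andP[hfg1 hfg2].
have [[lg _] [C' [h [C'0 h0] near]]] := (rtest_itg Omega hg, moll_near hg).
pose W := int (fun x => `|w x * \1_(cube 0 h) x|).
have iW : itg mu (fun x => `|w x * \1_(cube 0 h) x|) by apply: itg_norm; apply: l2_itg_cube.
have W0 : 0 <= W by apply: int_ge0.
have CW : 0 < C' * W + 1 by rewrite ltr_wpDl // mulr_ge0.
exists (Num.min 1 (e / 4 / (C' * W + 1))).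
 by rewrite lt_min ltr01 divr_gt0.
move=> t t0; rewrite le_min => /andP[t1 te].
have lfg := l2B hf lg.
have [i1 b1] := sch t s w _ t0 s0 hw lfg.
have [i2 _] := sch t s w _ t0 s0 hw lg.
have i3 := l2_mul hw lg; have i4 := l2_mul hw lfg.
have ct u : l2 mu u -> forall x, itg mu (fun y => rho t (x - y) * u y).
 by move=> lu x; exact: conv_itg (moll_rtest d eta0 t0) lu.
have split_conv x : w x * conv Omega (rho t) f x =
  w x * conv Omega (rho t) (fun y => f y - g y) x + w x * conv Omega (rho t) g x.
 rewrite -mulrDr; congr (_ * _); rewrite /conv -intD; [|exact: ct|exact: ct]. by apply: eq_Rintegral => y _; ring.
have splitw x : w x * f x = w x * (f x - g x) + w x * g x by ring.
have -> : int (fun x => w x * conv Omega (rho t) f x) = int (fun x => w x * conv Omega (rho t) (fun y => f y - g y) x) + int (fun x => w x * conv Omega (rho t) g x).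
 by rewrite -(intD i1 i2); congr (Rintegral _ _ _); apply/funext.
have -> : int (fun x => w x * f x) = int (fun x => w x * (f x - g x)) + int (fun x => w x * g x).
 by rewrite -(intD i4 i3); congr (Rintegral _ _ _); apply/funext.
have B1 : `|int (fun x => w x * conv Omega (rho t) (fun y => f y - g y) x)| <= e / 2.
 apply: le_trans b1 _; rewrite mulrDr [e / 2](_ : _ = e / 4 + e / 4); last by field. apply: lerD.
  rewrite mulrA mulrC -[leRHS]mul1r (_ : C * s = e / 4 / (sq w + 1)).
   rewrite mulrCA [1 * _]mulrC ler_wpM2l ?(ltW e4) // ler_pdivrMr // mul1r lerDl //.
  by rewrite /s; field; rewrite !lt0r_neq0.
 by rewrite mulrA ler_pdivrMr // mulrC -ler_pdivlMr.
have B2 : `|int (fun x => w x * conv Omega (rho t) g x) - int (fun x => w x * g x)| <= e / 4.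
 rewrite -(intB i2 i3); apply: le_trans (norm_int_le (itgB i2 i3)) _. apply: le_trans (_ : C' * t * W <= _).
  rewrite /W -(intZ _ iW); apply: le_int; [exact: itg_norm (itgB i2 i3)|exact: itgZ|move=> x].
  rewrite -mulrBr !normrM mulrCA ler_wpM2l // (ger0_norm (x := \1_(cube 0 h) x)) ?near //.
 rewrite mulrAC; move: te; rewrite ler_pdivlMr // mulrC; apply: le_trans. by rewrite ler_wpM2r ?(ltW t0) // lerDl.
have B3 : `|int (fun x => w x * (f x - g x))| <= e / 4.
 rewrite -ler_sqr ?nnegrE ?normr_ge0 ?(ltW e4) // real_normK ?num_real //.
 apply: le_trans (l2_cs hw lfg) _; apply: le_trans (ler_wpM2l sw hfg2) _.
 by rewrite mulrCA ler_piMr ?exprn_ge0 ?(ltW e4) // ler_pdivrMr // mul1r lerDl.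
exact: abs_split B1 B2 B3.
Qed.
End Mollify.
End Density.

(** * Pushing inwards at a Lipschitz boundary *)
Section Cone.
Variables (R : realType) (Omega : domain R).
Notation mu := (vol Omega).
Notation O := (Omega : set (R3 R)).
Implicit Types (x y z : R3 R) (a b n : 'cV[R]_3).

Definition inward x0 (r eta : R) (d : 'I_3 -> R) := forall x y t, closure O x -> cube x0 r x ->
  0 < t -> t <= r -> cube (t *: vec3 d) (2 * (eta * t)) y -> O (x + y).

Lemma dotv_co a x : dotv a (to_col x) = \sum_i a i 0 * co i x.
by []. Qed.
Lemma dotv_coD a x y : dotv a (to_col (x + y)) = dotv a (to_col x) + dotv a (to_col y).
by rewrite !dotv_co -big_split /=; apply: eq_bigr => i _; rewrite coD mulrDr. Qed.
Lemma unit_entry a i : dotv a a = 1 -> `|a i 0| <= 1.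
rewrite /dotv (bigD1 i) //= => e.
have : a i 0 ^+ 2 <= 1.
 by rewrite -e expr2 lerDl sumr_ge0 // => j _; rewrite -expr2 sqr_ge0.
by rewrite -real_normK ?num_real // expr_le1.
Qed.

Lemma dotv_co_le a x s : dotv a a = 1 -> (forall i, `|co i x| <= s) -> `|dotv a (to_col x)| <= 3 * s.
move=> ha hx; rewrite dotv_co; apply: le_trans (ler_norm_sum _ _ _) _.
rewrite (_ : 3 * s = \sum_(i < 3) s); last by rewrite sumr_const card_ord mulr_natl.
apply: ler_sum => i _; rewrite normrM -[s]mul1r; apply: ler_pM => //; exact: unit_entry.
Qed.

Lemma lip2 (g : R * R -> R) L (p q : R * R) s : L.-lipschitz g -> `|p.1 - q.1| <= s -> `|p.2 - q.2| <= s ->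
  `|g p - g q| <= `|L| * s.
move=> /(_ (p, q) (conj I I)) /= h h1 h2; apply: le_trans h _.
have s0 : 0 <= s by exact: le_trans (normr_ge0 _) h1.
apply: le_trans (ler_wpM2r (normr_ge0 _) (ler_norm L)) _.
by rewrite ler_wpM2l // prod_normE ge_max h1.
Qed.

(** The domain lies above a Lipschitz graph over the plane orthogonal to [n], so a translation along [n], up to
a deviation small against the Lipschitz constant, stays above. *)
Lemma inward_boundary x0 : lipschitz_boundary Omega -> exists r eta d, 0 < r /\ 0 < eta /\ inward x0 r eta d.
move=> lb; have [cx|ncx] := pselect (closure O x0); last first.
 have oc : open (~` closure O) by apply: closed_openC; exact: closed_closure.
 have nb : nbhs x0 (~` closure O) by apply: open_nbhs_nbhs.
 have [r r0 hr] := nbhs_cube nb; exists r, 1, (fun=> 0); split => //; split => //. by move=> x y t clx /hr.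
have [ox|nox] := pselect (O x0).
 have nb : nbhs x0 O by apply: open_nbhs_nbhs; split => //; exact: domain_open.
 have [r r0 hr] := nbhs_cube nb; exists (r / 3), 1, (fun=> 0); split; first by rewrite divr_gt0.
 split => // x y t _ hx t0 tr hy; apply: hr => i; rewrite coD.
 have := hx i; have := hy i; rewrite co_dir mulr0 subr0 !ler_norml; lra.
have [] := lb x0; first by split => // /nbhs_singleton.
move=> a [b [n [g [L [[ha hb hn] [ab an bn] hg near]]]]].
have [p p0 hp] := nbhs_cube near.
have K0 : 0 < `|L| + 1 by rewrite ltr_wpDl.
pose eta := (12 * (`|L| + 1))^-1.
have eta0 : 0 < eta by rewrite invr_gt0 mulr_gt0.
have eta1 : eta <= 1.
 rewrite invf_le1 ?mulr_gt0 //; have := normr_ge0 L; lra.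
exists (p / 6), eta, (fun i => n i 0); split; first by rewrite divr_gt0.
split => // x y t clx hx t0 tr hy.
have hyi i : `|co i y - t * n i 0| <= 2 * (eta * t) by have := hy i; rewrite co_dir.
have xp : cube x0 (p / 2) x by move=> i; apply: le_trans (hx i) _; lra.
have xyp : cube x0 p (x + y).
 move=> i; rewrite coD; have := xp i; have := hyi i; have := unit_entry i hn.
 have et : eta * t <= t by rewrite ler_piMl // ltW.
 have : `|t * n i 0| <= t by rewrite normrM (gtr0_norm t0) ler_piMr ?unit_entry // ltW. rewrite !ler_norml; lra.
apply: (hp _ xyp).2; rewrite !dotv_coD.
have gx : g (dotv a (to_col x), dotv b (to_col x)) <= dotv n (to_col x).
 apply/ler_addgt0Pl => e e0. pose s := Num.min (p / 2) (e / (3 * (`|L| + 1))).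
 have s0 : 0 < s by rewrite lt_min !divr_gt0 // mulr_gt0. have [x' [Ox' hx']] := clx _ (cube_nbhs x s0).
 have x'p : cube x0 p x'.
  move=> i; have : `|co i x' - co i x| <= p / 2 by apply: le_trans (hx' i) _; rewrite ge_min lexx.
  by have := xp i; rewrite !ler_norml; lra.
 have := (hp _ x'p).1 Ox'. have dif c : dotv c c = 1 -> `|dotv c (to_col x) - dotv c (to_col x')| <= 3 * s.
  move=> hc; rewrite -[in dotv c (to_col x)](subrK x' x) dotv_coD addrK.
  by apply: dotv_co_le => // i; rewrite coB distrC; exact: hx'.
 have l := lip2 (p := (dotv a (to_col x), dotv b (to_col x))) (q := (dotv a (to_col x'), dotv b (to_col x'))) hg (dif a ha) (dif b hb).
 have ln := dif n hn. have bound : `|L| * (3 * s) + 3 * s <= e.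
  have -> : `|L| * (3 * s) + 3 * s = s * (3 * (`|L| + 1)) by ring.
  rewrite -ler_pdivlMr ?mulr_gt0 //; by rewrite ge_min lexx orbT.
 by move: l ln; rewrite !ler_norml; lra.
have split_y c : dotv c (to_col y) = t * dotv c n + dotv c (to_col (y - t *: vec3 (fun i => n i 0))).
 rewrite !dotv_co /dotv mulr_sumr -big_split /=; apply: eq_bigr => i _. by rewrite coB co_dir; ring.
have small c : dotv c c = 1 -> `|dotv c (to_col (y - t *: vec3 (fun i => n i 0)))| <= 3 * (2 * (eta * t)).
 by move=> hc; apply: dotv_co_le => // i; rewrite coB; exact: hy.
have sa : `|dotv a (to_col y)| <= 3 * (2 * (eta * t)) by rewrite split_y an mulr0 add0r; exact: small.
have sb : `|dotv b (to_col y)| <= 3 * (2 * (eta * t)) by rewrite split_y bn mulr0 add0r; exact: small.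
have sn := small n hn; have := split_y n; rewrite hn mulr1 => yn.
have l := @lip2 g L (dotv a (to_col x) + dotv a (to_col y), dotv b (to_col x) + dotv b (to_col y))
 (dotv a (to_col x), dotv b (to_col x)) (3 * (2 * (eta * t))) hg.
have {}l := l _ _; rewrite /= in l.
have {l} : `|g (dotv a (to_col x) + dotv a (to_col y), dotv b (to_col x) + dotv b (to_col y)) -
  g (dotv a (to_col x), dotv b (to_col x))| <= `|L| * (3 * (2 * (eta * t))).
 by apply: l; rewrite addrAC subrr add0r.
have e6 : (`|L| + 1) * (3 * (2 * (eta * t))) = t / 2 by rewrite /eta; field; rewrite lt0r_neq0.
move: sn gx e6; rewrite yn mulrDl mul1r !ler_norml; lra.
Qed.

Lemma omega_ae : {ae mu, forall x, O x}.
have [E [_ EO _ aeE]] := @ae_subset R Omega setT (aeW mu (fun _ => I)).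
by apply: filterS aeE.
Qed.

Lemma conv_out (k f : R3 R -> R) x : continuous k -> l2 mu f -> (forall y, O y -> k (x - y) * f y = 0) -> conv Omega k f x = 0.
move=> ck [mf _] h; rewrite /conv -[RHS](int0 mu); apply: eq_int_ae => //.
 apply: measurable_funM => //; apply: cont_mf => y.
 apply: (@continuous_comp _ _ _ (fun y : R3 R => x - y) k); last exact: ck.
 by apply: cvgB; [exact: cvg_cst|exact: cvg_id].
by apply: filterS omega_ae.
Qed.

(** If the kernel charges only inward displacements, the convolution at a point sees only domain points from
which that point is reached by moving inwards. So it vanishes near the complement of the domain. *)
Lemma push_test x0 : lipschitz_boundary Omega -> exists r eta d, 0 < r /\ 0 < eta /\
  forall t (chi k f : R3 R -> R), 0 < t -> t <= r -> sm chi -> (forall x, ~ cube x0 r x -> chi x = 0) -> rtest setT k ->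
    (forall z, ~ cube (t *: vec3 d) (2 * (eta * t)) z -> k z = 0) -> l2 mu f ->
    rtest Omega (fun x => chi x * conv Omega k f x) /\ rtest Omega (conv Omega k (fun y => chi y * f y)).
move=> lb; have [p [eta [d [p0 [eta0 hin]]]]] := inward_boundary x0 lb.
pose D := \sum_i `|d i| + 2 * eta + 1.
have D1 : 1 <= D by rewrite lerDr addr_ge0 ?sumr_ge0 // mulr_ge0 // ltW.
have D0 : 0 < D by exact: lt_le_trans D1.
have Di i : `|d i| + 2 * eta <= D - 1 by rewrite /D addrK lerD2r (bigD1 i) //= lerDl sumr_ge0.
exists (p / (2 * D)), eta, d; split; first by rewrite divr_gt0 // mulr_gt0.
split => // t chi k f t0 tr schi chi0 hk k0 hf.
have pD : p / (2 * D) * D = p / 2 by field; rewrite lt0r_neq0.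
have rp2 : p / (2 * D) <= p / 2 by rewrite -pD ler_peMr // divr_ge0 ?ltW // mulr_gt0.
have tp : t <= p by move: tr; lra.
have tD : t * D <= p / 2 by rewrite -pD ler_wpM2r // ltW.
pose K1 := closure O `&` cube x0 p; pose K2 := cube (t *: vec3 d) (2 * (eta * t)).
pose K := (fun q : R3 R * R3 R => q.1 + q.2) @` (K1 `*` K2).
have cK : compact K.
 apply: continuous_compact.
  apply: continuous_subspaceT => q; apply: cvgD; [exact: cvg_fst|exact: cvg_snd].
 apply: compact_setX; last exact: cube_compact.
 by rewrite /K1 setIC; apply: compact_closedI; [exact: cube_compact|exact: closed_closure].
have KO : K `<=` O by move=> _ [[x y] [/= [cx hx] hy] <-]; exact: (hin x y t).
have KI x y : O y -> cube x0 p y -> K2 (x - y) -> K x.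
 move=> Oy hy hxy; exists (y, x - y); last by rewrite /= addrC subrK.
 by split => //=; split => //; exact: subset_closure.
have ck : continuous k by apply: sm_cts; case: hk.
have [M [_ chiB]] : exists M, 0 < M /\ forall x, `|chi x| <= M.
 have : rtest setT chi by split => //; exists (cube x0 (p / (2 * D))) => //; split => //; exact: cube_compact.
 by case/rtest_bd => M M0 hM; exists M.
have lcf : l2 mu (fun y => chi y * f y).
 by apply: l2M chiB hf; apply: cont_mf; exact: sm_cts.
split; (split; first by (try apply: smoothM => //); apply: (conv_sm hk)); exists K => // x nK.
 have [cx|/chi0 ->] := pselect (cube x0 (p / (2 * D)) x); last by rewrite mul0r.
 rewrite conv_out ?mulr0 // => y Oy; rewrite k0 ?mul0r // => hz; apply: nK; apply: (KI x y Oy) => // i.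
 have := cx i; have := hz i; rewrite co_dir coB => h1 h2. have tdi : `|t * d i| + 2 * (eta * t) <= t * D - t.
  by have := Di i; rewrite normrM (gtr0_norm t0) -(ler_pM2l t0); lra.
 have p12 : p / (2 * D) <= t * 0 + p / 2 by rewrite mulr0 add0r.
 have := ler_norm (t * d i); have := ler_norm (- (t * d i)); rewrite normrN. by move: h1 h2; rewrite !ler_norml; lra.
rewrite conv_out // => y Oy; have [cy|/chi0 ->] := pselect (cube x0 (p / (2 * D)) y); last by rewrite mul0r mulr0.
rewrite k0 ?mul0r // => hz; apply: nK; apply: (KI x y Oy) => // i.
by apply: le_trans (cy i) _; move: rp2; lra.
Qed.
End Cone.

(** * Weak curl and divergence in real components *)
Section WeakForms.
Variables (R : realType) (Omega : domain R).
Notation C := R[i].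
Notation H := (L2 Omega).
Notation mu := (vol Omega).
Notation int f := (\int[mu]_x f x).
Notation V := (R3 R -> 'cV[C]_3).
Notation F3 := ('I_3 -> R3 R -> R).
Notation rp := (@rp R Omega).
Notation sqi := (sqi Omega).
Implicit Types (a b c al be : F3) (psi th : R3 R -> R).

Definition l2v a := forall i, l2 mu (a i).
Definition pair a b : R := \sum_m int (fun x => a m x * b m x).
Definition rcurl al : F3 := fun m x => pd (m + 1) (al (m + 2%:R)) x - pd (m + 2%:R) (al (m + 1)) x.
Definition rgrad psi : F3 := fun m x => pd m psi x.
Definition tests (U : set (R3 R)) al := forall m, rtest U (al m).
Definition weak_curl U a c := forall al, tests U al -> pair c al = pair a (rcurl al).
Definition weak_div0 a := forall psi, rtest Omega psi -> pair a (rgrad psi) = 0.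

Lemma rtest_l2 U psi : rtest U psi -> l2 mu psi.
by move=> h; have [] := rtest_itg Omega h. Qed.
Lemma tests_l2 U al : tests U al -> l2v al.
by move=> h m; exact: rtest_l2 (h m). Qed.
Lemma rcurl_tests U al : tests U al -> tests U (rcurl al).
move=> h m; rewrite /rcurl (_ : (fun x => _) = (fun x => pd (m + 1) (al (m + 2%:R)) x + (-1) * pd (m + 2%:R) (al (m + 1)) x)).
 apply: rtestD; first exact: rtest_pd. by apply: rtestMl; [exact: smooth_cst|exact: rtest_pd].
by apply/funext => x; rewrite mulN1r.
Qed.

Lemma rgrad_tests U psi : rtest U psi -> tests U (rgrad psi).
by move=> h m; exact: rtest_pd. Qed.
Lemma pairDr a b b' : l2v a -> l2v b -> l2v b' -> pair a (fun m x => b m x + b' m x) = pair a b + pair a b'.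
move=> ha hb hb'; rewrite /pair -big_split; apply: eq_bigr => m _ /=.
by under eq_fun do rewrite mulrDr; rewrite intD //; exact: l2_mul.
Qed.

Definition only m psi : F3 := fun i x => if i == m then psi x else 0.

Lemma rtest0 U : rtest U (fun=> 0 : R).
split; first exact: smooth_cst.
by exists set0 => //; split; [exact: compact0|exact: sub0set].
Qed.

Lemma only_tests U m psi : rtest U psi -> tests U (only m psi).
by move=> h i; rewrite /only; case: (i == m) => //; exact: rtest0. Qed.
Lemma pair_only a m psi : pair a (only m psi) = int (fun x => a m x * psi x).
rewrite /pair (bigD1 m) //= /only eqxx big1 ?addr0 // => i /negPf ->.
by under eq_fun do rewrite mulr0; exact: int0.
Qed.

Lemma weak_curl1 U a c m psi : l2v a -> weak_curl U a c -> rtest U psi ->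
  int (fun x => c m x * psi x) =
  int (fun x => a (m + 1) x * pd (m + 2%:R) psi x) - int (fun x => a (m + 2%:R) x * pd (m + 1) psi x).
move=> la hc hp; have := hc _ (only_tests m hp); rewrite pair_only => ->.
have z f : int (fun x => f x * 0) = 0 by under eq_fun do rewrite mulr0; exact: int0.
have pz i : (fun x => pd i (fun=> 0 : R) x) = fun=> 0 by apply/funext => x; exact: pd_cst.
have e0 i : rcurl (only m psi) i =
  fun x => (if i == m + 1 then pd (m + 2%:R) psi x else 0) - (if i == m + 2%:R then pd (m + 1) psi x else 0).
 apply/funext => x; rewrite /rcurl /only.
 have -> : (i + 2%:R == m) = (i == m + 1) by move: (i) (m); apply: I3P; apply: I3P.
 have -> : (i + 1 == m) = (i == m + 2%:R) by move: (i) (m); apply: I3P; apply: I3P.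
 have em1 : i == m + 1 -> i + 1 = m + 2%:R by move: (i) (m); apply: I3P; apply: I3P => //= _; apply/val_inj.
 have em2 : i == m + 2%:R -> i + 2%:R = m + 1 by move: (i) (m); apply: I3P; apply: I3P => //= _; apply/val_inj.
 case: (boolP (i == m + 1)) => [/em1 ->|_]; case: (boolP (i == m + 2%:R)) => [/em2 ->|_]; by rewrite ?pd_cst.
rewrite /pair (bigD1 (m + 1)) //= (bigD1 (m + 2%:R)) //=; last by move: (m); apply: I3P.
have n12 : (m + 1 == m + 2%:R) = false by move: (m); apply: I3P.
have n21 : (m + 2%:R == m + 1) = false by move: (m); apply: I3P.
rewrite !e0 !eqxx n12 n21 big1 ?addr0; last first.
 move=> i /andP[/negPf n1 /negPf n2]; rewrite e0 n1 n2. by under eq_fun do rewrite subrr; exact: z.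
congr (_ + _); first by under eq_fun do rewrite subr0.
under eq_fun do rewrite sub0r mulrN.
by rewrite intN //; apply: l2_mul => //; exact: rtest_l2 (rtest_pd _ hp).
Qed.

Lemma integralC_dotv (w phi : V) : sqi w -> sqi phi ->
  integralC Omega (fun x => dotv (w x) (phi x)) =
  Complex (pair (re w) (re phi) - pair (im w) (im phi)) (pair (re w) (im phi) + pair (im w) (re phi)).
move=> hw hp.
have i1 m := l2_mul (hw m).1 (hp m).1; have i2 m := l2_mul (hw m).2 (hp m).2.
have i3 m := l2_mul (hw m).1 (hp m).2; have i4 m := l2_mul (hw m).2 (hp m).1.
rewrite /integralC /pair; congr Complex.
 rewrite -sumrB -[RHS](eq_bigr _ (fun m _ => intB (i1 m) (i2 m))) -int_sum => [|m]; last exact: itgB.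
 apply: eq_Rintegral => x _; rewrite /dotv Re_sum; apply: eq_bigr => m _.
 by rewrite /re /im; case: (w x m 0) (phi x m 0) => [? ?] [? ?].
rewrite -big_split -[RHS](eq_bigr _ (fun m _ => intD (i3 m) (i4 m))) -int_sum => [|m]; last exact: itgD.
apply: eq_Rintegral => x _; rewrite /dotv Im_sum; apply: eq_bigr => m _.
by rewrite /re /im; case: (w x m 0) (phi x m 0) => [? ?] [? ?].
Qed.

Lemma test_fieldP U (phi : V) : test_field U phi <-> tests U (re phi) /\ tests U (im phi).
split=> [h|[h1 h2] i]; first by split => i; have [] := (test_funP _ _).1 (h i).
by apply/test_funP; split; [exact: h1|exact: h2].
Qed.

Lemma tests_sqi U (phi : V) : tests U (re phi) -> tests U (im phi) -> sqi phi.
by move=> h1 h2 i; split; [exact: rtest_l2 (h1 i)|exact: rtest_l2 (h2 i)]. Qed.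
Lemma curl_fieldE (phi : V) x m : curl_field phi x m 0 =
  partial (m + 1) (fun y => phi y (m + 2%:R) 0) x - partial (m + 2%:R) (fun y => phi y (m + 1) 0) x.
have e0 : inord 0 = 0 :> 'I_3 by apply/val_inj; rewrite /= inordK.
have e1 : inord 1 = 1 :> 'I_3 by apply/val_inj; rewrite /= inordK.
have e2 : inord 2 = 2%:R :> 'I_3 by apply/val_inj; rewrite /= inordK.
have a0 : (1 + 2%:R = 0 :> 'I_3) * (2%:R + 1 = 0 :> 'I_3) * (2%:R + 2%:R = 1 :> 'I_3) * (1 + 1 = 2%:R :> 'I_3).
 by do !split; apply/val_inj.
by rewrite mxE e0 e1 e2; move: m; apply: I3P; rewrite /= ?add0r ?a0.
Qed.

Lemma re_curl (phi : V) : re (curl_field phi) = rcurl (re phi).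
by apply/funext => m; apply/funext => x; rewrite /re curl_fieldE. Qed.
Lemma im_curl (phi : V) : im (curl_field phi) = rcurl (im phi).
by apply/funext => m; apply/funext => x; rewrite /im curl_fieldE. Qed.
Lemma pair0r a : pair a (fun _ _ => 0) = 0.
by rewrite /pair big1 // => m _; under eq_fun do rewrite mulr0; exact: int0. Qed.
Lemma rcurl0 : rcurl (fun _ _ => 0) = (fun _ _ => 0).
by apply/funext => m; apply/funext => x; rewrite /rcurl !pd_cst subr0. Qed.
Lemma weak_curl_fieldP U (u w : H) :
  (forall phi, test_field U phi -> integralC Omega (fun x => dotv (w x) (phi x)) =
     integralC Omega (fun x => dotv (u x) (curl_field phi x))) <->
  weak_curl U (re u) (re w) /\ weak_curl U (im u) (im w).
have [su sw] := (L2_sqi u, L2_sqi w); split=> [h|[h1 h2] phi /test_fieldP[t1 t2]].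
 have hh al : tests U al -> pair (re w) al = pair (re u) (rcurl al) /\ pair (im w) al = pair (im u) (rcurl al).
  move=> hal; pose phi := mkc al (fun _ _ => 0). have t1 : tests U (re phi) by move=> i; rewrite re_mkc.
  have t2 : tests U (im phi) by move=> i; rewrite im_mkc; exact: rtest0.
  have er : re phi = al by apply/funext => i; rewrite re_mkc.
  have ei : im phi = (fun _ _ => 0) by apply/funext => i; rewrite im_mkc.
  have := h phi ((test_fieldP _ _).2 (conj t1 t2)). rewrite integralC_dotv //; last exact: tests_sqi t1 t2.
  rewrite integralC_dotv //; last first.
   by apply: (@tests_sqi U); rewrite ?re_curl ?im_curl; exact: rcurl_tests.
  by rewrite re_curl im_curl er ei rcurl0 !pair0r !subr0 !add0r => -[].
 by split => al hal; have [] := hh al hal.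
have sc : sqi (curl_field phi).
 by apply: (@tests_sqi U); rewrite ?re_curl ?im_curl; exact: rcurl_tests.
rewrite !integralC_dotv //; last exact: tests_sqi t1 t2.
by rewrite re_curl im_curl !(h1 _ t1, h1 _ t2, h2 _ t1, h2 _ t2).
Qed.

Lemma curlP (u w : H) : curl (u, w) <-> weak_curl Omega (re u) (re w) /\ weak_curl Omega (im u) (im w).
exact: weak_curl_fieldP. Qed.
Lemma curl0P (u w : H) : curl0 (u, w) <-> weak_curl setT (re u) (re w) /\ weak_curl setT (im u) (im w).
rewrite -weak_curl_fieldP; have [su sw] := (L2_sqi u, L2_sqi w).
have tr phi : test_field setT phi -> tangential_trace u w phi =
  integralC Omega (fun x => dotv (w x) (phi x)) - integralC Omega (fun x => dotv (u x) (curl_field phi x)).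
 move=> /test_fieldP[t1 t2]. have sp : sqi phi by exact: tests_sqi t1 t2. have sc : sqi (curl_field phi).
  by apply: (@tests_sqi setT); rewrite ?re_curl ?im_curl; exact: rcurl_tests.
 have it (f g : V) : sqi f -> sqi g -> itg mu (fun x => complex.Re (dotv (f x) (g x))) /\ itg mu (fun x => complex.Im (dotv (f x) (g x))).
  move=> hf hg; have i1 m := l2_mul (hf m).1 (hg m).1; have i2 m := l2_mul (hf m).2 (hg m).2.
  have i3 m := l2_mul (hf m).1 (hg m).2; have i4 m := l2_mul (hf m).2 (hg m).1; split.
   rewrite (_ : (fun x => _) = (fun x => \sum_m (re f m x * re g m x - im f m x * im g m x))).
    by apply: itg_sum => m; exact: itgB.
   apply/funext => x; rewrite /dotv Re_sum; apply: eq_bigr => m _.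
   by rewrite /re /im; case: (f x m 0) (g x m 0) => [? ?] [? ?].
  rewrite (_ : (fun x => _) = (fun x => \sum_m (re f m x * im g m x + im f m x * re g m x))).
   by apply: itg_sum => m; exact: itgD.
  apply/funext => x; rewrite /dotv Im_sum; apply: eq_bigr => m _.
  by rewrite /re /im; case: (f x m 0) (g x m 0) => [? ?] [? ?].
 have [j1 j2] := it _ _ sw sp; have [j3 j4] := it _ _ su sc.
 rewrite /tangential_trace /integralC; apply/eqP; rewrite eq_complex /=; apply/andP; split; apply/eqP.
  by rewrite -intB //; apply: eq_Rintegral => x _; case: (dotv _ _) (dotv _ _) => [? ?] [? ?].
 by rewrite -intB //; apply: eq_Rintegral => x _; case: (dotv _ _) (dotv _ _) => [? ?] [? ?].
split=> [[_ h] phi hp|h].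
 by apply/eqP; rewrite -subr_eq0 -tr //; apply/eqP; exact: h.
split=> [phi hp|phi hp].
 by apply: h => i; have := hp i; rewrite !test_funP => -[h1 h2]; split; apply: rtestW; [|exact: h1| |exact: h2].
by rewrite tr // h // subrr.
Qed.

Lemma Hdiv0P (u : H) : Hdiv0 Omega u <-> weak_div0 (re u) /\ weak_div0 (im u).
have su := L2_sqi u; have rg phi : re (grad phi) = rgrad (fun x => complex.Re (phi x)).
 by apply/funext => m; apply/funext => x; rewrite /re mxE.
have ig phi : im (grad phi) = rgrad (fun x => complex.Im (phi x)).
 by apply/funext => m; apply/funext => x; rewrite /im mxE.
have sg phi : test_fun Omega phi -> sqi (grad phi).
 by move=> /test_funP[t1 t2]; apply: (@tests_sqi Omega); rewrite ?rg ?ig; exact: rgrad_tests.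
split=> [h|[h1 h2] phi hp].
 have hh psi : rtest Omega psi -> pair (re u) (rgrad psi) = 0 /\ pair (im u) (rgrad psi) = 0.
  move=> hpsi; have tp : test_fun Omega (fun x => (psi x)%:C%C).
   by apply/test_funP; split => //; exact: rtest0.
  have := h _ tp; rewrite integralC_dotv //; last exact: sg.
  rewrite rg ig /= (_ : rgrad (fun=> 0) = (fun _ _ => 0)); last by apply/funext => m; apply/funext => x; exact: pd_cst.
  by rewrite !pair0r subr0 add0r => -[].
 by split => psi hpsi; have [] := hh psi hpsi.
rewrite integralC_dotv //; last exact: sg.
have [t1 t2] := (test_funP _ _).1 hp.
by rewrite rg ig !(h1 _ t1, h1 _ t2, h2 _ t1, h2 _ t2) subrr addr0.
Qed.

Lemma rp_pair (u v : H) (f g : V) : sqi f -> sqi g -> {ae mu, forall x, u x = f x} -> {ae mu, forall x, v x = g x} ->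
  rp u v = pair (re f) (re g) + pair (im f) (im g).
by move=> hf hg eu ev; rewrite (rp_sum hf hg eu ev) big_split. Qed.
End WeakForms.

(** * Cutoffs *)
Section Cutoffs.
Variable R : realType.
Implicit Types (x c : R3 R).

Lemma finite_cover (K : set (R3 R)) (r : R3 R -> R) : compact K -> (forall c, 0 < r c) ->
  exists s : seq (R3 R), forall x, K x -> exists2 c, c \in s & cube c (r c) x.
move=> cK r0.
have : cover_compact K by rewrite -compact_cover.
move=> /(_ (R3 R) K (fun c => interior (cube c (r c)))) [].
- by move=> c _; exact: open_interior.
- by move=> x Kx; exists x => //; exact: cube_nbhs.
move=> D _ hD; exists (finmap.enum_fset D) => x /hD[c /= cD /nbhs_singleton cx].
by exists c.
Qed.

Definition bell (s : R) : R := step (2 - 2 * s) * step (2 + 2 * s).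

Lemma bell_smooth : smooth [set (1 : R)] bell.
have aff (u v : R) : smooth [set (1 : R)] (fun s : R => step (u + v * s)).
 apply: (smooth_affine (l := fun s : R => u + v * s) step_smooth).
  move=> s; apply: cvgD; [exact: cvg_cst|apply: cvgM; [exact: cvg_cst|exact: cvg_id]].
 move=> w ->; exists v, 1; split => // s h; rewrite /GRing.scale /=; ring.
apply: smoothM; last exact: aff.
by rewrite (_ : (fun s => _) = (fun s : R => step (2 + (-2) * s))) //; apply/funext => s; rewrite mulNr.
Qed.

Lemma bell_bounds s : 0 <= bell s <= 1.
by rewrite mulr_ge0 ?step_ge0 //= mulr_ile1 ?step_ge0 ?step_le1. Qed.
Lemma bell_in s : `|s| <= 1 / 2 -> bell s = 1.
by rewrite ler_norml => h; rewrite /bell !step_ge1 ?mulr1 //; lra. Qed.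
Lemma bell_out s : ~ `|s| <= 1 -> bell s = 0.
rewrite ler_norml => h; rewrite /bell; have [s1|s1] := leP s 1; last by rewrite step_le0 ?mul0r //; lra.
by rewrite [X in _ * X]step_le0 ?mulr0 //; have [|//] := leP (-1) s; [move=> s2; case: h; rewrite s1 s2|lra].
Qed.

Lemma dbell_bounded : exists2 M, 0 < M & forall s, `|'D_1 bell s| <= M.
have cd : continuous (fun s => 'D_1 bell s).
 by apply: (@smooth_cts _ _ [set (1 : R)]); apply: smooth_D => //; exact: bell_smooth.
have [M [_ hM]] : bounded_set ((fun s => 'D_1 bell s) @` `[-2, 2]%classic).
 by apply: compact_bounded; apply: continuous_compact; [exact: continuous_subspaceT|exact: segment_compact].
have M1 : `|M| < `|M| + 1 by rewrite ltrDl.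
exists (`|M| + 1) => [|s]; first by rewrite (le_lt_trans (normr_ge0 M)).
have [s01|ns] := pselect (-2 <= s <= 2).
 by apply: hM; [rewrite (le_lt_trans (ler_norm _))|exists s => //; rewrite /= in_itv].
rewrite (@near_eq_derive _ _ _ bell (cst 0)) ?derive_cst ?normr0 ?addr_ge0 ?oner_eq0 //.
have out r : (r < -1 \/ 1 < r) -> bell r = 0.
 by move=> h; apply: bell_out; rewrite ler_norml => /andP[u v]; case: h; rewrite ltNge ?u ?v.
have [s1|s1] := leP s 0.
 by near=> r; apply: out; left; near: r; apply: lt_nbhsl; rewrite ltNge; apply/negP => h; apply: ns; lra.
by near=> r; apply: out; right; near: r; apply: lt_nbhsr; rewrite ltNge; apply/negP => h; apply: ns; lra.
Unshelve. all: by end_near.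
Qed.

Definition plateau c r : R3 R -> R := prodf (fun j s => bell ((s - co j c) / r)).

Section Plateau.
Variables (c : R3 R) (r : R).
Hypothesis r0 : 0 < r.

Let comp_smooth j : smooth [set (1 : R)] (fun s : R => bell ((s - co j c) / r)).
apply: (smooth_affine (l := fun s : R => (s - co j c) / r) bell_smooth).
 move=> s; apply: cvgM; last exact: cvg_cst. by apply: cvgB; [exact: cvg_id|exact: cvg_cst].
move=> v ->; exists r^-1, 1; split => // s h.
by rewrite /GRing.scale /=; ring.
Qed.

Let comp_out j s : ~ `|s - co j c| <= r -> bell ((s - co j c) / r) = 0.
by move=> h; apply: bell_out; rewrite normrM normfV (gtr0_norm r0) ler_pdivrMr // mul1r. Qed.
Lemma plateau_out x : ~ cube c r x -> plateau c r x = 0.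
exact: prodf_out comp_out. Qed.
Lemma plateau_rtest : rtest setT (plateau c r).
exact: prodf_rtest comp_smooth comp_out. Qed.
Lemma plateau_in x : cube c (r / 2) x -> plateau c r x = 1.
move=> hx; rewrite /plateau /prodf big1 // => j _; apply: bell_in.
by rewrite normrM normfV (gtr0_norm r0) ler_pdivrMr // mulrC; have := hx j; rewrite mul1r.
Qed.

Lemma plateau_ge0 x : 0 <= plateau c r x.
by apply: prodr_ge0 => j _; have /andP[] := bell_bounds ((co j x - co j c) / r). Qed.
Lemma plateau_le1 x : plateau c r x <= 1.
by apply: prodr_ile1 => j _; exact: bell_bounds. Qed.
Lemma pd_plateau M i x : (forall s, `|'D_1 bell s| <= M) -> `|pd i (plateau c r) x| <= M / r.
move=> hM.
have dc j s : is_derive s (1 : R) (fun s : R => bell ((s - co j c) / r)) ('D_1 bell ((s - co j c) / r) / r).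
 have h : is_derive s (1 : R) (fun s : R => (s - co j c) / r) r^-1.
  rewrite (_ : (fun s : R => _) = r^-1 *: (fun s : R => s - co j c)).
   rewrite -[X in is_derive _ _ _ X]mulr1; apply: is_deriveZ.
   by rewrite -[X in is_derive _ _ _ X]subr0; apply: is_deriveB.
  by apply/funext => q; rewrite /GRing.scale /= mulrC.
 by apply: (@is_derive1_comp _ bell (fun s => (s - co j c) / r)) => //; apply: (smooth_der _ bell_smooth).
rewrite /plateau (@pd_prodf _ _ (fun j s => 'D_1 bell ((s - co j c) / r) / r) i x (dc i)).
rewrite (bigD1 i) //= eqxx !normrM normfV (gtr0_norm r0) -[leRHS]mulr1; apply: ler_pM => //.
- by rewrite mulr_ge0 // invr_ge0 ltW.
- by rewrite ler_wpM2r // invr_ge0 ltW.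
rewrite normr_prod; apply: prodr_ile1 => j /negPf ->.
by rewrite normr_ge0 /=; have /andP[b0 b1] := bell_bounds ((co j x - co j c) / r); rewrite ger0_norm.
Qed.
End Plateau.
End Cutoffs.

(** * The two curls are adjoint *)
Section Adjoint.
Variables (R : realType) (Omega : domain R).
Notation mu := (vol Omega).
Notation int f := (\int[mu]_x f x).
Notation F3 := ('I_3 -> R3 R -> R).
Notation l2v := (l2v Omega).
Notation pair := (pair Omega).
Notation weak_curl := (weak_curl Omega).
Implicit Types (a b c w al : F3) (psi chi : R3 R -> R).

Lemma pairE a b : l2v a -> l2v b -> itg mu (fun x => \sum_m a m x * b m x) /\ pair a b = int (fun x => \sum_m a m x * b m x).
move=> ha hb; have i m := l2_mul (ha m) (hb m); split; first exact: itg_sum.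
by rewrite int_sum.
Qed.

Definition mulv chi a : F3 := fun m x => chi x * a m x.
Definition gradx chi w : F3 := fun m x => pd (m + 1) chi x * w (m + 2%:R) x - pd (m + 2%:R) chi x * w (m + 1) x.
Definition curl_mul chi w b : F3 := fun m x => chi x * b m x + gradx chi w m x.

Lemma rtest_mul_l2 U chi f : rtest U chi -> l2 mu f -> l2 mu (fun x => chi x * f x).
move=> hc hf; have [M M0 hM] := rtest_bd hc; apply: l2M hM hf.
by apply: sm_mf; case: hc.
Qed.

Lemma mulv_l2 U chi a : rtest U chi -> l2v a -> l2v (mulv chi a).
by move=> hc ha m; exact: rtest_mul_l2 hc (ha m). Qed.
Lemma gradx_l2 U chi w : rtest U chi -> l2v w -> l2v (gradx chi w).
by move=> hc hw m; apply: l2B; apply: (rtest_mul_l2 (U := U)) => //; exact: rtest_pd. Qed.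
Lemma curl_mul_l2 U chi w b : rtest U chi -> l2v w -> l2v b -> l2v (curl_mul chi w b).
by move=> hc hw hb m; apply: l2D; [exact: rtest_mul_l2 hc (hb m)|exact: (gradx_l2 hc hw m)]. Qed.
Lemma I3E : (1 + 2%:R = 0 :> 'I_3) * (2%:R + 1 = 0 :> 'I_3) * (2%:R + 2%:R = 1 :> 'I_3) * (1 + 1 = 2%:R :> 'I_3) *
  (0 + 1 = 1 :> 'I_3) * (0 + 2%:R = 2%:R :> 'I_3).
by do !split; apply/val_inj. Qed.
Lemma weak_curl_mul U chi w b : rtest setT chi -> l2v w -> l2v b -> weak_curl U w b ->
  weak_curl U (mulv chi w) (curl_mul chi w b).
move=> hc hw hb h al hal; have [sc _] := hc.
have tc : tests U (fun m x => chi x * al m x) by move=> m; exact: rtestMl sc (hal m).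
have := h _ tc.
have [l1 l2] := (tests_l2 Omega tc, tests_l2 Omega (rcurl_tests tc)).
have [l3 l4] := (tests_l2 Omega hal, tests_l2 Omega (rcurl_tests hal)).
have [l5 l6] := (curl_mul_l2 hc hw hb, mulv_l2 hc hw).
have [i1 ->] := pairE hb l1; have [i2 ->] := pairE hw l2.
have [i3 ->] := pairE l5 l3; have [i4 ->] := pairE l6 l4.
move=> e.
have k1 := intB i3 i1; have k2 := intB i4 i2; rewrite -e in k2.
apply: (addIr (- int (fun x => \sum_m b m x * (chi x * al m x)))); rewrite -k1 -k2.
apply: eq_Rintegral => x _.
have rc m : rcurl (fun m x => chi x * al m x) m x = chi x * rcurl al m x +
  (pd (m + 1) chi x * al (m + 2%:R) x - pd (m + 2%:R) chi x * al (m + 1) x).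
 have s i := (hal i).1; rewrite /rcurl !pdM //; ring.
rewrite !sum3 !rc /curl_mul /gradx /mulv !I3E; ring.
Qed.

Lemma conv_curl k w b m x : l2v w -> l2v b -> weak_curl setT w b -> rtest setT k ->
  rcurl (fun m => conv Omega k (w m)) m x = conv Omega k (b m) x.
move=> hw hb h hk.
have := weak_curl1 m hw h (rtest_refl x hk).
rewrite /rcurl (pd_conv _ _ hk (hw _)) (pd_conv _ _ hk (hw _)) /conv.
have sk := hk.1.
under eq_fun do rewrite mulrC; move=> ->.
have e i f : l2 mu f -> int (fun y => f y * pd i (fun z => k (x - z)) y) = - int (fun y => pd i k (x - y) * f y).
 move=> hf; rewrite -(intN (conv_itg x (rtest_pd i hk) hf)); apply: eq_Rintegral => y _.
 by rewrite pd_refl // mulrN mulrC.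
by rewrite !e // opprK addrC.
Qed.

Lemma dbl_lim (u v : R -> R) p q : (forall e, 0 < e -> exists2 T, 0 < T & forall t, 0 < t -> t <= T -> `|u t - p| <= e) ->
  (forall e, 0 < e -> exists2 T, 0 < T & forall t, 0 < t -> t <= T -> `|v t - q| <= e) ->
  (exists2 T, 0 < T & forall t, 0 < t -> t <= T -> u t = v t) -> p = q.
move=> hu hv [T T0 hT]; apply/eqP; rewrite -subr_eq0 -normr_le0; apply/ler_addgt0Pl => e e0; rewrite addr0.
have e2 : 0 < e / 2 by rewrite divr_gt0.
have [Tu Tu0 hu'] := hu _ e2; have [Tv Tv0 hv'] := hv _ e2.
pose t := Num.min T (Num.min Tu Tv).
have t0 : 0 < t by rewrite !lt_min T0 Tu0 Tv0.
have [t1 [t2 t3]] : t <= T /\ t <= Tu /\ t <= Tv by rewrite /t !ge_min !lexx !orbT.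
have := hu' t t0 t2; have := hv' t t0 t3; rewrite (hT t t0 t1) !ler_norml; lra.
Qed.

Lemma pair_moll d eta a b : 0 < eta -> l2v a -> l2v b -> forall e, 0 < e -> exists2 T, 0 < T &
  forall t, 0 < t -> t <= T -> `|pair a (fun m => conv Omega (moll d eta t) (b m)) - pair a b| <= e.
move=> eta0 ha hb e e0; have e3 : 0 < e / 3 by rewrite divr_gt0.
have [T0 T00 h0] := moll_weak d eta0 (ha 0) (hb 0) e3.
have [T1 T10 h1] := moll_weak d eta0 (ha 1) (hb 1) e3.
have [T2 T20 h2] := moll_weak d eta0 (ha 2%:R) (hb 2%:R) e3.
exists (Num.min T0 (Num.min T1 T2)); first by rewrite !lt_min T00 T10 T20.
move=> t t0; rewrite !le_min => /and3P[t1 t2 t3].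
have := h0 t t0 t1; have := h1 t t0 t2; have := h2 t t0 t3.
rewrite /pair !sum3.
move: (int (fun x => a 0 x * conv _ _ _ x)) (int (fun x => a 0 x * b 0 x)).
move: (int (fun x => a 1 x * conv _ _ _ x)) (int (fun x => a 1 x * b 1 x)).
move: (int (fun x => a 2%:R x * conv _ _ _ x)) (int (fun x => a 2%:R x * b 2%:R x)) => p q p' q' p'' q''.
rewrite !ler_norml; lra.
Qed.

Hypothesis lb : lipschitz_boundary Omega.
Variables a c w b : F3.
Hypotheses (la : l2v a) (lc : l2v c) (lw : l2v w) (l_b : l2v b) (hac : weak_curl Omega a c)
  (hwb : weak_curl setT w b).

Definition defect chi := pair c (mulv chi w) - pair a (curl_mul chi w b).

(** Mollified inwards, the cut-off field becomes an admissible test field for the curl on [Omega]. *)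
Lemma defect_local x0 : exists2 r, 0 < r & forall chi, sm chi -> (forall x, ~ cube x0 r x -> chi x = 0) -> defect chi = 0.
have [r [eta [d [r0 [eta0 hpush]]]]] := push_test x0 lb; exists r => // chi schi chi0.
have tchi : rtest setT chi.
 by split => //; exists (cube x0 r) => //; split => //; exact: cube_compact.
have [l1 l2] := (mulv_l2 tchi lw, curl_mul_l2 tchi lw l_b).
apply/eqP; rewrite subr_eq0; apply/eqP.
apply: (dbl_lim (pair_moll d eta0 lc l1) (pair_moll d eta0 la l2)).
exists r; first exact: r0.
move=> t t0 tr.
have hk := moll_rtest d eta0 t0.
have k0 z : ~ cube (t *: vec3 d) (2 * (eta * t)) z -> moll d eta t z = 0.
 have [A A0 hA] := @dstep_bounded R => nz; have := moll_bound d eta0 t0 z hA.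
 rewrite indicE memNset ?mulr0 ?normr_le0 => [/eqP //|hz]; apply: nz => i; apply: le_trans (hz i) _.
 by rewrite ler_peMl ?mulr_ge0 ?ler1n // ltW.
have tt : tests Omega (fun m => conv Omega (moll d eta t) (mulv chi w m)).
 by move=> m; have [_] := hpush t chi (moll d eta t) (w m) t0 tr schi chi0 hk k0 (lw m).
rewrite (hac tt); congr pair; apply/funext => m; apply/funext => x.
by rewrite (conv_curl m x l1 l2 (weak_curl_mul tchi lw l_b hwb) hk).
Qed.

Lemma defectD chi chi' : rtest setT chi -> rtest setT chi' -> defect (fun x => chi x + chi' x) = defect chi + defect chi'.
move=> h h'; rewrite /defect.
have [l1 l2] := (mulv_l2 h lw, curl_mul_l2 h lw l_b); have [l1' l2'] := (mulv_l2 h' lw, curl_mul_l2 h' lw l_b).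
rewrite (_ : mulv (fun x => chi x + chi' x) w = fun m x => mulv chi w m x + mulv chi' w m x); last first.
 by apply/funext => m; apply/funext => x; rewrite /mulv mulrDl.
rewrite (_ : curl_mul (fun x => chi x + chi' x) w b = fun m x => curl_mul chi w b m x + curl_mul chi' w b m x); last first.
 have [s s'] := (h.1, h'.1). by apply/funext => m; apply/funext => x; rewrite /curl_mul /gradx !pdD //; ring.
by rewrite (pairDr lc l1 l1') (pairDr la l2 l2') opprD addrACA.
Qed.

Lemma defect_test psi : rtest setT psi -> defect psi = 0.
move=> hpsi; have [h h0 psi0] := rtest_cube hpsi.
have /choice[r hr] x0 : exists r, 0 < r /\ forall chi, sm chi -> (forall x, ~ cube x0 r x -> chi x = 0) -> defect chi = 0.
 by have [r r0 hr] := defect_local x0; exists r.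
have r20 x0 : 0 < r x0 / 2 by have [? _] := hr x0; rewrite divr_gt0.
have [s cov] := finite_cover (@cube_compact R 0 h) r20.
pose rest := foldr (fun x0 (f : R3 R -> R) x => f x * (1 - plateau x0 (r x0) x)) psi.
have srest : forall s, rtest setT (rest s) /\ defect (rest s) = defect psi.
 elim=> [|x0 s' [IH1 IH2]]; first exact: (conj hpsi erefl). have [rx0 hx0] := hr x0.
 rewrite (_ : rest (x0 :: s') = fun x => rest s' x * (1 - plateau x0 (r x0) x)); last by [].
 have tp := plateau_rtest x0 rx0.
 have sp1 : sm (fun x => 1 - plateau x0 (r x0) x) by apply: smoothB; [exact: smooth_cst|case: tp].
 have t1 := rtestMr IH1 tp.1; have t2 := rtestMr IH1 sp1. split; first exact: t2.
 have e1 : rest s' = (fun x => rest s' x * plateau x0 (r x0) x + rest s' x * (1 - plateau x0 (r x0) x)).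
  by apply/funext => x; ring.
 have e2 : defect (fun x => rest s' x * plateau x0 (r x0) x) = 0.
  have pz x : ~ cube x0 (r x0) x -> rest s' x * plateau x0 (r x0) x = 0.
   by move=> nx; rewrite (plateau_out rx0 nx) mulr0.
  exact: (hx0 _ t1.1 pz).
 have gen (p q u v : R) : p = q + u -> q = 0 -> p = v -> u = v by move=> -> -> <-; rewrite add0r.
 exact: (gen _ _ _ _ (etrans (congr1 defect e1) (defectD t1 t2)) e2 IH2).
have [_ <-] := srest s.
rewrite (_ : rest s = fun=> 0).
 rewrite /defect (_ : mulv _ w = fun _ _ => 0); last by apply/funext => m; apply/funext => x; rewrite /mulv mul0r.
 rewrite (_ : curl_mul _ w b = fun _ _ => 0); last first.
  by apply/funext => m; apply/funext => x; rewrite /curl_mul /gradx !pd_cst !mul0r subr0 addr0.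
 by rewrite !pair0r subr0.
apply/funext => x; have [cx|nx] := pselect (cube 0 h x).
 have [y ys yx] := cov x cx; elim: s ys {cov srest} => //= z s' IH; rewrite inE => /orP[/eqP e|/IH ->]; last by rewrite mul0r.
 by rewrite -e plateau_in ?subrr ?mulr0 //; case: (hr y).
by elim: s {cov srest} => /= [|z s' IH]; [exact: psi0|rewrite IH mul0r].
Qed.

(** The defect vanishes for cutoffs near one point, hence, by subtracting finitely many plateaus, for every
cutoff; finally the cutoffs exhaust space and dominated convergence applies. *)
Theorem curl_adjoint : pair c w = pair a b.
have [M M0 hM] := @dbell_bounded R.
pose chi n := plateau (0 : R3 R) n.+1%:R.
have tchi n : rtest setT (chi n) by apply: plateau_rtest.
pose F n x := \sum_m c m x * mulv (chi n) w m x - \sum_m a m x * curl_mul (chi n) w b m x.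
have iF n : itg mu (F n) /\ int (F n) = 0.
 have [i1 e1] := pairE lc (mulv_l2 (tchi n) lw); have [i2 e2] := pairE la (curl_mul_l2 (tchi n) lw l_b).
 by split; [exact: itgB|rewrite /F intB // -e1 -e2; exact: defect_test].
pose F0 x := \sum_m c m x * w m x - \sum_m a m x * b m x.
have [i1 e1] := pairE lc lw; have [i2 e2] := pairE la l_b.
have i0 : itg mu F0 by exact: itgB.
pose G x := \sum_m `|c m x * w m x| + \sum_m (`|a m x * b m x| + (`|M * (a m x * w (m + 2%:R) x)| + `|M * (a m x * w (m + 1) x)|)).
have iG : itg mu G.
 apply: itgD; apply: itg_sum => m; first exact: itg_norm (l2_mul (lc m) (lw m)).
 apply: itgD; first exact: itg_norm (l2_mul (la m) (l_b m)).
 by apply: itgD; apply: itg_norm; apply: itgZ; exact: l2_mul.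
have cM n x : 0 <= chi n x <= 1 by rewrite plateau_ge0 plateau_le1.
have pM n i x : `|pd i (chi n) x| <= M / n.+1%:R by exact: (pd_plateau _ _ i x hM).
have pM' n i x : `|pd i (chi n) x| <= M.
 by apply: le_trans (pM n i x) _; rewrite ler_piMr ?(ltW M0) // invf_le1 // ler1n.
have bF n x : `|F n x| <= G x.
 rewrite /F /G; apply: le_trans (ler_normB _ _) _; apply: lerD; apply: le_trans (ler_norm_sum _ _ _) _; apply: ler_sum => m _.
  rewrite /mulv mulrCA normrM ler_piMl //; have /andP[u v] := cM n x; by rewrite ger0_norm.
 rewrite /curl_mul /gradx mulrDr; apply: le_trans (ler_normD _ _) _; apply: lerD.
  rewrite mulrCA normrM ler_piMl //; have /andP[u v] := cM n x; by rewrite ger0_norm.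
 rewrite mulrBr; apply: le_trans (ler_normB _ _) _.
 by apply: lerD; rewrite mulrCA !normrM (gtr0_norm M0) ler_wpM2r ?mulr_ge0.
have cF x : F n x @[n --> \oo] --> F0 x.
 have cc : chi n x @[n --> \oo] --> (1 : R).
  pose q := 2 * `|x|. apply: cvg_near_cst; near=> n; rewrite /chi plateau_in // => i; rewrite co0 subr0.
  have /norm_co h : `|x| <= `|x| by []. apply: le_trans (h i) _; rewrite ler_pdivlMr // mulrC.
  by apply: le_trans (_ : n%:R <= _); [near: n; exact: nbhs_infty_ger|rewrite ler_nat].
 have cp i : pd i (chi n) x @[n --> \oo] --> (0 : R).
  apply: (@squeeze_cvgr _ _ _ _ (fun n => - (M * n.+1%:R^-1)) (fun n => M * n.+1%:R^-1)).
  - by near=> n; rewrite -ler_norml.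
  - rewrite -oppr0; apply: cvgN; rewrite -(mulr0 M); apply: cvgM; [exact: cvg_cst|exact: cvg_harmonic].
  - rewrite -(mulr0 M); apply: cvgM; [exact: cvg_cst|exact: cvg_harmonic].
 rewrite /F /F0 !sum3; under eq_fun do rewrite !sum3 /mulv /curl_mul /gradx.
 have c1 m : c m x * (chi n x * w m x) @[n --> \oo] --> c m x * w m x.
  apply: cvgM; first exact: cvg_cst. by rewrite -[X in _ --> X]mul1r; apply: cvgM; [exact: cc|exact: cvg_cst].
 have c2 m : a m x * (chi n x * b m x + (pd (m + 1) (chi n) x * w (m + 2%:R) x - pd (m + 2%:R) (chi n) x * w (m + 1) x)) @[n --> \oo] --> a m x * b m x.
  apply: cvgM; first exact: cvg_cst.
  rewrite [X in _ --> X](_ : b m x = 1 * b m x + (0 * w (m + 2%:R) x - 0 * w (m + 1) x)); last by ring.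
  apply: cvgD; first by apply: cvgM; [exact: cc|exact: cvg_cst].
  by apply: cvgB; (apply: cvgM; [exact: cp|exact: cvg_cst]).
 by apply: cvgB; (apply: cvgD; first apply: cvgD); (exact: c1 || exact: c2).
have [_] := @dominated_cvg _ _ _ mu F F0 G (fun n => itg_mf (iF n).1) (itg_mf i0) iG (aeW mu cF) bF.
under eq_fun do rewrite (iF _).2.
move=> H; have : int F0 = 0 by apply/esym; apply: (cvg_unique _ _ H) => //; exact: cvg_cst.
by rewrite /F0 intB // -e1 -e2 => /subr0_eq.
Unshelve. all: by end_near.
Qed.
End Adjoint.

(** * Local compactness *)
Section FiniteRank.
Variables (R : realType) (Omega : domain R).
Notation mu := (vol Omega).
Notation int f := (\int[mu]_x f x).
Notation F3 := ('I_3 -> R3 R -> R).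
Notation l2v := (l2v Omega).
Notation sq := (sq mu).
Implicit Types (a c : F3) (chi : R3 R -> R) (T : F3 -> F3 -> R).

Definition Sq a := \sum_m sq (a m).
Definition finq (es : seq (R3 R -> R)) a := \sum_(e <- es) \sum_m int (fun x => a m x * e x) ^+ 2.

Lemma sq_le_Sq a m : sq (a m) <= Sq a.
by rewrite /Sq (bigD1 m) //= lerDl sumr_ge0 // => i _; exact: sq_ge0. Qed.
Lemma Sq_ge0 a : 0 <= Sq a.
by apply: sumr_ge0 => m _; exact: sq_ge0. Qed.
Lemma finq_ge0 es a : 0 <= finq es a.
by apply: sumr_ge0 => e _; apply: sumr_ge0 => m _; exact: sqr_ge0. Qed.
Lemma finq_cat es es' a : finq (es ++ es') a = finq es a + finq es' a.
exact: big_cat. Qed.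
Definition nearly_finite T := forall d, 0 < d -> exists2 es, (forall e, List.In e es -> l2 mu e) &
  forall a c, l2v a -> l2v c -> `|T a c| <= d * (Sq a + Sq c) + finq es a.

Lemma nearly_finiteD T T' : nearly_finite T -> nearly_finite T' -> nearly_finite (fun a c => T a c + T' a c).
move=> h h' d d0; have d2 : 0 < d / 2 by rewrite divr_gt0.
have [es e1 hes] := h _ d2; have [es' e1' hes'] := h' _ d2.
exists (es ++ es') => [e /(@List.in_app_or _ _ _ _)[/e1|/e1'] //|a c la lc].
apply: le_trans (ler_normD _ _) _; have := hes a c la lc; have := hes' a c la lc.
rewrite finq_cat; move: (`|T a c|) (`|T' a c|) (Sq a + Sq c) (finq es a) (finq es' a) => *; lra.
Qed.

Lemma nearly_finiteN T : nearly_finite T -> nearly_finite (fun a c => - T a c).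
by move=> h d d0; have [es e1 hes] := h _ d0; exists es => // a c la lc; rewrite normrN; exact: hes. Qed.
Lemma nearly_finite0 : nearly_finite (fun _ _ => 0).
move=> d d0; exists [::] => // a c _ _.
by rewrite normr0 addr_ge0 ?finq_ge0 // mulr_ge0 ?addr_ge0 ?Sq_ge0 // ltW.
Qed.

Lemma nearly_finite_sum n (T : nat -> F3 -> F3 -> R) : (forall i, nearly_finite (T i)) ->
  nearly_finite (fun a c => \sum_(0 <= i < n) T i a c).
move=> h; elim: n => [|n IH].
 by rewrite (_ : (fun _ _ => _) = fun _ _ => 0); [exact: nearly_finite0|apply/funext => a; apply/funext => c; rewrite big_nil].
rewrite (_ : (fun _ _ => _) = fun a c => \sum_(0 <= i < n) T i a c + T n a c); first exact: nearly_finiteD.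
by apply/funext => a; apply/funext => c; rewrite big_nat_recr.
Qed.

Lemma nearly_finite_sum3 (T : 'I_3 -> F3 -> F3 -> R) : (forall i, nearly_finite (T i)) ->
  nearly_finite (fun a c => \sum_i T i a c).
move=> h; rewrite (_ : (fun _ _ => _) = fun a c => T 0 a c + T 1 a c + T 2%:R a c).
 by do 2!apply: nearly_finiteD => //.
by apply/funext => a; apply/funext => c; rewrite sum3.
Qed.

Lemma nearly_finite_conv chi U k (g : F3 -> F3 -> R3 R -> R) l : rtest U chi -> rtest setT k ->
  (forall a c, l2v a -> l2v c -> l2 mu (g a c) /\ sq (g a c) <= Sq a + Sq c) ->
  nearly_finite (fun a c => int (fun x => chi x * a l x * conv Omega k (g a c) x)).
move=> hchi hk hg d d0; have d2 : 0 < d / 2 by rewrite divr_gt0.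
have [B B0 chiB] := rtest_bd hchi; have [h h0 chi0] := rtest_cube hchi.
have mchi : mfT chi by apply: sm_mf; case: hchi.
have [es [e1 hes]] := finite_rank Omega mchi chiB chi0 hk d2.
exists es => // a c la lc; have [lg sg] := hg a c la lc.
apply: le_trans (hes _ _ (la l) lg) _; apply: lerD.
 have := sq_le_Sq a l; have := Sq_ge0 c; move: sg => s1 s2 s3. rewrite -mulrA ler_pM2l //; rewrite mulrC; lra.
apply: ler_sum => e _; rewrite (bigD1 l) //= lerDl sumr_ge0 // => i _; exact: sqr_ge0.
Qed.
End FiniteRank.

Section LocalCompactness.
Variables (R : realType) (Omega : domain R).
Notation mu := (vol Omega).
Notation int f := (\int[mu]_x f x).
Notation F3 := ('I_3 -> R3 R -> R).
Notation l2v := (l2v Omega).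
Notation pair := (pair Omega).
Notation sq := (sq mu).
Notation Sq := (Sq Omega).
Notation weak_curl := (weak_curl Omega).
Implicit Types (a c : F3) (chi : R3 R -> R).

Definition bconv chi k f g := int (fun x => chi x * f x * conv Omega k g x).

Lemma quad_arith (b v p q s g : R) : 0 <= b -> 0 <= v -> 0 <= p -> 0 <= q -> v <= p -> s <= b * v -> g <= p + q ->
  (s + g) / 2 <= (b + 1) * (p + q).
move=> b0 v0 p0 q0 vp sbv gpq.
have : b * v <= b * (p + q) by rewrite ler_wpM2l //; lra.
by have : 0 <= b * (p + q) by [rewrite mulr_ge0 // addr_ge0]; lra.
Qed.

Lemma sum15 (q : R) : \sum_(l < 3) \sum_(i < 3) q + \sum_(l < 3) (q + q) = 15 * q.
by rewrite !sum3; ring. Qed.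
Lemma cyclic_sum (G : 'I_3 -> 'I_3 -> 'I_3 -> R) l : \sum_i G i i l = \sum_i G l i i +
  (G (l + 1 + 1) (l + 2%:R) (l + 1 + 2%:R) - G (l + 1 + 2%:R) (l + 2%:R) (l + 1 + 1) -
   (G (l + 2%:R + 1) (l + 1) (l + 2%:R + 2%:R) - G (l + 2%:R + 2%:R) (l + 1) (l + 2%:R + 1))).
by rewrite !sum3; move: l; apply: I3P; rewrite !I3E; ring. Qed.

Section OneScale.
Variables (K : 'I_3 -> R3 R -> R) (chi : R3 R -> R).
Hypotheses (hK : forall i, rtest setT (K i)) (hchi : rtest setT chi)
  (push : forall i f, l2 mu f -> rtest Omega (fun x => chi x * conv Omega (K i) f x)).

Definition scale_term a c : R :=
  - (\sum_l \sum_i bconv (pd l chi) (K i) (a l) (a i)) +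
  \sum_l (bconv chi (K (l + 2%:R)) (a l) (c (l + 1)) - bconv chi (K (l + 1)) (a l) (c (l + 2%:R))).

Lemma nearly_finite_scale_term : nearly_finite Omega scale_term.
apply: nearly_finiteD.
 apply: nearly_finiteN; apply: nearly_finite_sum3 => l; apply: nearly_finite_sum3 => i.
 apply: (nearly_finite_conv (chi := pd l chi) (g := fun a c => a i) l (rtest_pd l hchi) (hK i)) => a c la _.
 by split; [exact: la|apply: le_trans (sq_le_Sq _ a i) _; rewrite lerDl Sq_ge0].
apply: nearly_finite_sum3 => l; apply: nearly_finiteD.
 apply: (nearly_finite_conv (chi := chi) (g := fun a c => c (l + 1)) l hchi (hK _)) => a c _ lc.
 by split; [exact: lc|apply: le_trans (sq_le_Sq _ c _) _; rewrite lerDr Sq_ge0].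
apply: nearly_finiteN.
apply: (nearly_finite_conv (chi := chi) (g := fun a c => c (l + 2%:R)) l hchi (hK _)) => a c _ lc.
by split; [exact: lc|apply: le_trans (sq_le_Sq _ c _) _; rewrite lerDr Sq_ge0].
Qed.

Lemma bconv_itg chi' k f g : rtest setT chi' -> rtest setT k -> l2 mu f -> l2 mu g ->
  itg mu (fun x => chi' x * f x * conv Omega k g x).
by move=> h hk hf hg; apply: (rtest_conv_itg hk) => //; exact: rtest_mul_l2 h hf. Qed.
Lemma scale_term_bound B S a c : (forall x, `|chi x| <= B) -> (forall l x, `|pd l chi x| <= B) -> 0 <= S ->
  (forall i w f, l2 mu w -> l2 mu f -> `|int (fun x => w x * conv Omega (K i) f x)| <= S * ((sq w + sq f) / 2)) ->
  l2v a -> l2v c -> `|scale_term a c| <= 15 * S * (B ^+ 2 + 1) * (Sq a + Sq c).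
move=> hB hB' S0 sch la lc.
set Q := S * (B ^+ 2 + 1) * (Sq a + Sq c).
have B0 : 0 <= B by exact: le_trans (normr_ge0 _) (hB 0).
have term chi' i l g : rtest setT chi' -> (forall x, `|chi' x| <= B) -> l2 mu g -> sq g <= Sq a + Sq c ->
  `|bconv chi' (K i) (a l) g| <= Q.
 move=> tc cB lg sg; have lca := rtest_mul_l2 tc (la l).
 apply: le_trans (sch i _ _ lca lg) _; rewrite /Q -mulrA ler_wpM2l //.
 have : sq (fun x => chi' x * a l x) <= B ^+ 2 * sq (a l).
  rewrite /sq -intZ; last exact: l2_sqr. apply: le_int; [exact: l2_sqr|apply: itgZ; exact: l2_sqr|move=> x].
  rewrite exprMn ler_wpM2r ?sqr_ge0 // -real_normK ?num_real //. by rewrite lerXn2r ?nnegrE.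
 have := sq_le_Sq Omega a l; have := Sq_ge0 Omega c; have := Sq_ge0 Omega a; have := sq_ge0 mu (a l).
 have b2 : 0 <= B ^+ 2 by exact: sqr_ge0. by move=> h1 h2 h3 h4 h5; exact: (quad_arith b2 h1 h2 h3 h4 h5 sg).
have Q0 : 0 <= Q by apply: le_trans (term chi 0 0 (a 0) hchi hB (la 0) _); rewrite ?normr_ge0 //; apply: le_trans (sq_le_Sq _ a _) _; rewrite lerDl Sq_ge0.
have t1 l i : `|bconv (pd l chi) (K i) (a l) (a i)| <= Q.
 apply: term => //; [exact: rtest_pd|]. by apply: le_trans (sq_le_Sq _ a _) _; rewrite lerDl Sq_ge0.
have t2 l i m : `|bconv chi (K i) (a l) (c m)| <= Q.
 by apply: term => //; apply: le_trans (sq_le_Sq _ c _) _; rewrite lerDr Sq_ge0.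
rewrite (_ : 15 * S * _ * _ = 15 * Q); last by rewrite /Q !mulrA.
rewrite -sum15.
apply: le_trans (ler_normD _ _) _; rewrite normrN; apply: lerD.
 by apply: le_trans (ler_norm_sum _ _ _) _; apply: ler_sum => l _; apply: le_trans (ler_norm_sum _ _ _) _; exact: ler_sum.
apply: le_trans (ler_norm_sum _ _ _) _; apply: ler_sum => l _.
by apply: le_trans (ler_normB _ _) _; exact: lerD.
Qed.

Lemma conv_div a c l x : l2v a -> l2v c -> weak_curl setT a c ->
  \sum_i conv Omega (pd i (K i)) (a l) x =
  pd l (fun x => \sum_i conv Omega (K i) (a i) x) x +
  (conv Omega (K (l + 2%:R)) (c (l + 1)) x - conv Omega (K (l + 1)) (c (l + 2%:R)) x).
move=> la lc h.
have sc i m : sm (conv Omega (K i) (a m)) by exact: (conv_sm (hK i) (la m)).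
have -> : pd l (fun x => \sum_i conv Omega (K i) (a i) x) x = \sum_i pd l (conv Omega (K i) (a i)) x.
 rewrite (_ : (fun x => \sum_i _) = (fun x => conv Omega (K 0) (a 0) x + conv Omega (K 1) (a 1) x + conv Omega (K 2%:R) (a 2%:R) x)).
  by rewrite sum3 (pdD _ _ (smoothD (sc _ _) (sc _ _)) (sc _ _)) (pdD _ _ (sc _ _) (sc _ _)).
 by apply/funext => y; rewrite sum3.
rewrite -(conv_curl (l + 1) x la lc h (hK _)) -(conv_curl (l + 2%:R) x la lc h (hK _)).
under eq_bigr do rewrite -(pd_conv _ _ (hK _) (la _)).
exact: (cyclic_sum (fun i j m => pd i (conv Omega (K j) (a m)) x) l).
Qed.

(** The derivatives of the kernel are moved to the field and the cutoff; the field being divergence free, only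
its curl and derivatives of the cutoff are left. *)
Lemma scale_step a c : l2v a -> l2v c -> weak_curl setT a c -> weak_div0 Omega a ->
  \sum_l int (fun x => chi x * a l x * \sum_i conv Omega (pd i (K i)) (a l) x) = scale_term a c.
move=> la lc hac hdiv.
pose p x := \sum_i conv Omega (K i) (a i) x.
have sp : sm p by apply: smooth_sum => i; exact: (conv_sm (hK i) (la i)).
have tp : rtest Omega (fun x => chi x * p x).
 rewrite (_ : (fun x => _) = (fun x => chi x * conv Omega (K 0) (a 0) x + chi x * conv Omega (K 1) (a 1) x + chi x * conv Omega (K 2%:R) (a 2%:R) x)).
  by apply: rtestD; [apply: rtestD|]; exact: push.
 by apply/funext => y; rewrite /p sum3; ring.
have g0 := hdiv _ tp.
have sc := hchi.1.
have i1 l : itg mu (fun x => a l x * pd l (fun x => chi x * p x) x).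
 by apply: l2_mul => //; exact: rtest_l2 (rtest_pd l tp).
have i2 l i : itg mu (fun x => pd l chi x * a l x * conv Omega (K i) (a i) x) by exact: bconv_itg (rtest_pd l hchi) _ _ _.
have i2' l : itg mu (fun x => \sum_i pd l chi x * a l x * conv Omega (K i) (a i) x) by exact: itg_sum.
have i3 l i m : itg mu (fun x => chi x * a l x * conv Omega (K i) (c m) x) by exact: bconv_itg.
have key l : int (fun x => chi x * a l x * \sum_i conv Omega (pd i (K i)) (a l) x) =
  int (fun x => a l x * pd l (fun x => chi x * p x) x) - \sum_i bconv (pd l chi) (K i) (a l) (a i) +
  (bconv chi (K (l + 2%:R)) (a l) (c (l + 1)) - bconv chi (K (l + 1)) (a l) (c (l + 2%:R))).
 rewrite /bconv -int_sum // -(intB (i1 l) (i2' l)) -(intB (i3 l _ _) (i3 l _ _)).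
 rewrite -(intD (itgB (i1 l) (i2' l)) (itgB (i3 l (l + 2%:R) (l + 1)) (i3 l (l + 1) (l + 2%:R)))).
 apply: eq_Rintegral => x _; rewrite (conv_div l x la lc hac) -/p pdM // -mulr_sumr -/(p x). ring.
rewrite (eq_bigr _ (fun l _ => key l)) /scale_term !big_split /= sumrN.
by move: g0; rewrite /pair /rgrad => ->; rewrite add0r.
Qed.
End OneScale.

Lemma geometric_tail (l : R) N J : 0 <= l -> l < 1 -> (1 - l) * \sum_(N <= j < N + J) l ^+ j <= l ^+ N.
move=> l0 l1; elim: J => [|J IH]; first by rewrite addn0 big_geq // mulr0 exprn_ge0.
have -> : (1 - l) * \sum_(N <= j < N + J.+1) l ^+ j = l ^+ N - l ^+ (N + J.+1).
 elim: J {IH} => [|J IH]; first by rewrite addn1 big_nat1 exprS; ring.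
 by rewrite addnS big_nat_recr ?leq_addr //= mulrDr IH addnS [in RHS]exprS; ring.
by rewrite lerBlDr lerDl exprn_ge0.
Qed.

(** Telescoping over the scales writes the field as its mollification at the first scale plus the terms of
[scale_step], of the order of the scales; the first term is of finite rank up to a small error. *)
Theorem local_compactness x0 : lipschitz_boundary Omega -> exists2 r, 0 < r &
  forall chi, sm chi -> (forall x, ~ cube x0 r x -> chi x = 0) ->
  forall e, 0 < e -> exists2 es, (forall g, List.In g es -> l2 mu g) &
    forall a c, l2v a -> l2v c -> weak_curl setT a c -> weak_div0 Omega a ->
      pair (mulv chi a) a <= e * (Sq a + Sq c) + finq Omega es a.
move=> lb; have [r [eta [d [r0 [eta0 hpush]]]]] := push_test x0 lb; exists r => // chi schi chi0 e e0.
have hchi : rtest setT chi.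
 by split => //; exists (cube x0 r) => //; split => //; exact: cube_compact.
(* scales in geometric progression, close enough for the cone *)
pose D := \sum_i `|d i| + eta.
have D0 : 0 < D by rewrite ltr_wpDl ?sumr_ge0.
have Di i : `|d i| + eta <= D by rewrite lerD2r (bigD1 i) //= lerDl sumr_ge0.
have eD : eta <= D by rewrite lerDr sumr_ge0.
pose lam := 1 - eta / (2 * D).
have q0 : 0 < eta / (2 * D) by rewrite divr_gt0 // mulr_gt0.
have q1 : eta / (2 * D) <= 1 / 2 by rewrite ler_pdivrMr ?mulr_gt0 //; lra.
have l0 : 0 < lam by rewrite /lam; lra.
have l1 : lam < 1 by rewrite /lam; lra.
pose t j := lam ^+ j * r.
have t0 j : 0 < t j by rewrite mulr_gt0 ?exprn_gt0.
have tS j : t j.+1 = lam * t j by rewrite /t exprS mulrA.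
have tr j : t j <= r by rewrite ler_piMl ?(ltW r0) // exprn_ile1 // ltW.
have tt j : t j.+1 <= t j by rewrite tS ler_piMl // ltW.
have close j i : (t j - t j.+1) * (`|d i| + eta) <= eta * t j.
 rewrite tS (_ : t j - lam * t j = eta / (2 * D) * t j); last by rewrite /lam; ring.
 rewrite mulrAC ler_wpM2r ?(ltW (t0 j)) // mulrAC ler_pdivrMr ?mulr_gt0 // ler_pM2l //. by have := Di i; lra.
pose K j := flux d eta (t j) (t j.+1).
have hK j i : rtest setT (K j i) by exact: (flux_rtest eta0 (t0 j) (t0 j.+1) (tt j) (close j)).
have [A A0 hA] := @dstep_bounded R.
have Kb j i z := flux_bound eta0 (t0 j) (t0 j.+1) (tt j) (close j) i z hA.
have K0 j i z : ~ cube (t j *: vec3 d) (2 * (eta * t j)) z -> K j i z = 0.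
 by move=> nz; have := Kb j i z; rewrite indicE memNset // mulr0 normr_le0 => /eqP.
have push j i f : l2 mu f -> rtest Omega (fun x => chi x * conv Omega (K j i) f x).
 by move=> hf; have [] := hpush (t j) chi (K j i) f (t0 j) (tr j) schi chi0 (hK j i) (K0 j i) hf.
pose C1 := (A / (eta * lam)) ^+ 2 * (4 * eta) ^+ 3.
have C10 : 0 < C1 by rewrite mulr_gt0 ?exprn_gt0 ?divr_gt0 ?mulr_gt0.
have sch j i w f : l2 mu w -> l2 mu f -> `|int (fun x => w x * conv Omega (K j i) f x)| <= C1 * t j * ((sq w + sq f) / 2).
 move=> hw hf. have et : 0 <= 2 * (eta * t j) by apply: ltW; apply: mulr_gt0 => //; exact: mulr_gt0.
 have M0 : 0 <= (A / (eta * t j.+1)) ^+ 2 by exact: sqr_ge0.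
 have [_] := conv_schur M0 et (sm_cts (hK j i).1) (fun z => Kb j i z) hw hf.
 move/le_trans; apply; rewrite ler_wpM2r ?divr_ge0 ?addr_ge0 ?sq_ge0 // tS /C1. apply: le_of_eq; field.
 by rewrite !lt0r_neq0.
have [B1 B10 hB1] := rtest_bd hchi.
have [B2 hB2] : exists B, 0 < B /\ forall l x, `|pd l chi x| <= B.
 have [b0 b00 h0] := rtest_bd (rtest_pd 0 hchi); have [b1 b10 h1] := rtest_bd (rtest_pd 1 hchi).
 have [b2 b20 h2] := rtest_bd (rtest_pd 2%:R hchi). exists (b0 + b1 + b2); split; first by rewrite !addr_gt0.
 by apply: I3P => x; [have := h0 x|have := h1 x|have := h2 x]; lra.
pose B := B1 + B2.
have hB x : `|chi x| <= B by apply: le_trans (hB1 x) _; rewrite lerDl; exact: ltW hB2.1.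
have hB' l x : `|pd l chi x| <= B by apply: le_trans (hB2.2 l x) _; rewrite lerDr; exact: ltW B10.
pose C2 := 15 * C1 * (B ^+ 2 + 1) * r.
have B21 : 0 < B ^+ 2 + 1 by apply: (ltr_wpDl (sqr_ge0 B)).
have c15 : 0 < 15 * C1 by apply: mulr_gt0.
have C20 : 0 < C2 by exact: (mulr_gt0 (mulr_gt0 c15 B21) r0).
have small j a c : l2v a -> l2v c -> `|scale_term (K j) chi a c| <= C2 * lam ^+ j * (Sq a + Sq c).
 move=> la lc; have S0 : 0 <= C1 * t j by rewrite mulr_ge0 // ltW.
 apply: le_trans (scale_term_bound hchi hB hB' S0 (sch j) la lc) _. by apply: le_of_eq; rewrite /C2 /t; ring.
have hm j := moll_rtest d eta0 (t0 j).
pose base a (c : F3) := \sum_l bconv chi (moll d eta (t 0%N)) (a l) (a l).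
have nbase : nearly_finite Omega base.
 apply: nearly_finite_sum3 => l.
 apply: (nearly_finite_conv (chi := chi) (g := fun a c => a l) l hchi (hm 0%N)) => a c la _.
 by split; [exact: la|apply: le_trans (sq_le_Sq _ a l) _; rewrite lerDl Sq_ge0].
have [N hN] : exists N, C2 * (lam ^+ N / (1 - lam)) <= e / 3.
 have : lam ^+ n @[n --> \oo] --> (0 : R) by apply: cvg_expr; rewrite gtr0_norm.
 have p0 : 0 < e / 3 / C2 * (1 - lam) by rewrite mulr_gt0 ?divr_gt0 // subr_gt0.
 move/cvgrPdist_le => /(_ _ p0)[N _ /(_ N (leqnn N))].
 rewrite sub0r normrN ger0_norm ?exprn_ge0 ?(ltW l0) // => hN; exists N.
 by rewrite mulrC -ler_pdivlMr // ler_pdivrMr ?subr_gt0.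
have e3 : 0 < e / 3 by rewrite divr_gt0.
have [es e1 hes] := nearly_finiteD nbase (nearly_finite_sum N (fun j => nearly_finite_scale_term (hK j) hchi)) e3.
exists es => // a c la lc hac hdiv.
have tele J : \sum_l bconv chi (moll d eta (t J)) (a l) (a l) =
  base a c + \sum_(0 <= j < J) scale_term (K j) chi a c.
 elim: J => [|J IH]; first by rewrite big_geq // addr0.
 rewrite big_nat_recr //= addrA -IH -(scale_step (hK J) hchi (push J) la lc hac hdiv) -big_split /=.
 apply: eq_bigr => l _; rewrite /bconv.
 have ic i x : itg mu (fun y => pd i (K J i) (x - y) * a l y) by exact: conv_itg (rtest_pd i (hK J i)) (la l).
 have im x : itg mu (fun y => moll d eta (t J) (x - y) * a l y) by exact: conv_itg (hm J) (la l).
 have i1 := bconv_itg hchi (hm J) (la l) (la l).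
 have i2 : itg mu (fun x => chi x * a l x * \sum_i conv Omega (pd i (K J i)) (a l) x).
  rewrite (_ : (fun x => _) = (fun x => \sum_i chi x * a l x * conv Omega (pd i (K J i)) (a l) x)).
   by apply: itg_sum => i; apply: bconv_itg => //; exact: rtest_pd.
  by apply/funext => x; rewrite mulr_sumr.
 rewrite -(intD i1 i2); apply: eq_Rintegral => x _; rewrite -mulrDr; congr (_ * _).
 rewrite /conv -int_sum // -intD //; last exact: itg_sum.
 apply: eq_Rintegral => y _; rewrite -mulr_suml -mulrDl; congr (_ * _).
 by rewrite -(flux_div d eta (t J) (t J.+1) (x - y)) [RHS]addrC subrK.
have lca := mulv_l2 hchi la.
have Q0 : 0 <= Sq a + Sq c by rewrite addr_ge0 ?Sq_ge0.
have lim := pair_moll d eta0 lca la.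
have bound J : (N <= J)%N -> pair (mulv chi a) (fun m => conv Omega (moll d eta (t J)) (a m)) <=
  e / 3 * (Sq a + Sq c) + finq Omega es a + e / 3 * (Sq a + Sq c).
 move=> NJ; apply: le_trans (ler_norm _) _.
 have -> : pair (mulv chi a) (fun m => conv Omega (moll d eta (t J)) (a m)) = \sum_l bconv chi (moll d eta (t J)) (a l) (a l) by [].
 rewrite tele (@big_cat_nat _ _ _ N) //= addrA; apply: le_trans (ler_normD _ _) _; apply: lerD; first exact: hes.
 apply: le_trans (ler_norm_sum _ _ _) _.
 apply: le_trans (_ : \sum_(N <= j < J) C2 * lam ^+ j * (Sq a + Sq c) <= _); first by apply: ler_sum => j _; exact: small.
 rewrite -mulr_suml -mulr_sumr ler_wpM2r //; apply: le_trans hN; rewrite ler_wpM2l ?(ltW C20) //.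
 rewrite ler_pdivlMr ?subr_gt0 // mulrC -(subnKC NJ). exact: geometric_tail (ltW l0) l1.
apply/ler_addgt0Pl => e' e'0; have [T T0 hT] := lim _ e'0.
have [J NJ tJ] : exists2 J, (N <= J)%N & t J <= T.
 have : lam ^+ n @[n --> \oo] --> (0 : R) by apply: cvg_expr; rewrite gtr0_norm.
 move/cvgrPdist_le => /(_ _ (divr_gt0 T0 r0))[M _ hM]; exists (maxn N M); first exact: leq_maxl.
 have := hM (maxn N M) (leq_maxr _ _); rewrite sub0r normrN ger0_norm ?exprn_ge0 ?(ltW l0) // => h.
 by rewrite /t -ler_pdivlMr.
have := hT (t J) (t0 J) tJ; have := bound J NJ; rewrite ler_norml.
have : 0 <= e / 3 * (Sq a + Sq c) by rewrite mulr_ge0 // ltW.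
rewrite (_ : e * (Sq a + Sq c) = e / 3 * (Sq a + Sq c) + e / 3 * (Sq a + Sq c) + e / 3 * (Sq a + Sq c)); last by field.
move: (pair _ _) (pair _ _) (finq _ _ _) (e / 3 * _) => u v f q; lra.
Qed.
End LocalCompactness.

(** * Cutoffs of fields and the Caccioppoli inequality *)
Section Arithmetic.
Variable R : realFieldType.
Implicit Types (a b s p g k m x z : R).

Lemma square_combo (D U W B F : R) : 0 <= D -> 0 <= U -> 0 <= W -> 0 <= B -> 0 <= F ->
  D ^+ 2 * (U ^+ 2 + W ^+ 2) + B ^+ 2 * F ^+ 2 <= (D * (U + W) + B * F) ^+ 2.
move=> D0 U0 W0 B0 F0; rewrite -subr_ge0.
rewrite (_ : _ - _ = 2 * (D ^+ 2 * (U * W)) + 2 * (D * (U + W) * (B * F))); last by ring.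
by rewrite addr_ge0 // mulr_ge0 // mulr_ge0 ?mulr_ge0 ?addr_ge0 ?sqr_ge0.
Qed.

Lemma part_arith p s g k : - (s / 4 + 4 * g) <= p -> g <= k -> 0 <= s -> s / 2 - 4 * k <= s + p.
lra. Qed.

Lemma combine_arith s1 s2 m x1 x2 a1 a2 b z : s1 / 2 - 4 * (4 * m * x1) <= a1 -> s2 / 2 - 4 * (4 * m * x2) <= a2 ->
  a1 + a2 <= b * z -> 0 <= m * z -> 0 <= b * (x1 + x2) ->
  s1 + s2 <= (2 * b + 32 * m) * z + (2 * b + 32 * m) * (x1 + x2).
rewrite !mulrDl -!mulrA !mulrDr; move: (m * x1) (m * x2) (b * z) (m * z) (b * x1) (b * x2) => *; lra.
Qed.
End Arithmetic.

Section Decay.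
Variables (R : realType) (Omega : domain R).
Notation H := (L2 Omega).
Notation mu := (vol Omega).
Notation int f := (\int[mu]_x f x).
Notation F3 := ('I_3 -> R3 R -> R).
Notation l2v := (l2v Omega).
Notation pair := (pair Omega).
Notation sq := (sq mu).
Notation Sq := (Sq Omega).
Notation rp := (@rp R Omega).
Notation nrm := (ipnorm rp).
Notation fin := (fin (rp := rp)).
Implicit Types (a b c : F3) (chi : R3 R -> R) (u w : H).
Let hH := rp_is_cip Omega.
Let ip := rp_is_ip Omega.

Lemma re_l2v u : l2v (re u). by move=> m; have [] := L2_sqi u m. Qed.
Lemma im_l2v u : l2v (im u). by move=> m; have [] := L2_sqi u m. Qed.

Lemma Sq_pair a : Sq a = pair a a.
by apply: eq_bigr => m _; rewrite /sq; under eq_fun do rewrite expr2. Qed.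
Lemma rp_self u : rp u u = Sq (re u) + Sq (im u).
by rewrite (rp_pair (L2_sqi u) (L2_sqi u) (aeW _ (fun x => erefl)) (aeW _ (fun x => erefl))) !Sq_pair. Qed.
Lemma nrm_self u : nrm u ^+ 2 = Sq (re u) + Sq (im u).
by rewrite (nrm_sqr ip) rp_self. Qed.
Lemma sum_sqr_le (I : Type) (s : seq I) (F : I -> R) : \sum_(i <- s) F i ^+ 2 <= (\sum_(i <- s) `|F i|) ^+ 2.
elim: s => [|i s IH]; first by rewrite !big_nil expr0n.
rewrite !big_cons /= sqrrD real_normK ?num_real // -addrA lerD2l.
apply: le_trans IH _; rewrite lerDr mulrn_wge0 // mulr_ge0 // sumr_ge0 // => j _; exact: normr_ge0.
Qed.

Lemma finq_fin es : (forall e, List.In e es -> l2 mu e) -> exists es' : seq H,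
  forall u, finq Omega es (re u) + finq Omega es (im u) <= fin es' u ^+ 2.
move=> les.
pose v (p : 'I_3 * bool) e : H := mkL2 Omega (mkc (fun i => if p.2 then only p.1 e i else fun=> 0) (fun i => if p.2 then fun=> 0 else only p.1 e i)).
pose idx : seq ('I_3 * bool) := enum {: 'I_3 * bool}.
exists (flatten [seq [seq v p e | p <- idx] | e <- es]) => u.
have rpv p e : l2 mu e -> rp u (v p e) = if p.2 then int (fun x => re u p.1 x * e x) else int (fun x => im u p.1 x * e x).
 move=> le; have lo m : l2v (only m e) by move=> i; rewrite /only; case: (i == m) => //; exact: l20.
 have sv : sqi Omega (mkc (fun i => if p.2 then only p.1 e i else fun=> 0) (fun i => if p.2 then fun=> 0 else only p.1 e i)).
  by move=> i; rewrite re_mkc im_mkc; case: (p.2); split; (exact: lo || exact: l20).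
 rewrite (rp_pair (L2_sqi u) sv (aeW _ (fun x => erefl)) (mkL2E sv)).
 have -> : re (mkc (fun i => if p.2 then only p.1 e i else fun=> 0) (fun i => if p.2 then fun=> 0 else only p.1 e i)) =
   fun i => if p.2 then only p.1 e i else fun=> 0 by apply/funext => i; rewrite re_mkc.
 have -> : im (mkc (fun i => if p.2 then only p.1 e i else fun=> 0) (fun i => if p.2 then fun=> 0 else only p.1 e i)) =
   fun i => if p.2 then fun=> 0 else only p.1 e i by apply/funext => i; rewrite im_mkc.
 by case: (p.2); rewrite ?pair0r ?addr0 ?add0r pair_only.
apply: le_trans (sum_sqr_le _ _).
rewrite big_flatten big_map -big_split /= le_eqVlt; apply/orP; left; apply/eqP.
elim: es les => [|e es IH] les; first by rewrite !big_nil.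
rewrite !big_cons IH => [|e' he']; last by apply: les; right.
congr (_ + _); have le : l2 mu e by apply: les; left.
rewrite big_map /idx big_enum /= -(pair_bigA _ (fun (m : 'I_3) (t : bool) => rp u (v (m, t) e) ^+ 2)) /= -big_split /=.
by apply: eq_bigr => m _; rewrite big_bool !rpv.
Qed.

Definition cutn chi u := Sq (mulv chi (re u)) + Sq (mulv chi (im u)).

Lemma Sq_le chi chi' B a : rtest setT chi -> rtest setT chi' -> l2v a -> 0 <= B ->
  (forall x, `|chi x| <= B * `|chi' x|) -> Sq (mulv chi a) <= B ^+ 2 * Sq (mulv chi' a).
move=> h h' la B0 le; rewrite /Sq mulr_sumr; apply: ler_sum => m _.
have [l1 l2] := (mulv_l2 h la, mulv_l2 h' la).
rewrite /sq -intZ; last exact: l2_sqr (l2 m).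
apply: le_int; [exact: l2_sqr (l1 m)|apply: itgZ; exact: l2_sqr (l2 m)|move=> x].
have le2 : chi x ^+ 2 <= B ^+ 2 * chi' x ^+ 2.
 rewrite -exprMn -(real_normK (num_real (chi x))) -(real_normK (num_real (B * chi' x))).
 by rewrite lerXn2r ?nnegrE // normrM (ger0_norm B0).
have -> : mulv chi a m x ^+ 2 = chi x ^+ 2 * a m x ^+ 2 by rewrite /mulv exprMn.
have -> : mulv chi' a m x ^+ 2 = chi' x ^+ 2 * a m x ^+ 2 by rewrite /mulv exprMn.
by rewrite mulrA; exact: ler_wpM2r (sqr_ge0 (a m x)) _ _ le2.
Qed.

Hypothesis lb : lipschitz_boundary Omega.

Lemma cutoff_compact chi : rtest setT chi -> forall d, 0 < d -> exists es, forall u w,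
  curl0 (u, w) -> Hdiv0 Omega u -> Num.sqrt (cutn chi u) <= d * (nrm u + nrm w) + fin es u.
move=> hchi d d0; have [h h0 chi0] := rtest_cube hchi; have [B B0 chiB] := rtest_bd hchi.
pose good (c : R3 R) (r : R) := 0 < r /\ forall chi, sm chi -> (forall x, ~ cube c r x -> chi x = 0) ->
 forall e, 0 < e -> exists2 es, (forall g, List.In g es -> l2 mu g) &
  forall a b, l2v a -> l2v b -> weak_curl Omega setT a b -> weak_div0 Omega a ->
   pair (mulv chi a) a <= e * (Sq a + Sq b) + finq Omega es a.
have /choice[r hr] (c : R3 R) : exists r, good c r.
 by have [r r0 hr] := local_compactness c lb; exists r.
have r0 (c : R3 R) : 0 < r c by have [] := hr c.
have r20 (c : R3 R) : 0 < r c / 2 by rewrite divr_gt0.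
have [s cov] := finite_cover (@cube_compact R 0 h) r20.
pose pl (c : R3 R) := plateau c (r c).
have tpl (c : R3 R) : rtest setT (pl c) by exact: plateau_rtest.
have sumP : forall s e, 0 < e -> exists2 es, (forall g, List.In g es -> l2 mu g) &
  forall a b, l2v a -> l2v b -> weak_curl Omega setT a b -> weak_div0 Omega a ->
   \sum_(c <- s) pair (mulv (pl c) a) a <= e * (Sq a + Sq b) + finq Omega es a.
 elim=> [|c s' IH] e e0.
  exists [::] => // a b _ _ _ _; rewrite big_nil addr_ge0 ?finq_ge0 // mulr_ge0 ?addr_ge0 ?Sq_ge0 //. exact: ltW.
 have e2 : 0 < e / 2 by rewrite divr_gt0. have [es l1 h1] := IH _ e2; have [_ hc] := hr c.
 have [es' l2 h2] := hc (pl c) (tpl c).1 (@plateau_out _ c (r c) (r0 c)) _ e2.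
 exists (es' ++ es) => [g /(@List.in_app_or _ _ _ _)[/l2|/l1] //|a b la lb' wab da].
 rewrite big_cons finq_cat; have := h1 a b la lb' wab da; have := h2 a b la lb' wab da.
 move: (Sq a + Sq b) (pair _ _) (finq _ _ _) (finq _ _ _) (\sum_(_ <- _) _) => *; lra.
pose q := (d / B) ^+ 2.
have q0 : 0 < q by rewrite exprn_gt0 // divr_gt0.
have [es les hes] := sumP s q q0.
have [es' hes'] := finq_fin les.
exists [seq B%:C%C *: e | e <- es'] => u w /curl0P[c1 c2] /Hdiv0P[v1 v2].
rewrite fin_scale // (gtr0_norm B0).
have fn := fin_ge0 (rp := rp) es' u; have nu := nrm_ge0 (rp := rp) u; have nw := nrm_ge0 (rp := rp) w.
have y0 : 0 <= d * (nrm u + nrm w) + B * fin es' u.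
 by apply: addr_ge0; apply: mulr_ge0; rewrite ?addr_ge0 ?(ltW d0) ?(ltW B0).
rewrite -(ger0_norm y0) -sqrtr_sqr; apply: ler_wsqrtr.
have cutS a : l2v a -> Sq (mulv chi a) <= B ^+ 2 * \sum_(c <- s) pair (mulv (pl c) a) a.
 move=> la; have ip' (c : R3 R) m : itg mu (fun x => mulv (pl c) a m x * a m x) by apply: l2_mul => //; exact: (mulv_l2 (tpl c) la m).
 rewrite exchange_big /= /Sq mulr_sumr; apply: ler_sum => m _. rewrite -int_sum // /sq -intZ; last exact: itg_sum.
 apply: le_int; [exact: l2_sqr (mulv_l2 hchi la m)|by apply: itgZ; exact: itg_sum|move=> x].
 rewrite /mulv exprMn (eq_bigr (fun c : R3 R => pl c x * a m x ^+ 2)); last by move=> c' _; rewrite expr2 mulrA.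
 rewrite -mulr_suml mulrA; apply: ler_wpM2r; first exact: sqr_ge0.
 have pl0 (c : R3 R) : 0 <= pl c x by exact: plateau_ge0.
 have [/cov[c cs cx]|/chi0 ->] := pselect (cube 0 h x); last first.
  by rewrite expr0n mulr_ge0 ?sqr_ge0 ?sumr_ge0.
 apply: le_trans (_ : B ^+ 2 * 1 <= _).
  by rewrite mulr1 -(real_normK (num_real (chi x))) lerXn2r ?nnegrE // ltW.
 rewrite ler_wpM2l ?sqr_ge0 //. by rewrite (big_rem c) //= {1}/pl plateau_in // lerDl sumr_ge0.
have k1 := cutS _ (re_l2v u); have k2 := cutS _ (im_l2v u).
have h1 := hes _ _ (re_l2v u) (re_l2v w) c1 v1; have h2 := hes _ _ (im_l2v u) (im_l2v w) c2 v2.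
have h3 := hes' u; have n1 := nrm_self u; have n2 := nrm_self w.
have bq : B ^+ 2 * q = d ^+ 2 by rewrite /q -exprMn mulrC divfK // lt0r_neq0.
have b2 : 0 <= B ^+ 2 by exact: sqr_ge0.
rewrite /cutn; apply: le_trans (lerD k1 k2) _; rewrite -mulrDr.
apply: le_trans (ler_wpM2l b2 (lerD h1 h2)) _.
rewrite (_ : _ + _ + (_ + _) = q * (nrm u ^+ 2 + nrm w ^+ 2) + (finq Omega es (re u) + finq Omega es (im u))); last first.
 by rewrite n1 n2; ring.
rewrite mulrDr mulrA bq; apply: le_trans (lerD (lexx _) (ler_wpM2l b2 h3)) _.
by apply: square_combo => //; exact: ltW.
Qed.

Lemma cross_sq (p q u v m : R) : p ^+ 2 <= m -> q ^+ 2 <= m -> (q * v - p * u) ^+ 2 <= 2 * m * (u ^+ 2 + v ^+ 2).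
move=> pm qm; have t1 := ler_wpM2r (sqr_ge0 u) pm; have t2 := ler_wpM2r (sqr_ge0 v) qm.
rewrite (_ : (q * v - p * u) ^+ 2 = 2 * (p ^+ 2 * u ^+ 2) + 2 * (q ^+ 2 * v ^+ 2) - (q * v + p * u) ^+ 2); last by ring.
have := sqr_ge0 (q * v + p * u).
move: t1 t2; rewrite !mulrDr -!(mulrA 2).
move: (p ^+ 2 * _) (q ^+ 2 * _) (m * u ^+ 2) (m * v ^+ 2) ((_ + _) ^+ 2) => *; lra.
Qed.

Lemma re_mkcE a b : re (mkc a b) = a. by apply/funext => i; rewrite re_mkc. Qed.
Lemma im_mkcE a b : im (mkc a b) = b. by apply/funext => i; rewrite im_mkc. Qed.

Definition mkH a b : H := mkL2 Omega (mkc a b).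

Lemma mkc_sqi a b : l2v a -> l2v b -> sqi Omega (mkc a b).
by move=> la l_b i; rewrite re_mkc im_mkc; split; [exact: la|exact: l_b]. Qed.
Lemma rp_mkH u a b : l2v a -> l2v b -> rp u (mkH a b) = pair (re u) a + pair (im u) b.
move=> la l_b; have sv := mkc_sqi la l_b.
by rewrite (rp_pair (L2_sqi u) sv (aeW _ (fun x => erefl)) (mkL2E sv)) re_mkcE im_mkcE.
Qed.

Lemma nrm_mkH a b : l2v a -> l2v b -> nrm (mkH a b) ^+ 2 = Sq a + Sq b.
move=> la l_b; have sv := mkc_sqi la l_b.
by rewrite (nrm_sqr ip) (rp_pair sv sv (mkL2E sv) (mkL2E sv)) re_mkcE im_mkcE !Sq_pair.
Qed.

Lemma pair_ae a a' b : l2v a -> l2v a' -> l2v b -> {ae mu, forall x, forall m, a m x = a' m x} -> pair a b = pair a' b.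
move=> la la' l_b h; apply: eq_bigr => m _; apply: eq_int_ae.
- by apply: measurable_funM; [case: (la m)|case: (l_b m)].
- by apply: measurable_funM; [case: (la' m)|case: (l_b m)].
by apply: filterS h => x ->.
Qed.

Lemma mkH_ae a b : l2v a -> l2v b -> {ae mu, forall x, forall m, re (mkH a b) m x = a m x} /\
  {ae mu, forall x, forall m, im (mkH a b) m x = b m x}.
move=> la l_b; have h := mkL2E (mkc_sqi la l_b).
by split; apply: filterS h => x e m; rewrite /re /im /mkH e mxE.
Qed.

Lemma curl0_mkH a b a' b' : l2v a -> l2v b -> l2v a' -> l2v b' ->
  weak_curl Omega setT a a' -> weak_curl Omega setT b b' -> curl0 (mkH a b, mkH a' b').
move=> la l_b la' l_b' h h'; apply/curl0P.
have [e1 e2] := mkH_ae la l_b; have [e1' e2'] := mkH_ae la' l_b'.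
split => al hal; have lal := tests_l2 Omega hal; have lc := tests_l2 Omega (rcurl_tests hal).
 by rewrite (pair_ae (re_l2v _) la' lal e1') (pair_ae (re_l2v _) la lc e1); exact: h.
by rewrite (pair_ae (im_l2v _) l_b' lal e2') (pair_ae (im_l2v _) l_b lc e2); exact: h'.
Qed.

Lemma young_pair a b : l2v a -> l2v b -> - (Sq a / 4 + Sq b) <= pair a b.
move=> la l_b; rewrite /Sq /pair mulr_suml -big_split -sumrN; apply: ler_sum => m _ /=.
have h1 := l2_sqr (la m); have h2 := l2_sqr (l_b m); have h3 := l2_mul (la m) (l_b m).
have p : 0 <= int (fun x => 1 / 4 * a m x ^+ 2 + (b m x ^+ 2 + a m x * b m x)).
 apply: int_ge0 => x; rewrite [X in _ <= X](_ : _ = (a m x / 2 + b m x) ^+ 2) ?sqr_ge0 //; by field.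
rewrite (intD (itgZ _ h1) (itgD h2 h3)) (intZ _ h1) (intD h2 h3) in p.
by move: p; rewrite /sq; move: (int (fun x => a m x ^+ 2)) (int (fun x => b m x ^+ 2)) (int (fun x => a m x * b m x)) => *; lra.
Qed.

(** The equation is tested with the field multiplied by the square of the cutoff. *)
Lemma caccioppoli chi : rtest setT chi -> exists chi' K, [/\ rtest setT chi', 0 <= K & forall x w g,
  curl0 (x, w) -> (forall y z, curl0 (y, z) -> rp w z = rp g y) ->
  cutn chi w <= K * (nrm g * Num.sqrt (cutn chi' x)) + K * cutn chi' x].
move=> hchi; have [h h0 chi0] := rtest_cube hchi; have sc := hchi.1.
have h20 : 0 < 2 * h by rewrite mulr_gt0.
pose chi' := plateau (0 : R3 R) (2 * h).
have hchi' : rtest setT chi' by exact: plateau_rtest.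
have chi'1 x : cube 0 h x -> chi' x = 1.
 by move=> hx; apply: plateau_in => //; rewrite mulrAC divff ?mul1r // pnatr_eq0.
pose P x := chi x * chi x.
have hP : rtest setT P by exact: rtestMr hchi sc.
have [B B0 PB] := rtest_bd hP.
have [M M0 hM] : exists2 M, 0 < M & forall l x, `|pd l chi x| <= M.
 have [b0 b00 k0] := rtest_bd (rtest_pd 0 hchi); have [b1 b10 k1] := rtest_bd (rtest_pd 1 hchi).
 have [b2 b20 k2] := rtest_bd (rtest_pd 2%:R hchi). exists (b0 + b1 + b2); first by rewrite !addr_gt0.
 apply: I3P => x.
 - by apply: le_trans (k0 x) _; rewrite -addrA lerDl addr_ge0 // ltW.
 - by apply: le_trans (k1 x) _; rewrite addrAC lerDr addr_ge0 // ltW.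
 - by apply: le_trans (k2 x) _; rewrite lerDr addr_ge0 // ltW.
have PB' x : `|P x| <= B * `|chi' x|.
 have [hx|/chi0 e] := pselect (cube 0 h x); first by rewrite chi'1 // normr1 mulr1.
 by rewrite /P e mul0r normr0 mulr_ge0 // ltW.
have gradS a : l2v a -> Sq (gradx chi a) <= 4 * M ^+ 2 * Sq (mulv chi' a).
 move=> la; have [lg lm] := (gradx_l2 hchi la, mulv_l2 hchi' la).
 have pt m x : gradx chi a m x ^+ 2 <= 2 * M ^+ 2 * (mulv chi' a (m + 1) x ^+ 2 + mulv chi' a (m + 2%:R) x ^+ 2).
  have [hx|nx] := pselect (cube 0 h x); last first.
   rewrite /gradx !(pd_out _ (@cube_closed R 0 h) chi0 nx) !mul0r subr0 expr0n /=.
   by rewrite mulr_ge0 ?addr_ge0 ?sqr_ge0 // mulr_ge0 ?sqr_ge0.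
  rewrite /mulv /gradx chi'1 // !mul1r. have q1 := hM (m + 1) x; have q2 := hM (m + 2%:R) x.
  have s1 : pd (m + 1) chi x ^+ 2 <= M ^+ 2 by rewrite -(real_normK (num_real (pd _ _ _))) lerXn2r ?nnegrE // ltW.
  have s2 : pd (m + 2%:R) chi x ^+ 2 <= M ^+ 2 by rewrite -(real_normK (num_real (pd _ _ _))) lerXn2r ?nnegrE // ltW.
  move: s1 s2 {q1 q2}; move: (pd _ _ _) (pd _ _ _) (a _ _) (a _ _) => p q u v s1 s2. exact: cross_sq s2 s1.
 have ib m : itg mu (fun x => 2 * M ^+ 2 * (mulv chi' a (m + 1) x ^+ 2 + mulv chi' a (m + 2%:R) x ^+ 2)).
  by apply: itgZ; apply: itgD; exact: l2_sqr.
 apply: le_trans (_ : \sum_m int (fun x => 2 * M ^+ 2 * (mulv chi' a (m + 1) x ^+ 2 + mulv chi' a (m + 2%:R) x ^+ 2)) <= _).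
  by apply: ler_sum => m _; apply: le_int => //; exact: l2_sqr.
 apply: le_of_eq; rewrite /Sq.
 rewrite (eq_bigr (fun m => 2 * M ^+ 2 * (sq (mulv chi' a (m + 1)) + sq (mulv chi' a (m + 2%:R))))); last first.
  by move=> m _; rewrite intZ ?intD //; (try apply: itgD); exact: l2_sqr.
 rewrite !sum3 !I3E; ring.
have SqP a : l2v a -> Sq (mulv P a) <= B ^+ 2 * Sq (mulv chi' a).
 by move=> la; exact: (Sq_le hP hchi' la (ltW B0) PB').
have part a b : l2v a -> l2v b -> Sq (mulv chi b) / 2 - 4 * (4 * M ^+ 2 * Sq (mulv chi' a)) <= pair b (curl_mul P a b).
 move=> la l_b; have [l1 l2] := (mulv_l2 hchi l_b, gradx_l2 hchi la).
 have l22 : l2v (fun m x => 2 * gradx chi a m x) by move=> m; apply: l2Z.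
 have e : pair b (curl_mul P a b) = Sq (mulv chi b) + pair (mulv chi b) (fun m x => 2 * gradx chi a m x).
  rewrite Sq_pair -pairDr //; have lp := curl_mul_l2 hP la l_b. apply: eq_bigr => m _; apply: eq_Rintegral => x _.
  have dP i : pd i P x = 2 * (chi x * pd i chi x) by rewrite /P pdM //; ring.
  rewrite /curl_mul /gradx !dP /mulv /P; ring.
 have y := young_pair l1 l22; rewrite e. have g := gradS a la.
 have e2 : Sq (fun m x => 2 * gradx chi a m x) = 4 * Sq (gradx chi a).
  rewrite /Sq mulr_sumr; apply: eq_bigr => m _; rewrite /sq -intZ; last exact: l2_sqr.
  by apply: eq_Rintegral => x _; ring.
 rewrite e2 in y; have s0 := Sq_ge0 Omega (mulv chi b). exact: part_arith y g s0.
exists chi', (2 * B + 32 * M ^+ 2); split => //.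
 by rewrite addr_ge0 // mulr_ge0 ?sqr_ge0 // ltW.
move=> x w g /curl0P[c1 c2] hyz.
have [lx1 lx2] := (re_l2v x, im_l2v x); have [lw1 lw2] := (re_l2v w, im_l2v w).
have [m1 m2] := (mulv_l2 hP lx1, mulv_l2 hP lx2).
have [n1 n2] := (curl_mul_l2 hP lx1 lw1, curl_mul_l2 hP lx2 lw2).
have := hyz _ _ (curl0_mkH m1 m2 n1 n2 (weak_curl_mul hP lx1 lw1 c1) (weak_curl_mul hP lx2 lw2 c2)).
rewrite (rp_mkH w n1 n2) => e.
have p1 := part _ _ lx1 lw1; have p2 := part _ _ lx2 lw2.
have le1 := rp_le ip g (mkH (mulv P (re x)) (mulv P (im x))).
have le2 : nrm (mkH (mulv P (re x)) (mulv P (im x))) <= B * Num.sqrt (cutn chi' x).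
 have k0 : 0 <= B * Num.sqrt (cutn chi' x) by rewrite mulr_ge0 ?sqrtr_ge0 // ltW.
 rewrite -ler_sqr ?nnegrE ?(nrm_ge0 (rp := rp)) // (nrm_mkH m1 m2) exprMn sqr_sqrtr; last by rewrite addr_ge0 ?Sq_ge0.
 by rewrite /cutn mulrDr lerD ?SqP.
have le3 : rp g (mkH (mulv P (re x)) (mulv P (im x))) <= B * (nrm g * Num.sqrt (cutn chi' x)).
 by apply: le_trans le1 _; rewrite mulrCA ler_wpM2l ?(nrm_ge0 (rp := rp)).
have z1 : 0 <= nrm g * Num.sqrt (cutn chi' x) by rewrite mulr_ge0 ?sqrtr_ge0 ?(nrm_ge0 (rp := rp)).
have z2 : 0 <= cutn chi' x by rewrite addr_ge0 ?Sq_ge0.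
have M20 := sqr_ge0 M.
have q1 : 0 <= M ^+ 2 * (nrm g * Num.sqrt (cutn chi' x)) by rewrite mulr_ge0.
have q2 : 0 <= B * cutn chi' x by rewrite mulr_ge0 // ltW.
rewrite -e in le3.
exact: (combine_arith p1 p2 le3 q1 q2).
Qed.
End Decay.

(** * Symmetry of second derivatives *)
Section Schwarz.
Variable R : realType.
Implicit Types (f : R3 R -> R) (x : R3 R).

Lemma axis_line_at i x : axis_line i (fun s : R => x + s *: unit_vec R i).
by move=> h s j; rewrite !coD !coZ co_unit; ring. Qed.
Lemma mean_value (F G : R -> R) (h : R) : (forall s : R, is_derive s (1 : R) F (G s)) -> 0 < h ->
  exists2 s, 0 < s < h & F h - F 0 = h * G s.
move=> d h0.
have cF : {within `[0, h], continuous F}.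
 apply: continuous_subspaceT => s. by apply: differentiable_continuous; apply/derivable1_diffP; have [] := d s.
have [s sh e] := MVT h0 (fun s _ => d s) cF.
by exists s; [move: sh; rewrite in_itv|move: e; rewrite subr0 mulrC].
Qed.

Lemma mixed_difference i j f x (h : R) : sm f -> 0 < h -> exists2 y, cube x (2 * h) y &
  f (x + h *: unit_vec R j + h *: unit_vec R i) - f (x + h *: unit_vec R i) - (f (x + h *: unit_vec R j) - f x) =
  h ^+ 2 * pd j (pd i f) y.
move=> sf h0; pose z := x + h *: unit_vec R j.
have d s : is_derive s (1 : R) (fun s : R => f (z + s *: unit_vec R i) - f (x + s *: unit_vec R i))
  (pd i f (z + s *: unit_vec R i) - pd i f (x + s *: unit_vec R i)).
 by apply: is_deriveB; apply: (axis_line_derive _ sf); exact: axis_line_at.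
have [s /andP[s0 sh]] := mean_value d h0; rewrite !scale0r !addr0 => ->.
pose y0 := x + s *: unit_vec R i.
have d' s' : is_derive s' (1 : R) (fun t : R => pd i f (y0 + t *: unit_vec R j)) (pd j (pd i f) (y0 + s' *: unit_vec R j)).
 by apply: (axis_line_derive _ (sm_pd i sf)); exact: axis_line_at.
have [t /andP[t0 th]] := mean_value d' h0; rewrite scale0r addr0 => e.
exists (y0 + t *: unit_vec R j); last first.
 by rewrite expr2 -mulrA -e /z /y0 addrAC.
have b (k : 'I_3) (m : 'I_3) (q : R) : 0 < q -> q < h -> `|q * (m == k)%:R| <= h.
 by move=> q0 qh; case: (m == k); rewrite ?mulr1 ?mulr0 ?normr0 ?gtr0_norm // ltW.
move=> m; rewrite /y0 !coD !coZ !co_unit (_ : _ - _ = s * (m == i)%:R + t * (m == j)%:R); last by ring.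
apply: le_trans (ler_normD _ _) _.
by rewrite (_ : 2 * h = h + h); [apply: lerD; exact: b|ring].
Qed.

Lemma schwarz i j f x : sm f -> pd j (pd i f) x = pd i (pd j f) x.
move=> sf; apply/eqP; rewrite -subr_eq0 -normr_le0; apply/ler_addgt0Pl => e e0; rewrite addr0.
have e2 : 0 < e / 2 by rewrite divr_gt0.
have c1 : continuous (pd j (pd i f)) by apply: sm_cts; do 2!apply: sm_pd.
have c2 : continuous (pd i (pd j f)) by apply: sm_cts; do 2!apply: sm_pd.
have n1 := (cvgrPdist_le _ _).1 (c1 x) _ e2; have n2 := (cvgrPdist_le _ _).1 (c2 x) _ e2.
have [r r0 hr] := nbhs_cube (filterI (n1 (nbhs_filter x)) (n2 (nbhs_filter x))).
have r20 : 0 < r / 2 by rewrite divr_gt0.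
have [y cy ey] := mixed_difference i j x sf r20; have [z cz ez] := mixed_difference j i x sf r20.
have rr : 2 * (r / 2) = r by field.
rewrite rr in cy cz; have [h1 _] := hr _ cy; have [_ h2] := hr _ cz.
have ep : f (x + (r / 2) *: unit_vec R j + (r / 2) *: unit_vec R i) = f (x + (r / 2) *: unit_vec R i + (r / 2) *: unit_vec R j).
 by congr f; exact: addrAC.
have swap (p q s t : R) : p - q - (s - t) = p - s - (q - t) by ring.
have e3 : pd j (pd i f) y = pd i (pd j f) z :=
 mulfI (lt0r_neq0 (exprn_gt0 2 r20)) (etrans (esym ey) (etrans (etrans (congr1 (fun p => p - _ - _) ep) (swap _ _ _ _)) ez)).
rewrite (splitr e); apply: le_trans (ler_distD (pd j (pd i f) y) _ _) (lerD h1 _).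
by rewrite e3 distrC; exact: h2.
Qed.
End Schwarz.

Lemma curl_parts_identity (R : comNzRingType) (A B : 'I_3 -> R) (P Q : 'I_3 -> 'I_3 -> R) :
  \sum_m (P (m + 1) (m + 2%:R) - P (m + 2%:R) (m + 1)) * B m - \sum_m A m * (Q (m + 1) (m + 2%:R) - Q (m + 2%:R) (m + 1)) =
  \sum_m ((A (m + 2%:R) * Q (m + 1) m + B m * P (m + 1) (m + 2%:R)) - (A (m + 1) * Q (m + 2%:R) m + B m * P (m + 2%:R) (m + 1))).
by rewrite !sum3 !I3E; ring. Qed.

(** * The Maxwell graphs *)
Section TestGraphs.
Context {R : realType} {H : lmodType R[i]} {rp : H -> H -> R} {J : H -> H}.
Hypotheses (hH : is_cip rp) (hJ : is_conj rp J).
Let ip := cip_ip hH.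
Variable T : set (H * H).
Hypotheses (Ti : forall y z, T (y, z) -> T ('i%C *: y, 'i%C *: z)) (TJ : forall y z, T (y, z) -> T (J y, J z)).

Definition test_graph : set (H * H) := [set p | forall y z, T (y, z) -> rp p.2 y = rp p.1 z].

Lemma test_graph0 : test_graph (0, 0).
by move=> y z _ /=; rewrite !(rp0l ip). Qed.
Lemma test_graphD x f y g : test_graph (x, f) -> test_graph (y, g) -> test_graph (x + y, f + g).
by move=> h1 h2 a b t; rewrite /= !(rpDl ip) (h1 a b t) (h2 a b t). Qed.
Lemma test_graphZ (c : R[i]) x f : test_graph (x, f) -> test_graph (c *: x, c *: f).
move=> h a b t; rewrite /= (scaleCE c x) (scaleCE c f) !(rpDl ip) !(rpZl ip) !(rpi_l hH).
by rewrite (h a b t) (h _ _ (Ti t)).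
Qed.

Lemma test_graphJ x f : test_graph (x, f) -> test_graph (J x, J f).
by move=> h a b t; rewrite /= !(rpJl hJ) (h _ _ (TJ t)). Qed.
Lemma test_graph_closed x_ f_ x f : (forall n, test_graph (x_ n, f_ n)) -> ip_cvg rp x_ x -> ip_cvg rp f_ f -> test_graph (x, f).
move=> h hx hf y z t; apply: (ip_cvg_rp2 ip hx hf) => n; exact: h.
Qed.
End TestGraphs.

Section MaxwellGraphs.
Variables (R : realType) (Omega : domain R).
Notation H := (L2 Omega).
Notation mu := (vol Omega).
Notation int f := (\int[mu]_x f x).
Notation F3 := ('I_3 -> R3 R -> R).
Notation l2v := (l2v Omega).
Notation pair := (pair Omega).
Notation rp := (@rp R Omega).
Notation nrm := (ipnorm rp).
Notation J := (@cj R Omega).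
Notation mkH := (mkH Omega).
Implicit Types (a b c al be : F3) (u v w : H).
Let hH := rp_is_cip Omega.
Let hJ := cj_is_conj Omega.
Let ip := rp_is_ip Omega.

Definition neg al : F3 := fun m x => - al m x.

Lemma tests_neg U al : tests U al -> tests U (neg al).
move=> h m; rewrite /neg (_ : (fun x => _) = (fun x => (-1) * al m x)); last by apply/funext => x; rewrite mulN1r.
by apply: rtestMl => //; exact: smooth_cst.
Qed.

Lemma rcurl_neg U al : tests U al -> rcurl (neg al) = neg (rcurl al).
move=> h; apply/funext => m; apply/funext => x; rewrite /rcurl /neg.
have e i j : pd i (fun x => - al j x) x = - pd i (al j) x.
 by under eq_fun do rewrite -mulN1r; rewrite pdZ ?mulN1r //; case: (h j).
by rewrite !e; ring.
Qed.

Lemma mkHi a b : l2v a -> l2v b -> 'i%C *: mkH a b = mkH (neg b) a.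
move=> la l_b; have lnb : l2v (neg b) by move=> m; apply: l2N.
apply: L2_ext; apply: filterS3 (L2ZE 'i%C (mkH a b)) (mkL2E (mkc_sqi la l_b)) (mkL2E (mkc_sqi lnb la)).
move=> x e1 e2 e3; rewrite /mkH e1 e2 e3; apply/matrixP => i j; rewrite (ord1 j) !mxE /neg.
by apply/eqP; rewrite eq_complex /=; apply/andP; split; apply/eqP; ring.
Qed.

Lemma mkHJ a b : l2v a -> l2v b -> J (mkH a b) = mkH a (neg b).
move=> la l_b; have lnb : l2v (neg b) by move=> m; apply: l2N.
apply: L2_ext; apply: filterS3 (cjE (mkH a b)) (mkL2E (mkc_sqi la l_b)) (mkL2E (mkc_sqi la lnb)).
by move=> x e1 e2 e3; rewrite /mkH e1 /conjf e2 e3; apply/matrixP => i j; rewrite (ord1 j) !mxE /neg.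
Qed.

Definition curl_tests U : set (H * H) := [set p | exists al be, [/\ tests U al, tests U be,
  p.1 = mkH al be & p.2 = mkH (rcurl al) (rcurl be)]].

Lemma curl_tests_i U y z : curl_tests U (y, z) -> curl_tests U ('i%C *: y, 'i%C *: z).
move=> [al [be [hal hbe /= -> ->]]]; exists (neg be), al; split => //; first exact: tests_neg.
 by rewrite mkHi //; exact: tests_l2.
by rewrite /= (rcurl_neg hbe) (mkHi (tests_l2 Omega (rcurl_tests hal)) (tests_l2 Omega (rcurl_tests hbe))).
Qed.

Lemma curl_tests_J U y z : curl_tests U (y, z) -> curl_tests U (J y, J z).
move=> [al [be [hal hbe /= -> ->]]]; exists al, (neg be); split => //; first exact: tests_neg.
 by rewrite mkHJ //; exact: tests_l2.
by rewrite /= (rcurl_neg hbe) (mkHJ (tests_l2 Omega (rcurl_tests hal)) (tests_l2 Omega (rcurl_tests hbe))).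
Qed.

Lemma tests0 U : tests U (fun _ _ => 0 : R). by move=> m; exact: rtest0. Qed.

Lemma weak_curl_graph U u w : test_graph (rp := rp) (curl_tests U) (u, w) <->
  weak_curl Omega U (re u) (re w) /\ weak_curl Omega U (im u) (im w).
split=> [h|[h1 h2] y z [al [be [hal hbe /= -> ->]]]].
 have t0 := @tests0 U; have l0 := tests_l2 Omega t0.
 split => al hal; have la := tests_l2 Omega hal; have lc := tests_l2 Omega (rcurl_tests hal).
  have := h _ _ (ex_intro _ al (ex_intro _ _ (And4 hal t0 erefl erefl))).
  by rewrite /= rcurl0 !rp_mkH // !pair0r !addr0.
 have := h _ _ (ex_intro _ _ (ex_intro _ al (And4 t0 hal erefl erefl))).
 by rewrite /= rcurl0 !rp_mkH // !pair0r !add0r.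
have [la lb] := (tests_l2 Omega hal, tests_l2 Omega hbe).
have [lc ld] := (tests_l2 Omega (rcurl_tests hal), tests_l2 Omega (rcurl_tests hbe)).
by rewrite !rp_mkH // h1 // h2.
Qed.

Lemma curl0_graph : (@curl0 R Omega) = test_graph (rp := rp) (curl_tests setT).
by apply/seteqP; split => -[u w] h; [apply/weak_curl_graph/curl0P|apply/curl0P/weak_curl_graph]. Qed.
Lemma curl_graph : (@curl R Omega) = test_graph (rp := rp) (curl_tests Omega).
by apply/seteqP; split => -[u w] h; [apply/weak_curl_graph/curlP|apply/curlP/weak_curl_graph]. Qed.
Lemma rcurl_parts al be : tests Omega al -> tests setT be -> pair (rcurl al) be = pair al (rcurl be).
move=> hal hbe; have [la lb] := (tests_l2 Omega hal, tests_l2 Omega hbe).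
have [lc ld] := (tests_l2 Omega (rcurl_tests hal), tests_l2 Omega (rcurl_tests hbe)).
have [i1 ->] := pairE lc lb; have [i2 ->] := pairE la ld.
apply/eqP; rewrite -subr_eq0 -(intB i1 i2); apply/eqP.
have tp m l i : rtest Omega (pd i (fun x => al m x * be l x)) by apply: rtest_pd; apply: rtestMr => //; case: (hbe l).
have ip' m l i : itg mu (pd i (fun x => al m x * be l x)) by have [] := rtest_itg Omega (tp m l i).
rewrite (_ : (fun x => _) = (fun x => \sum_m (pd (m + 1) (fun x => al (m + 2%:R) x * be m x) x
  - pd (m + 2%:R) (fun x => al (m + 1) x * be m x) x))).
 rewrite int_sum => [|m]; last exact: itgB. rewrite big1 // => m _; rewrite intB //.
 by rewrite !int_pd ?subrr //; apply: rtestMr => //; case: (hbe m).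
apply/funext => x.
have e m l i : pd i (fun x => al m x * be l x) x = al m x * pd i (be l) x + be l x * pd i (al m) x.
 by apply: pdM; [case: (hal m)|case: (hbe l)].
rewrite /rcurl [RHS](eq_bigr _ (fun m _ => congr2 _ (e (m + 2%:R) m (m + 1)) (congr1 -%R (e (m + 1) m (m + 2%:R))))).
exact: (curl_parts_identity (fun m => al m x) (fun m => be m x) (fun i l => pd i (al l) x) (fun i l => pd i (be l) x)).
Qed.

Hypothesis lb : lipschitz_boundary Omega.

(** This describes curl through curl0 alone, so that the pencils become weak graphs over the closed graph curl0.
*)
Theorem curl_is_adjoint v g : curl (v, g) <-> forall y z, curl0 (y, z) -> rp v z = rp g y.
split=> [/curlP[c1 c2] y z /curl0P[d1 d2]|h].
 rewrite (rp_pair (L2_sqi v) (L2_sqi z) (aeW _ (fun x => erefl)) (aeW _ (fun x => erefl))).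
 rewrite (rp_pair (L2_sqi g) (L2_sqi y) (aeW _ (fun x => erefl)) (aeW _ (fun x => erefl))).
 rewrite -(curl_adjoint lb (re_l2v v) (re_l2v g) (re_l2v y) (re_l2v z) c1 d1).
 by rewrite -(curl_adjoint lb (im_l2v v) (im_l2v g) (im_l2v y) (im_l2v z) c2 d2).
rewrite curl_graph => y z [al [be [hal hbe /= -> ->]]]; apply/esym/h.
apply: curl0_mkH; (try exact: tests_l2); (try exact: (tests_l2 Omega (rcurl_tests _)));
 by move=> ga hga; exact: rcurl_parts.
Qed.

Lemma grad_testP v : grad_test v <-> exists phi psi, [/\ rtest Omega phi, rtest Omega psi & v = mkH (rgrad phi) (rgrad psi)].
split=> [[phi [/test_funP[t1 t2] e]]|[phi [psi [t1 t2 ->]]]].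
 exists (fun x => complex.Re (phi x)), (fun x => complex.Im (phi x)); split => //.
 have [l1 l2] := (tests_l2 Omega (rgrad_tests t1), tests_l2 Omega (rgrad_tests t2)).
 apply: L2_ext; apply: filterS2 e (mkL2E (mkc_sqi l1 l2)) => x e1 e2; rewrite /mkH e1 e2.
 by apply/matrixP => i j; rewrite (ord1 j) !mxE.
have [l1 l2] := (tests_l2 Omega (rgrad_tests t1), tests_l2 Omega (rgrad_tests t2)).
exists (fun x => (phi x +i* psi x)%C); split; first exact/test_funP.
apply: filterS (mkL2E (mkc_sqi l1 l2)) => x e; rewrite /mkH e.
by apply/matrixP => i j; rewrite (ord1 j) !mxE.
Qed.

Lemma rgradD U (phi psi : R3 R -> R) : rtest U phi -> rtest U psi -> rgrad (fun x => phi x + psi x) = fun m x => rgrad phi m x + rgrad psi m x.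
by move=> [s1 _] [s2 _]; apply/funext => m; apply/funext => x; rewrite /rgrad pdD. Qed.
Lemma rgradN U (phi : R3 R -> R) : rtest U phi -> rgrad (fun x => - phi x) = neg (rgrad phi).
move=> [s1 _]; apply/funext => m; apply/funext => x; rewrite /rgrad /neg.
by under eq_fun do rewrite -mulN1r; rewrite pdZ ?mulN1r.
Qed.

Lemma mkHD a b a' b' : l2v a -> l2v b -> l2v a' -> l2v b' ->
  mkH a b + mkH a' b' = mkH (fun m x => a m x + a' m x) (fun m x => b m x + b' m x).
move=> la l_b la' l_b'.
have [l1 l2] : l2v (fun m x => a m x + a' m x) /\ l2v (fun m x => b m x + b' m x) by split => m; apply: l2D.
apply: L2_ext; apply: filterS3 (L2DE (mkH a b) (mkH a' b')) (mkL2E (mkc_sqi l1 l2))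
 (filterI (mkL2E (mkc_sqi la l_b)) (mkL2E (mkc_sqi la' l_b'))).
by move=> x e1 e2 [e3 e4]; rewrite /mkH e1 e2 e3 e4; apply/matrixP => i j; rewrite (ord1 j) !mxE.
Qed.

Lemma mkHZ (r : R) a b : l2v a -> l2v b -> r%:C%C *: mkH a b = mkH (fun m x => r * a m x) (fun m x => r * b m x).
move=> la l_b; have [l1 l2] : l2v (fun m x => r * a m x) /\ l2v (fun m x => r * b m x) by split => m; apply: l2Z.
apply: L2_ext; apply: filterS3 (L2ZE r%:C%C (mkH a b)) (mkL2E (mkc_sqi l1 l2)) (mkL2E (mkc_sqi la l_b)).
move=> x e1 e2 e3; rewrite /mkH e1 e2 e3; apply/matrixP => i j; rewrite (ord1 j) !mxE.
by apply/eqP; rewrite eq_complex /=; apply/andP; split; apply/eqP; ring.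
Qed.

Lemma grad_test_csub : csubspace (@grad_test R Omega).
have tl phi : rtest Omega phi -> l2v (rgrad phi) by move=> h; exact: tests_l2 (rgrad_tests h).
have gz (r : R) phi : rtest Omega phi -> rtest Omega (fun x => r * phi x) /\ rgrad (fun x => r * phi x) = fun m x => r * rgrad phi m x.
 move=> h; split; first by apply: rtestMl => //; exact: smooth_cst.
 by apply/funext => m; apply/funext => x; rewrite /rgrad pdZ //; case: h.
have D v w : grad_test v -> grad_test w -> grad_test (v + w).
 move=> /grad_testP[p [q [hp hq ->]]] /grad_testP[p' [q' [hp' hq' ->]]]; apply/grad_testP.
 exists (fun x => p x + p' x), (fun x => q x + q' x); split; [exact: rtestD|exact: rtestD|].
 by rewrite (mkHD (tl _ hp) (tl _ hq) (tl _ hp') (tl _ hq')) (rgradD hp hp') (rgradD hq hq').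
have Z (r : R) v : grad_test v -> grad_test (r%:C%C *: v).
 move=> /grad_testP[p [q [hp hq ->]]]; apply/grad_testP; have [t1 e1] := gz r p hp; have [t2 e2] := gz r q hq.
 by exists (fun x => r * p x), (fun x => r * q x); split => //; rewrite mkHZ ?e1 ?e2 //; exact: tl.
have I' v : grad_test v -> grad_test ('i%C *: v).
 move=> /grad_testP[p [q [hp hq ->]]]; apply/grad_testP.
 exists (fun x => - q x), p; split => //; last by rewrite mkHi ?(rgradN hq) //; exact: tl.
 by under eq_fun do rewrite -mulN1r; have [] := gz (-1) q hq.
split => //.
 have g0 : grad_test (mkH (rgrad (fun=> 0)) (rgrad (fun=> 0))).
  by apply/grad_testP; exists (fun=> 0), (fun=> 0); split => //; exact: rtest0.
 by have := Z 0 _ g0; rewrite (_ : 0%:C%C = 0) // scale0r.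
by move=> c v h; rewrite scaleCE; apply: D; [exact: Z|apply: Z; exact: I'].
Qed.

Definition VV : set H := @grad_H10dot R Omega.

Lemma grad_H10dotE : VV = adherence (rp := rp) (@grad_test R Omega).
apply/seteqP; split => v.
 move=> [g_ hg /cvgrPdist_le hv] e e0; have [N _ /(_ N (leqnn N)) h] := hv _ e0.
 exists (g_ N) => //; move: h; rewrite sub0r normrN ger0_norm //; exact: sqrtr_ge0.
move=> hv; have /choice[g_ hg] n : exists g, grad_test g /\ nrm (g - v) <= n.+1%:R^-1.
 have n0 : 0 < n.+1%:R^-1 :> R by []. by have [g gg le] := hv _ n0; exists g.
exists g_ => [n|]; first by have [] := hg n.
apply: (@squeeze_cvgr _ _ _ _ (fun=> 0) (fun n => n.+1%:R^-1)); [|exact: cvg_cst|exact: cvg_harmonic].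
by near=> n; apply/andP; split; [exact: sqrtr_ge0|have [] := hg n].
Unshelve. all: by end_near.
Qed.

Lemma VV_csub : csubspace VV.
by rewrite grad_H10dotE; apply: adherence_csub => //; exact: grad_test_csub. Qed.
Lemma VV_complete : ip_complete rp VV.
rewrite grad_H10dotE; apply: (adherence_complete hH); exact: L2_complete. Qed.

Lemma VV_ind (P : set H) : (forall x_ x, (forall n, P (x_ n)) -> ip_cvg rp x_ x -> P x) ->
  (forall phi psi, rtest Omega phi -> rtest Omega psi -> P (mkH (rgrad phi) (rgrad psi))) -> VV `<=` P.
move=> cl h v; rewrite grad_H10dotE => hv.
have /choice[g_ hg] n : exists g, grad_test g /\ nrm (g - v) <= n.+1%:R^-1.
 have n0 : 0 < n.+1%:R^-1 :> R by []. by have [g gg le] := hv _ n0; exists g.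
apply: (cl g_) => [n|e e0].
 by have [/grad_testP[phi [psi [h1 h2 ->]]] _] := hg n; exact: h.
have [N _ hN] := near_infty_natSinv_lt (PosNum e0).
exists N => n Nn; have [_ le] := hg n; apply: le_trans le _; exact: ltW (hN n Nn).
Qed.

Lemma VV_J v : VV v -> VV (J v).
apply: (VV_ind (P := fun v => VV (J v))) => [x_ x hx cx|phi psi h1 h2].
 rewrite grad_H10dotE => e e0; have e2 : 0 < e / 2 by rewrite divr_gt0.
 have [N hN] := cx _ e2; have := hx N; rewrite grad_H10dotE => /(_ _ e2)[g gg le].
 exists g => //; rewrite -[g - _](subrKA (J (x_ N))); apply: le_trans (nrmD ip _ _) _.
 rewrite [e]splitr; apply: lerD; first exact: le. rewrite -(conjB hJ) (nrmJ hJ); exact: hN.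
have [l1 l2] := (tests_l2 Omega (rgrad_tests h1), tests_l2 Omega (rgrad_tests h2)).
rewrite mkHJ // -(rgradN h2) grad_H10dotE; apply: adherence_sub => //.
apply/grad_testP; exists phi, (fun x => - psi x); split => //.
by under eq_fun do rewrite -mulN1r; apply: rtestMl => //; exact: smooth_cst.
Qed.

Lemma curl0_closed x_ f_ x f : (forall n, curl0 (x_ n, f_ n)) -> ip_cvg rp x_ x -> ip_cvg rp f_ f -> (@curl0 R Omega) (x, f).
rewrite curl0_graph; exact: test_graph_closed. Qed.

Lemma grad_curl_pair phi be : rtest Omega phi -> tests setT be -> pair (rgrad phi) (rcurl be) = 0.
move=> hphi hbe; have lp := tests_l2 Omega (rgrad_tests hphi).
have tc := rcurl_tests hbe; have lc := tests_l2 Omega tc.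
have [i1 ->] := pairE lp lc.
have tp m : rtest Omega (fun x => phi x * rcurl be m x) by apply: rtestMr => //; case: (tc m).
have ip' m : itg mu (pd m (fun x => phi x * rcurl be m x)) by have [] := rtest_itg Omega (rtest_pd m (tp m)).
rewrite (_ : (fun x => _) = (fun x => \sum_m pd m (fun x => phi x * rcurl be m x) x)).
 by rewrite int_sum // big1 // => m _; exact: int_pd.
apply/funext => x.
have e m : pd m (fun x => phi x * rcurl be m x) x = phi x * pd m (rcurl be m) x + rcurl be m x * pd m phi x.
 by apply: pdM; [case: hphi|case: (tc m)].
have s m : sm (be m) by case: (hbe m).
have c m : pd m (rcurl be m) x = pd m (pd (m + 1) (be (m + 2%:R))) x - pd m (pd (m + 2%:R) (be (m + 1))) x.
 rewrite /rcurl (_ : (fun x => _) = (fun x => pd (m + 1) (be (m + 2%:R)) x + (-1) * pd (m + 2%:R) (be (m + 1)) x)).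
  rewrite pdD ?pdZ ?mulN1r //; try exact: sm_pd. by apply: smoothM; [exact: smooth_cst|exact: sm_pd].
 by apply/funext => y; rewrite mulN1r.
rewrite !sum3 !e !c /rgrad !I3E.
rewrite (schwarz 1 0 x (s 2%:R)) (schwarz 2%:R 0 x (s 1)) (schwarz 2%:R 1 x (s 0)).
move: (pd 1 (pd 0 _) x) (pd 2%:R (pd 0 _) x) (pd 2%:R (pd 1 _) x) => p q r; ring.
Qed.

Lemma VV_curl0 v : VV v -> curl0 (v, 0).
apply: (VV_ind (P := fun v => curl0 (v, 0))) => [x_ x hx cx|phi psi h1 h2].
 apply: (curl0_closed hx cx) => e e0; exists 0%N => n _; rewrite subrr (nrm0 ip); exact: ltW.
rewrite curl0_graph => y z [al [be [hal hbe /= -> ->]]].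
have [l1 l2] := (tests_l2 Omega (rgrad_tests h1), tests_l2 Omega (rgrad_tests h2)).
have [lc ld] := (tests_l2 Omega (rcurl_tests hal), tests_l2 Omega (rcurl_tests hbe)).
rewrite (rp0l ip) rp_mkH //; have [e1 e2] := mkH_ae l1 l2.
rewrite (pair_ae (re_l2v _) l1 lc e1) (pair_ae (im_l2v _) l2 ld e2).
by rewrite !grad_curl_pair // addr0.
Qed.

Lemma ortho_Hdiv0 : ortho (rp := rp) VV = @Hdiv0 R Omega.
have key u phi psi : rtest Omega phi -> rtest Omega psi ->
  rp u (mkH (rgrad phi) (rgrad psi)) = pair (re u) (rgrad phi) + pair (im u) (rgrad psi).
 by move=> h1 h2; exact: (rp_mkH u (tests_l2 Omega (rgrad_tests h1)) (tests_l2 Omega (rgrad_tests h2))).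
have inV phi psi : rtest Omega phi -> rtest Omega psi -> VV (mkH (rgrad phi) (rgrad psi)).
 by move=> h1 h2; rewrite grad_H10dotE; apply: adherence_sub => //; apply/grad_testP; exists phi, psi.
have g0 : rgrad (fun=> 0 : R) = fun _ _ => 0 by apply/funext => m; apply/funext => x; exact: pd_cst.
apply/seteqP; split => [u h|u /Hdiv0P[h1 h2]].
 apply/Hdiv0P; split => psi hpsi.
  by have := h _ (inV _ _ hpsi (rtest0 _)); rewrite key //; [rewrite g0 pair0r addr0|exact: rtest0].
 by have := h _ (inV _ _ (rtest0 _) hpsi); rewrite key //; [rewrite g0 pair0r add0r|exact: rtest0].
apply: VV_ind => [x_ x hx cx|phi psi t1 t2]; last by rewrite key // h1 // h2 // addr0.
by rewrite (rpC ip); apply: (ip_cvg_rp ip cx) => n; rewrite (rpC ip).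
Qed.
End MaxwellGraphs.

(** * Compactness of the decaying parts *)
Section OperatorNorm.
Variable R : realType.
Implicit Types (A : 'M[R]_3) (h : 'cV[R]_3).

Lemma opnorm_has_sup A : has_sup [set enorm (A *m h) | h in [set h : 'cV[R]_3 | enorm h = 1]].
pose B := \sum_i \sum_j `|A i j|.
have hB i j : `|A i j| <= B.
 rewrite /B (bigD1 i) //= (bigD1 j) //= -addrA lerDl addr_ge0 // ?sumr_ge0 // => k _. by rewrite sumr_ge0.
have B0 : 0 <= B by exact: le_trans (normr_ge0 _) (hB 0 0).
split.
 by exists (enorm (A *m delta_mx 0 0)), (delta_mx 0 0) => //; exact: enorm_delta.
exists (3 * B) => _ [h /= h1 <-].
have := dotv_entries h hB; rewrite (enorm1_dotv h1) mulr1 => le.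
have k0 : 0 <= 3 * B by rewrite mulr_ge0.
by rewrite /enorm -(ger0_norm k0) -sqrtr_sqr ler_wsqrtr.
Qed.

Lemma opnorm_bound A h d : opnorm A <= d -> dotv (A *m h) (A *m h) <= d ^+ 2 * dotv h h.
move=> Ad; have [->|h0] := eqVneq h 0; first by rewrite mulmx0 !dotv0 mulr0.
have [g g1 [t t0 [-> t2]]] := enorm1_scale h0.
have le : enorm (A *m g) <= d.
 apply: le_trans Ad; apply: sup_upper_bound; first exact: opnorm_has_sup. by exists g.
have -> : dotv (A *m (t *: g)) (A *m (t *: g)) = dotv (A *m g) (A *m g) * t ^+ 2.
 by rewrite -scalemxAr dotvZl dotvZr mulrA mulrC expr2.
rewrite -t2; apply: ler_wpM2r; first exact: sqr_ge0.
have : 0 <= enorm (A *m g) by exact: sqrtr_ge0.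
move=> e0; rewrite -(sqr_sqrtr (dotv_ge0 (A *m g))) lerXn2r // nnegrE //; exact: le_trans e0 le.
Qed.
End OperatorNorm.

Section Compactness.
Variables (R : realType) (Omega : domain R).
Notation H := (L2 Omega).
Notation mu := (vol Omega).
Notation rp := (@rp R Omega).
Notation nrm := (ipnorm rp).
Notation fin := (fin (rp := rp)).
Notation Sq := (Sq Omega).
Notation cutn := (@cutn R Omega).
Implicit Types (A : R3 R -> 'M[R]_3) (u w : H).
Let hH := rp_is_cip Omega.
Let ip := rp_is_ip Omega.
Hypothesis lb : lipschitz_boundary Omega.

Definition vanishing A := forall d, 0 < d -> exists r, {ae mu, forall x, ~ cube 0 r x ->
  forall h, dotv (A x *m h) (A x *m h) <= d ^+ 2 * dotv h h}.

Lemma bmf_scalar C chi : rtest setT chi -> exists B, bmf B (fun x : R3 R => (C * chi x)%:M).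
move=> hchi; have [M M0 hM] := rtest_bd hchi; exists (`|C| * M).
split=> [i j|x i j]; last first.
 rewrite !mxE; case: (i == j); rewrite ?mulr1n ?mulr0n ?normr0; last by rewrite mulr_ge0 // ltW.
 by rewrite normrM ler_wpM2l.
under eq_fun do rewrite mxE; case: (i == j); last by under eq_fun do rewrite mulr0n; exact: measurable_cst.
under eq_fun do rewrite mulr1n; apply: measurable_funM => //.
by apply: sm_mf; case: hchi.
Qed.

Lemma opm_cutoff C chi u : rtest setT chi ->
  rp (opm (fun x => (C * chi x)%:M) u) (opm (fun x => (C * chi x)%:M) u) = C ^+ 2 * cutn chi u.
move=> hchi; have [M hb] := bmf_scalar C hchi.
rewrite (rp_opm2 hb) /cutn /Sq -big_split /= mulr_sumr.
have [l1 l2] := (mulv_l2 hchi (re_l2v u), mulv_l2 hchi (im_l2v u)).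
rewrite (_ : (fun x => _) = (fun x => \sum_i (C ^+ 2 * (mulv chi (re u) i x ^+ 2 + mulv chi (im u) i x ^+ 2)))).
 rewrite int_sum => [|i]; last by apply: itgZ; apply: itgD; exact: l2_sqr.
 apply: eq_bigr => i _; rewrite intZ ?intD //; (try apply: itgD); exact: l2_sqr.
apply/funext => x; rewrite -big_split /=; apply: eq_bigr => i _.
have e (v : 'I_3 -> R) : \sum_j (C * chi x)%:M i j * v j = C * chi x * v i.
 rewrite (bigD1 i) //= big1 ?addr0 => [|j /negPf ji]; rewrite mxE; first by rewrite eqxx mulr1n.
 by rewrite eq_sym ji mulr0n mul0r.
by rewrite !e /mulv; ring.
Qed.

(** Outside a large cube the field of matrices is small, and inside, the cutoff is one. *)
Lemma decay_bound A C : 0 <= C -> bmf C A -> vanishing A -> forall d, 0 < d -> exists2 chi, rtest setT chi &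
  forall u, nrm (opm A u) <= d * nrm u + 3 * C * Num.sqrt (cutn chi u).
move=> C0 hA vA d d0; have [r0 hr] := vA d d0.
pose r := `|r0| + 1.
have rp0 : 0 < r by rewrite ltr_wpDl.
have r20 : 0 < 2 * r by rewrite mulr_gt0.
have tchi := plateau_rtest (0 : R3 R) r20; exists (plateau 0 (2 * r)) => // u.
have [M hb] := bmf_scalar (3 * C) tchi.
have dom : {ae mu, forall x, forall h, dotv (A x *m h) (A x *m h) <= d ^+ 2 * dotv h h +
  dotv ((3 * C * plateau (0 : R3 R) (2 * r) x)%:M *m h) ((3 * C * plateau (0 : R3 R) (2 * r) x)%:M *m h)}.
 apply: filterS hr => x hx h. have [cx|ncx] := pselect (cube 0 r x); last first.
  apply: le_trans (hx _ h) _; last by rewrite lerDl dotv_ge0. move=> cx; apply: ncx => i; apply: le_trans (cx i) _.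
  by rewrite /r (le_trans (ler_norm _)) // lerDl.
 rewrite plateau_in //; last by rewrite mulrAC divff ?mul1r // pnatr_eq0.
 rewrite mulr1 mul_scalar_mx dotvZl dotvZr mulrA -expr2. apply: le_trans (dotv_entries h (hA.2 x)) _.
 by rewrite lerDr mulr_ge0 ?sqr_ge0 ?dotv_ge0.
have := @opm_dom R Omega C A hA (d ^+ 2) M _ u hb dom; rewrite opm_cutoff // -(nrm_sqr ip u) => le.
have s0 := sqrtr_ge0 (cutn (plateau 0 (2 * r)) u); have n0 := nrm_ge0 (rp := rp) u.
have c3 : 0 <= 3 * C by rewrite mulr_ge0.
have cu : 0 <= cutn (plateau 0 (2 * r)) u by rewrite addr_ge0 ?Sq_ge0.
have y0 : 0 <= d * nrm u + 3 * C * Num.sqrt (cutn (plateau 0 (2 * r)) u).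
 by rewrite addr_ge0 // mulr_ge0 // ltW.
rewrite -ler_sqr ?nnegrE ?(nrm_ge0 (rp := rp)) // (nrm_sqr ip); apply: le_trans le _.
rewrite sqrrD !exprMn (sqr_sqrtr cu) -[X in _ <= X]addrA [_ *+ 2 + _]addrC addrA lerDl mulrn_wge0 //.
by rewrite mulr_ge0 // mulr_ge0 // ltW.
Qed.

Definition compact_part (q : H -> R) := forall d, 0 < d -> exists es, forall u w, curl0 (u, w) -> Hdiv0 Omega u ->
  q u <= d * (nrm u + nrm w) + fin es u.

Lemma compact_partD q q' : compact_part q -> compact_part q' -> compact_part (fun u => q u + q' u).
move=> h h' d d0; have d2 : 0 < d / 2 by rewrite divr_gt0.
have [es hes] := h _ d2; have [es' hes'] := h' _ d2; exists (es ++ es') => u w D X.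
rewrite fin_cat; apply: le_trans (lerD (hes u w D X) (hes' u w D X)) _.
by rewrite addrACA -mulrDl -splitr.
Qed.

Lemma compact_partZ k q : 0 <= k -> compact_part q -> compact_part (fun u => k * q u).
move=> k0 h d d0; have k1 : 0 < k + 1 by rewrite ltr_wpDl.
have [es hes] := h _ (divr_gt0 d0 k1); exists [seq k%:C%C *: e | e <- es] => u w D X.
rewrite fin_scale // (ger0_norm k0); apply: le_trans (ler_wpM2l k0 (hes u w D X)) _.
rewrite mulrDr lerD2r mulrA ler_wpM2r ?addr_ge0 ?(nrm_ge0 (rp := rp)) //.
by rewrite mulrA ler_pdivrMr // mulrC ler_pM2l // lerDl.
Qed.

Lemma compact_part_le q q' : compact_part q' -> (forall u, q u <= q' u) -> compact_part q.
by move=> h le d d0; have [es hes] := h _ d0; exists es => u w D X; apply: le_trans (le u) _; exact: hes. Qed.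
Lemma compact_part_opm A C : 0 <= C -> bmf C A -> vanishing A -> compact_part (fun u => nrm (opm A u)).
move=> C0 hA vA d d0; have d2 : 0 < d / 2 by rewrite divr_gt0.
have [chi hchi le] := decay_bound C0 hA vA d2.
have c3 : 0 <= 3 * C by rewrite mulr_ge0.
have [es hes] := compact_partZ c3 (fun d d0 => cutoff_compact lb hchi d0) d2.
exists es => u w D X; apply: le_trans (le u) _.
apply: le_trans (lerD (lexx _) (hes u w D X)) _; rewrite addrA lerD2r.
rewrite -mulrDr [d in leRHS]splitr mulrDl; rewrite -mulrDr.
have := nrm_ge0 (rp := rp) w; have := nrm_ge0 (rp := rp) u; move: (nrm u) (nrm w) => p q p0 q0.
have : 0 <= d / 2 * q by rewrite mulr_ge0 // ltW.
by rewrite !mulrDr; move: (d / 2 * p) (d / 2 * q) => *; lra.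
Qed.

Lemma young_sqrt K s G N : 0 <= K -> 0 < s -> 0 <= G -> 0 <= N ->
  K * (G * N) + K * N ^+ 2 <= (s * G + (K / s + K + 1) * N) ^+ 2 :> R.
move=> K0 s0 G0 N0; set L := K / s + K + 1.
have ks : 0 <= K / s by rewrite divr_ge0 // ltW.
have sL : K <= s * L.
 rewrite /L !mulrDr (_ : s * (K / s) = K); last by field; rewrite lt0r_neq0.
 rewrite mulr1 -addrA lerDl; apply: addr_ge0; last exact: ltW. by apply: mulr_ge0 => //; exact: ltW.
have L1 : 1 <= L by rewrite /L lerDr addr_ge0.
have LK : K <= L by rewrite /L -addrA addrCA lerDl addr_ge0.
have L2 : K <= L ^+ 2 by rewrite expr2; apply: le_trans LK _; rewrite ler_peMl // (le_trans ler01).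
have GN : 0 <= G * N by rewrite mulr_ge0.
have t1 := ler_wpM2r GN sL; have t2 := ler_wpM2r (sqr_ge0 N) L2.
rewrite (_ : (s * G + L * N) ^+ 2 = (s * G) ^+ 2 + 2 * (s * L * (G * N)) + L ^+ 2 * N ^+ 2); last by ring.
have t3 : 0 <= s * L * (G * N) by apply: le_trans t1; rewrite mulr_ge0.
have t4 := sqr_ge0 (s * G).
move: t1 t2 t3 t4; move: (K * (G * N)) (K * N ^+ 2) (s * L * _) (L ^+ 2 * _) ((s * G) ^+ 2) => *; lra.
Qed.

Lemma half_split (F S X W G Q : R) : S <= G -> 0 <= X -> 0 <= W -> Q <= (X + W) / 2 + F ->
  W / 2 + (S + Q) <= X + W + G + F.
lra. Qed.

Lemma compact_part_curl A C : 0 <= C -> bmf C A -> vanishing A -> forall d, 0 < d -> exists es, forall x w g,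
  Hdiv0 Omega x -> curl0 (x, w) -> (forall y z, curl0 (y, z) -> rp w z = rp g y) ->
  nrm (opm A w) <= d * (nrm x + nrm w + nrm g) + fin es x.
move=> C0 hA vA d d0; have d2 : 0 < d / 2 by rewrite divr_gt0.
have [chi hchi le] := decay_bound C0 hA vA d2.
have [chi' [K [hchi' K0 cac]]] := caccioppoli Omega hchi.
have c3 : 0 < 3 * C + 1 by rewrite ltr_wpDl // mulr_ge0.
pose s := d / (3 * C + 1).
have s0 : 0 < s by rewrite divr_gt0.
pose L := K / s + K + 1.
have L0 : 0 <= L by rewrite addr_ge0 // addr_ge0 // divr_ge0 // ltW.
have c30 : 0 <= 3 * C by rewrite mulr_ge0.
have [es hes] := compact_partZ (mulr_ge0 c30 L0) (fun d d0 => cutoff_compact lb hchi' d0) d2.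
exists es => x w g X D hyz; apply: le_trans (le w) _.
have cw := cac x w g D hyz.
have G0 := nrm_ge0 (rp := rp) g; have N0 := sqrtr_ge0 (cutn chi' x).
have cu : 0 <= cutn chi' x by rewrite addr_ge0 ?Sq_ge0.
have sw : Num.sqrt (cutn chi w) <= s * nrm g + L * Num.sqrt (cutn chi' x).
 have y0 : 0 <= s * nrm g + L * Num.sqrt (cutn chi' x) by apply: addr_ge0; apply: mulr_ge0 => //; exact: ltW.
 rewrite -(ger0_norm y0) -sqrtr_sqr; apply: ler_wsqrtr; apply: le_trans cw _.
 by rewrite -[X in _ + K * X](sqr_sqrtr cu); exact: young_sqrt.
have h := hes x w D X.
have sg : 3 * C * (s * nrm g) <= d * nrm g.
 rewrite mulrA ler_wpM2r // /s mulrA ler_pdivrMr // mulrC ler_pM2l // lerDl //.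
apply: le_trans (lerD (lexx _) (ler_wpM2l c30 sw)) _; rewrite mulrDr.
rewrite [3 * C * (L * _)]mulrA.
have dx : 0 <= d * nrm x by apply: mulr_ge0; [exact: ltW|exact: nrm_ge0].
have dw : 0 <= d * nrm w by apply: mulr_ge0; [exact: ltW|exact: nrm_ge0].
have e1 : d / 2 * (nrm x + nrm w) = (d * nrm x + d * nrm w) / 2 by rewrite mulrAC mulrDr.
have e2 : d / 2 * nrm w = (d * nrm w) / 2 by rewrite mulrAC.
have e3 : d * (nrm x + nrm w + nrm g) = d * nrm x + d * nrm w + d * nrm g by rewrite !mulrDr.
rewrite e2 e3; rewrite e1 in h; exact: half_split sg dx dw h.
Qed.
End Compactness.

(** * The coefficients at infinity *)
Section Coefficients.
Variables (R : realType) (Omega : domain R).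
Notation mu := (vol Omega).
Implicit Types (A F : R3 R -> 'M[R]_3).

Lemma coef_model A m M : coefficient Omega A m M -> exists B F, [/\ 0 < B, bmf B F &
  {ae mu, forall x, [/\ F x = A x, (F x)^T = F x & forall h, m * dotv h h <= dotv h (F x *m h) <= M * dotv h h]}].
move=> hA; have [B [E [B0 [mE _] aeE mA good]]] := coef_good hA.
exists B, (cutfield E A); split=> //.
 by apply: cutfield_bmf => //; [exact: ltW|move=> x /good[]].
by apply: filterS aeE => x Ex; rewrite cutfieldE //; have [_ s q] := good x Ex.
Qed.

Lemma inv_model A m M : 0 < m -> coefficient Omega A m M -> exists B F, [/\ 0 < B, bmf B F &
  exists2 c, 0 < c & {ae mu, forall x, [/\ F x = invmx (A x), (F x)^T = F x,
    forall h, c * dotv h h <= dotv h (F x *m h) &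
    A x \in unitmx /\ forall h, m ^+ 2 * dotv (F x *m h) (F x *m h) <= dotv h h]}].
move=> m0 hA; have [B [E [B0 [mE _] aeE mA good]]] := coef_good hA.
have lo x : E x -> forall h, m * dotv h h <= dotv h (A x *m h).
 by move=> /good[_ _ q] h; case/andP: (q h).
exists m^-1, (cutfield E (fun x => invmx (A x))); split; first by rewrite invr_gt0.
 apply: cutfield_bmf => //; first by rewrite invr_ge0 ltW.
  by apply: measurable_invmx => // x /lo; exact: posdef_unit.
 by move=> x /lo lx i j; exact: invmx_entry.
exists (m / (3 * B) ^+ 2); first by rewrite divr_gt0 // exprn_gt0 // mulr_gt0.
apply: filterS aeE => x Ex; rewrite cutfieldE //; have [b s _] := good x Ex.
split => //; first exact: (invmx_sym s).
 exact: invmx_ge m0 (lo x Ex) B0 b.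
by split; [exact: posdef_unit m0 (lo x Ex)|exact: invmx_bound m0 (lo x Ex)].
Qed.

Lemma far_enorm (x : R3 R) r : ~ cube 0 r x -> r < enorm (to_col x).
move=> ncx; rewrite ltNge; apply/negP => le; apply: ncx => i; apply: le_trans le.
rewrite -sqrtr_sqr /enorm; apply: ler_wsqrtr.
rewrite /dotv (bigD1 i) //= -expr2.
have -> : co i x - co i (0 : R3 R) = to_col x i 0.
 by rewrite co0 subr0.
by rewrite lerDl sumr_ge0 // => j _; rewrite -expr2 sqr_ge0.
Qed.

Lemma tail_small (eps mu sig : R3 R -> 'M[R]_3) eps_inf mu_inf :
  tail_deviation Omega eps mu sig eps_inf mu_inf r @[r --> +oo] --> 0%E ->
  forall d, 0 < d -> exists r, {ae vol Omega, forall x, ~ cube 0 r x ->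
    [/\ opnorm (eps x - eps_inf%:M) <= d, opnorm (mu x - mu_inf%:M) <= d & opnorm (sig x) <= d]}.
move=> /fine_cvgP[fin cv] d d0.
have lt := cvgr_lt _ cv d d0.
have [r [fr lr]] := filter_ex (filterI fin (lt _)); exists r.
have : (tail_deviation Omega eps mu sig eps_inf mu_inf r <= d%:E)%E.
 by rewrite -(fineK fr) lee_fin ltW.
move/ess_supP; apply: filterS => x hx /far_enorm lx.
by move: hx; rewrite lx lee_fin !ge_max => /andP[-> /andP[-> ->]].
Qed.

Lemma vanishing_coef A F c : {ae mu, forall x, F x = A x} ->
  (forall d, 0 < d -> exists r, {ae mu, forall x, ~ cube 0 r x -> opnorm (A x - c%:M) <= d}) ->
  vanishing Omega (fun x => F x - c%:M).
move=> FA h d d0; have [r hr] := h d d0; exists r; apply: filterS2 FA hr => x -> hx ncx k.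
by apply: opnorm_bound; exact: hx.
Qed.

(** F - 1/c = - F (A - c) / c, with [F] bounded. *)
Lemma vanishing_inv A F m c : 0 < m -> 0 < c ->
  {ae mu, forall x, F x = invmx (A x) /\ (A x \in unitmx /\ forall h, m ^+ 2 * dotv (F x *m h) (F x *m h) <= dotv h h)} ->
  (forall d, 0 < d -> exists r, {ae mu, forall x, ~ cube 0 r x -> opnorm (A x - c%:M) <= d}) ->
  vanishing Omega (fun x => F x - (c^-1)%:M).
move=> m0 c0 FA h d d0; have k0 : 0 < d * (m * c) by rewrite !mulr_gt0.
have [r hr] := h _ k0; exists r; apply: filterS2 FA hr => x [Fx [ux bx]] hx ncx k.
have -> : (F x - (c^-1)%:M) *m k = - c^-1 *: (F x *m ((A x - c%:M) *m k)).
 rewrite Fx !mulmxBl !mul_scalar_mx mulmxBr mulKmx // -scalemxAr scalerBr scalerA mulNr.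
 by rewrite mulVf ?gt_eqF // scaleN1r opprK scaleNr addrC.
rewrite dotvZl dotvZr mulrA -expr2 sqrrN.
have b1 := bx ((A x - c%:M) *m k); have b2 := opnorm_bound k (hx ncx).
have c2 : 0 < c^-1 ^+ 2 by rewrite exprn_gt0 // invr_gt0.
have m2 : 0 < m ^+ 2 by rewrite exprn_gt0.
have := le_trans b1 b2; move: (dotv _ _) (dotv k k) => p q le.
rewrite -(ler_pM2l m2) mulrCA.
apply: le_trans (ler_wpM2l (ltW c2) le) _.
apply: le_of_eq; field; exact: lt0r_neq0.
Qed.
End Coefficients.

(** * The pencils *)
Section Pencils.
Variables (R : realType) (Omega : domain R).
Notation H := (L2 Omega).
Notation rp := (@rp R Omega).
Notation nrm := (ipnorm rp).
Notation J := (@cj R Omega).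
Notation D := (@curl0 R Omega).
Notation V := (@VV R Omega).
Notation X := (Hdiv0 Omega).
Notation bel := (bounded_mod_finite rp).
Let hH := rp_is_cip Omega.
Let hJ := cj_is_conj Omega.
Let ip := rp_is_ip Omega.
Let Hc := @L2_complete R Omega.

Lemma ae_exists (P : set (R3 R)) : {ae vol Omega, forall x, P x} -> exists x, P x.
move=> [N [mN N0 PN]]; apply: contrapT => nP.
have NT : N = setT by apply/seteqP; split=> // x _; apply: PN => /= Px; apply: nP; exists x.
have [x0 Ox0] := domain_nonempty Omega.
have [r r0 hr] := nbhs_cube (open_nbhs_nbhs (conj (domain_open Omega) Ox0)).
have : (volume R (cube x0 r) <= vol Omega setT)%E.
 have -> : vol Omega setT = volume R (setT `&` Omega) by [].
 rewrite setTI; apply: le_measure => //; rewrite inE; first exact: cube_meas.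
 exact: open_measurable_R3 (domain_open Omega).
rewrite -NT N0 volume_cube; last exact: ltW.
by rewrite lee_fin leNgt => /negP; apply; rewrite exprn_gt0 // mulr_gt0.
Qed.

Lemma ae_conj (P Q : R3 R -> Prop) : {ae vol Omega, forall x, P x} -> {ae vol Omega, forall x, Q x} ->
  {ae vol Omega, forall x, P x /\ Q x}.
by move=> p q; apply: filterS2 p q. Qed.
Lemma bmf_shift B F c : bmf B F -> bmf (B + `|c|) (fun x : R3 R => F x - c%:M).
move=> [mF bF]; split=> [i j|x i j].
 by under eq_fun do rewrite !mxE; apply: measurable_funB => //; exact: measurable_cst.
rewrite !mxE; apply: le_trans (ler_normB _ _) _; apply: lerD => //.
by case: (i == j); rewrite ?mulr1n ?mulr0n ?normr0.
Qed.

Lemma opm_shift B F c (u : H) : bmf B F -> opm (fun x => F x - c%:M) u = opm F u - c%:C%C *: u.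
move=> hF; symmetry; apply: (opm_eq (bmf_shift c hF)).
apply: filterS3 (L2BE (opm F u) (c%:C%C *: u)) (opmE hF u) (L2ZE c%:C%C u) => x -> -> ->.
rewrite /toC map_mxB map_scalar_mx mulmxBl mul_scalar_mx //.
Qed.

Lemma curl0_D0 : D (0, 0).
rewrite curl0_graph; exact: test_graph0. Qed.
Lemma curl0_DD x f y g : D (x, f) -> D (y, g) -> D (x + y, f + g).
rewrite curl0_graph; exact: test_graphD. Qed.
Lemma curl0_DZ (c : R[i]) x f : D (x, f) -> D (c *: x, c *: f).
by rewrite curl0_graph; apply: test_graphZ => //; exact: curl_tests_i. Qed.
Lemma curl0_DJ x f : D (x, f) -> D (J x, J f).
by rewrite curl0_graph; apply: test_graphJ => //; exact: curl_tests_J. Qed.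
Lemma Im_L2inner (u v : H) : complex.Im (L2inner u v) = rp u ('i%C *: v).
have ae_u : {ae vol Omega, forall x, u x = u x} by apply: aeW.
rewrite (rp_ae (L2_sqi u) (sqiZ 'i%C (L2_sqi v)) ae_u (L2ZE 'i%C v)) /=.
apply: eq_Rintegral => x _; rewrite /rdot Im_sum; apply: eq_bigr => i _.
rewrite reZ imZ Im_conjM /= /re /im /L2repr; ring.
Qed.

Lemma op_add_scalar0 (T : set (H * H)) : op_add T (op_scalar (- 0)) = T.
apply/seteqP; split=> -[u f] /=.
 by move=> [g [h [/= Tg]]]; rewrite /op_scalar /= oppr0 scale0r => -> ->; rewrite addr0.
by move=> Tf; exists f, 0; split=> //=; rewrite ?addr0 // /op_scalar /= oppr0 scale0r.
Qed.

Lemma mul_opP B F (M : R3 R -> 'M[R[i]]_3) (u h : H) : bmf B F -> {ae vol Omega, forall x, M x = toC (F x)} ->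
  mul_op M (u, h) <-> h = opm F u :> H.
move=> hF MF; split=> [e|->].
 by apply: (opm_eq hF); apply: filterS2 e MF => x /= -> ->.
by apply: filterS2 (opmE hF u) MF => x /= -> ->.
Qed.

Hypothesis lb : lipschitz_boundary Omega.

Lemma VV_D v : V v -> D (v, 0). exact: VV_curl0. Qed.

Definition wave (E S : R3 R -> 'M[R]_3) (w : R[i]) (u : H) : H :=
  - w ^+ 2 *: opm E u + - ('i%C * w) *: opm S u.

Section Wave.
Variables (E S : R3 R -> 'M[R]_3) (BE BS : R) (eps sig : R3 R -> 'M[R]_3).
Hypotheses (hE : bmf BE E) (hS : bmf BS S) (BE0 : 0 <= BE) (BS0 : 0 <= BS).

Lemma wave_bl w : exists2 C, 0 <= C & bounded_linear (rp := rp) (wave E S w) C.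
have bE := opm_bl Omega hE BE0; have bS := opm_bl Omega hS BS0.
pose k1 := `|complex.Re (- w ^+ 2)| + `|complex.Im (- w ^+ 2)|.
pose k2 := `|complex.Re (- ('i%C * w))| + `|complex.Im (- ('i%C * w))|.
exists (k1 * (3 * BE) + k2 * (3 * BS)).
 by rewrite addr_ge0 // mulr_ge0 ?addr_ge0 // mulr_ge0.
split=> [x y|c x|x].
- by rewrite /wave (blD bE) (blD bS) !scalerDr addrACA.
- by rewrite /wave (blZ bE) (blZ bS) scalerDr !scalerA ![_ * c]mulrC.
rewrite mulrDl; apply: le_trans (nrmD ip _ _) _; apply: lerD.
 apply: le_trans (nrm_scale_le hH _ _) _; rewrite -mulrA; apply: ler_wpM2l; first exact: addr_ge0. exact: (bl_bd bE).
apply: le_trans (nrm_scale_le hH _ _) _; rewrite -mulrA; apply: ler_wpM2l; first exact: addr_ge0.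
exact: (bl_bd bS).
Qed.

Hypotheses (sE : {ae vol Omega, forall x, (E x)^T = E x}) (sS : {ae vol Omega, forall x, (S x)^T = S x}).

Lemma wave_J w x y : rp (wave E S w x) y = rp x (J (wave E S w (J y))).
rewrite /wave (opmJ hE) (opmJ hS) (conjD hJ) !(conjZ hJ) !(conjK hJ) (rpDl ip) (rpDr ip).
congr (_ + _); rewrite (rp_scaler hH) conjcK.
 by rewrite -(opmZ hE) (opm_sym hE) // opmZ.
by rewrite -(opmZ hS) (opm_sym hS) // opmZ.
Qed.

Hypotheses (epsE : {ae vol Omega, forall x, E x = eps x}) (sigS : {ae vol Omega, forall x, S x = sig x}).

Lemma mul_W_wave w u h : @mul_W R Omega eps sig w (u, h) <-> h = wave E S w u.
have key : {ae vol Omega, forall x, wave E S w u x =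
  (- w *: (w *: toC (eps x) + 'i%C *: toC (sig x))) *m u x}.
 have a1 := L2DE (- w ^+ 2 *: opm E u) (- ('i%C * w) *: opm S u).
 have a2 := ae_conj (L2ZE (- w ^+ 2) (opm E u)) (L2ZE (- ('i%C * w)) (opm S u)).
 have a3 := ae_conj (ae_conj (opmE hE u) (opmE hS u)) (ae_conj epsE sigS).
 apply: (filterS3 _ _ a1 a2 a3) => x b1 [b2 b2'] [[b3 b3'] [b4 b4']].
 rewrite b1 b2 b2' b3 b3' b4 b4' -scalemxAl mulmxDl -!scalemxAl scalerDr !scalerA.
 by rewrite expr2 !mulNr ['i%C * w]mulrC.
split=> [e|->]; last exact: key.
by apply: L2_ext; apply: filterS2 e key => x /= -> ->.
Qed.

Variables (N mu : R3 R -> 'M[R]_3) (BN : R).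
Hypotheses (hN : bmf BN N) (muN : {ae vol Omega, forall x, N x = invmx (mu x)}).

Lemma pencil_LE w : pencil_L Omega eps mu sig w = graph_L (rp := rp) D (opm N) (wave E S w).
have mE a b : @mul_op R Omega (fun x => toC (invmx (mu x))) (a, b) <-> b = opm N a.
 have MF : {ae vol Omega, forall x, toC (invmx (mu x)) = toC (N x)} by apply: filterS muN => x ->.
 exact: (mul_opP a b hN MF).
apply/seteqP; split=> -[u f] /=.
 move=> [g [h [[b [[a [Da mab]] cg]] hW fE]]]; exists a; first exact: Da.
 move=> y z Dyz; have bE : b = opm N a := (mE a b).1 mab. have fE' : f = g + h := fE; have gE : f - wave E S w u = g.
  by rewrite fE' ((mul_W_wave w u h).1 hW) addrK.
 rewrite -bE; rewrite [_ - _]gE; exact: ((curl_is_adjoint lb b g).1 cg).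
move=> [a Da ha]; exists (f - wave E S w u), (wave E S w u); split; last by rewrite subrK.
 by exists (opm N a); split; [exists a; split=> //; exact/mE|exact/(curl_is_adjoint lb)].
exact/mul_W_wave.
Qed.

Lemma orth_projP u p : orth_proj V (u, p) <-> V p /\ ortho (rp := rp) V (u - p).
split=> -[Vp h]; (split; first exact: Vp) => v Vv; first by have e : L2inner (u - p) v = 0 := h v Vv; rewrite -[LHS]/(complex.Re (L2inner (u - p) v)) e.
apply/eqP; rewrite eq_complex Im_L2inner; apply/andP; split; apply/eqP; first exact: h.
by apply: h; have [_ _ VZ] := @VV_csub R Omega; exact: VZ.
Qed.

Lemma pencil_WE w : pencil_W Omega eps sig w =
  graph_W hH (@VV_csub R Omega) (@VV_complete R Omega) (wave E S w).
apply/seteqP; split=> -[u f] /=.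
 move=> [Vu [h [/mul_W_wave -> /orth_projP[Vf Xf]]]]; split; first exact: Vu. exact/esym/prj_uniq.
move=> [Vu fE]; have {fE} -> : f = _ := fE; split; first exact: Vu.
exists (wave E S w u); split; first exact/mul_W_wave.
apply/orth_projP; split; [exact: prjV|exact: prjX].
Qed.
End Wave.

Lemma curl_curl0_scalar (mi : R) (a : R[i]) u f :
  scalar_graph (rp := rp) D X mi a (u, f) <->
  X u /\ exists2 b, D (u, b) & curl (mi%:C%C *: b, f + a *: u).
split=> [[[b Db hb] [Xu Xf]]|[Xu [b Db /(curl_is_adjoint lb) cb]]].
 split; first exact: Xu. exists b; first exact: Db. apply/(curl_is_adjoint lb) => y z Dyz.
 by rewrite (hb y z Dyz) /Winf scaleNr opprK.
have Xf : X f.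
 rewrite -ortho_Hdiv0 in Xu *; move=> v Vv. have := cb _ _ (VV_D Vv); rewrite (rp0r ip) (rpDl ip).
 have -> : rp (a *: u) v = 0; last by rewrite addr0.
 by have [_ _ XZ] := ortho_csub hH (@VV_csub R Omega); exact: (XZ a _ Xu).
split; last by split; [exact: Xu|exact: Xf].
exists b; first exact: Db.
by move=> y z Dyz; rewrite /minf (cb y z Dyz) /Winf scaleNr opprK.
Qed.

Lemma pencil_LinfE eps_inf mu_inf w : pencil_Linf Omega eps_inf mu_inf w =
  scalar_graph (rp := rp) D X mu_inf^-1 (eps_inf%:C%C * w ^+ 2).
apply/seteqP; split=> -[u f].
 move=> [Xu [g [h [[b [[a' [Da ba]] cg]] hu fE]]]]; apply/curl_curl0_scalar; split; first exact: Xu.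
 exists a'; first exact: Da. have fE' : f = g + h := fE; have hu' : h = - (eps_inf%:C%C * w ^+ 2) *: u := hu.
 have ba' : b = mu_inf^-1%:C%C *: a' := ba. by rewrite fE' hu' scaleNr subrK -ba'.
move=> /curl_curl0_scalar[Xu [b Db cb]]; split=> //=.
exists (f + (eps_inf%:C%C * w ^+ 2) *: u), (- (eps_inf%:C%C * w ^+ 2) *: u); split=> //=.
 by exists (mu_inf^-1%:C%C *: b); split=> //; exists b.
by rewrite scaleNr addrK.
Qed.

Lemma curlcurl0_div0E (l : R[i]) : op_add (curlcurl0_div0 Omega) (op_scalar (- l)) =
  scalar_graph (rp := rp) D X 1 l.
apply/seteqP; split=> -[u f].
 move=> [g [h [[Xu [a' [Da cg]]] hu fE]]]; apply/curl_curl0_scalar; split; first exact: Xu.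
 exists a'; first exact: Da. have fE' : f = g + h := fE; have hu' : h = - l *: u := hu.
 by rewrite scale1r fE' hu' scaleNr subrK.
move=> /curl_curl0_scalar[Xu [b Db]]; rewrite scale1r => cb.
exists (f + l *: u), (- l *: u); split=> //=.
 by split=> //; exists b.
by rewrite scaleNr addrK.
Qed.

Lemma Hdiv0_csub : csubspace X.
by rewrite -ortho_Hdiv0; exact: (ortho_csub hH (@VV_csub R Omega)). Qed.
Lemma Hdiv0_complete : ip_complete rp X.
by rewrite -ortho_Hdiv0; exact: (ortho_complete hH Hc). Qed.
Lemma Hdiv0_J x : X x -> X (J x).
by rewrite -ortho_Hdiv0 => h; apply: (ortho_J hJ) h => v; exact: VV_J. Qed.
Lemma scalar_graph_fredholm k mi a : 0 < mi ->
  bel (scalar_graph (rp := rp) D X mi a) <-> fredholm_kind nrm k X (scalar_graph (rp := rp) D X mi a).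
move=> mi0; apply: (conj_selfadjoint_fredholm hH hJ); [exact: Hdiv0_csub|exact: Hdiv0_complete|exact: Hdiv0_J|].
apply: (weak_graph_csa hH hJ Hc curl0_D0 curl0_DD curl0_DZ (@curl0_closed R Omega) curl0_DJ
 (minf_mass hH hJ mi0) (Winf_bl hH a) (Winf_J hH hJ a)).
- exact: Hdiv0_csub.
- exact: Hdiv0_complete.
- exact: Hdiv0_J.
- by move=> y Xy; have [_ _ XZ] := Hdiv0_csub; exact: XZ.
move=> g p; rewrite -ortho_Hdiv0; exact: (ortho_sol hH VV_D).
Qed.

Lemma wave_decay (E S : R3 R -> 'M[R]_3) (BE BS e : R) w : 0 <= BE -> 0 <= BS -> bmf BE E -> bmf BS S ->
  vanishing Omega (fun x => E x - e%:M) -> vanishing Omega (fun x => S x - 0%:M) ->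
  compact_part (fun u : H => nrm (decaying (wave E S w) (e%:C%C * w ^+ 2) u)).
move=> BE0 BS0 hE hS vE vS.
pose k1 := `|complex.Re (- w ^+ 2)| + `|complex.Im (- w ^+ 2)|.
pose k2 := `|complex.Re (- ('i%C * w))| + `|complex.Im (- ('i%C * w))|.
have cE : compact_part (fun u : H => nrm (opm (fun x => E x - e%:M) u)).
 by apply: (compact_part_opm lb _ (bmf_shift e hE) vE); rewrite addr_ge0.
have cS : compact_part (fun u : H => nrm (opm (fun x => S x - 0%:M) u)).
 by apply: (compact_part_opm lb _ (bmf_shift 0 hS) vS); rewrite addr_ge0.
have k10 : 0 <= k1 by exact: addr_ge0.
have k20 : 0 <= k2 by exact: addr_ge0.
apply: (compact_part_le (compact_partD (compact_partZ k10 cE) (compact_partZ k20 cS))) => u.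
have -> : decaying (wave E S w) (e%:C%C * w ^+ 2) u =
  - w ^+ 2 *: opm (fun x => E x - e%:M) u + - ('i%C * w) *: opm (fun x => S x - 0%:M) u.
 rewrite (opm_shift _ _ hE) (opm_shift _ _ hS) scale0r subr0 /decaying /wave scalerBr addrAC.
 by congr (_ + _ + _); rewrite scalerA -scaleNr; congr (_ *: _); ring.
apply: le_trans (nrmD ip _ _) _; apply: lerD; exact: nrm_scale_le.
Qed.

Lemma graph_W_test (VVc : csubspace V) (Vc : ip_complete rp V) W v f (c : R[i]) :
  graph_W hH VVc Vc W (v, f) -> rp f (c *: v) = rp (W v) (c *: v).
move=> [Vv fE]; have -> : f = prj hH VVc Vc (W v) := fE.
by apply: rp_prj; have [_ _ VZ] := VVc; exact: VZ.
Qed.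

Variables (eps mu sig : R3 R -> 'M[R]_3).
Variables (eps_min eps_max mu_min mu_max sig_max eps_inf mu_inf : R).
Hypotheses (eps_min_gt0 : 0 < eps_min) (mu_min_gt0 : 0 < mu_min)
  (eps_coef : coefficient Omega eps eps_min eps_max) (mu_coef : coefficient Omega mu mu_min mu_max)
  (sig_coef : coefficient Omega sig 0 sig_max) (mu_inf_gt0 : 0 < mu_inf)
  (coef_limit : tail_deviation Omega eps mu sig eps_inf mu_inf r @[r --> +oo] --> 0%E).

Lemma sig_max_ge0 : 0 <= sig_max.
have [_ _ q] := sig_coef; have [x hx] := ae_exists q.
by have /andP[] := hx _ (enorm_delta R); exact: le_trans.
Qed.

Let Linf w := scalar_graph (rp := rp) D X mu_inf^-1 (eps_inf%:C%C * w ^+ 2).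

(** All that the theorem needs to know about the pencils: the lower bounds compare, they express the Fredholm
kinds, and dissipation gives one off the segment. *)
Lemma pencils_bounded_below k (w : R[i]) :
  [/\ bel (pencil_L Omega eps mu sig w) <-> bel (Linf w) /\ bel (pencil_W Omega eps sig w),
     bel (pencil_L Omega eps mu sig w) <-> fredholm_kind nrm k [set: H] (pencil_L Omega eps mu sig w),
     bel (pencil_W Omega eps sig w) <-> fredholm_kind nrm k V (pencil_W Omega eps sig w) &
     w != 0 -> [\/ complex.Re w != 0, 0 < complex.Im w | complex.Im w < - (sig_max / eps_min)] ->
       bel (pencil_W Omega eps sig w)].
have [BE [E [BE0 hE aeE]]] := coef_model eps_coef.
have [BS [S [BS0 hS aeS]]] := coef_model sig_coef.
have [BN [N [BN0 hN [c c0 aeN]]]] := inv_model mu_min_gt0 mu_coef.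
have tail := tail_small coef_limit.
have epsE : {ae vol Omega, forall x, E x = eps x} by apply: filterS aeE => x [].
have sigS : {ae vol Omega, forall x, S x = sig x} by apply: filterS aeS => x [].
have muN : {ae vol Omega, forall x, N x = invmx (mu x)} by apply: filterS aeN => x [].
have sE : {ae vol Omega, forall x, (E x)^T = E x} by apply: filterS aeE => x [].
have sS : {ae vol Omega, forall x, (S x)^T = S x} by apply: filterS aeS => x [].
have sN : {ae vol Omega, forall x, (N x)^T = N x} by apply: filterS aeN => x [].
have BE1 := ltW BE0; have BS1 := ltW BS0; have BN1 := ltW BN0.
have vE : vanishing Omega (fun x => E x - eps_inf%:M).
 by apply: vanishing_coef epsE _ => d /tail[r hr]; exists r; apply: filterS hr => x hx /hx[].
have vS : vanishing Omega (fun x => S x - 0%:M).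
 apply: vanishing_coef sigS _ => d /tail[r hr]; exists r; apply: filterS hr => x hx /hx[_ _]. by rewrite raddf0 subr0.
have vN : vanishing Omega (fun x => N x - (mu_inf^-1)%:M).
 apply: (vanishing_inv (A := mu) mu_min_gt0 mu_inf_gt0).
  by apply: filterS aeN => x [? _ _ ?].
 by move=> d /tail[r hr]; exists r; apply: filterS hr => x hx /hx[].
have [CW CW0 bW] := wave_bl hE hS BE1 BS1 w.
have WJ := wave_J hE hS sE sS w.
have hm : mass (rp := rp) (J := J) (opm N) c (3 * BN).
 split=> //; first exact: opm_bl.
 - by move=> x y; exact: (opm_sym hN _ _ sN).
 - by move=> x; exact: (opmJ hN).
 - by rewrite mulr_ge0.
 by move=> x; apply: (opm_ge hN); apply: filterS aeN => y [].
have C1 d : 0 < d -> exists es, forall u w', D (u, w') -> ortho (rp := rp) V u ->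
  nrm (decaying (wave E S w) (eps_inf%:C%C * w ^+ 2) u) <= d * (nrm u + nrm w') + fin (rp := rp) es u.
 by rewrite ortho_Hdiv0; exact: (wave_decay w BE1 BS1 hE hS vE vS).
have C2 d : 0 < d -> exists es, forall x w' g, ortho (rp := rp) V x -> D (x, w') ->
  (forall y z, D (y, z) -> rp w' z = rp g y) ->
  nrm (opm N w' - minf mu_inf^-1 w') <= d * (nrm x + nrm w' + nrm g) + fin (rp := rp) es x.
 move=> d0; have B0 : 0 <= BN + `|mu_inf^-1| by rewrite addr_ge0.
 have [es hes] := compact_part_curl lb B0 (bmf_shift mu_inf^-1 hN) vN d0.
 exists es => x w' g; rewrite ortho_Hdiv0 => Xx Dx hx. by rewrite /minf -(opm_shift _ _ hN); exact: hes.
have mi0 : 0 < mu_inf^-1 by rewrite invr_gt0.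
pose cl := @curl0_closed R Omega; pose VVc := @VV_csub R Omega; pose Vc := @VV_complete R Omega.
rewrite (pencil_LE hE hS epsE sigS hN muN) (pencil_WE hE hS epsE sigS).
have LX : Linf w = graph_Linf (rp := rp) D V mu_inf^-1 (eps_inf%:C%C * w ^+ 2).
 by rewrite /graph_Linf ortho_Hdiv0.
split.
- rewrite LX; split=> [h|[h1 h2]].
  split.
   exact: (bel_Linf hH hJ Hc curl0_D0 curl0_DD curl0_DZ cl hm mi0 CW0 bW C1 C2 h).
  exact: (bel_W hH hJ Hc curl0_D0 curl0_DD curl0_DZ cl curl0_DJ VVc Vc (@VV_J R Omega)
   VV_D hm CW0 bW WJ C1 h).
 exact: (bel_conv hJ Hc curl0_D0 curl0_DD curl0_DZ cl VV_D hm mi0 CW0 bW WJ C1 C2 h1 h2).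
- have sT : csubspace [set: H] by []. apply: (conj_selfadjoint_fredholm hH hJ k sT Hc (fun y _ => I)).
 have csa := weak_graph_csa hH hJ Hc curl0_D0 curl0_DD curl0_DZ cl curl0_DJ hm bW WJ sT Hc
  (fun y _ => I) (fun y _ => I) (fun g p _ _ => I).
 by rewrite setXTT setIT in csa.
- apply: (conj_selfadjoint_fredholm hH hJ k VVc Vc (@VV_J R Omega)).
 exact: (compression_csa hH hJ VVc Vc (@VV_J R Omega) bW WJ).
move=> w0 side.
have oE c' (x : H) : opm E (c' *: x) = c' *: opm E x by exact: opmZ hE c' x.
have oS c' (x : H) : opm S (c' *: x) = c' *: opm S x by exact: opmZ hS c' x.
have E_ge (x : H) : eps_min * nrm x ^+ 2 <= rp (opm E x) x.
 by apply: (opm_ge hE); apply: filterS aeE => y [_ _ q] h; case/andP: (q h).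
have S_ge x : 0 <= rp (opm S x) x.
 have := @opm_ge R Omega BS S hS 0 x; rewrite mul0r; apply. by apply: filterS aeS => y [_ _ q] h; case/andP: (q h).
have S_le x : rp (opm S x) x <= sig_max * nrm x ^+ 2.
 by apply: (opm_le hS); apply: filterS aeS => y [_ _ q] h; case/andP: (q h).
have sE' (x y : H) : rp (opm E x) y = rp x (opm E y) by exact: (opm_sym hE x y sE).
have sS' (x y : H) : rp (opm S x) y = rp x (opm S y) by exact: (opm_sym hS x y sS).
have WE (x : H) : wave E S w x = - w ^+ 2 *: opm E x + - ('i%C * w) *: opm S x by [].
have TW v f : graph_W hH VVc Vc (wave E S w) (v, f) -> forall c' : R[i], rp f (c' *: v) = rp (wave E S w v) (c' *: v).
 by move=> h c'; exact: graph_W_test h.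
have := dissipation_bel hH oE oS sE' sS' eps_min_gt0 E_ge sig_max_ge0 S_ge S_le WE TW w0 side.
exact.
Qed.
End Pencils.

Lemma square_off_axis (R : realType) (e : R) (w : R[i]) : 0 < e -> complex.Im w != 0 ->
  complex.Re (e%:C%C * w ^+ 2) < 0 \/ complex.Im (e%:C%C * w ^+ 2) != 0.
move=> e0 q0; rewrite expr2 !(Re_mul, Im_mul) /= !mul0r subr0 addr0.
move: (complex.Re w) (complex.Im w) q0 => p q q0; have [->|p0] := eqVneq p 0.
 by left; rewrite mul0r sub0r mulrN oppr_lt0 mulr_gt0 // -expr2 lt_neqAle sqr_ge0 andbT eq_sym sqrf_eq0.
right; apply: mulf_neq0; first by rewrite gt_eqF.
by rewrite [q * p]mulrC -mulr2n mulrn_eq0 /=; exact: mulf_neq0.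
Qed.

Theorem theorem5p5 (R : realType) (Omega : domain R)
    (eps mu sig : R3 R -> 'M[R]_3)
    (eps_min eps_max mu_min mu_max sig_max eps_inf mu_inf : R)
    (Omega_lipschitz : lipschitz_boundary Omega)
    (eps_min_gt0 : 0 < eps_min)
    (mu_min_gt0 : 0 < mu_min)
    (eps_coef : coefficient Omega eps eps_min eps_max)
    (mu_coef : coefficient Omega mu mu_min mu_max)
    (sig_coef : coefficient Omega sig 0 sig_max)
    (Omega_unbounded : ~ bounded_set (domain_set Omega))
    (eps_inf_gt0 : 0 < eps_inf)
    (mu_inf_gt0 : 0 < mu_inf)
    (coef_limit :
      tail_deviation Omega eps mu sig eps_inf mu_inf r @[r --> +oo] --> 0%E)
    (k : ess_kind) :
  let nrm := L2norm Omega in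
  let spec_L :=
    ess_spectrum_pencil nrm k [set: L2 Omega] (pencil_L Omega eps mu sig) in
  let spec_Linf :=
    ess_spectrum_pencil nrm k (Hdiv0 Omega) (pencil_Linf Omega eps_inf mu_inf) in
  let spec_W :=
    ess_spectrum_pencil nrm k (grad_H10dot Omega) (pencil_W Omega eps sig) in
  [/\ spec_L = spec_Linf `|` spec_W,
      spec_Linf `<=` [set w | complex.Im w = 0],
      spec_Linf `\ 0 =
        [set w | [/\ complex.Im w = 0, w != 0 &
          ess_spectrum nrm k (Hdiv0 Omega) (curlcurl0_div0 Omega)
            (Complex (eps_inf * mu_inf) 0 * w ^+ 2)]] &
      spec_W `<=`
        [set w | complex.Re w = 0 /\
          - (sig_max / eps_min) <= complex.Im w <= 0]].

Proof.
have coefs := pencils_bounded_below Omega_lipschitz eps_min_gt0 mu_min_gt0 eps_coef mu_coef sig_coef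
 mu_inf_gt0 coef_limit k.
have fr0 Y T : ess_spectrum (L2norm Omega) k Y T 0 <-> ~ fredholm_kind (L2norm Omega) k Y T.
 by rewrite /ess_spectrum /= op_add_scalar0.
move=> nrm spec_L spec_Linf spec_W.
have mi0 : 0 < mu_inf^-1 by rewrite invr_gt0.
have specL w : spec_L w <-> ~ bounded_mod_finite (@rp R Omega) (pencil_L Omega eps mu sig w).
 have [_ e _ _] := coefs w; rewrite -[spec_L w]/(ess_spectrum _ _ _ _ _); split=> [/fr0 h b|h]; first by apply/h/e.
 by apply/fr0 => f; apply/h/e.
have specW w : spec_W w <-> ~ bounded_mod_finite (@rp R Omega) (pencil_W Omega eps sig w).
 have [_ _ e _] := coefs w; rewrite -[spec_W w]/(ess_spectrum _ _ _ _ _); split=> [/fr0 h b|h]; first by apply/h/e.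
 by apply/fr0 => f; apply/h/e.
pose G mi a := scalar_graph (rp := @rp R Omega) (@curl0 R Omega) (Hdiv0 Omega) mi a.
have specG mi a : 0 < mi -> ~ fredholm_kind nrm k (Hdiv0 Omega) (G mi a) <->
  ~ bounded_mod_finite (@rp R Omega) (G mi a).
 move=> mi1; have e := scalar_graph_fredholm Omega k a mi1. by split=> h b; apply/h/e.
have specI w : spec_Linf w <-> ~ bounded_mod_finite (@rp R Omega) (G mu_inf^-1 (eps_inf%:C%C * w ^+ 2)).
 rewrite -[spec_Linf w]/(ess_spectrum _ _ _ _ _) (pencil_LinfE Omega_lipschitz).
 by split=> [/fr0/specG|h]; [exact|apply/fr0/specG].
have real w : spec_Linf w -> complex.Im w = 0.
 move/specI => nb; apply: contrapT => /eqP im0; apply: nb.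
 apply: (scalar_graph_bel (rp_is_cip Omega) (Hdiv0 Omega) (@curl0_DZ R Omega) mi0). exact: square_off_axis.
split.
- apply/seteqP; split=> w.
  move/specL => nb; apply: contrapT => /not_orP[nI nW]; apply: nb.
  have [[_ e] _ _ _] := coefs w; apply: e; split; apply: contrapT => ?; [apply: nI; exact/specI|apply: nW; exact/specW].
 move=> h; apply/specL => b; have [[e _] _ _ _] := coefs w; have [bI bW] := e b. by case: h => [/specI|/specW]; exact.
- exact: real.
- have eqv w : complex.Im w = 0 -> spec_Linf w <->
   ess_spectrum nrm k (Hdiv0 Omega) (curlcurl0_div0 Omega) (Complex (eps_inf * mu_inf) 0 * w ^+ 2).
  move=> im0; rewrite /ess_spectrum /= (curlcurl0_div0E Omega_lipschitz).
  rewrite (_ : Complex (eps_inf * mu_inf) 0 * w ^+ 2 = (mu_inf^-1)^-1%:C%C * (eps_inf%:C%C * w ^+ 2)); last first.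
   by rewrite invrK mulrA -rmorphM [mu_inf * _]mulrC.
  have XZ (c : R[i]) x : Hdiv0 Omega x -> Hdiv0 Omega (c *: x) by have [_ _ XZ] := Hdiv0_csub Omega; exact: XZ.
  have e := scalar_graph_normalize (rp_is_cip Omega) (@curl0 R Omega) XZ (eps_inf%:C%C * w ^+ 2) mi0.
  split=> [/specI h|/(specG _ _ ltr01) h].
   by apply/(specG _ _ ltr01) => b; apply/h/e.
  by apply/specI => b; apply: h; exact: (e.1 b).
 apply/seteqP; split=> [w [Iw /eqP w0]|w [im0 w0 h]].
  by split=> //; [exact: real|apply/eqv => //; exact: real].
 by split; [exact/eqv|exact/eqP].
move=> w /specW nb; have s0 := sig_max_ge0 sig_coef.
have q0 : 0 <= sig_max / eps_min by rewrite divr_ge0 // ltW.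
have [->|w0] := eqVneq w 0; first by rewrite /= oppr_le0 q0 lexx.
have [_ _ _ e] := coefs w; split.
 by apply/eqP; apply: contrapT => /negP h; apply: nb; apply: e => //; constructor 1.
apply/andP; split; rewrite leNgt; apply/negP => h; apply: nb; apply: e => //.
 by constructor 3.
by constructor 2.
Qed.
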